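(* Let $G$ be a connected reductive complex algebraic group with maximal torus $T$, fix a choice of positive roots, and let $N$ be the number of positive roots of $T$ in $G$. For each dominant $\lambda\in X^*(T)$ let $\pi_\lambda$ be the irreducible algebraic representation of $G$ with highest weight $\lambda$, and let $c_k^T(\pi_\lambda)\in H^{2k}(BT,\mathbb{Z})$ be the restriction to $T$ of the $k$th Chern class $c_k(\pi_\lambda)\in H^{2k}(BG,\mathbb{Z})$. Then for all integers $k\ge 0$, the function $\lambda\mapsto c_k^T(\pi_\lambda)\in H^{2k}(BT,\mathbb{Z})$ is polynomial in $\lambda$ of degree no greater than $k(N+1)$.
   Context: All representations are finite-dimensional, complex and algebraic. $X^*(T)$ is the group of algebraic characters $T\to\mathbb{C}^\times$, a free abelian group of finite rank. $BG$, $BT$ are classifying spaces; the inclusion $T\hookrightarrow G$ induces the restriction map $H^*(BG,\mathbb{Z})\to H^*(BT,\mathbb{Z})$. The ring $H^*(BT,\mathbb{Z})$ is identified with $\mathrm{Sym}_{\mathbb{Z}}X^*(T)$ via the first Chern class, with $\mathrm{Sym}^k$ corresponding to $H^{2k}$. The Chern classes of $\pi$ are those of the complex vector bundle on $BG$ associated to $\pi$; equivalently, on $T$, $c^T(\pi)=\prod_\chi(1+c_1(\chi))^{m_\pi(\chi)}$ where $m_\pi(\chi)$ is the multiplicity of the weight $\chi$ in $\pi|_T$. A function $f$ from a subset of a finite-rank free abelian group $L$ to a finitely generated free abelian group $M$ is called polynomial (of degree $\le d$) if it is the restriction of a polynomial function $L\otimes_{\mathbb{Z}}\mathbb{C}\to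 M\otimes_{\mathbb{Z}}\mathbb{C}$ (of degree $\le d$). Here $L=X^*(T)$ and $M=H^{2k}(BT,\mathbb{Z})$, and the subset is the set of dominant weights in $X^*(T)$. *)

(* Defs.v *)
(* Linear algebraic groups over R[i] are handled as
   Zariski-closed subgroups of GL_n, following the classical (Borel, Humphreys,
   Springer) point of view, in which groups are identified with their sets of
   complex points. *)
From mathcomp Require Import all_boot all_order all_algebra.
From mathcomp Require Import classical_sets reals.
From mathcomp Require Export complex mpoly.

Set Implicit Arguments.
Unset Strict Implicit.
Unset Printing Implicit Defensive.
Import GRing.Theory.
Local Open Scope classical_set_scope.
Local Open Scope ring_scope.
Local Open Scope complex_scope.

Section AlgebraicGroups.
Variable R : realType.
Local Notation C := R[i].

(* The n * n variables are the matrix entries, enumerated by mxvec. *)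
Definition mxeval n (p : {mpoly C[n * n]}) (A : 'M[C]_n) : C :=
  p.@[mxvec A 0].

Definition GL n : set 'M[C]_n := [set A | A \in unitmx].

Definition SL n : set 'M[C]_n := [set A | \det A = 1].

Definition diagGL n : set 'M[C]_n := [set A | A \in unitmx /\ is_diag_mx A].

(* Closed in the Zariski topology of GL_n: equations in the entries and in
   1/det can be multiplied by a power of det. *)
Definition zariski_closed n (Z : set 'M[C]_n) : Prop :=
  exists S : set {mpoly C[n * n]},
    Z = [set A | GL A /\ forall p, S p -> mxeval p A = 0].

Definition subgroup_GL n (G : set 'M[C]_n) : Prop :=
  [/\ G `<=` @GL n, G 1%:M, forall g h, G g -> G h -> G (g *m h)
    & forall g, G g -> G (invmx g)].

Definition closed_subgroup n (G : set 'M[C]_n) : Prop :=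
  zariski_closed G /\ subgroup_GL G.

Definition zariski_connected n (G : set 'M[C]_n) : Prop :=
  forall A B : set 'M[C]_n, zariski_closed A -> zariski_closed B ->
    A `|` B = G -> A `&` B = set0 -> A = set0 \/ B = set0.

Definition unipotent n (U : set 'M[C]_n) : Prop :=
  forall u, U u -> exists d : nat, (u - 1%:M) ^+ d = 0.

Definition normal_in n (G U : set 'M[C]_n) : Prop :=
  U `<=` G /\ forall g u, G g -> U u -> U (g *m u *m invmx g).

(* Reductive: the unipotent radical is trivial. *)
Definition connected_reductive n (G : set 'M[C]_n) : Prop :=
  [/\ closed_subgroup G, zariski_connected G
    & forall U : set 'M[C]_n, closed_subgroup U -> zariski_connected U ->
        unipotent U -> normal_in G U -> U = [set 1%:M]].

Definition regular n (G : set 'M[C]_n) (f : 'M[C]_n -> C) : Prop :=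
  exists (p : {mpoly C[n * n]}) (d : nat),
    forall g, G g -> f g = mxeval p g / (\det g) ^+ d.

(* Only the values of f on G matter, here and below. *)
Definition alg_morphism n m (G : set 'M[C]_n) (H : set 'M[C]_m)
    (f : 'M[C]_n -> 'M[C]_m) : Prop :=
  [/\ forall g, G g -> H (f g),
      forall g h, G g -> G h -> f (g *m h) = f g *m f h
    & forall i j, regular G (fun g => f g i j)].

Definition alg_rep n m (G : set 'M[C]_n) (rho : 'M[C]_n -> 'M[C]_m) : Prop :=
  alg_morphism G (@GL m) rho.

Definition alg_character n (T : set 'M[C]_n) (chi : 'M[C]_n -> C) : Prop :=
  [/\ forall t, T t -> chi t != 0,
      forall s t, T s -> T t -> chi (s *m t) = chi s * chi t
    & regular T chi].

Definition torus n (T : set 'M[C]_n) : Prop :=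
  closed_subgroup T /\
  exists (r : nat) (f : 'M[C]_n -> 'M[C]_r) (g : 'M[C]_r -> 'M[C]_n),
    [/\ alg_morphism T (@diagGL r) f, alg_morphism (@diagGL r) T g,
        forall t, T t -> g (f t) = t & forall d, diagGL d -> f (g d) = d].

Definition maximal_torus n (G T : set 'M[C]_n) : Prop :=
  [/\ torus T, T `<=` G
    & forall T' : set 'M[C]_n, torus T' -> T `<=` T' -> T' `<=` G -> T' = T].

(* Tangent space at 1, for the ideal of all polynomials vanishing on G. *)
Definition Lie n (G : set 'M[C]_n) : set 'M[C]_n :=
  [set X | forall p : {mpoly C[n * n]}, (forall g, G g -> mxeval p g = 0) ->
     \sum_(l < n * n) mxeval (mderiv l p) 1%:M * mxvec X 0 l = 0].

Section Weights.
Variables (n : nat) (G T : set 'M[C]_n) (r : nat) (e : 'I_r -> 'M[C]_n -> C).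

(* The character with (additive) coordinates v in the basis e of X^*(T). *)
Definition char_of (v : 'rV[int]_r) (t : 'M[C]_n) : C :=
  \prod_(i < r) (e i t) ^ (v 0 i).

(* e is a Z-basis of X^*(T), which is thereby identified with 'rV[int]_r. *)
Definition char_basis : Prop :=
  (forall i, alg_character T (e i)) /\
  forall chi, alg_character T chi ->
    exists! v : 'rV[int]_r, forall t, T t -> chi t = char_of v t.

Definition root (a : 'rV[int]_r) : Prop :=
  a != 0 /\ exists2 X : 'M[C]_n, Lie G X /\ X != 0
    & forall t, T t -> t *m X *m invmx t = char_of a t *: X.

(* The roots positive on a cocharacter h that is orthogonal to no root. *)
Definition positive_system (Phi : seq 'rV[int]_r) : Prop :=
  uniq Phi /\ exists h : 'rV[int]_r,
    (forall a, root a -> \sum_(i < r) a 0 i * h 0 i != 0) /\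
    (forall a, a \in Phi <-> root a /\ 0 < \sum_(i < r) a 0 i * h 0 i).

Definition upper2 (x : C) : 'M[C]_2 := 1%:M + x *: delta_mx 0 1.
Definition lower2 (x : C) : 'M[C]_2 := 1%:M + x *: delta_mx 1 0.
Definition diag2 (s : C) : 'M[C]_2 :=
  s *: delta_mx 0 0 + s^-1 *: delta_mx 1 1.

Definition root_SL2 (a : 'rV[int]_r) (phi : 'M[C]_2 -> 'M[C]_n) : Prop :=
  [/\ alg_morphism (@SL 2) G phi,
      exists x, phi (upper2 x) != 1%:M,
      forall t x, T t ->
        t *m phi (upper2 x) *m invmx t = phi (upper2 (char_of a t * x)),
      forall t x, T t ->
        t *m phi (lower2 x) *m invmx t = phi (lower2 ((char_of a t)^-1 * x))
    & forall s, s != 0 -> T (phi (diag2 s))].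

(* The coroot s |-> phi (diag2 s) of a, in the coordinates dual to e. *)
Definition coroot (a c : 'rV[int]_r) : Prop :=
  exists2 phi, root_SL2 a phi
    & forall i s, s != 0 -> e i (phi (diag2 s)) = s ^ (c 0 i).

Definition dominant (Phi : seq 'rV[int]_r) (lam : 'rV[int]_r) : Prop :=
  forall a c, a \in Phi -> coroot a c -> 0 <= \sum_(i < r) lam 0 i * c 0 i.

Section Representation.
Variables (m : nat) (rho : 'M[C]_n -> 'M[C]_m).

Definition irreducible_rep : Prop :=
  [/\ alg_rep G rho, (0 < m)%N
    & forall U : {vspace 'cV[C]_m},
        (forall g u, G g -> u \in U -> rho g *m u \in U) ->
        U = 0%VS \/ U = fullv].

Definition weight_mult (mu : 'rV[int]_r) (d : nat) : Prop :=
  exists2 U : {vspace 'cV[C]_m},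
    forall u, u \in U <-> (forall t, T t -> rho t *m u = char_of mu t *: u)
    & \dim U = d.

Definition weight (mu : 'rV[int]_r) : Prop :=
  exists2 d, weight_mult mu d & (0 < d)%N.

(* Highest for the order in which mu <= lam iff lam - mu is a sum of positive
   roots. *)
Definition highest_weight (Phi : seq 'rV[int]_r) (lam : 'rV[int]_r) : Prop :=
  weight lam /\ forall mu, weight mu ->
    exists c : 'rV[int]_r -> nat, lam - mu = \sum_(a <- Phi) a *+ c a.

(* H^*(BT, Z) = Sym X^*(T) is {mpoly int[r]}, the i-th variable being c_1 of
   the i-th basis character, and H^{2k} is the homogeneous part of degree k. *)
Definition c1 (v : 'rV[int]_r) : {mpoly int[r]} := \sum_(i < r) v 0 i *: 'X_i.

(* c is the degree k part of c^T(rho), the product of the 1 + c_1(chi) over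
   the sequence ws of all weights chi of rho, listed with multiplicity. *)
Definition chernT (k : nat) (c : {mpoly int[r]}) : Prop :=
  exists2 ws : seq 'rV[int]_r, forall mu, weight_mult mu (count_mem mu ws)
    & c = pihomog (@mdeg r) k (\prod_(chi <- ws) (1 + c1 chi)).

End Representation.
End Weights.

(* f is, on D, the restriction of a polynomial function of degree <= d from
   C^r = X^*(T) (x) C to H^{2k}(BT, Z) (x) C, the space of forms of degree k in
   {mpoly C[r]}.  Such a function is a polynomial P in the r coordinates whose
   coefficients are forms of degree k. *)
Definition polynomial_on r (D : set 'rV[int]_r) (k d : nat)
    (f : 'rV[int]_r -> {mpoly int[r]}) : Prop :=
  exists P : {mpoly {mpoly C[r]}[r]},
    [/\ (msize P <= d.+1)%N, forall q, P@_q \is k.-homog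
      & forall lam, D lam ->
          map_mpoly intr (f lam) = P.@[fun i => ((lam 0 i)%:~R : C)%:MP]].

End AlgebraicGroups.

(* Main.v *)
(* Let m be the multiplicity function of the weights of an irreducible pi with
   highest weight lam, and let D_a f (x) = f (x - a/2) - f (x + a/2).  The Casimir
   element acts on pi as a scalar, which is a recurrence for m; applying the
   product D of the D_a over the positive roots a to it shows that D m, which is
   antisymmetric under the Weyl group, is supported on vectors of the norm of
   lam + rho, hence is the alternating sum of the point masses at w (lam + rho)
   (the Weyl character formula).  If <a, H> <> 0 for all roots a, then D_a maps
   polynomials of degree j + 1 in <x, H> onto those of degree j, so the power sum
   of the <mu, H>^j over the weights mu is the pairing of D m with a polynomial of
   degree j + N in <x, H>, and has degree at most j + N in lam.  By Newton's
   identities c_k^T, evaluated at H, has degree at most k (N + 1) in lam; its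
   coefficients are recovered by taking H = (t, t^b, t^(b^2), ..).

   The structure of G comes from the form tr (X Y) on Lie G: the exponentials of
   its radical lie in a normal unipotent subgroup, so it is nondegenerate.  Jordan
   decompositions stay in G or Lie G because a polynomial vanishing on the powers
   of g (or on the formal exponential of X) vanishes on a whole family of matrices,
   by independence of exponentials.  Everything else about pi uses only that its
   restriction to Lie G is irreducible, which rests on the fact that matrices
   commuting with Lie G commute with G: G acts on them by conjugation through
   elements of finite order, so with bounded trace, and a bounded regular function
   on G takes finitely many values by Chevalley's theorem, so is constant. *)
Require Import Defs.
From HB Require Import structures.
From mathcomp Require Import all_boot all_order all_algebra.
From mathcomp Require Import perm classical_sets reals boolp ring lra zify.
From mathcomp Require closed_field.
Set Implicit Arguments.
Unset Strict Implicit.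
Unset Printing Implicit Defensive.
Import Order.TTheory GRing.Theory Num.Theory.
Local Open Scope classical_set_scope.
Local Open Scope ring_scope.
Local Open Scope complex_scope.

(** Where the bound comes from: undoing one operator D_a costs one degree, so the j-th power sum has
    degree j + N, and the worst term in Newton's identities is the k-th power of the first power
    sum, of degree k (1 + N). The commutator of multiplication by the norm with D is a finite
    combination of translations, so it is known once it is known on the point mass at 0; there the
    claim is that the norm is constant on the support of D applied to that mass. This is a
    divisibility statement: an antisymmetric function with integral support is divisible by each
    D_a, hence by D. All this takes place over the real span of X^*(T), because rho and the half
    roots need not be characters. On the group side, elements are produced through polynomial
    identities: the semisimple and unipotent parts of an element vary separately, within the
    relations between its eigenvalues, in a family on which every polynomial vanishing on the group
    vanishes. Eigenvalues may be related up to roots of unity, so only a power of a group element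
    reaches a torus, and conjugation on the commutant is at first only known to have finite
    order. *)

Lemma seq_maxP (K : eqType) (F : realFieldType) (h : K -> F) (s : seq K) (P : pred K) :
  has P s -> exists x, [/\ x \in s, P x & forall y, y \in s -> P y -> h y <= h x].
Proof.
elim: s => //= x s IH /orP[Px|].
  case: (boolP (has P s)) => [/IH[y [ys Py Hy]]|/hasPn H].
    case: (leP (h y) (h x)) => hxy.
      exists x; split=> //; first by rewrite inE eqxx.
      move=> z; rewrite inE => /orP[/eqP-> //|zs] Pz.
      exact: le_trans (Hy _ zs Pz) hxy.
    exists y; split=> //; first by rewrite inE ys orbT.
    move=> z; rewrite inE => /orP[/eqP->|zs] Pz; [exact: ltW|exact: Hy].
  exists x; split=> //; first by rewrite inE eqxx.
  by move=> z; rewrite inE => /orP[/eqP->//|/H/negP].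
move=> /IH[y [ys Py Hy]].
case: (boolP (P x && (h y <= h x))) => [/andP[Px hxy]|nPx].
  exists x; split=> //; first by rewrite inE eqxx.
  move=> z; rewrite inE => /orP[/eqP-> //|zs] Pz.
  exact: le_trans (Hy _ zs Pz) hxy.
exists y; split=> //; first by rewrite inE ys orbT.
move=> z; rewrite inE => /orP[/eqP->|zs] Pz; last exact: Hy.
by move: nPx; rewrite Pz /= -ltNge => /ltW.
Qed.

(** A pair {b, t b} of distinct elements contributes twice the same bit, and a fixed point
    contributes nothing. It serves to count signs and parities under the reflection in a positive
    root. *)
Lemma involution_parity (K : eqType) (s : seq K) (t : K -> K) (f : K -> bool) :
  uniq s -> {in s, forall b, t b \in s} -> {in s, forall b, t (t b) = b} ->
  {in s, forall b, f (t b) = f b} -> {in s, forall b, t b = b -> f b = false} ->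
  \big[addb/false]_(b <- s) f b = false.
Proof.
have [k] := ubnP (size s); elim: k s => // k IH [|b s] /=; first by rewrite big_nil.
rewrite ltnS => sk /andP[bs us] ts tts ft fx.
have bin : b \in b :: s by rewrite inE eqxx.
have sub : {subset s <= b :: s} by move=> x xs; rewrite inE xs orbT.
rewrite big_cons; case: (eqVneq (t b) b) => [tb|tb].
  rewrite (fx b) //= IH //.
  - by move=> x xs; have := ts x (sub _ xs); rewrite inE => /orP[/eqP txb|//];
      move: (tts x (sub _ xs)); rewrite txb tb => xb; move: bs; rewrite xb xs.
  - by move=> x xs; apply/tts/sub.
  - by move=> x xs; apply/ft/sub.
  - by move=> x xs; apply/fx/sub.
have tbs : t b \in s by move: (ts b bin); rewrite inE (negPf tb).
rewrite (perm_big _ (perm_to_rem tbs)) big_cons ft // addbA addbb /=.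
have subr : {subset rem (t b) s <= b :: s} by move=> x /mem_rem /sub.
apply: IH.
- by apply: leq_ltn_trans sk; rewrite size_rem // leq_pred.
- exact: rem_uniq.
- move=> x; rewrite mem_rem_uniq // => /andP[/= xtb xs].
  rewrite mem_rem_uniq // inE; apply/andP; split.
    apply/negP => /eqP txb; have /(congr1 t) := txb.
    by rewrite (tts b) // (tts x (sub _ xs)) => xb; move: bs; rewrite -xb xs.
  have := ts x (sub _ xs); rewrite inE => /orP[/eqP txb|//].
  by move: (tts x (sub _ xs)); rewrite txb => xb; move: xtb; rewrite /= xb eqxx.
- by move=> x /subr xs; apply: tts.
- by move=> x /subr xs; apply: ft.
- by move=> x /subr xs; apply: fx.
Qed.

(** * Difference operators and the Weyl numerator *)

Section Shift.
Variables (F : realFieldType) (V : lmodType F).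
Implicit Types (f g m : V -> F) (x y a b : V).

Definition half a : V := 2^-1 *: a.
Lemma halfD a : half a + half a = a.
Proof. by rewrite /half -scalerDl -[RHS]scale1r; congr (_ *: _); field. Qed.

Definition indicator0 x : F := (x == 0)%:R.
Definition fs f := exists s : seq V, forall x, x \notin s -> f x = 0.

(** In the group algebra of V, [Dop a] is multiplication by e^(a/2) - e^(-a/2), so that [delta] over
    the positive roots is multiplication by the Weyl denominator and [rhos] is the half sum rho. *)
Definition Dop a f x := f (x - half a) - f (x + half a).
Definition Aop a f x := 2^-1 * (f (x - half a) + f (x + half a)).
Definition delta (s : seq V) f := foldr Dop f s.
Definition rhos (s : seq V) : V := \sum_(a <- s) half a.

(** Shift-invariant operators, that is the group algebra of V acting by convolution. It is
    commutative, and functions of finite support play the role of formal characters. *)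
Definition SI (Th : (V -> F) -> V -> F) :=
  exists L : seq (F * V), forall f x, Th f x = \sum_(u <- L) u.1 * f (x - u.2).

Lemma SI_id : SI (fun f => f).
Proof. by exists [:: (1, 0)] => f x; rewrite big_seq1 mul1r subr0. Qed.
Lemma SI_0 : SI (fun f x => 0).
Proof. by exists [::] => f x; rewrite big_nil. Qed.
Lemma SI_D a : SI (Dop a).
Proof.
by exists [:: (1, half a); (-1, - half a)] => f x;
  rewrite big_cons big_seq1 /= mul1r mulN1r opprK.
Qed.
Lemma SI_A a : SI (Aop a).
Proof.
by exists [:: (2^-1, half a); (2^-1, - half a)] => f x;
  rewrite big_cons big_seq1 /= -mulrDr opprK.
Qed.
Lemma SI_comp T1 T2 : SI T1 -> SI T2 -> SI (fun f => T1 (T2 f)).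
Proof.
move=> [L1 H1] [L2 H2].
exists [seq (u.1 * v.1, u.2 + v.2) | u <- L1, v <- L2] => f x.
rewrite H1 big_allpairs_dep; apply: eq_bigr => u _; rewrite H2 mulr_sumr.
by apply: eq_bigr => v _ /=; rewrite mulrA opprD addrA.
Qed.
Lemma SI_add T1 T2 : SI T1 -> SI T2 -> SI (fun f x => T1 f x + T2 f x).
Proof. by move=> [L1 H1] [L2 H2]; exists (L1 ++ L2) => f x; rewrite big_cat H1 H2. Qed.
Lemma SI_scale c T1 : SI T1 -> SI (fun f x => c * T1 f x).
Proof.
move=> [L1 H1]; exists [seq (c * u.1, u.2) | u <- L1] => f x.
by rewrite big_map H1 mulr_sumr; apply: eq_bigr => u _; rewrite mulrA.
Qed.
Lemma SI_ext T f g : SI T -> f =1 g -> T f =1 T g.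
Proof. by move=> [L H] fg x; rewrite !H; apply: eq_bigr => u _; rewrite fg. Qed.
Lemma SI_addf T f g x : SI T -> T (fun y => f y + g y) x = T f x + T g x.
Proof. by move=> [L H]; rewrite !H -big_split; apply: eq_bigr => u _; rewrite mulrDr. Qed.
Lemma SI_scalef T c f x : SI T -> T (fun y => c * f y) x = c * T f x.
Proof. by move=> [L H]; rewrite !H mulr_sumr; apply: eq_bigr => u _; rewrite mulrCA. Qed.
Lemma SI_C T1 T2 f x : SI T1 -> SI T2 -> T1 (T2 f) x = T2 (T1 f) x.
Proof.
move=> [L1 H1] [L2 H2]; rewrite H1 H2.
under eq_bigr do rewrite H2 mulr_sumr.
under [RHS]eq_bigr do rewrite H1 mulr_sumr.
rewrite exchange_big; apply: eq_bigr => v _; apply: eq_bigr => u _.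
by rewrite mulrCA; congr (_ * (_ * f _)); rewrite addrAC.
Qed.
Lemma SI_delta s : SI (delta s).
Proof. by elim: s => [|a s IH]; [exact: SI_id | exact: SI_comp (SI_D a) IH]. Qed.

Lemma fs_uniq f : fs f -> exists2 s, uniq s & forall x, x \notin s -> f x = 0.
Proof. by move=> [s Hs]; exists (undup s); rewrite ?undup_uniq // => x; rewrite mem_undup => /Hs. Qed.

Lemma fs_shift f v : fs f -> fs (fun x => f (x - v)).
Proof.
move=> [s Hs]; exists [seq x + v | x <- s] => x xs; apply: Hs.
by apply: contra xs => xs; apply/mapP; exists (x - v) => //; rewrite subrK.
Qed.
Lemma fs_add f g : fs f -> fs g -> fs (fun x => f x + g x).
Proof.
move=> [s Hs] [t Ht]; exists (s ++ t) => x; rewrite mem_cat negb_or => /andP[/Hs-> /Ht->].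
by rewrite addr0.
Qed.
Lemma fs_mul f (c : V -> F) : fs f -> fs (fun x => c x * f x).
Proof. by move=> [s Hs]; exists s => x /Hs->; rewrite mulr0. Qed.
Lemma fs_SI T f : SI T -> fs f -> fs (T f).
Proof.
move=> [L H] ff.
have : fs (fun x => \sum_(u <- L) u.1 * f (x - u.2)).
  elim: L {H} => [|u L IH]; first by exists [::] => x _; rewrite big_nil.
  have [t Ht] := fs_add (fs_mul (fun=> u.1) (fs_shift u.2 ff)) IH.
  by exists t => x /Ht; rewrite big_cons.
by move=> [t Ht]; exists t => x /Ht; rewrite H.
Qed.
Lemma fs_ind0 : fs indicator0.
Proof. by exists [:: 0] => x; rewrite inE /indicator0 => /negPf->. Qed.

(** A finitely supported function is a combination of translates of the point mass at 0, and these
    operators commute with translations. *)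
Lemma SI_eq0 T1 T2 : SI T1 -> SI T2 -> T1 indicator0 =1 T2 indicator0 ->
  forall f, fs f -> T1 f =1 T2 f.
Proof.
move=> S1 S2 E f /fs_uniq[s us Hs].
have dec : f =1 (fun z => \sum_(y <- s) f y * indicator0 (z - y)).
  move=> z; case: (boolP (z \in s)) => zs; last first.
    rewrite Hs // big_seq big1 // => y ys; rewrite /indicator0 subr_eq0.
    by case: eqP => [zy|]; rewrite ?mulr0 //; move: zs; rewrite zy ys.
  rewrite (bigD1_seq z) //= /indicator0 subrr eqxx mulr1 big1 ?addr0 // => y yz.
  by rewrite subr_eq0 eq_sym (negPf yz) mulr0.
have key T : SI T -> forall x, T f x = \sum_(y <- s) f y * T indicator0 (x - y).
  move=> [L H] x; rewrite H; under eq_bigr do rewrite dec mulr_sumr.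
  rewrite exchange_big; apply: eq_bigr => y _; rewrite H mulr_sumr.
  by apply: eq_bigr => u _; rewrite mulrCA; congr (_ * (_ * indicator0 _)); rewrite addrAC.
by move=> x; rewrite !key //; apply: eq_bigr => y _; rewrite E.
Qed.

Lemma delta_cat s1 s2 f : delta (s1 ++ s2) f = delta s1 (delta s2 f).
Proof. by rewrite /delta foldr_cat. Qed.

Lemma delta_perm s1 s2 f : perm_eq s1 s2 -> delta s1 f =1 delta s2 f.
Proof.
have ins a t1 t2 g x : delta (t1 ++ a :: t2) g x = delta (a :: t1 ++ t2) g x.
  rewrite -[a :: t2]cat1s -[a :: t1 ++ t2]cat1s !delta_cat.
  exact: SI_C (SI_delta _) (SI_D a).
elim: s1 s2 => [|a s1 IH] s2 p; first by rewrite (perm_nilP (_ : perm_eq s2 [::])) // perm_sym.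
have as2 : a \in s2 by rewrite -(perm_mem p) inE eqxx.
move: p; case/splitPr: as2 => t1 t2 p x; rewrite ins /=.
apply: (SI_ext (SI_D a)); apply: IH.
by rewrite -(perm_cons a) (perm_trans p) // perm_sym -cat1s perm_catCA.
Qed.
End Shift.

Section Form.
Variables (F : realFieldType) (V : lmodType F) (ip : V -> V -> F).
Hypothesis ipDl : forall x y z, ip (x + y) z = ip x z + ip y z.
Hypothesis ipZl : forall c x y, ip (c *: x) y = c * ip x y.
Hypothesis ipC : forall x y, ip x y = ip y x.
Implicit Types (f g m : V -> F) (x y a b : V).

Lemma formDr x y z : ip x (y + z) = ip x y + ip x z.
Proof. by rewrite ipC ipDl !(ipC x). Qed.
Lemma formZr c x y : ip x (c *: y) = c * ip x y.
Proof. by rewrite ipC ipZl ipC. Qed.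
Lemma formNl x y : ip (- x) y = - ip x y.
Proof. by rewrite -scaleN1r ipZl mulN1r. Qed.
Lemma formNr x y : ip x (- y) = - ip x y.
Proof. by rewrite ipC formNl ipC. Qed.
Lemma ip0l y : ip 0 y = 0.
Proof. by rewrite -(scale0r 0) ipZl mul0r. Qed.
Lemma ip_suml (I : Type) (r : seq I) (G : I -> V) y :
  ip (\sum_(i <- r) G i) y = \sum_(i <- r) ip (G i) y.
Proof. by elim: r => [|i r IH]; rewrite ?big_nil ?ip0l // !big_cons ipDl IH. Qed.

(** Multiplication by a linear form is a derivation for convolution. On e^(b/2) and e^(-b/2) it has
    opposite eigenvalues, so differentiating [Dop b] gives a multiple of the mean [Aop b]. *)
Lemma mul_Dop a b f x :
  ip x a * Dop b f x = Dop b (fun y => ip y a * f y) x + ip b a * Aop b f x.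
Proof. by rewrite /Dop /Aop /half !ipDl !formNl !ipZl; ring. Qed.

Lemma normsq_Dop b f x :
  ip x x * Dop b f x = Dop b (fun y => ip y y * f y) x
    + 2 * Aop b (fun y => ip y b * f y) x + 4^-1 * ip b b * Dop b f x.
Proof.
rewrite /Dop /Aop /half !(ipDl, formDr, formNl, formNr, ipZl, formZr) (ipC b x).
have -> : (4^-1 : F) = 2^-1 * 2^-1 by field.
by field.
Qed.

Lemma mul_delta a s : exists2 Th, SI Th & forall f x,
  ip x a * delta s f x = delta s (fun y => ip y a * f y) x + Th f x.
Proof.
elim: s => [|b s [Th STh IH]].
  by exists (fun f x => 0); [exact: SI_0 | move=> f x; rewrite addr0].
exists (fun f x => Dop b (Th f) x + ip b a * Aop b (delta s f) x).
  apply: SI_add; first exact: SI_comp (SI_D b) STh.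
  exact: SI_scale (SI_comp (SI_A b) (SI_delta s)).
move=> f x /=; rewrite mul_Dop addrA; congr (_ + _).
rewrite (SI_ext (SI_D b) (IH f)) (SI_addf _ _ _ (SI_D b)) //.
Qed.

(* The relation on T is the one satisfied by mu |-> tr (f e) on V_mu, for e and
   f dual root vectors of a and -a. *)
Lemma normsq_delta s : exists2 Xi, SI Xi & forall m (T : V -> V -> F),
  (forall a x, a \in s -> T a (x - a) - T a x = ip x a * m x) ->
  forall x, ip x x * delta s m x =
    delta s (fun y => ip y y * m y + \sum_(a <- s) (ip y a * m y + 2 * T a y)) x
    + Xi m x.
Proof.
elim: s => [|a s [Xi SXi IH]].
  exists (fun f x => 0); [exact: SI_0 | move=> m T _ x].
  by rewrite /= big_nil !addr0.
have [Th STh HTh] := mul_delta a s.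
exists (fun f x => Dop a (Xi f) x + (2 * Aop a (Th f) x + 4^-1 * ip a a * Dop a (delta s f) x)).
  apply: SI_add; first exact: SI_comp (SI_D a) SXi.
  apply: SI_add; first exact: SI_scale (SI_comp (SI_A a) STh).
  exact: SI_scale (SI_comp (SI_D a) (SI_delta s)).
move=> m T HT x.
have HT' b y : b \in s -> T b (y - b) - T b y = ip y b * m y.
  by move=> bs; apply: HT; rewrite inE bs orbT.
rewrite /= normsq_Dop (SI_ext (SI_D a) (IH m T HT')) (SI_addf _ _ _ (SI_D a)).
rewrite (SI_ext (SI_A a) (HTh m)) (SI_addf _ _ _ (SI_A a)).
(* By the recurrence, [ip y a * m y] is [Dop a] of T shifted by half a root. The cross term of the
   Leibniz rule, a mean over [a], thus becomes [Dop a] of a mean, which is the missing summand for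
   [a] in the sum over [a :: s]. *)
pose h y := T a (y - half a).
have hE : (fun y => ip y a * m y) =1 Dop a h.
  move=> y; rewrite /Dop /h addrK -HT ?inE ?eqxx //.
  by rewrite -addrA -opprD halfD.
have -> : Aop a (delta s (fun y => ip y a * m y)) x =
    Dop a (delta s (fun y => 2^-1 * (ip y a * m y + 2 * T a y))) x.
  rewrite (SI_ext (SI_comp (SI_A a) (SI_delta s)) hE).
  rewrite (SI_C _ _ (SI_comp (SI_A a) (SI_delta s)) (SI_D a)).
  apply: (SI_ext (SI_D a)) => {}x; rewrite (SI_C _ _ (SI_A a) (SI_delta s)).
  apply: (SI_ext (SI_delta s)) => y; rewrite -HT ?inE ?eqxx // /Aop /h addrK.
  rewrite -addrA -opprD halfD; ring.
have -> : Dop a (delta s (fun y => ip y y * m y +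
      \sum_(b <- a :: s) (ip y b * m y + 2 * T b y))) x =
    Dop a (delta s (fun y => ip y y * m y + \sum_(b <- s) (ip y b * m y + 2 * T b y))) x
    + 2 * Dop a (delta s (fun y => 2^-1 * (ip y a * m y + 2 * T a y))) x.
  pose S := SI_comp (SI_D a) (SI_delta s).
  rewrite -(SI_scalef 2 _ x S) -(SI_addf _ _ x S); apply: (SI_ext S) => y.
  by rewrite big_cons; field.
ring.
Qed.

Definition reflection a x : V := x - (2 * ip x a / ip a a) *: a.
Local Notation refl := reflection.
Lemma reflD a x y : refl a (x + y) = refl a x + refl a y.
Proof. by rewrite /reflection ipDl mulrDr mulrDl scalerDl opprD addrACA. Qed.
Lemma reflZ a c x : refl a (c *: x) = c *: refl a x.
Proof.
rewrite /reflection ipZl scalerBr scalerA; congr (_ - _ *: _); by rewrite mulrCA !mulrA.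
Qed.
Lemma reflN a x : refl a (- x) = - refl a x.
Proof. by rewrite -scaleN1r reflZ scaleN1r. Qed.
Lemma refl0 a : refl a 0 = 0.
Proof. by rewrite -[X in refl _ X](scale0r 0) reflZ scale0r. Qed.
Hypothesis ip_gt0 : forall x, x != 0 -> 0 < ip x x.

Lemma ip_neq0 a : a != 0 -> ip a a != 0.
Proof. by move=> /ip_gt0; apply: lt0r_neq0. Qed.
Lemma refl_self a : a != 0 -> refl a a = - a.
Proof. by move=> a0; rewrite /reflection mulfK ?ip_neq0 // scaler_nat mulr2n opprD addNKr. Qed.
Lemma reflK a : a != 0 -> involutive (refl a).
Proof.
move=> a0 x; rewrite {2}/reflection reflD reflN reflZ refl_self // /reflection scalerN opprK subrK //.
Qed.
Lemma ip_refl a x y : a != 0 -> ip (refl a x) (refl a y) = ip x y.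
Proof.
move=> a0; rewrite /reflection !(ipDl, formDr, formNl, formNr, ipZl, formZr) (ipC a y).
by field; rewrite ip_neq0.
Qed.
Lemma ip_refll a x y : a != 0 -> ip (refl a x) y = ip x (refl a y).
Proof. by move=> a0; rewrite -(ip_refl _ _ a0) reflK. Qed.

Lemma Dop_refl a b f x : a != 0 -> Dop b f (refl a x) = Dop (refl a b) (fun y => f (refl a y)) x.
Proof.
move=> a0; have hb : refl a (half (refl a b)) = half b by rewrite /half reflZ reflK.
by rewrite /Dop !reflD reflN hb.
Qed.
Lemma DopN b f x : Dop (- b) f x = - Dop b f x.
Proof. by rewrite /Dop /half scalerN opprK opprB. Qed.
Lemma delta_refl a s f x : a != 0 ->
  delta s f (refl a x) = delta (map (refl a) s) (fun y => f (refl a y)) x.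
Proof.
move=> a0; elim: s x => //= b s IH x; rewrite Dop_refl //.
by apply: (SI_ext (SI_D _)) => y; rewrite IH.
Qed.
End Form.

(** * Divisibility by difference operators *)

Section ClassSums.
Variables (F : realFieldType) (V : lmodType F).
Implicit Types (f g m : V -> F) (x y a b : V).

(* Functions modulo the image of [Dop a] are detected by their sums over the
   cosets of the group generated by a. *)
Definition zrel a x y : bool := `[< exists k : int, y = x + a *~ k >].
Lemma zrel_refl a x : zrel a x x.
Proof. by apply/asboolP; exists 0; rewrite mulr0z addr0. Qed.
Lemma zrel_sym a x y : zrel a x y = zrel a y x.
Proof.
suff H u v : zrel a u v -> zrel a v u by apply/idP/idP => /H.
by move=> /asboolP[k ->]; apply/asboolP; exists (- k); rewrite mulrNz addrK.
Qed.
Lemma zrel_trans a x y z : zrel a x y -> zrel a y z -> zrel a x z.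
Proof.
move=> /asboolP[k ->] /asboolP[l ->]; apply/asboolP; exists (k + l).
by rewrite mulrzDr addrA.
Qed.
Lemma zrel_eql a x y z : zrel a x y -> zrel a x z = zrel a y z.
Proof.
move=> xy; apply/idP/idP => [xz|yz]; last exact: zrel_trans yz.
by apply: zrel_trans xz; rewrite zrel_sym.
Qed.
Lemma zrel_add a x y z : zrel a (x + z) (y + z) = zrel a x y.
Proof.
apply/idP/idP => /asboolP[k H]; apply/asboolP; exists k.
  by apply: (addIr z); rewrite H addrAC.
by rewrite H addrAC.
Qed.

Definition clsum a (s : seq V) f x : F := \sum_(y <- s | zrel a x y) f y.

Lemma clsum_sub a (s t : seq V) f x : uniq s -> uniq t -> {subset s <= t} ->
  (forall y, y \notin s -> f y = 0) -> clsum a t f x = clsum a s f x.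
Proof.
move=> us ut st Hs; rewrite /clsum -!(big_filter _ (zrel a x)).
rewrite (bigID (mem s)) /= [X in _ + X]big1 ?addr0; last by move=> y /Hs.
rewrite -big_filter; apply: perm_big; apply: uniq_perm; rewrite ?filter_uniq //.
move=> y; rewrite !mem_filter; case: (boolP (y \in s)) => //= ys; last by rewrite andbF.
by rewrite (st _ ys) andbT.
Qed.
Lemma clsum_indep a (s t : seq V) f x : uniq s -> uniq t ->
  (forall y, y \notin s -> f y = 0) -> (forall y, y \notin t -> f y = 0) ->
  clsum a s f x = clsum a t f x.
Proof.
move=> us ut Hs Ht; pose u := undup (s ++ t).
have uu : uniq u by exact: undup_uniq.
rewrite -(@clsum_sub a s u) //; last by move=> y ys; rewrite mem_undup mem_cat ys.
by rewrite (@clsum_sub a t u) // => y ys; rewrite mem_undup mem_cat ys orbT.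
Qed.

Definition vanishing a f := exists2 s, uniq s &
  (forall y, y \notin s -> f y = 0) /\ forall x, clsum a s f x = 0.

Lemma vanishingP a f s : vanishing a f -> uniq s -> (forall y, y \notin s -> f y = 0) ->
  forall x, clsum a s f x = 0.
Proof. by move=> [t ut [Ht H]] us Hs x; rewrite (clsum_indep a x us ut Hs Ht). Qed.

Lemma clsum_shift a (s : seq V) f v x :
  clsum a [seq y + v | y <- s] (fun y => f (y - v)) x = clsum a s f (x - v).
Proof.
rewrite /clsum big_map; apply: eq_big => y; last by rewrite addrK.
by rewrite -[in RHS](zrel_add _ _ _ v) subrK.
Qed.

Lemma uniq_shift (s : seq V) v : uniq s -> uniq [seq y + v | y <- s].
Proof. by move=> us; rewrite map_inj_uniq //; exact: addIr. Qed.
Lemma notin_shift (s : seq V) v y : y \notin [seq z + v | z <- s] -> y - v \notin s.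
Proof. by apply: contra => ys; apply/mapP; exists (y - v); rewrite ?subrK. Qed.

Lemma clsum_Dop a b (s t : seq V) f x : uniq s -> uniq t ->
  (forall y, y \notin s -> f y = 0) -> (forall y, y \notin t -> Dop b f y = 0) ->
  clsum a t (Dop b f) x = clsum a s f (x - half b) - clsum a s f (x + half b).
Proof.
move=> us ut Hs Ht.
have -> : clsum a s f (x + half b) = clsum a s f (x - (- half b)) by rewrite opprK.
rewrite -(clsum_shift a s f (half b)) -(clsum_shift a s f (- half b)).
set t1 := map _ s; set t2 := map _ s.
pose u := undup (t ++ t1 ++ t2).
have uu : uniq u by exact: undup_uniq.
rewrite -(@clsum_sub a t u) //; last by move=> y ys; rewrite mem_undup mem_cat ys.
rewrite -(@clsum_sub a t1 u) ?uniq_shift //; last first.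
- by move=> y /notin_shift /Hs.
- by move=> y ys; rewrite mem_undup !mem_cat ys orbT.
rewrite -(@clsum_sub a t2 u) ?uniq_shift //; last first.
- by move=> y /notin_shift; rewrite opprK => /Hs.
- by move=> y ys; rewrite mem_undup !mem_cat ys !orbT.
by rewrite /clsum -sumrB; apply: eq_bigr => y _; rewrite /Dop opprK.
Qed.

Lemma vanishing_Dop a f : fs f -> vanishing a (Dop a f).
Proof.
move=> ff; have [t ut Ht] := fs_uniq (fs_SI (SI_D a) ff); have [s us Hs] := fs_uniq ff.
exists t => //; split=> // x; rewrite (clsum_Dop a x us ut Hs Ht).
apply/eqP; rewrite subr_eq0; apply/eqP; apply: eq_bigl => y.
apply: zrel_eql; apply/asboolP; exists 1.
by rewrite mulr1z -[X in _ = _ + X](halfD a) addrA subrK.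
Qed.

(** Telescoping along the chain x, x + a, ...: the masses at two neighbours differ by [Dop a] of
    minus the mass at their midpoint. *)
Lemma ind_diff a x (k : int) : exists2 g, fs g &
  forall y, indicator0 (y - x) - indicator0 (y - (x + a *~ k)) = Dop a g y.
Proof.
have pos x' (k' : nat) : exists2 g, fs g &
  forall y, indicator0 (y - x') - indicator0 (y - (x' + a *+ k')) = Dop a g y.
  elim: k' => [|k' [g fg Hg]].
    exists (fun=> 0); first by exists [::].
    by move=> y; rewrite mulr0n addr0 /Dop !subrr.
  exists (fun y => g y + -1 * indicator0 (y - (x' + a *+ k' + half a))).
    exact: fs_add (fs_mul (fun=> -1) (fs_shift _ (fs_ind0 _))).
  move=> y; have := Hg y; rewrite /Dop => H.
  rewrite -(subrK (indicator0 (y - (x' + a *+ k'))) (indicator0 (y - x'))) H.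
  have -> : y - half a - (x' + a *+ k' + half a) = y - (x' + a *+ k'.+1).
    rewrite mulrSr; move: (a *+ k') => A.
    rewrite -[X in _ = y - (x' + (A + X))](halfD a) !(addrA x') (addrA _ (half a)).
    by rewrite [in RHS]opprD [RHS]addrA addrAC.
  have -> : y + half a - (x' + a *+ k' + half a) = y - (x' + a *+ k').
    by rewrite [in LHS]opprD addrACA subrr addr0 opprD.
  ring.
case: k => k; first exact: pos.
have [g fg Hg] := pos (x + a *~ Negz k) k.+1.
exists (fun y => - g y).
  by have [s Hs] := fg; exists s => y /Hs->; rewrite oppr0.
move=> y; rewrite /Dop opprK addrC; have := Hg y; rewrite /Dop.
have -> : x + a *~ Negz k + a *+ k.+1 = x by rewrite NegzE mulrNz subrK.
by move=> H; rewrite addrC -opprB H opprB addrC.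
Qed.

Lemma vanishingD a f g : vanishing a f -> vanishing a g -> vanishing a (fun x => f x + g x).
Proof.
move=> vf vg; have [s us [Hs _]] := vf; have [t ut [Ht _]] := vg.
pose u := undup (s ++ t); have uu : uniq u by exact: undup_uniq.
have Hf y : y \notin u -> f y = 0.
  by rewrite mem_undup mem_cat negb_or => /andP[/Hs].
have Hg y : y \notin u -> g y = 0.
  by rewrite mem_undup mem_cat negb_or => /andP[_ /Ht].
exists u => //; split=> [y yu|x]; first by rewrite Hf ?Hg ?addr0.
by rewrite /clsum big_split /= -/(clsum a u f x) -/(clsum a u g x) !(vanishingP _ uu) ?addr0.
Qed.
Lemma vanishingZ a c f : vanishing a f -> vanishing a (fun x => c * f x).
Proof.
move=> [s us [Hs H]]; exists s => //; split=> [y /Hs->|x]; first by rewrite mulr0.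
by rewrite /clsum -mulr_sumr -/(clsum a s f x) H mulr0.
Qed.
Lemma vanishing_ext a f g : f =1 g -> vanishing a f -> vanishing a g.
Proof.
move=> fg [s us [Hs H]]; exists s => //; split=> [y /Hs|x]; first by rewrite fg.
by rewrite -(H x); apply: eq_bigr.
Qed.

(** Induction on the support. Since the class sum is 0, a point x carrying mass has another point of
    the support in its class; subtracting a multiple of [Dop a g] moves the mass of x there. *)
Lemma vanishing_div a f : vanishing a f -> exists2 g, fs g & f =1 Dop a g.
Proof.
move=> vf; have [s us [Hs _]] := vf.
have [k] := ubnP (size s); elim: k s f vf us Hs => // k IH [|x s] f vf us Hs.
  move=> _; exists (fun=> 0); first by exists [::].
  by move=> y; rewrite Hs // /Dop subrr.
rewrite /= ltnS => sk; have [xs us'] := andP us.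
have [fx|fx] := eqVneq (f x) 0.
  apply: (IH s) => // y ys; have [->//|yx] := eqVneq y x.
  by apply: Hs; rewrite inE (negPf yx).
have := vanishingP vf us Hs x; rewrite /clsum big_cons zrel_refl => H.
have : has (zrel a x) s.
  apply: contraNT fx => /hasPn H0; rewrite -H big_seq_cond big1 ?addr0 //.
  by move=> y /andP[/H0/negPf->].
case/hasP => y ys /asboolP[l yE].
have [g fg Hg] := ind_diff a x l.
have [] := IH s (fun z => f z + - f x * Dop a g z) _ us' _ sk.
- by apply: vanishingD => //; apply: vanishingZ; exact: vanishing_Dop.
- move=> z zs; rewrite -Hg -yE /indicator0 !subr_eq0.
  have -> /= : (z == y) = false by apply: contraNF zs => /eqP->.
  have [->|zx] := eqVneq z x; first by rewrite subr0 mulr1 subrr.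
  by rewrite subrr mulr0 addr0 Hs // inE (negPf zx).
move=> g' fg' Hg'; exists (fun z => g' z + f x * g z).
  exact: fs_add (fs_mul (fun=> f x) fg).
by move=> z; rewrite -[LHS](addrK (- f x * Dop a g z)) Hg' /Dop; ring.
Qed.

(* Coprimality of the factors attached to nonproportional vectors. *)
Lemma vanishing_coprime a b f : fs f -> (forall c, b != c *: a) ->
  vanishing a (Dop b f) -> vanishing a f.
Proof.
move=> ff nab v; have [s us Hs] := fs_uniq ff.
have [t ut Ht] := fs_uniq (fs_SI (SI_D b) ff).
exists s => //; split=> // x.
(* The class sums of f modulo a are periodic under b, while the points x + k b lie in pairwise
   distinct classes. One nonzero class sum would therefore require infinitely many points in the
   support. *)
have per z : clsum a s f z = clsum a s f (z + b).
  have := clsum_Dop a (z + half b) us ut Hs Ht.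
  by rewrite (vanishingP v) // addrK -addrA halfD => /esym/eqP; rewrite subr_eq0 => /eqP.
have pern z k : clsum a s f z = clsum a s f (z + b *+ k).
  by elim: k => [|k IH]; rewrite ?mulr0n ?addr0 // IH per mulrSr addrA.
have sep k l y : zrel a (x + b *+ k) y -> zrel a (x + b *+ l) y -> k = l.
  move=> H1 H2; have /asboolP[z Hz] : zrel a (x + b *+ k) (x + b *+ l).
    by rewrite zrel_sym in H2; exact: zrel_trans H1 H2.
  apply/eqP; apply/negPn/negP => kl.
  have [] := negP (nab ((l%:R - k%:R)^-1 * z%:~R)).
  have nz : l%:R - k%:R != 0 :> F by rewrite subr_eq0 eqr_nat eq_sym.
  rewrite -scalerA scaler_int; apply/eqP; apply: (scalerI nz).
  rewrite scalerA mulfV // scale1r scalerBl !scaler_nat.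
  by move/eqP: Hz; rewrite -addrA (inj_eq (addrI x)) => /eqP->; rewrite addrAC subrr add0r.
apply: contrapT => /eqP nz.
have ex k : has (zrel a (x + b *+ k)) s.
  apply: contraNT nz => /hasPn H; rewrite (pern x k) /clsum big_seq_cond big1 //.
  by move=> y /andP[/H/negPf->].
pose F' k := nth 0 s (find (zrel a (x + b *+ k)) s).
have Fs k : F' k \in s by rewrite mem_nth // -has_find.
have Finj : injective F'.
  move=> k l kl; apply: (sep k l (F' k)); first exact: nth_find.
  by rewrite kl; exact: nth_find.
have := @uniq_leq_size _ (map F' (iota 0 (size s).+1)) s.
rewrite map_inj_uniq ?iota_uniq // size_map size_iota ltnn => /(_ isT) H.
by have : false by apply: H => y /mapP[k _ ->].
Qed.
End ClassSums.

(** * Reflections of a positive system and the half sum of its roots *)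

Section Roots.
Variables (F : realFieldType) (V : lmodType F) (ip : V -> V -> F).
Hypothesis ipDl : forall x y z, ip (x + y) z = ip x z + ip y z.
Hypothesis ipZl : forall c x y, ip (c *: x) y = c * ip x y.
Hypothesis ipC : forall x y, ip x y = ip y x.
Hypothesis ip_gt0 : forall x, x != 0 -> 0 < ip x x.
Variables (Phi : seq V) (h : V -> F).
Hypothesis hD : forall x y, h (x + y) = h x + h y.
Hypothesis hZ : forall c x, h (c *: x) = c * h x.
Hypothesis h_gt0 : forall a, a \in Phi -> 0 < h a.
Hypothesis Phi_uniq : uniq Phi.
Hypothesis Phi_refl : forall a b, a \in Phi -> b \in Phi ->
  (reflection ip a b \in Phi) || (- reflection ip a b \in Phi).
Hypothesis Phi_red : forall a b c, a \in Phi -> b \in Phi -> b = c *: a -> b = a.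
Hypothesis Phi_int : forall a b, a \in Phi -> b \in Phi ->
  exists k : int, 2 * ip b a / ip a a = k%:~R.
Implicit Types (f g m : V -> F) (x y a b : V).

Local Notation refl := (reflection ip).

Lemma hN x : h (- x) = - h x.
Proof. by rewrite -scaleN1r hZ mulN1r. Qed.
Lemma h0 : h 0 = 0.
Proof. by rewrite -(scale0r 0) hZ mul0r. Qed.
Lemma h_half a : h (half a) = 2^-1 * h a.
Proof. exact: hZ. Qed.
Lemma Phi_neq0 a : a \in Phi -> a != 0.
Proof. by move=> /h_gt0; apply: contraTneq => ->; rewrite h0 ltxx. Qed.
Lemma Phi_opp a : a \in Phi -> (- a \in Phi) = false.
Proof.
by move=> /h_gt0 ha; apply/negP => /h_gt0; rewrite hN oppr_gt0 => /(lt_trans ha); rewrite ltxx.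
Qed.

Section Refl.
Variable a : V.
Hypothesis aP : a \in Phi.
Let a0 : a != 0 := Phi_neq0 aP.

(** The root [a] is any positive root, not only a simple one, so its reflection may send members of
    [rest] to negative roots. [tau] is the reflection followed by the choice of the positive root
    among b and - b; it is an involution of [rest]. *)
Definition posr b := if b \in Phi then b else - b.
Definition tau b := posr (refl a b).
Definition rest := rem a Phi.

Lemma mem_rest b : (b \in rest) = (b != a) && (b \in Phi).
Proof. by rewrite mem_rem_uniq. Qed.
Lemma posr_Phi b : (b \in Phi) || (- b \in Phi) -> posr b \in Phi.
Proof. by rewrite /posr; case: ifP. Qed.
Lemma posrE b : b \in Phi -> posr b = b.
Proof. by rewrite /posr => ->. Qed.
Lemma posrN b : b \in Phi -> posr (- b) = b.
Proof. by move=> bP; rewrite /posr Phi_opp // opprK. Qed.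
Lemma posr_cases b : posr b = b \/ posr b = - b.
Proof. by rewrite /posr; case: ifP; [left|right]. Qed.

Lemma tauK b : b \in Phi -> tau (tau b) = b.
Proof.
move=> bP; rewrite /tau; case: (posr_cases (refl a b)) => ->.
  by rewrite reflK // posrE.
by rewrite (reflN ipZl) reflK // posrN.
Qed.
Lemma tau_rest b : b \in rest -> tau b \in rest.
Proof.
rewrite !mem_rest => /andP[ba bP].
have tP : tau b \in Phi by apply: posr_Phi; exact: Phi_refl.
rewrite tP andbT; apply: contraNneq ba => tba.
by rewrite -(tauK bP) tba /tau (refl_self ip_gt0) // posrN.
Qed.

Lemma refl_fixN b : b \in Phi -> refl a b = - b -> b = a.
Proof.
move=> bP H; apply: (Phi_red (c := ip b a / ip a a)) => //.
have /eqP : b + b = (2 * (ip b a / ip a a)) *: a.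
  by move: H; rewrite /reflection -mulrA => /eqP; rewrite subr_eq addrC -subr_eq opprK => /eqP.
rewrite -mulr2n -scaler_nat -scalerA => /eqP; apply: scalerI.
by rewrite pnatr_eq0.
Qed.

Definition neg b := refl a b \notin Phi.
Lemma neg_tau b : b \in Phi -> neg (tau b) = neg b.
Proof.
move=> bP; rewrite /neg /tau /posr.
case: ifPn => [H|H]; first by rewrite reflK // bP.
by rewrite (reflN ipZl) reflK // Phi_opp.
Qed.

(** [tau] preserves [neg], and a fixed point with [neg] would be sent to its opposite by the
    reflection, hence equal [a]. The sign of the reflection on the Weyl denominator therefore comes
    from the factor of [a] alone. *)
Lemma neg_parity : \big[addb/false]_(b <- rest) neg b = false.
Proof.
apply: (involution_parity (t := tau)); first exact: rem_uniq.
- exact: tau_rest.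
- by move=> b; rewrite mem_rest => /andP[_ /tauK].
- by move=> b; rewrite mem_rest => /andP[_ /neg_tau].
move=> b; rewrite mem_rest => /andP[ba bP] tb; case nb: (neg b) => //; exfalso.
move: tb; rewrite /tau /posr; move/negPf: nb => nb; rewrite nb => /eqP; rewrite eqr_oppLR => /eqP /refl_fixN.
by move=> /(_ bP) E; rewrite E eqxx in ba.
Qed.

Lemma perm_tau : perm_eq (map tau rest) rest.
Proof.
have ur : uniq rest := rem_uniq _ Phi_uniq.
apply: uniq_perm => //.
  rewrite map_inj_in_uniq // => b c; rewrite !mem_rest => /andP[_ bP] /andP[_ cP] H.
  by rewrite -(tauK bP) H tauK.
move=> b; apply/mapP/idP => [[c cr ->]|br]; first exact: tau_rest.
by exists (tau b); [exact: tau_rest | rewrite tauK //; move: br; rewrite mem_rest => /andP[]].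
Qed.

Lemma delta_rest_refl f x : delta rest f (refl a x) = delta rest (fun y => f (refl a y)) x.
Proof.
rewrite (delta_refl ipDl ipZl ip_gt0) //.
have sgn s g y : delta (map (refl a) s) g y =
    (-1) ^+ (\big[addb/false]_(b <- s) neg b) * delta (map tau s) g y.
  elim: s y => [|b s IH] y; first by rewrite big_nil mul1r.
  rewrite big_cons /= (SI_ext (SI_D _) IH) (SI_scalef _ _ _ (SI_D _)).
  rewrite signr_addb -mulrA mulrCA; congr (_ * _).
  rewrite /neg /tau /posr; case: ifP => _ /=; first by rewrite mul1r.
  by rewrite expr1 mulN1r DopN opprK.
by rewrite sgn neg_parity mul1r; apply: delta_perm; exact: perm_tau.
Qed.

Lemma delta_Phi_rest f : delta Phi f =1 Dop a (delta rest f).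
Proof. by apply: (delta_perm _ (perm_to_rem aP)). Qed.

Lemma delta_anti f x : delta Phi f (refl a x) = - delta Phi (fun y => f (refl a y)) x.
Proof.
rewrite !delta_Phi_rest (Dop_refl ipDl ipZl ip_gt0) // (refl_self ip_gt0) // DopN.
by congr (- _); apply: (SI_ext (SI_D a)) => y; rewrite delta_rest_refl.
Qed.

(** In the pairing of rho with the coroot of [a], the root [a] contributes 1. The other roots
    contribute half the sum of their pairings, and that sum is even: [tau] preserves each pairing up
    to sign, and its fixed points pair to 0. *)
Lemma int_rhos : exists k : int, 2 * ip (rhos Phi) a / ip a a = k%:~R.
Proof.
have nz := ip_neq0 ip_gt0 a0.
have /choice[c cE] b : exists k : int, b \in Phi -> 2 * ip b a / ip a a = k%:~R.
  case: (boolP (b \in Phi)) => bP; last by exists 0.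
  by have [k Hk] := Phi_int aP bP; exists k.
have ctau b : b \in Phi -> c (tau b) = if neg b then c b else - c b.
  move=> bP; apply: (@intr_inj F).
  have tP : tau b \in Phi by apply: posr_Phi; exact: Phi_refl.
  rewrite -cE // /tau /posr /neg; case: ifP => _ /=.
    rewrite (ip_refll ipDl ipZl ipC ip_gt0) // (refl_self ip_gt0) //.
    by rewrite (formNr ipZl ipC) mulrN mulNr cE // -mulrNz.
  rewrite (formNl ipZl) (ip_refll ipDl ipZl ipC ip_gt0) // (refl_self ip_gt0) //.
  by rewrite (formNr ipZl ipC) opprK cE.
have par : \big[addb/false]_(b <- rest) odd `|c b|%N = false.
  apply: (involution_parity (t := tau)); first exact: rem_uniq.
  - exact: tau_rest.
  - by move=> b; rewrite mem_rest => /andP[_ /tauK].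
  - by move=> b; rewrite mem_rest => /andP[_ bP]; rewrite ctau //; case: ifP => _; rewrite ?abszN.
  move=> b; rewrite mem_rest => /andP[ba bP] tb.
  have nb : neg b = false.
    case nb: (neg b) => //; exfalso; move: tb; rewrite /tau /posr; move/negPf: nb => nb; rewrite nb => /eqP.
    by rewrite eqr_oppLR => /eqP /refl_fixN E; rewrite E // eqxx in ba.
  by have := ctau b bP; rewrite tb nb => /eqP; rewrite -addr_eq0 -mulr2n mulrn_eq0 /= => /eqP->.
have ev (s : seq V) : exists k : int,
    \sum_(b <- s) c b = k *+ 2 + (\big[addb/false]_(b <- s) odd `|c b|%N)%:R.
  elim: s => [|b s [k IH]]; first by exists 0; rewrite !big_nil.
  have [k' Hk'] : exists k' : int, c b = k' *+ 2 + (odd `|c b|%N)%:R.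
    have e n : (n%:Z = (n./2)%:Z *+ 2 + (odd n)%:R)%R.
      by have := odd_double_half n; case: (odd n) => /=; lia.
    case: (c b) => n; first by exists (n./2)%:Z; rewrite /= -e.
    exists (- (n.+1./2)%:Z - (odd n.+1)%:R); rewrite NegzE abszN absz_nat.
    by have := e n.+1; case: (odd _) => /=; lia.
  rewrite !big_cons IH {1}Hk'.
  case: (odd _); case: (\big[_/_]_(_ <- _) _) => /=.
  - by exists (k' + k + 1); ring.
  - by exists (k' + k); ring.
  - by exists (k' + k); ring.
  - by exists (k' + k); ring.
have [k Hk] := ev rest; rewrite par addr0 in Hk.
exists (k + 1).
rewrite /rhos (perm_big _ (perm_to_rem aP)) big_cons /= ipDl (ip_suml ipDl ipZl).
rewrite mulrDr mulrDl /half ipZl mulrA mulfV ?pnatr_eq0 // mul1r mulfV // addrC.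
rewrite intrD; congr (_ + _).
have -> : 2 * (\sum_(b <- rem a Phi) ip (2^-1 *: b) a) / ip a a =
    2^-1 * \sum_(b <- rest) (c b)%:~R.
  rewrite mulr_sumr mulr_suml mulr_sumr; apply: eq_big_seq => b.
  rewrite mem_rest => /andP[_ bP]; rewrite -cE // ipZl.
  by field.
by rewrite -rmorph_sum /= Hk rmorphMn /=; field.
Qed.
End Refl.
End Roots.

(** * Antisymmetric functions and the Weyl numerator *)

Section Numerator.
Variables (F : realFieldType) (V : lmodType F) (ip : V -> V -> F).
Hypothesis ipDl : forall x y z, ip (x + y) z = ip x z + ip y z.
Hypothesis ipZl : forall c x y, ip (c *: x) y = c * ip x y.
Hypothesis ipC : forall x y, ip x y = ip y x.
Hypothesis ip_gt0 : forall x, x != 0 -> 0 < ip x x.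
Variables (Phi : seq V) (h : V -> F).
Hypothesis hD : forall x y, h (x + y) = h x + h y.
Hypothesis hZ : forall c x, h (c *: x) = c * h x.
Hypothesis h_gt0 : forall a, a \in Phi -> 0 < h a.
Hypothesis Phi_uniq : uniq Phi.
Hypothesis Phi_refl : forall a b, a \in Phi -> b \in Phi ->
  (reflection ip a b \in Phi) || (- reflection ip a b \in Phi).
Hypothesis Phi_red : forall a b c, a \in Phi -> b \in Phi -> b = c *: a -> b = a.
Hypothesis Phi_int : forall a b, a \in Phi -> b \in Phi ->
  exists k : int, 2 * ip b a / ip a a = k%:~R.

Implicit Types (f g m : V -> F) (x y a b : V).

Local Notation refl := (reflection ip).
Local Notation ind0 := (@indicator0 F V).
Local Notation hN := (hN hZ).
Local Notation Phi_neq0 := (Phi_neq0 hZ h_gt0).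

Lemma hB x y : h (x - y) = h x - h y.
Proof. by rewrite hD hN. Qed.

Lemma delta_top s f M : {subset s <= Phi} -> (forall x, M < h x -> f x = 0) ->
  (forall x, h (rhos s) + M < h x -> delta s f x = 0) /\
  (forall y, M <= h y -> delta s f (rhos s + y) = f y).
Proof.
move=> sP Hf; elim: s sP => [|a s IH] sP.
  rewrite /rhos big_nil (h0 hZ) /=; split=> [x|y _]; first by rewrite add0r; exact: Hf.
  by rewrite add0r.
have aP : a \in Phi by apply: sP; rewrite inE eqxx.
have [IH1 IH2] := IH (fun x xs => sP x (mem_behead (s := a :: s) xs)).
have ha := h_gt0 aP; rewrite /rhos big_cons -/(rhos s); split=> [x|y My] /=.
  by rewrite /Dop hD (h_half hZ) => H; rewrite !IH1 ?subrr // ?hB ?hD (h_half hZ); lra.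
have e : half a + rhos s + y - half a = rhos s + y by rewrite -(addrA (half a)) (addrC (half a)) addrK.
rewrite /Dop e IH2 //.
by rewrite IH1 ?subr0 // !hD (h_half hZ); lra.
Qed.

Lemma delta_bottom s f M : {subset s <= Phi} -> (forall x, h x < M -> f x = 0) ->
  (forall x, h x < M - h (rhos s) -> delta s f x = 0) /\
  (forall y, h y <= M -> delta s f (y - rhos s) = (-1) ^+ size s * f y).
Proof.
move=> sP Hf; elim: s sP => [|a s IH] sP.
  rewrite /rhos big_nil (h0 hZ) /=; split=> [x|y _]; first by rewrite subr0; exact: Hf.
  by rewrite subr0 mul1r.
have aP : a \in Phi by apply: sP; rewrite inE eqxx.
have [IH1 IH2] := IH (fun x xs => sP x (mem_behead (s := a :: s) xs)).
have ha := h_gt0 aP; rewrite /rhos big_cons -/(rhos s); split=> [x|y My] /=.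
  by rewrite /Dop hD (h_half hZ) => H; rewrite !IH1 ?subrr // ?hB ?hD (h_half hZ); lra.
have e : y - (half a + rhos s) + half a = y - rhos s by rewrite opprD addrA addrAC subrK.
rewrite /Dop e IH2 // IH1 ?sub0r ?exprS ?mulN1r ?mulNr //.
by rewrite !hB hD (h_half hZ); lra.
Qed.

Lemma delta_supp s f x : delta s f x != 0 -> exists y t,
  [/\ f y != 0, {subset t <= s} & x = y + rhos s - \sum_(a <- t) a].
Proof.
elim: s x => [|a s IH] x /=.
  by move=> fx; exists x, [::]; split=> //; rewrite /rhos !big_nil addr0 subr0.
rewrite /Dop => H.
have [H1|H1] := eqVneq (delta s f (x - half a)) 0.
  have /IH[y [t [fy ts E]]] : delta s f (x + half a) != 0.
    by apply: contraNneq H => ->; rewrite H1 subrr.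
  exists y, (a :: t); split=> //.
    by move=> z; rewrite !inE => /orP[->|/ts->]; rewrite ?orbT.
  rewrite /rhos !big_cons -/(rhos s) -(addrK (half a) x) E.
  rewrite -[X in - (X + _)](halfD a) (addrC (half a) (rhos s)) (addrA y).
  by rewrite -(addrA (half a) (half a)) (opprD (half a)) (addrA _ (- half a)) addrK opprD addrA addrAC.
have [y [t [fy ts E]]] := IH _ H1; exists y, t; split=> //.
  by move=> z /ts zs; rewrite inE zs orbT.
by rewrite /rhos big_cons -/(rhos s) -(subrK (half a) x) E addrAC (addrAC y) addrA.
Qed.

Definition cone z := exists2 t, {subset t <= Phi} & z = \sum_(a <- t) a.
Lemma coneD x y : cone x -> cone y -> cone (x + y).
Proof.
move=> [s sP ->] [t tP ->]; exists (s ++ t); last by rewrite big_cat.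
by move=> z; rewrite mem_cat => /orP[/sP|/tP].
Qed.
Lemma cone_h z : cone z -> 0 <= h z.
Proof.
move=> [t tP ->]; elim: t tP => [|a t IH] tP; first by rewrite big_nil (h0 hZ).
rewrite big_cons hD addr_ge0 ?IH // => [|x xt]; last by apply: tP; rewrite inE xt orbT.
by apply/ltW/h_gt0/tP; rewrite inE eqxx.
Qed.

Definition anti f := forall a x, a \in Phi -> f (refl a x) = - f x.
Definition dom x := forall a, a \in Phi -> 0 < ip x a.

(** On a wall antisymmetry forces f x = 0, and on the negative side of a wall the reflected point is
    higher for h. *)
Lemma anti_max f x : anti f -> f x != 0 ->
  (forall y, f y != 0 -> h y <= h x) -> dom x.
Proof.
move=> af fx mx a aP; have a0 := Phi_neq0 aP; have paa := ip_gt0 a0.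
rewrite ltNge; apply/negP => xa.
have := af a x aP; case: (eqVneq (ip x a) 0) => [xa0|xa0].
  rewrite /reflection xa0 mulr0 mul0r scale0r subr0 => /eqP.
  by rewrite -addr_eq0 -mulr2n mulrn_eq0 (negPf fx).
move=> E; have : h (refl a x) <= h x by apply: mx; rewrite E oppr_eq0.
rewrite /reflection hB hZ lerBlDr lerDl leNgt => /negP; apply.
rewrite nmulr_rlt0 ?h_gt0 // ltr_pdivrMr // mul0r pmulr_rlt0 //.
by rewrite lt_neqAle xa0.
Qed.

Lemma anti_dom f : anti f -> fs f -> (exists x, f x != 0) -> exists2 x, f x != 0 & dom x.
Proof.
move=> af [s Hs] [x0 fx0].
have [] := @seq_maxP V F h s (fun x => f x != 0).
  by apply/hasP; exists x0 => //; apply: contraNT fx0 => /Hs->.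
move=> x [_ fx mx]; exists x => //; apply: (anti_max af fx) => y fy.
by apply: mx => //; apply: contraNT fy => /Hs->.
Qed.

Definition integral_supp f := forall a x, a \in Phi -> f x != 0 ->
  exists k : int, 2 * ip x a / ip a a = k%:~R.

(** Integrality makes the reflection in a preserve every class modulo a, so antisymmetry turns each
    class sum into its own opposite. *)
Lemma anti_vanishing a f : a \in Phi -> anti f -> fs f -> integral_supp f -> vanishing a f.
Proof.
move=> aP af [s0 Hs0] intf; have a0 := Phi_neq0 aP.
have rK := reflK ipDl ipZl ip_gt0 a0 : involutive (refl a).
pose s := undup (s0 ++ map (refl a) s0).
have us : uniq s by exact: undup_uniq.
have Hs y : y \notin s -> f y = 0.
  by rewrite mem_undup mem_cat negb_or => /andP[/Hs0].
have sr y : (refl a y \in s) = (y \in s).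
  have E z : (z \in map (refl a) s0) = (refl a z \in s0).
    by rewrite -{1}(rK z) mem_map //; exact: inv_inj.
  by rewrite !mem_undup !mem_cat !E rK orbC.
exists s => //; split=> // x; set S := clsum a s f x; suff /eqP : S = - S.
  by rewrite -addr_eq0 -mulr2n mulrn_eq0 /= => /eqP.
rewrite {1}/S /clsum -big_filter.
have pm : perm_eq s (map (refl a) s).
  apply: uniq_perm => //; first by rewrite map_inj_uniq //; exact: inv_inj.
  by move=> y; rewrite -{2}(rK y) mem_map ?sr //; exact: inv_inj.
rewrite big_filter (perm_big _ pm) big_map /S /clsum -sumrN.
rewrite [LHS]big_mkcond [RHS]big_mkcond; apply: eq_bigr => y _ /=.
rewrite af //; have [fy|fy] := eqVneq (f y) 0; first by rewrite fy oppr0; do 2 case: ifP.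
have [k Hk] := intf a y aP fy.
suff -> : zrel a x (refl a y) = zrel a x y by [].
rewrite zrel_sym (zrel_sym a x); apply: zrel_eql; apply/asboolP; exists k.
by rewrite /reflection Hk scaler_int subrK.
Qed.

Lemma vanishing_delta b s f : b \in Phi -> {subset s <= Phi} -> b \notin s -> fs f ->
  vanishing b (delta s f) -> vanishing b f.
Proof.
move=> bP; elim: s => //= c s IH sP; rewrite inE negb_or => /andP[bc bs] ff v.
apply: IH => //; first by move=> x xs; apply: sP; rewrite inE xs orbT.
apply: vanishing_coprime v; first exact: fs_SI (SI_delta s) ff.
have cP : c \in Phi by apply: sP; rewrite inE eqxx.
by move=> k; apply: contraNneq bc => /(Phi_red bP cP)->.
Qed.

(** Roots are divided out one at a time. The partial quotient is no longer known to be
    antisymmetric, so its vanishing modulo the next root is deduced from that of f by coprimality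
    with the factors already removed. *)
Lemma anti_div f : anti f -> fs f -> integral_supp f -> exists2 g, fs g & f =1 delta Phi g.
Proof.
move=> af ff intf.
suff H s : {subset s <= Phi} -> uniq s -> exists2 g, fs g & f =1 delta s g by exact: H.
elim: s => [|b s IH] sP /=; first by exists f.
move=> /andP[bs us].
have [|g fg Hg] := IH _ us; first by move=> x xs; apply: sP; rewrite inE xs orbT.
have bP : b \in Phi by apply: sP; rewrite inE eqxx.
have [] := @vanishing_div _ _ b g.
  apply: (@vanishing_delta b s) => //.
    by move=> x xs; apply: sP; rewrite inE xs orbT.
  exact: vanishing_ext Hg (anti_vanishing bP af ff intf).
move=> g' fg' Hg'; exists g' => // x.
by rewrite Hg (SI_ext (SI_delta s) Hg') (SI_C _ _ (SI_delta s) (SI_D b)).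
Qed.

Local Notation rho := (rhos Phi).
Local Notation del := (delta Phi).

Lemma ind0_refl a x : a \in Phi -> ind0 (refl a x) = ind0 x :> F.
Proof.
move=> /Phi_neq0 a0; rewrite /indicator0; congr (nat_of_bool _)%:R.
by rewrite -[X in _ == X](refl0 ipZl a) (inj_eq (inv_inj (reflK ipDl ipZl ip_gt0 a0))).
Qed.
Lemma delta_antiP m : (forall a x, a \in Phi -> m (refl a x) = m x) -> anti (del m).
Proof.
move=> Hm a x aP.
rewrite (delta_anti ipDl ipZl ip_gt0 hZ h_gt0 Phi_uniq Phi_refl Phi_red aP).
by congr (- _); apply: (SI_ext (SI_delta _)) => y; exact: Hm.
Qed.

(* The quotient of [ip x x * del ind0 x] by [del] is supported at 0, as seen on
   its extreme terms in the direction of h. *)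
Lemma normsq_delta0 x : ip x x * del ind0 x = ip rho rho * del ind0 x.
Proof.
pose q y : F := ip y y * del ind0 y.
have ad := delta_antiP ind0_refl.
have aq : anti q.
  move=> a y aP; rewrite /q ad // (ip_refl ipDl ipZl ipC ip_gt0) ?Phi_neq0 //.
  by rewrite mulrN.
have fd : fs (del ind0) := fs_SI (SI_delta Phi) (fs_ind0 V).
have fq : fs q by exact: fs_mul.
have iq : integral_supp q.
  move=> a y aP; rewrite mulf_eq0 negb_or => /andP[_ /delta_supp[z [t [z0 tP ->]]]].
  have {z0} -> : z = 0 by move: z0; rewrite /indicator0; case: (z =P 0) => //; rewrite eqxx.
  rewrite add0r ipDl (formNl ipZl) mulrDr mulrDl.
  have [k ->] := int_rhos ipDl ipZl ipC ip_gt0 hZ h_gt0 Phi_uniq Phi_refl Phi_red Phi_int aP.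
  have [l Hl] : exists l : int, 2 * ip (\sum_(b <- t) b) a / ip a a = l%:~R.
    elim: t tP => [|b t IH] tP; first by exists 0; rewrite big_nil (ip0l ipZl) mulr0 mul0r.
    have [|l Hl] := IH; first by move=> c ct; apply: tP; rewrite inE ct orbT.
    have [|l' Hl'] := Phi_int aP (_ : b \in Phi); first by apply: tP; rewrite inE eqxx.
    by exists (l' + l); rewrite big_cons ipDl mulrDr mulrDl Hl Hl' intrD.
  by exists (k - l); rewrite mulrN mulNr Hl intrB.
have [g fg Hg] := anti_div aq fq iq.
have ih y : h y != 0 -> ind0 y = 0.
  by rewrite /indicator0; case: (y =P 0) => // ->; rewrite (h0 hZ) eqxx.
have [d1 d2] := @delta_top Phi ind0 0 (fun _ H => H) (fun y H => ih y (lt0r_neq0 H)).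
have [b1 b2] := @delta_bottom Phi ind0 0 (fun _ H => H) (fun y H => ih y (ltr0_neq0 H)).
have [s Hs] := fg.
(* If g had mass above level 0, its top would survive in [q] above the level of rho. But [q] has the
   support of [del ind0] at most, which lies between the levels of - rho and rho. *)
have gpos y : 0 < h y -> g y = 0.
  move=> hy; apply/eqP/negPn/negP => gy.
  have [] := @seq_maxP V F h s (fun y => (g y != 0)).
    by apply/hasP; exists y => //; apply: contraNT gy => /Hs->.
  move=> z [zs gz mz].
  have gtop u : h z < h u -> g u = 0.
    move=> zu; apply/eqP/negPn/negP => gu; move: zu; rewrite ltNge mz //.
    by apply: contraNT gu => /Hs->.
  have hz : 0 < h z.
    by apply: lt_le_trans hy (mz _ _ gy); apply: contraNT gy => /Hs->.
  have [_ E] := delta_top (fun _ H => H) gtop.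
  move: gz; rewrite -(E z) // -Hg /q d1 ?mulr0 ?eqxx // hD addr0; lra.
have gneg y : h y < 0 -> g y = 0.
  move=> hy; apply/eqP/negPn/negP => gy.
  have [] := @seq_maxP V F (fun y => - h y) s (fun y => (g y != 0)).
    by apply/hasP; exists y => //; apply: contraNT gy => /Hs->.
  move=> z [zs gz mz].
  have gtop u : h u < h z -> g u = 0.
    move=> zu; apply/eqP/negPn/negP => gu; move: zu; rewrite ltNge -lerN2 mz //.
    by apply: contraNT gu => /Hs->.
  have hz : h z < 0.
    have := mz y; rewrite lerN2 => H; apply: le_lt_trans (H _ gy) hy.
    by apply: contraNT gy => /Hs->.
  have [_ E] := delta_bottom (fun _ H => H) gtop.
  have := E z (lexx _); rewrite -Hg /q b1; last by rewrite hB sub0r; lra.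
  rewrite mulr0 => /esym/eqP; rewrite mulf_eq0 (negPf gz) orbF.
  by rewrite expf_eq0 oppr_eq0 oner_eq0 andbF.
have [_ E] := delta_top (fun _ H => H) gpos.
have gE : g =1 (fun y => ip rho rho * ind0 y).
  move=> y; have [hy|hy|hy] := ltgtP (h y) 0.
  - by rewrite gneg // /ind0; case: eqP hy => [->|]; rewrite ?(h0 hZ) ?ltxx ?mulr0.
  - by rewrite gpos // /ind0; case: eqP hy => [->|]; rewrite ?(h0 hZ) ?ltxx ?mulr0.
  rewrite -E ?hy // -Hg /q d2 ?hy // /ind0; case: eqP => [->|]; rewrite ?mulr0 //.
  by rewrite addr0.
by rewrite -/(q x) Hg (SI_ext (SI_delta _) gE) (SI_scalef _ _ _ (SI_delta _)).
Qed.

(** What the combinatorial part uses of the multiplicity function of an irreducible representation.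
    In [wf_casimir], c is the scalar by which the Casimir element acts; the first equation is the
    sl2 recurrence for the traces T, the second the trace of the Casimir element on the weight space
    of x. *)
Record weightfun (m : V -> F) (lam : V) : Prop := WeightFun {
  wf_fs : fs m;
  wf_refl : forall a x, a \in Phi -> m (refl a x) = m x;
  wf_lam : m lam = 1;
  wf_cone : forall x, m x != 0 -> cone (lam - x);
  wf_casimir : exists (T : V -> V -> F) (c : F),
    (forall a x, a \in Phi -> T a (x - a) - T a x = ip x a * m x) /\
    forall x, c * m x = ip x x * m x + \sum_(a <- Phi) (ip x a * m x + 2 * T a x) }.

Section Num.
Variables (m : V -> F) (lam : V).
Hypothesis wm : weightfun m lam.
Let f := del m.

Lemma num_anti : anti f.
Proof. exact: delta_antiP (wf_refl wm). Qed.
Lemma num_fs : fs f.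
Proof. exact: fs_SI (SI_delta _) (wf_fs wm). Qed.
Lemma num_top : f (lam + rho) = 1.
Proof.
have H y : h lam < h y -> m y = 0.
  move=> H; apply/eqP/negPn/negP => /(wf_cone wm)/cone_h; rewrite hB; lra.
have [_ E] := delta_top (fun _ H => H) H.
by rewrite /f addrC E ?(wf_lam wm).
Qed.
Lemma num_cone x : f x != 0 -> cone (lam + rho - x).
Proof.
move=> /delta_supp[y [t [my tP ->]]].
have [|s sP E] := coneD (wf_cone wm my) (_ : cone (\sum_(a <- t) a)); first by exists t.
exists s => //; rewrite -E opprB addrA (addrAC lam) opprD addrACA subrr addr0.
by rewrite addrAC.
Qed.
Lemma num_norm x : f x != 0 -> ip x x = ip (lam + rho) (lam + rho).
Proof.
have [Xi SXi HXi] := normsq_delta ipDl ipZl ipC Phi.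
have [T [c [HT Hc]]] := wf_casimir wm.
(* The operator Xi does not depend on m, so it can be read off from the trivial representation:
   there m is [ind0], and T = 0 obeys the recurrence because [ip x a] vanishes at x = 0. *)
have Xi0 : Xi ind0 =1 (fun y => ip rho rho * del ind0 y).
  move=> y; rewrite -normsq_delta0 (HXi ind0 (fun _ _ => 0)).
    have S := SI_delta Phi.
    rewrite (SI_ext S (g := fun z => 0 * ind0 z)) ?(SI_scalef _ _ _ S) ?mul0r ?add0r //.
    move=> z; rewrite big1 ?addr0 => [|a _]; rewrite /indicator0; case: eqP => [->|];
      by rewrite ?(ip0l ipZl) ?mulr0 ?mul0r ?addr0.
  by move=> a z _; rewrite subrr /ind0; case: eqP => [->|]; rewrite ?(ip0l ipZl) ?mul0r ?mulr0.
have Xim : Xi m =1 (fun y => ip rho rho * del m y).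
  have S : SI (fun f y => ip rho rho * del f y) := SI_scale _ (SI_delta _).
  exact: (SI_eq0 SXi S Xi0 (wf_fs wm)).
have key y : ip y y * f y = (c + ip rho rho) * f y.
  rewrite /f (HXi m T HT) Xim mulrDl; congr (_ + _).
  by rewrite -(SI_scalef c m y (SI_delta Phi)); apply: (SI_ext (SI_delta Phi)) => z; rewrite Hc.
move=> fx; have /(mulIf fx)-> := key x.
by have := key (lam + rho); rewrite num_top !mulr1.
Qed.
Lemma num_dom_top : dom (lam + rho).
Proof.
apply: (anti_max num_anti); first by rewrite num_top oner_eq0.
by move=> y /num_cone/cone_h; rewrite hB subr_ge0.
Qed.
(** With lam + rho - x a sum of positive roots, equality of norms says that this sum is orthogonal
    to lam + rho + x. Both vectors are strictly dominant, so every root in the sum would have a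
    positive pairing; the sum is empty. *)
Lemma num_dom x : f x != 0 -> dom x -> x = lam + rho.
Proof.
move=> fx dx; have [t tP E] := num_cone fx.
have : ip (lam + rho - x) (lam + rho + x) = 0.
  rewrite ipDl (formNl ipZl) !(formDr ipDl ipC _ _ x) (ipC x (lam + rho)) (num_norm fx); ring.
rewrite E (ip_suml ipDl ipZl); case: t tP E => [|a t] tP E.
  by move=> _; move: E; rewrite big_nil => /eqP; rewrite subr_eq0 => /eqP.
have pos b : b \in a :: t -> 0 < ip b (lam + rho + x).
  by move=> bt; rewrite (formDr ipDl ipC) addr_gt0 // ipC; [apply: num_dom_top|apply: dx]; exact: tP.
move=> /eqP; rewrite gt_eqF // big_cons ltr_wpDr ?pos ?inE ?eqxx //.
rewrite big_seq; apply: sumr_ge0 => b bt; apply/ltW/pos.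
by rewrite inE bt orbT.
Qed.
End Num.
End Numerator.

Lemma finite_coding (T : eqType) (U : eqType) (P : T -> Prop) (c : T -> U) (l : seq U) :
  (forall x, P x -> c x \in l) -> (forall x y, P x -> P y -> c x = c y -> x = y) ->
  exists2 s, uniq s & forall x, x \in s <-> P x.
Proof.
elim: l P => [|u l IH] P Hl inj.
  by exists [::] => // x; split=> // /Hl.
have [s us Hs] : exists2 s, uniq s & forall x, x \in s <-> P x /\ c x != u.
  apply: IH => [x [/Hl + /negPf cu]|x y [Px _] [Py _]]; last exact: inj.
  by rewrite inE cu.
case: (pselect (exists2 x, P x & c x = u)) => [[x Px cx]|nx].
  exists (x :: s); first by rewrite /= us andbT; apply/negP => /Hs[_]; rewrite cx eqxx.
  move=> y; rewrite inE; split=> [/orP[/eqP->//|/Hs[]//]|Py].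
  have [cy|cy] := eqVneq (c y) u; last by apply/orP; right; apply/Hs.
  by apply/orP; left; apply/eqP/inj => //; rewrite cy cx.
exists s => // x; split=> [/Hs[]//|Px]; apply/Hs; split=> //.
by apply/eqP => cx; apply: nx; exists x.
Qed.

Lemma seqs_of_size (T : eqType) (s : seq T) n :
  exists l : seq (seq T), forall t, size t = n -> {subset t <= s} -> t \in l.
Proof.
elim: n => [|n [l Hl]]; first by exists [:: [::]] => -[].
exists [seq x :: t | x <- s, t <- l] => -[//|x t] [st] ts.
apply/allpairsP; exists (x, t); split=> //=; first by apply: ts; rewrite inE eqxx.
by apply: Hl => // y yt; apply: ts; rewrite inE yt orbT.
Qed.

(** * The Weyl group and the character formula *)

Section WeylGroup.
Variables (F : realFieldType) (r : nat).
Local Notation V := 'rV[F]_r.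
Variable ip : V -> V -> F.
Hypothesis ipDl : forall x y z, ip (x + y) z = ip x z + ip y z.
Hypothesis ipZl : forall c x y, ip (c *: x) y = c * ip x y.
Hypothesis ipC : forall x y, ip x y = ip y x.
Hypothesis ip_gt0 : forall x, x != 0 -> 0 < ip x x.
Variables (Phi : seq V) (h : V -> F).
Hypothesis hD : forall x y, h (x + y) = h x + h y.
Hypothesis hZ : forall c x, h (c *: x) = c * h x.
Hypothesis h_gt0 : forall a, a \in Phi -> 0 < h a.
Hypothesis Phi_uniq : uniq Phi.
Hypothesis Phi_refl : forall a b, a \in Phi -> b \in Phi ->
  (reflection ip a b \in Phi) || (- reflection ip a b \in Phi).
Hypothesis Phi_red : forall a b c, a \in Phi -> b \in Phi -> b = c *: a -> b = a.
Hypothesis Phi_int : forall a b, a \in Phi -> b \in Phi ->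
  exists k : int, 2 * ip b a / ip a a = k%:~R.


Implicit Types (f m : V -> F) (x y a b : V).
(* A finite set of vectors, such as the weights of a faithful representation,
   that spans V and is stable under the reflections makes the group that they
   generate finite. *)
Variable Om : seq V.
Hypothesis Om_refl : forall a x, a \in Phi -> x \in Om -> reflection ip a x \in Om.
Hypothesis Om_span : forall w w' : 'M[F]_r,
  (forall x, x \in Om -> x *m w = x *m w') -> w = w'.

Local Notation refl := (reflection ip).
Local Notation rho := (rhos Phi).
Local Notation del := (delta Phi).
Local Notation anti := (anti ip Phi).
Local Notation dom := (dom ip Phi).
Local Notation weightfun := (weightfun ip Phi).
Local Notation Phi_neq0 := (Phi_neq0 hZ h_gt0).

Definition reflmx a : 'M[F]_r := \matrix_(i < r) refl a (delta_mx 0 i).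
Lemma mul_reflmx a x : x *m reflmx a = refl a x.
Proof.
rewrite mulmx_sum_row {2}[x]row_sum_delta.
elim/big_rec2: _ => [|i y1 y2 _ ->]; first by rewrite (refl0 ipZl).
by rewrite (reflD ipDl) (reflZ ipZl) rowK.
Qed.

(** The sign of a product of reflections is carried along with its matrix, so that it need not be
    recovered from the matrix. *)
Inductive weyl : 'M[F]_r * F -> Prop :=
| weyl1 : weyl (1%:M, 1)
| weylM a w e : a \in Phi -> weyl (w, e) -> weyl (w *m reflmx a, - e).

Lemma weyl_Om p x : weyl p -> x \in Om -> x *m p.1 \in Om.
Proof.
move=> W xO; elim: W => [|a w e aP _ IH]; first by rewrite mulmx1.
by rewrite mulmxA mul_reflmx; exact: Om_refl.
Qed.
Lemma weyl_sign p : weyl p -> p.2 = 1 \/ p.2 = -1.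
Proof. by elim=> [|a w e _ _ /= [->|->]]; [left|right|left; rewrite opprK]. Qed.
Lemma weyl_ip p x y : weyl p -> ip (x *m p.1) (y *m p.1) = ip x y.
Proof.
elim=> [|a w e aP _ IH] /=; first by rewrite !mulmx1.
by rewrite !mulmxA !mul_reflmx (ip_refl ipDl ipZl ipC ip_gt0) ?Phi_neq0.
Qed.
Lemma weyl_anti p f x : anti f -> weyl p -> f (x *m p.1) = p.2 * f x.
Proof.
move=> af; elim=> [|a w e aP _ IH] /=; first by rewrite mulmx1 mul1r.
by rewrite mulmxA mul_reflmx af // IH mulNr.
Qed.
Lemma weyl_Phi p b : weyl p -> b \in Phi -> (b *m p.1 \in Phi) || (- (b *m p.1) \in Phi).
Proof.
move=> W bP; elim: W => [|a w e aP _ /= IH]; first by rewrite mulmx1 bP.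
rewrite mulmxA mul_reflmx; case/orP: IH => H; first exact: Phi_refl.
by have := Phi_refl aP H; rewrite (reflN ipZl) opprK orbC.
Qed.

Lemma weyl_finite : exists2 W : seq ('M[F]_r * F), uniq W & forall p, p \in W <-> weyl p.
Proof.
have [l Hl] := seqs_of_size Om (size Om).
apply: (@finite_coding _ _ _ (fun p => ([seq x *m p.1 | x <- Om], p.2))
  [seq (t, e) | t <- l, e <- [:: 1; -1]]).
  move=> p W; apply/allpairsP; exists ([seq x *m p.1 | x <- Om], p.2); split=> //=.
    by apply: Hl; rewrite ?size_map // => y /mapP[x xO ->]; exact: weyl_Om.
  by rewrite !inE; case: (weyl_sign W) => ->; rewrite eqxx ?orbT.
move=> [w e] [w' e'] _ _ [/= H ->]; congr (_, _); apply: Om_span => x xO.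
by move/eq_in_map: H => H; exact: H.
Qed.

(** Both sides are antisymmetric and agree on the open chamber, where only lam + rho occurs. The
    factor k0 is the number of group elements fixing lam + rho; counted as the elements that
    preserve Phi, it does not depend on lam. That W and k0 are chosen before m and lam is what later
    makes the power sums polynomial in lam. *)
Theorem weyl_numerator : exists (W : seq ('M[F]_r * F)) (k0 : F), k0 != 0 /\
  forall m lam, weightfun m lam -> forall x,
    k0 * del m x = \sum_(p <- W) p.2 * (x == (lam + rho) *m p.1)%:R.
Proof.
have [W uW HW] := weyl_finite.
pose pres (p : 'M[F]_r * F) := all (fun a => a *m p.1 \in Phi) Phi.
exists W, (count pres W)%:R; split.
  rewrite pnatr_eq0 -lt0n -has_count; apply/hasP; exists (1%:M, 1); first by apply/HW/weyl1.
  by apply/allP => a aP; rewrite mulmx1.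
move=> m lam wm.
pose f := del m; set mu := lam + rho.
have af : anti f := num_anti ipDl ipZl ip_gt0 hZ h_gt0 Phi_uniq Phi_refl Phi_red wm.
have fmu : f mu = 1 := num_top hD hZ h_gt0 wm.
have dmu : dom mu := num_dom_top ipDl ipZl ip_gt0 hD hZ h_gt0 Phi_uniq Phi_refl Phi_red wm.
have ndom x : f x != 0 -> dom x -> x = mu.
  exact: (num_dom ipDl ipZl ipC ip_gt0 hD hZ h_gt0 Phi_uniq Phi_refl Phi_red Phi_int wm).
have ff : fs f := num_fs wm.
pose A x := \sum_(p <- W) p.2 * (x == mu *m p.1)%:R.
(* If w preserves Phi, the image of mu is a strictly dominant point of the support of f, hence mu
   itself. If w fixes mu, the image of a positive root pairs positively with mu, so it is not the
   opposite of a positive root. *)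
have presP p : p \in W -> pres p = (mu *m p.1 == mu).
  move=> /HW Wp; apply/allP/eqP => [H|H a aP]; last first.
    have := weyl_Phi Wp aP; case/orP => // /dmu; rewrite -H (formNr ipZl ipC) ipC.
    by rewrite (weyl_ip _ _ Wp) oppr_gt0 ltNge ltW // ipC dmu.
  apply: ndom.
    rewrite (weyl_anti _ af Wp) fmu mulr1.
    by case: (weyl_sign Wp) => ->; rewrite ?oppr_eq0 oner_eq0.
  have inj : {in Phi &, injective (fun a => a *m p.1)}.
    move=> a b aP bP E; apply/eqP; rewrite -subr_eq0; apply/negPn/negP => /ip_gt0.
    by rewrite -(weyl_ip _ _ Wp) mulmxBl E subrr (ip0l ipZl) ltxx.
  have [|||_ eqi] := @uniq_min_size _ (map (fun a => a *m p.1) Phi) Phi.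
  - by rewrite map_inj_in_uniq.
  - by move=> y /mapP[a aP ->]; exact: H.
  - by rewrite size_map.
  move=> b; rewrite -eqi => /mapP[a aP ->].
  by rewrite (weyl_ip _ _ Wp); exact: dmu.
have aA : anti A.
  move=> a x aP; have a0 := Phi_neq0 aP; rewrite /A -sumrN.
  pose phi (p : 'M[F]_r * F) := (p.1 *m reflmx a, - p.2).
  have rr : reflmx a *m reflmx a = 1%:M.
    apply: Om_span => y yO; rewrite mulmxA !mul_reflmx mulmx1.
    exact: (reflK ipDl ipZl ip_gt0 a0).
  have phiK p : phi (phi p) = p.
    by case: p => w e; rewrite /phi /= -mulmxA rr mulmx1 opprK.
  have phiW p : p \in W -> phi p \in W.
    by move=> /HW Wp; apply/HW; case: p Wp => w e Wp; exact: weylM.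
  have pm : perm_eq W (map phi W).
    apply: uniq_perm => //; first by rewrite map_inj_uniq //; exact: (can_inj phiK).
    move=> p; apply/idP/mapP => [pW|[q qW ->]]; last exact: phiW.
    by exists (phi p); rewrite ?phiK ?phiW.
  rewrite (perm_big _ pm) big_map; apply: eq_bigr => p _ /=.
  rewrite mulmxA mul_reflmx mulNr; congr (- (_ * (nat_of_bool _)%:R)).
  by rewrite (inj_eq (inv_inj (reflK ipDl ipZl ip_gt0 a0))).
have fA : fs A.
  exists [seq mu *m p.1 | p <- W] => x xW; rewrite /A big_seq big1 // => p pW.
  case: eqP => [xE|]; rewrite ?mulr0 //.
  by move: xW; rewrite xE (map_f (fun p : 'M[F]_r * F => mu *m p.1) pW).
have Asupp x : A x != 0 -> f x != 0.
  move=> Ax; have /hasP[p pW /eqP ->] : has (fun p => x == mu *m p.1) W.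
    apply: contraNT Ax => /hasPn H; rewrite /A big_seq big1 // => p /H /negPf->.
    by rewrite mulr0.
  have Wp := (HW p).1 pW; rewrite (weyl_anti _ af Wp) fmu mulr1.
  by case: (weyl_sign Wp) => ->; rewrite ?oppr_eq0 oner_eq0.
pose g x := (count pres W)%:R * f x - A x.
have ag : anti g by move=> a x aP; rewrite /g af // aA // mulrN opprB opprK addrC.
have fg : fs g.
  apply: (fs_add (fs_mul (fun=> _) ff)).
  by have [s Hs] := fA; exists s => x /Hs->; rewrite oppr0.
suff g0 x : g x = 0 by move=> x; apply/eqP; rewrite -subr_eq0; apply/eqP; exact: g0.
apply: contrapT => gx; have [] := anti_dom ip_gt0 hD hZ h_gt0 ag fg.
  by exists x; apply/eqP.
move=> y gy dy.
have fy : f y != 0.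
  by apply: contraNneq gy => fy0; rewrite /g fy0 mulr0 sub0r oppr_eq0;
    apply: contraTT isT => /Asupp; rewrite fy0 eqxx.
move: gy; rewrite (ndom y fy dy) /g fmu mulr1 /A => /eqP; apply; apply/eqP.
rewrite subr_eq0 -sum1_count natr_sum big_mkcond /=; apply/eqP; apply: eq_big_seq => p pW.
rewrite presP // eq_sym; case: eqP => [E|_]; last by rewrite mulr0.
have := weyl_anti mu af ((HW p).1 pW); by rewrite -E fmu mulr1 => <-; rewrite ?mulr1.
Qed.
End WeylGroup.

(** * Moments of functions with known differences *)

Section CentralDifference.
Variables (F : realFieldType) (c : F).
Implicit Types p q : {poly F}.

Definition cdiff p : {poly F} := (p \Po ('X + c%:P)) - (p \Po ('X - c%:P)).

Lemma cdiffD p q : cdiff (p + q) = cdiff p + cdiff q.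
Proof. by rewrite /cdiff !comp_polyD opprD addrACA. Qed.
Lemma cdiff_eval p x : (cdiff p).[x] = p.[x + c] - p.[x - c].
Proof. by rewrite /cdiff hornerD hornerN !horner_comp !hornerE. Qed.

Lemma size_exp_shift n (d : F) :
  (size (('X + d%:P) ^+ n.+1 - 'X^(n.+1) - (n.+1%:R * d) *: 'X^n)%R <= n)%N.
Proof.
rewrite exprDn big_ord_recl subn0 expr0 mulr1 bin0 mulr1n [X in (X - _ *: _)]addrAC subrr add0r.
rewrite big_ord_recl /= /bump /= subn1 /= expr1 bin1.
have -> : 'X^n * d%:P *+ n.+1 = (n.+1%:R * d) *: 'X^n.
  by rewrite mulrC mul_polyC -scaler_nat scalerA.
rewrite addrAC subrr add0r (leq_trans (size_sum _ _ _)) //; apply/bigmax_leqP => i _.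
rewrite /bump /= !add1n -polyC_exp mulrC mul_polyC -scaler_nat (leq_trans (size_scale_leq _ _)) //.
rewrite (leq_trans (size_scale_leq _ _)) // size_polyXn subSS.
by rewrite ltn_subrL (leq_ltn_trans (leq0n i) (ltn_ord i)).
Qed.

(** The monomial of degree n + 1 has central difference 2 c (n + 1) X^n up to lower terms, so the
    leading term of p can be matched and the rest treated by induction on the size. *)
Lemma cdiff_surj : c != 0 -> forall p, exists2 q : {poly F}, (size q <= (size p).+1)%N & cdiff q = p.
Proof.
move=> c0 p; have [k] := ubnP (size p); elim: k p => // k IH p sp.
have [->|p0] := eqVneq p 0.
  by exists 0; rewrite ?size_poly0 // /cdiff !comp_poly0 subrr.
have [n sn] : exists n, size p = n.+1 by exists (size p).-1; rewrite prednK // lt0n size_poly_eq0.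
pose a := lead_coef p / (n.+1%:R * (2 * c)).
pose q0 : {poly F} := a *: 'X^(n.+1).
have nz : n.+1%:R * (2 * c) != 0 by rewrite !mulf_neq0 ?pnatr_eq0.
have small : (size (p - cdiff q0)%R <= n)%N.
  have E : cdiff q0 = a *: (('X + c%:P) ^+ n.+1 - 'X^(n.+1) - (n.+1%:R * c) *: 'X^n)
     - a *: (('X + (- c)%:P) ^+ n.+1 - 'X^(n.+1) - (n.+1%:R * - c) *: 'X^n)
     + lead_coef p *: 'X^n.
    rewrite -scalerBr /cdiff !comp_polyZ -scalerBr !comp_Xn_poly polyCN.
    rewrite -[lead_coef p](divfK nz) -/a -(scalerA a) -scalerDr; congr (_ *: _).
    have -> : (n.+1%:R * (2 * c)) *: 'X^n = (n.+1%:R * c) *: 'X^n - (n.+1%:R * - c) *: 'X^n.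
      by rewrite -scalerBl; congr (_ *: _); ring.
    ring.
  rewrite E opprD addrA addrAC.
  have s1 : (size (p - lead_coef p *: 'X^n)%R <= n)%N.
    apply/leq_sizeP => j nj; rewrite coefB coefZ coefXn; case: eqP => [->|jn].
      by rewrite mulr1 lead_coefE sn subrr.
    rewrite mulr0 subr0 nth_default // sn ltn_neqAle nj andbT; apply/eqP => jn'.
    by apply: jn; rewrite jn'.
  rewrite opprB; apply: (leq_trans (size_polyD _ _)); rewrite geq_max s1 /=.
  apply: (leq_trans (size_polyD _ _)); rewrite size_polyN geq_max.
  by apply/andP; split; apply: (leq_trans (size_scale_leq _ _)); exact: size_exp_shift.
have nk : (n < k)%N by move: sp; rewrite sn ltnS.
have [q1 sq1 Hq1] := IH _ (leq_ltn_trans small nk).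
exists (q1 + q0); last by rewrite cdiffD Hq1 subrK.
apply: (leq_trans (size_polyD _ _)); rewrite geq_max sn.
rewrite (leq_trans sq1) ?ltnS ?(leq_trans small) // /q0.
by rewrite (leq_trans (size_scale_leq _ _)) // size_polyXn.
Qed.
End CentralDifference.

Section Moments.
Variables (F : realFieldType) (V : lmodType F).
Implicit Types (f : V -> F) (g : V -> F).

(** A chosen finite support, empty by default when there is none. [pairE] shows that the pairing is
    independent of the choice. *)
Definition supp_seq f : seq V :=
  if pselect (exists2 s : seq V, uniq s & forall x, x \notin s -> f x = 0) is left H
  then s2val (cid2 H) else [::].
Definition pair f g := \sum_(x <- supp_seq f) f x * g x.

Lemma pairE f g s : uniq s -> (forall x, x \notin s -> f x = 0) ->
  pair f g = \sum_(x <- s) f x * g x.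
Proof.
move=> us Hs; rewrite /pair /supp_seq; case: pselect => [H|[]]; last by exists s.
case: (cid2 H) => t ut Ht /=.
pose T (w : seq V) := \sum_(x <- w) f x * g x.
pose u := undup (s ++ t).
have sub w : uniq w -> (forall x, x \notin w -> f x = 0) -> {subset w <= u} -> T u = T w.
  move=> uw Hw wu; rewrite /T (bigID (mem w)) /= [X in _ + X]big1 ?addr0; last first.
    by move=> x /Hw->; rewrite mul0r.
  rewrite -big_filter; apply: perm_big; apply: uniq_perm; rewrite ?filter_uniq ?undup_uniq //.
  by move=> x; rewrite mem_filter /=; case: (boolP (x \in w)) => //= /wu.
have tu : {subset t <= u} by move=> x xt; rewrite mem_undup mem_cat xt orbT.
have su : {subset s <= u} by move=> x xs; rewrite mem_undup mem_cat xs.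
by rewrite -/(T t) -/(T s) -(sub t) // (sub s).
Qed.

Lemma pair_ext f g g' : g =1 g' -> pair f g = pair f g'.
Proof. by move=> gg; apply: eq_bigr => x _; rewrite gg. Qed.

Lemma pair_Dop a f g : fs f -> pair (Dop a f) g = pair f (fun x => g (x + half a) - g (x - half a)).
Proof.
move=> ff; have [s us Hs] := fs_uniq ff; have [t ut Ht] := fs_uniq (fs_SI (SI_D a) ff).
pose s1 := [seq x + half a | x <- s]; pose s2 := [seq x + - half a | x <- s].
pose u := undup (t ++ s1 ++ s2); have uu : uniq u by exact: undup_uniq.
have U1 x : x \notin u -> f (x - half a) = 0.
  by rewrite mem_undup !mem_cat !negb_or => /and3P[_ /notin_shift /Hs].
have U2 x : x \notin u -> f (x - - half a) = 0.
  by rewrite mem_undup !mem_cat !negb_or => /and3P[_ _ /notin_shift /Hs].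
have sh v : uniq u -> (forall x, x \notin u -> f (x - v) = 0) ->
    \sum_(x <- u) f (x - v) * g x = pair f (fun x => g (x + v)).
  move=> _ Hu; pose u' := [seq x - v | x <- u].
  rewrite (@pairE _ _ u'); first by rewrite big_map; apply: eq_bigr => x _; rewrite subrK.
    exact: uniq_shift.
  by move=> x /notin_shift; rewrite opprK => /Hu; rewrite addrK.
rewrite (@pairE _ _ u) //; last first.
  by move=> x xu; rewrite /Dop -[half a]opprK U2 // opprK U1 // subrr.
rewrite (eq_bigr (fun x => f (x - half a) * g x - f (x - - half a) * g x)); last first.
  by move=> x _; rewrite /Dop opprK mulrBl.
rewrite sumrB !sh // !(pairE _ us Hs) -sumrB.
by apply: eq_bigr => x _; rewrite mulrBr.
Qed.

Variable ell : V -> F.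
Hypothesis ellD : forall x y, ell (x + y) = ell x + ell y.
Hypothesis ellZ : forall c x, ell (c *: x) = c * ell x.

(** Summation by parts moves each operator from f to the test polynomial, where it becomes a central
    difference with nonzero step. Inverting it raises the degree by one for each member of s: this
    is the N in the final bound. *)
Lemma moment_delta (s : seq V) (p : {poly F}) : (forall a, a \in s -> ell a != 0) ->
  exists2 q : {poly F}, (size q <= size p + size s)%N &
    forall f, fs f -> pair f (fun x => p.[ell x]) = pair (delta s f) (fun x => q.[ell x]).
Proof.
elim: s => [|a s IH] Hs /=; first by exists p; rewrite ?addn0.
have [|q sq Hq] := IH _; first by move=> b bs; apply: Hs; rewrite inE bs orbT.
have a0 : ell (half a) != 0 by rewrite ellZ mulf_neq0 ?invr_eq0 ?pnatr_eq0 // Hs ?inE ?eqxx.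
have [q' sq' Hq'] := cdiff_surj a0 q.
exists q'; first by rewrite addnS (leq_trans sq').
move=> f ff; rewrite Hq // pair_Dop; last exact: fs_SI (SI_delta s) ff.
apply: pair_ext => x; rewrite -Hq' cdiff_eval ellD.
have -> : ell (x - half a) = ell x - ell (half a).
  by rewrite -[- half a]scaleN1r ellD ellZ mulN1r.
by [].
Qed.
End Moments.

Section PolyDegree.
Variables (F : fieldType) (r : nat) (T : Type) (X : T -> 'I_r -> F).
Implicit Types (G : T -> F).
(** T will be the type of dominant weights and X the coordinates of a weight. *)
Definition pdeg d G := exists2 q : {mpoly F[r]}, (msize q <= d.+1)%N & forall t, G t = q.@[X t].
Lemma pdeg_ext d G G' : G =1 G' -> pdeg d G -> pdeg d G'.
Proof. by move=> E [q sq Hq]; exists q => // t; rewrite -E. Qed.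
Lemma pdeg_le d d' G : (d <= d')%N -> pdeg d G -> pdeg d' G.
Proof. by move=> dd [q sq Hq]; exists q => //; rewrite (leq_trans sq). Qed.
Lemma pdeg_const d c : pdeg d (fun=> c).
Proof. by exists c%:MP => [|t]; rewrite ?mevalC // msizeC; case: eqP. Qed.
Lemma pdeg_coord i : pdeg 1 (fun t => X t i).
Proof. by exists 'X_i => [|t]; rewrite ?mevalXU // msizeX mdeg1. Qed.
Lemma pdegD d G G' : pdeg d G -> pdeg d G' -> pdeg d (fun t => G t + G' t).
Proof.
move=> [q sq Hq] [q' sq' Hq']; exists (q + q') => [|t]; last by rewrite mevalD Hq Hq'.
by rewrite (leq_trans (msizeD_le _ _)) // geq_max sq sq'.
Qed.
Lemma pdegM d d' G G' : pdeg d G -> pdeg d' G' -> pdeg (d + d') (fun t => G t * G' t).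
Proof.
move=> [q sq Hq] [q' sq' Hq']; exists (q * q') => [|t]; last by rewrite mevalM Hq Hq'.
have [->|q0] := eqVneq q 0; first by rewrite mul0r msize0.
have [->|q'0] := eqVneq q' 0; first by rewrite mulr0 msize0.
rewrite msizeM // -subn1 leq_subLR add1n -addSn -addnS; exact: leq_add.
Qed.
Lemma pdegZ d c G : pdeg d G -> pdeg d (fun t => c * G t).
Proof. by move=> H; apply: (@pdegM 0 d) => //; exact: pdeg_const. Qed.
Lemma pdeg_sum d (I : Type) (s : seq I) (G : I -> T -> F) : (forall i, pdeg d (G i)) ->
  pdeg d (fun t => \sum_(i <- s) G i t).
Proof.
move=> H; elim: s => [|i s IH].
  by apply: pdeg_ext (pdeg_const d 0) => t; rewrite big_nil.
by apply: pdeg_ext (pdegD (H i) IH) => t; rewrite big_cons.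
Qed.
Lemma pdegX d G k : pdeg d G -> pdeg (k * d) (fun t => G t ^+ k).
Proof.
move=> H; elim: k => [|k IH]; first exact: pdeg_const.
by apply: pdeg_ext (pdegM H IH) => t; rewrite exprS.
Qed.
Lemma pdeg_horner (p : {poly F}) G : pdeg 1 G -> pdeg (size p).-1 (fun t => p.[G t]).
Proof.
move=> H; apply: (@pdeg_ext _ (fun t => \sum_(i <- enum 'I_(size p)) p`_i * G t ^+ i)).
  by move=> t; rewrite horner_coef big_enum.
apply: pdeg_sum => i; apply: pdegZ; apply: pdeg_le (pdegX i H).
by rewrite muln1 -ltnS (leq_trans (ltn_ord i)) // leqSpred.
Qed.
End PolyDegree.

Lemma mpoly_ring_ind (A : comNzRingType) n (P : {mpoly A[n]} -> Prop) :
  (forall c, P c%:MP) -> (forall i, P 'X_i) -> (forall p q, P p -> P q -> P (p + q)) ->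
  (forall p q, P p -> P q -> P (p * q)) -> forall p, P p.
Proof.
move=> PC PX PD PMl p; rewrite (mpolyE p); elim/big_rec: _ => [|m q _ Pq].
  by rewrite -mpolyC0; exact: PC.
apply: PD => //; rewrite -mul_mpolyC; apply: (PMl); first exact: PC.
rewrite mpolyXE_id; elim/big_rec: _ => [|i q' _ Pq']; first by rewrite -mpolyC1; exact: PC.
apply: (PMl) => //; elim: (m i) => [|k IH]; first by rewrite expr0 -mpolyC1; exact: PC.
by rewrite exprS; exact: PMl.
Qed.

(** * Lie algebras of matrix groups *)

Section PolynomialFunctions.
Variable R : realType.
Local Notation C := R[i].

Section OneSpace.
Variable n : nat.
Implicit Types (p q : {mpoly C[n * n]}) (A X Y : 'M[C]_n) (F G dF dG : 'M[C]_n -> C).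

Definition dird p A X : C := \sum_(l < n * n) mxeval (mderiv l p) A * mxvec X 0 l.

Lemma dirdD p q A X : dird (p + q) A X = dird p A X + dird q A X.
Proof.
by rewrite /dird -big_split; apply: eq_bigr => l _; rewrite mderivD /mxeval mevalD mulrDl.
Qed.
Lemma dirdM p q A X : dird (p * q) A X = dird p A X * mxeval q A + mxeval p A * dird q A X.
Proof.
rewrite /dird mulr_suml mulr_sumr -big_split; apply: eq_bigr => l _.
by rewrite mderivM /mxeval mevalD !mevalM mulrDl mulrAC mulrA.
Qed.
Lemma dirdC c A X : dird c%:MP A X = 0.
Proof. by rewrite /dird big1 // => l _; rewrite mderivC /mxeval meval0 mul0r. Qed.
Lemma dirdX l A X : dird 'X_l A X = mxvec X 0 l.
Proof.
rewrite /dird (bigD1 l) //= mderivX mnm1E eqxx scale1r.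
have -> : (U_(l) - U_(l))%MM = 0%MM :> 'X_{1.. _} by apply/mnmP => i; rewrite mnmBE subnn mnm0E.
rewrite mpolyX0 /mxeval meval1 mul1r big1 ?addr0 // => k kl.
by rewrite mderivX mnm1E eq_sym (negPf kl) scale0r meval0 mul0r.
Qed.
Lemma dird_lin p A a X Y : dird p A (a *: X + Y) = a * dird p A X + dird p A Y.
Proof.
rewrite /dird mulr_sumr -big_split; apply: eq_bigr => l _.
by rewrite linearP /= !mxE mulrDr mulrCA.
Qed.

(** A polynomial function together with its differential at 1. Keeping the pair makes products,
    compositions and translations computable without naming the underlying polynomial. *)
Definition pfun F dF := exists p, (forall A, mxeval p A = F A) /\ (forall X, dird p 1%:M X = dF X).

Lemma pfun_ext F F' dF dF' : F =1 F' -> dF =1 dF' -> pfun F dF -> pfun F' dF'.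
Proof. by move=> E dE [p [H1 H2]]; exists p; split=> A; rewrite ?H1 ?H2 ?E ?dE. Qed.
Lemma pfun_mxeval p : pfun (mxeval p) (dird p 1%:M).
Proof. by exists p. Qed.
Lemma pfun_const c : pfun (fun=> c) (fun=> 0).
Proof. by exists c%:MP; split=> A; rewrite ?dirdC // /mxeval mevalC. Qed.
Lemma pfun_entry i j : pfun (fun A => A i j) (fun X => X i j).
Proof.
exists 'X_(mxvec_index i j); split=> A; first by rewrite /mxeval mevalXU mxvecE.
by rewrite dirdX mxvecE.
Qed.
Lemma pfunD F dF G dG : pfun F dF -> pfun G dG ->
  pfun (fun A => F A + G A) (fun X => dF X + dG X).
Proof.
move=> [p [Hp1 Hp2]] [q [Hq1 Hq2]]; exists (p + q); split=> A.
  by rewrite /mxeval mevalD -/(mxeval p A) -/(mxeval q A) Hp1 Hq1.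
by rewrite dirdD Hp2 Hq2.
Qed.
Lemma pfunM F dF G dG : pfun F dF -> pfun G dG ->
  pfun (fun A => F A * G A) (fun X => dF X * G 1%:M + F 1%:M * dG X).
Proof.
move=> [p [Hp1 Hp2]] [q [Hq1 Hq2]]; exists (p * q); split=> A.
  by rewrite /mxeval mevalM -/(mxeval p A) -/(mxeval q A) Hp1 Hq1.
by rewrite dirdM Hp2 Hq2 Hp1 Hq1.
Qed.
Lemma pfunZ c F dF : pfun F dF -> pfun (fun A => c * F A) (fun X => c * dF X).
Proof.
by move=> H; apply: pfun_ext (pfunM (pfun_const c) H) => // X; rewrite mul0r add0r.
Qed.
Lemma pfunB F dF G dG : pfun F dF -> pfun G dG ->
  pfun (fun A => F A - G A) (fun X => dF X - dG X).
Proof.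
by move=> H1 H2; apply: pfun_ext (pfunD H1 (pfunZ (-1) H2)) => X; rewrite mulN1r.
Qed.
Lemma pfun_sum (I : Type) (s : seq I) (F dF : I -> 'M[C]_n -> C) :
  (forall i, pfun (F i) (dF i)) ->
  pfun (fun A => \sum_(i <- s) F i A) (fun X => \sum_(i <- s) dF i X).
Proof.
move=> H; elim: s => [|i s IH].
  by apply: pfun_ext (pfun_const 0) => X; rewrite big_nil.
by apply: pfun_ext (pfunD (H i) IH) => X; rewrite big_cons.
Qed.
Lemma pfun_lin F dF a X Y : pfun F dF -> dF (a *: X + Y) = a * dF X + dF Y.
Proof. by move=> [p [_ H]]; rewrite -!H dird_lin. Qed.

Definition isp F := exists dF, pfun F dF.
Lemma isp_prod (I : Type) (s : seq I) (F : I -> 'M[C]_n -> C) :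
  (forall i, isp (F i)) -> isp (fun A => \prod_(i <- s) F i A).
Proof.
move=> H; elim: s => [|i s [dG IH]].
  by exists (fun=> 0); apply: pfun_ext (pfun_const 1) => X; rewrite ?big_nil.
have [dF Hi] := H i; eexists; apply: pfun_ext (pfunM Hi IH) => X; last by [].
by rewrite big_cons.
Qed.
Lemma isp_exp F k : isp F -> isp (fun A => F A ^+ k).
Proof.
move=> H; have [dG HG] := @isp_prod _ (nseq k tt) (fun=> F) (fun=> H).
by exists dG; apply: pfun_ext HG => A //; rewrite big_const_seq count_nseq iter_mulr_1 mul1n.
Qed.
Lemma isp_det : isp (fun A => \det A).
Proof.
rewrite /determinant.
have /choice[dF HdF] (s : {perm 'I_n}) : exists dF,
    pfun (fun A => (-1) ^+ s * \prod_i A i (s i)) dF.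
  have [dG HG] := @isp_prod _ (index_enum 'I_n) (fun i A => A i (s i))
    (fun i => ex_intro _ _ (pfun_entry i (s i))).
  by eexists; exact: pfunZ HG.
by eexists; apply: pfun_sum HdF.
Qed.
End OneSpace.

Lemma pfun_comp n m (F dF : 'M[C]_n -> 'M[C]_m) :
  (forall i j, pfun (fun A => F A i j) (fun X => dF X i j)) ->
  forall p, pfun (fun A => mxeval p (F A)) (fun X => dird p (F 1%:M) (dF X)).
Proof.
move=> H p; elim/mpoly_ring_ind: p => [c|l|p q Hp Hq|p q Hp Hq].
- by have := pfun_const n c; apply: pfun_ext => X; rewrite ?dirdC // /mxeval mevalC.
- case/mxvec_indexP: l => i j; apply: pfun_ext (H i j) => X.
    by rewrite /mxeval mevalXU mxvecE.
  by rewrite dirdX mxvecE.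
- apply: pfun_ext (pfunD Hp Hq) => X; last by rewrite dirdD.
  by rewrite /mxeval mevalD.
- apply: pfun_ext (pfunM Hp Hq) => X; last by rewrite dirdM.
  by rewrite /mxeval mevalM.
Qed.

Lemma pfun_mul n m l q (A : 'M[C]_(m, l)) (B : 'M[C]_(l, q)) (F dF : 'M[C]_n -> 'M[C]_l) :
  (forall i j, pfun (fun X => F X i j) (fun X => dF X i j)) ->
  forall i j, pfun (fun X => (A *m F X *m B) i j) (fun X => (A *m dF X *m B) i j).
Proof.
move=> H i j.
have H1 j' : pfun (fun X => (A *m F X) i j') (fun X => (A *m dF X) i j').
  have := pfun_sum (index_enum 'I_l) (fun k => pfunZ (A i k) (H k j')).
  by apply: pfun_ext => X; rewrite mxE.
have := pfun_sum (index_enum 'I_l) (fun k => pfunZ (B k j) (H1 k)).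
by apply: pfun_ext => X; rewrite [RHS]mxE; apply: eq_bigr => k _; rewrite mulrC.
Qed.

Lemma pfun_id n (i j : 'I_n) : pfun (fun X : 'M[C]_n => X i j) (fun X => X i j).
Proof. exact: pfun_entry. Qed.

Lemma pfun_lr n (g k : 'M[C]_n) p :
  pfun (fun h => mxeval p (g *m h *m k)) (fun X => dird p (g *m k) (g *m X *m k)).
Proof.
have := @pfun_comp n n (fun h => g *m h *m k) (fun h => g *m h *m k) (pfun_mul g k (@pfun_id n)) p.
by rewrite mulmx1.
Qed.

Section LieAlgebra.
Variables (n : nat) (G : set 'M[C]_n).
Hypothesis sG : subgroup_GL G.
Implicit Types (g h X Y : 'M[C]_n).

Let G1 : G 1%:M. Proof. by case: sG. Qed.
Let GM g h : G g -> G h -> G (g *m h). Proof. by case: sG => _ _ H _; exact: H. Qed.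
Let GV g : G g -> G (invmx g). Proof. by case: sG => _ _ _; exact. Qed.
Lemma G_unit g : G g -> g \in unitmx. Proof. by case: sG => H _ _ _ /H. Qed.

Lemma lie_pfun X F dF : Lie G X -> pfun F dF -> (forall g, G g -> F g = 0) -> dF X = 0.
Proof. by move=> LX [p [H1 H2]] H; rewrite -H2; apply: LX => g Gg; rewrite H1 H. Qed.

Lemma lie_lin a X Y : Lie G X -> Lie G Y -> Lie G (a *: X + Y).
Proof.
move=> LX LY p Hp; rewrite -/(dird p 1%:M _) dird_lin.
by rewrite /dird (LX p Hp) (LY p Hp) mulr0 addr0.
Qed.
Lemma lie0 : Lie G 0.
Proof. by move=> p _; rewrite big1 // => l _; rewrite linear0 mxE mulr0. Qed.
Lemma lieZ a X : Lie G X -> Lie G (a *: X).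
Proof. by move=> LX; rewrite -[_ *: _]addr0; apply: lie_lin => //; exact: lie0. Qed.
Lemma lieD X Y : Lie G X -> Lie G Y -> Lie G (X + Y).
Proof. by move=> LX LY; rewrite -[X]scale1r; exact: lie_lin. Qed.
Lemma lieB X Y : Lie G X -> Lie G Y -> Lie G (X - Y).
Proof. by move=> LX LY; apply: lieD => //; rewrite -scaleN1r; exact: lieZ. Qed.
Lemma lie_sum (I : Type) (s : seq I) (P : pred I) (E : I -> 'M[C]_n) :
  (forall i, P i -> Lie G (E i)) -> Lie G (\sum_(i <- s | P i) E i).
Proof.
by move=> H; elim/big_rec: _ => [|i X Pi LX]; [exact: lie0 | apply: lieD => //; exact: H].
Qed.

(** The translate of p by g vanishes on G as well; differentiating it at 1 says that left invariant
    vector fields are tangent to G everywhere. *)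
Lemma lie_left p g X : (forall h, G h -> mxeval p h = 0) -> G g -> Lie G X ->
  dird p g (g *m X) = 0.
Proof.
move=> Hp Gg LX; have := lie_pfun LX (pfun_lr g 1%:M p).
by rewrite !mulmx1; apply=> h Gh; rewrite mulmx1; apply/Hp/GM.
Qed.
Lemma lie_right p g X : (forall h, G h -> mxeval p h = 0) -> G g -> Lie G X ->
  dird p g (X *m g) = 0.
Proof.
move=> Hp Gg LX; have := lie_pfun LX (pfun_lr 1%:M g p).
by rewrite !mul1mx; apply=> h Gh; rewrite mul1mx; apply/Hp/GM.
Qed.

Lemma lie_Ad g X : G g -> Lie G X -> Lie G (g *m X *m invmx g).
Proof.
move=> Gg LX p Hp; have := lie_pfun LX (pfun_lr g (invmx g) p).
rewrite mulmxV ?G_unit //; apply=> h Gh; apply: Hp; apply: (GM (GM _ _)) => //; exact: GV.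
Qed.

(** The second derivative of p at 1 in the directions Y and X. *)
Definition dird2 p Y X : C := \sum_(l < n * n) dird (mderiv l p) 1%:M Y * mxvec X 0 l.

Lemma pfun_dird_left p X :
  pfun (fun g => dird p g (g *m X)) (fun Y => dird2 p Y X + dird p 1%:M (Y *m X)).
Proof.
have E l : pfun (fun g : 'M[C]_n => mxvec (g *m X) 0 l) (fun Y => mxvec (Y *m X) 0 l).
  case/mxvec_indexP: l => i j.
  have := pfun_mul 1%:M X (@pfun_id n) i j.
  by apply: pfun_ext => Y; rewrite mxvecE mul1mx.
have := pfun_sum (index_enum 'I_(n * n)) (fun l => pfunM (pfun_mxeval (mderiv l p)) (E l)).
apply: pfun_ext => Y //; rewrite /dird2 [X in _ = _ + X]/dird -big_split; apply: eq_bigr => l _ /=.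
by rewrite mul1mx.
Qed.
Lemma pfun_dird_right p X :
  pfun (fun g => dird p g (X *m g)) (fun Y => dird2 p Y X + dird p 1%:M (X *m Y)).
Proof.
have E l : pfun (fun g : 'M[C]_n => mxvec (X *m g) 0 l) (fun Y => mxvec (X *m Y) 0 l).
  case/mxvec_indexP: l => i j.
  have := pfun_mul X 1%:M (@pfun_id n) i j.
  by apply: pfun_ext => Y; rewrite mxvecE mulmx1.
have := pfun_sum (index_enum 'I_(n * n)) (fun l => pfunM (pfun_mxeval (mderiv l p)) (E l)).
apply: pfun_ext => Y //; rewrite /dird2 [X in _ = _ + X]/dird -big_split; apply: eq_bigr => l _ /=.
by rewrite mulmx1.
Qed.

Lemma dirdB p A X Y : dird p A (X - Y) = dird p A X - dird p A Y.
Proof. by rewrite addrC -scaleN1r dird_lin mulN1r addrC. Qed.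

(** For p vanishing on G, the derivatives of p at g along g Y and along Y g vanish for g in G.
    Differentiating both along X produces the same second derivative, and the first order terms left
    over are X Y and Y X. *)
Lemma lie_bracket X Y : Lie G X -> Lie G Y -> Lie G (X *m Y - Y *m X).
Proof.
move=> LX LY p Hp; rewrite -/(dird p 1%:M _) dirdB.
have := lie_pfun LX (pfun_dird_left p Y) (fun g Gg => lie_left Hp Gg LY).
have := lie_pfun LX (pfun_dird_right p Y) (fun g Gg => lie_right Hp Gg LY).
by move=> /eqP; rewrite addr_eq0 => /eqP-> /eqP; rewrite addrC subr_eq0 => /eqP->; rewrite subrr.
Qed.

Section PolynomialRep.
Variables (m : nat) (P dP : 'M[C]_n -> 'M[C]_m).
Hypothesis pP : forall i j, pfun (fun A => P A i j) (fun X => dP X i j).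
Hypothesis PM : forall g h, G g -> G h -> P (g *m h) = P g *m P h.
Hypothesis P1 : P 1%:M = 1%:M.

Lemma dP_lin a X Y : dP (a *: X + Y) = a *: dP X + dP Y.
Proof. by apply/matrixP => i j; rewrite (pfun_lin _ _ _ (pP i j)) !mxE. Qed.

Lemma dP_conj g X : G g -> Lie G X -> P g *m dP X = dP (g *m X *m invmx g) *m P g.
Proof.
move=> Gg LX; have [pp Hpp] : exists pp : 'I_m -> 'I_m -> {mpoly C[n * n]},
    forall i j, (forall A, mxeval (pp i j) A = P A i j) /\ (forall X, dird (pp i j) 1%:M X = dP X i j).
  have H i : exists p : 'I_m -> {mpoly C[n * n]}, forall j,
    (forall A, mxeval (p j) A = P A i j) /\ (forall X, dird (p j) 1%:M X = dP X i j).
    by have [pp Hpp] := choice (pP i); exists pp.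
  by have [pp Hpp] := choice H; exists pp.
pose Q h := P (g *m h *m invmx g).
have HQ i j : pfun (fun h => Q h i j) (fun X => dP (g *m X *m invmx g) i j).
  have := pfun_lr g (invmx g) (pp i j); rewrite mulmxV ?G_unit //.
  by apply: pfun_ext => A; rewrite ?(Hpp i j).1 ?(Hpp i j).2.
apply/matrixP => i j; apply/eqP; rewrite eq_sym -subr_eq0; apply/eqP.
have H1 := pfun_mul 1%:M (P g) HQ i j.
have H2 := pfun_mul (P g) 1%:M pP i j.
have := lie_pfun LX (pfunB H1 H2); rewrite !mul1mx !mulmx1; apply=> h Gh.
rewrite mul1mx mulmx1 /Q -PM // ?mulmxKV ?G_unit // ?PM ?subrr //.
by apply: GM => //; [exact: GM | exact: GV].
Qed.

Lemma dP_bracket X Y : Lie G X -> Lie G Y ->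
  dP (X *m Y - Y *m X) = dP X *m dP Y - dP Y *m dP X.
Proof.
move=> LX LY; apply/matrixP => i j.
have [p [Hp1 Hp2]] := pP i j.
have HL g : G g -> dird p g (g *m Y) = (P g *m dP Y) i j.
  move=> Gg; have H2 := pfun_mul (P g) 1%:M pP i j.
  have := lie_pfun LY (pfunB (pfun_lr g 1%:M p) H2); rewrite !mulmx1 => H.
  apply/eqP; rewrite -subr_eq0; apply/eqP; apply: H => h Gh.
  by rewrite !mulmx1 Hp1 PM // subrr.
have HR g : G g -> dird p g (Y *m g) = (dP Y *m P g) i j.
  move=> Gg; have H2 := pfun_mul 1%:M (P g) pP i j.
  have := lie_pfun LY (pfunB (pfun_lr 1%:M g p) H2); rewrite !mul1mx => H.
  apply/eqP; rewrite -subr_eq0; apply/eqP; apply: H => h Gh.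
  by rewrite !mul1mx Hp1 PM // subrr.
have A1 := pfun_mul 1%:M (dP Y) pP i j.
have A2 := pfun_mul (dP Y) 1%:M pP i j.
have B1 := lie_pfun LX (pfunB (pfun_dird_left p Y) A1).
have B2 := lie_pfun LX (pfunB (pfun_dird_right p Y) A2).
have {}B1 : dird2 p X Y + dird p 1%:M (X *m Y) = (dP X *m dP Y) i j.
  apply/eqP; rewrite -subr_eq0; apply/eqP; rewrite mul1mx in B1; apply: B1 => g Gg.
  by rewrite mul1mx HL // subrr.
have {}B2 : dird2 p X Y + dird p 1%:M (Y *m X) = (dP Y *m dP X) i j.
  apply/eqP; rewrite -subr_eq0; apply/eqP; rewrite mulmx1 in B2; apply: B2 => g Gg.
  by rewrite mulmx1 HR // subrr.
rewrite -Hp2 dirdB [RHS]mxE [X in _ = _ + X]mxE -B1 -B2 opprD addrACA subrr add0r //.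
Qed.
End PolynomialRep.
End LieAlgebra.
End PolynomialFunctions.

(** Artin's argument: the relation at y x minus the value of the first character at y times the
    relation at x is a shorter relation. *)
Lemma artin_independence (F : fieldType) (X : Type) (op : X -> X -> X) (S : X -> Prop)
    (I : eqType) (chi : I -> X -> F) :
  (forall x y, S x -> S y -> S (op x y)) ->
  (forall i x y, S x -> S y -> chi i (op x y) = chi i x * chi i y) ->
  (forall i, exists2 x, S x & chi i x != 0) ->
  forall (s : seq I), uniq s ->
  {in s &, forall i j, (forall x, S x -> chi i x = chi j x) -> i = j} ->
  forall c : I -> F, (forall x, S x -> \sum_(i <- s) c i * chi i x = 0) ->
  {in s, forall i, c i = 0}.
Proof.
move=> Sop chiM chi0; elim=> [//|i0 s IH] /= /andP[i0s us] dist c Hc.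
have cs k : k \in s -> c k = 0.
  move=> ks.
  have [y [Sy ny]] : exists y, S y /\ chi k y != chi i0 y.
    apply: contrapT => H; move: i0s; rewrite -(dist k i0) ?ks ?inE ?eqxx ?ks ?orbT //.
    move=> x Sx; apply/eqP/negPn/negP => nx; apply: H; by exists x.
  suff /eqP : c k * (chi k y - chi i0 y) = 0.
    by rewrite mulf_eq0 subr_eq0 (negPf ny) orbF => /eqP.
  apply: (IH us _ (fun i => c i * (chi i y - chi i0 y)) _ k ks) => [i j is_ js|x Sx].
    by apply: dist; rewrite inE ?is_ ?js orbT.
  have := Hc _ (Sop _ _ Sy Sx); have := Hc _ Sx; rewrite !big_cons chiM // => E1 E2.
  have : 0 = (c i0 * (chi i0 y * chi i0 x) + \sum_(j <- s) c j * chi j (op y x))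
     - chi i0 y * (c i0 * chi i0 x + \sum_(j <- s) c j * chi j x).
    by rewrite E1 E2 mulr0 subrr.
  rewrite mulrDr opprD addrACA (mulrCA (c i0)) mulrCA subrr add0r => E.
  apply: etrans (esym E); rewrite mulr_sumr -sumrB; apply: eq_bigr => i _; rewrite chiM //; ring.
move=> i; rewrite inE => /orP[/eqP->|/cs//].
have [x Sx nx] := chi0 i0; have := Hc x Sx; rewrite big_cons big_seq big1 ?addr0.
  by move/eqP; rewrite mulf_eq0 (negPf nx) orbF => /eqP.
by move=> j /cs->; rewrite mul0r.
Qed.

(** The form in which independence is used throughout: in a relation between characters, the
    characters may be replaced by arbitrary values [phi]. An indicator [phi] extracts a coefficient;
    an additive [phi] differentiates the relation at the identity. *)
Lemma artin_functional (F : fieldType) (X : Type) (op : X -> X -> X) (S : X -> Prop)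
    (I : eqType) (chi : I -> X -> F) :
  (forall x y, S x -> S y -> S (op x y)) ->
  (forall i x y, S x -> S y -> chi i (op x y) = chi i x * chi i y) ->
  (forall i, exists2 x, S x & chi i x != 0) ->
  (forall i j, (forall x, S x -> chi i x = chi j x) -> i = j) ->
  forall l : seq (F * I), (forall x, S x -> \sum_(u <- l) u.1 * chi u.2 x = 0) ->
  forall phi : I -> F, \sum_(u <- l) u.1 * phi u.2 = 0.
Proof.
move=> Sop chiM chi0 dist l Hl phi.
pose s := undup (map snd l).
have grp (psi : I -> F) : \sum_(u <- l) u.1 * psi u.2 =
    \sum_(i <- s) (\sum_(u <- l | u.2 == i) u.1) * psi i.
  under [RHS]eq_bigr do rewrite mulr_suml big_mkcond.
  rewrite exchange_big /=; apply: eq_big_seq => u ul.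
  have us : u.2 \in s by rewrite mem_undup map_f.
  rewrite (bigD1_seq u.2) ?undup_uniq //= eqxx big1 ?addr0 // => i.
  by rewrite eq_sym => /negPf->.
rewrite grp big_seq big1 // => i is_.
rewrite (artin_independence Sop chiM chi0 (undup_uniq _) _ (c := fun i => \sum_(u <- l | u.2 == i) u.1) _ is_) ?mul0r //.
- by move=> j k _ _; exact: dist.
- by move=> x Sx; rewrite -grp Hl.
Qed.

(** * Tori and their characters *)

Section Laurent.
Variable F : numFieldType.
Definition mon d (z : 'I_d -> F) (v : 'rV[int]_d) : F := \prod_i z i ^ (v 0 i).
Definition nzv d (z : 'I_d -> F) := forall i, z i != 0.

Lemma mon_neq0 d (z : 'I_d -> F) v : nzv z -> mon z v != 0.
Proof. by move=> nz; apply/prodf_neq0 => i _; apply: expfz_neq0. Qed.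
Lemma monD d (z : 'I_d -> F) v w : nzv z -> mon z (v + w) = mon z v * mon z w.
Proof.
by move=> nz; rewrite /mon -big_split; apply: eq_bigr => i _; rewrite mxE expfzDr.
Qed.
Lemma mon0 d (z : 'I_d -> F) : mon z 0 = 1.
Proof. by rewrite /mon big1 // => i _; rewrite mxE expr0z. Qed.
Lemma monN d (z : 'I_d -> F) v : nzv z -> mon z (- v) = (mon z v)^-1.
Proof.
move=> nz; apply: (mulIf (mon_neq0 v nz)).
by rewrite -monD // addNr mon0 mulVf ?mon_neq0.
Qed.
Lemma mon_mull d (z z' : 'I_d -> F) v : mon (fun i => z i * z' i) v = mon z v * mon z' v.
Proof. by rewrite /mon -big_split; apply: eq_bigr => i _; rewrite expfzMl. Qed.
Lemma mon_one d v : mon (fun _ : 'I_d => 1 : F) v = 1.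
Proof. by rewrite /mon big1 // => i _; rewrite exp1rz. Qed.
Lemma monMn d (z : 'I_d -> F) v k : nzv z -> mon z (v *+ k) = mon z v ^+ k.
Proof.
by move=> nz; elim: k => [|k IH]; rewrite ?mulr0n ?mon0 ?expr0 // mulrS monD // exprS IH.
Qed.
Lemma mon_sum d (I : Type) (s : seq I) (z : 'I_d -> F) (v : I -> 'rV[int]_d) : nzv z ->
  mon z (\sum_(i <- s) v i) = \prod_(i <- s) mon z (v i).
Proof.
by move=> nz; elim: s => [|i s IH]; rewrite ?big_nil ?mon0 // !big_cons monD // IH.
Qed.
Lemma monMz d (z : 'I_d -> F) v (k : int) : nzv z -> mon z (k *: v) = mon z v ^ k.
Proof.
move=> nz; rewrite /mon; under eq_bigr do rewrite mxE mulrC -exprz_exp.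
by elim/big_rec2: _ => [|i y1 y2 _ ->]; rewrite ?exp1rz // expfzMl.
Qed.
Lemma mon_mon d d' (z : 'I_d -> F) (M : 'I_d' -> 'rV[int]_d) v : nzv z ->
  mon (fun j => mon z (M j)) v = mon z (\sum_j v 0 j *: M j).
Proof. by move=> nz; rewrite mon_sum //; apply: eq_bigr => j _; rewrite monMz. Qed.
Lemma nzv_mon d d' (z : 'I_d -> F) (M : 'I_d' -> 'rV[int]_d) : nzv z ->
  nzv (fun j => mon z (M j)).
Proof. by move=> nz j; exact: mon_neq0. Qed.
Lemma mon_delta d (z : 'I_d -> F) i : mon z (delta_mx 0 i) = z i.
Proof.
rewrite /mon (bigD1 i) //= mxE !eqxx /= expr1z big1 ?mulr1 // => j ji.
by rewrite mxE (negPf ji) andbF expr0z.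
Qed.

Lemma exp2z_inj : injective (fun k : int => (2 : F) ^ k).
Proof.
move=> k l H; have two : (2 : F) != 0 by rewrite pnatr_eq0.
have : (2 : F) ^ (k - l) == 1 by rewrite expfzDr // H -expfzDr // subrr.
by rewrite pexprz_eq1 ?ler0n // (eqr_nat F 2 1) orbF subr_eq0 => /eqP.
Qed.

Lemma mon_inj d (v w : 'rV[int]_d) : (forall z : 'I_d -> F, nzv z -> mon z v = mon z w) -> v = w.
Proof.
move=> H; apply/rowP => i.
have two : (2 : F) != 0 by rewrite pnatr_eq0.
pose z (j : 'I_d) : F := if j == i then 2 else 1.
have nz : nzv z by move=> j; rewrite /z; case: ifP => // _; exact: oner_neq0.
have E (u : 'rV[int]_d) : mon z u = 2 ^ (u 0 i).
  rewrite /mon (bigD1 i) //= /z eqxx big1 ?mulr1 // => j /negPf->.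
  by rewrite exp1rz.
by apply: exp2z_inj; rewrite -!E; exact: H.
Qed.

Lemma laurent_functional d (l : seq (F * 'rV[int]_d)) :
  (forall z : 'I_d -> F, nzv z -> \sum_(u <- l) u.1 * mon z u.2 = 0) ->
  forall phi : 'rV[int]_d -> F, \sum_(u <- l) u.1 * phi u.2 = 0.
Proof.
apply: (@artin_functional F _ (fun z z' i => z i * z' i) (@nzv d) _ (fun v z => mon z v)).
- by move=> z z' nz nz' i; rewrite mulf_neq0.
- by move=> v z z' _ _; exact: mon_mull.
- by move=> v; exists (fun=> 1); [move=> i; exact: oner_neq0 | rewrite mon_one oner_neq0].
- by move=> v w; exact: mon_inj.
Qed.

Lemma laurent_mult_mon d (chi : ('I_d -> F) -> F) (l : seq (F * 'rV[int]_d)) :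
  (forall z, nzv z -> chi z = \sum_(u <- l) u.1 * mon z u.2) ->
  (forall z z', nzv z -> nzv z' -> chi (fun i => z i * z' i) = chi z * chi z') ->
  (forall z, nzv z -> chi z != 0) -> exists v, forall z, nzv z -> chi z = mon z v.
Proof.
move=> Hl chiM chi0; apply: contrapT => nv.
pose ch (o : option 'rV[int]_d) z := if o is Some v then mon z v else chi z.
have n1 : nzv (fun _ : 'I_d => 1 : F) by move=> i; exact: oner_neq0.
have := @artin_functional F _ (fun z z' i => z i * z' i) (@nzv d) _ ch _ _ _ _
   ((-1, None) :: [seq (u.1, Some u.2) | u <- l]) _ (fun o => (o == None)%:R).
rewrite big_cons big_map /= mulr1 big1 ?addr0; last by move=> u _; rewrite mulr0.
move=> H; have /eqP : (-1 : F) = 0; last by rewrite oppr_eq0 oner_eq0.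
apply: H.
- by move=> z z' nz nz' i; rewrite mulf_neq0.
- by move=> [v|] z z' nz nz' /=; [exact: mon_mull | exact: chiM].
- by move=> [v|]; exists (fun=> 1) => //=; [rewrite mon_one oner_neq0 | exact: chi0].
- move=> [v|] [w|] //= H; first by congr Some; exact: mon_inj.
    by exfalso; apply: nv; exists v => z nz; rewrite H.
  by exfalso; apply: nv; exists w.
- move=> z nz; rewrite big_cons big_map /= mulN1r (Hl z nz) addrC; apply/eqP.
  by rewrite subr_eq0.
Qed.
End Laurent.

Section LaurentCurves.
Variable R : realType.
Local Notation C := R[i].
Variables (n d N : nat) (P : 'I_N -> 'M[C]_n) (cl : 'I_N -> 'rV[int]_d).

Definition curve (z : 'I_d -> C) : 'M[C]_n := \sum_i mon z (cl i) *: P i.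

(** One list of coefficients serves for the values and for the derivative: replacing z^v by b v, for
    additive b, is logarithmic differentiation at z = 1. *)
Lemma laurent_expand (p : {mpoly C[n * n]}) : exists l : seq (C * 'rV[int]_d),
  (forall z, nzv z -> mxeval p (curve z) = \sum_(u <- l) u.1 * mon z u.2) /\
  (forall b : {additive 'rV[int]_d -> C},
     dird p (\sum_i P i) (\sum_i b (cl i) *: P i) = \sum_(u <- l) u.1 * b u.2).
Proof.
have c1 : curve (fun=> 1) = \sum_i P i.
  by apply: eq_bigr => i _; rewrite mon_one scale1r.
have n1 : nzv (fun _ : 'I_d => 1 : C) by move=> i; exact: oner_neq0.
elim/mpoly_ring_ind: p => [c|k|p q [l [Hl1 Hl2]] [l' [Hl'1 Hl'2]]|p q [l [Hl1 Hl2]] [l' [Hl'1 Hl'2]]].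
- exists [:: (c, 0)]; split=> [z nz|b]; rewrite big_seq1 /=.
    by rewrite mon0 mulr1 /mxeval mevalC.
  by rewrite raddf0 mulr0 dirdC.
- case/mxvec_indexP: k => a b'.
  exists [seq (P i a b', cl i) | i <- index_enum 'I_N]; split=> [z nz|b]; rewrite big_map.
    rewrite /mxeval mevalXU mxvecE summxE; apply: eq_bigr => i _.
    by rewrite mxE mulrC.
  by rewrite dirdX mxvecE summxE; apply: eq_bigr => i _; rewrite mxE mulrC.
- exists (l ++ l'); split=> [z nz|b]; rewrite big_cat /=.
    by rewrite -Hl1 // -Hl'1 // /mxeval mevalD.
  by rewrite dirdD Hl2 Hl'2.
exists [seq (u.1 * w.1, u.2 + w.2) | u <- l, w <- l']; split=> [z nz|b].
  rewrite /mxeval mevalM -!/(mxeval _ _) Hl1 // Hl'1 // big_allpairs_dep mulr_suml.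
  apply: eq_bigr => u _; rewrite mulr_sumr; apply: eq_bigr => w _ /=.
  by rewrite monD // mulrACA.
have E (l0 : seq (C * 'rV[int]_d)) p0 :
    (forall z, nzv z -> mxeval p0 (curve z) = \sum_(u <- l0) u.1 * mon z u.2) ->
    mxeval p0 (\sum_i P i) = \sum_(u <- l0) u.1.
  by move=> /(_ _ n1); rewrite c1 => ->; apply: eq_bigr => u _; rewrite mon_one mulr1.
rewrite dirdM Hl2 Hl'2 (E _ _ Hl1) (E _ _ Hl'1) big_allpairs_dep !mulr_suml -big_split.
apply: eq_bigr => u _; rewrite !mulr_sumr -big_split; apply: eq_bigr => w _ /=.
by rewrite raddfD /=; ring.
Qed.

Lemma laurent_pfun (F dF : 'M[C]_n -> C) (l : seq (C * 'rV[int]_d)) :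
  \sum_i P i = 1%:M -> pfun F dF ->
  (forall z, nzv z -> F (curve z) = \sum_(u <- l) u.1 * mon z u.2) ->
  forall b : {additive 'rV[int]_d -> C}, dF (\sum_i b (cl i) *: P i) = \sum_(u <- l) u.1 * b u.2.
Proof.
move=> P1 [p [Hp1 Hp2]] Hl b; rewrite -Hp2; have [l' [Hl'1 Hl'2]] := laurent_expand p.
rewrite -P1 Hl'2; apply/eqP; rewrite -subr_eq0; apply/eqP.
have := @laurent_functional _ _ (l' ++ [seq (- u.1, u.2) | u <- l]) _ b.
rewrite big_cat big_map /= => H.
rewrite -[X in _ - X]/(\sum_(u <- l) _) -sumrN; under [X in _ + X]eq_bigr do rewrite -mulNr.
apply: H => z nz; rewrite big_cat big_map /= -Hl'1 // Hp1 Hl //.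
by under [X in _ + X]eq_bigr do rewrite mulNr; rewrite sumrN subrr.
Qed.

Lemma lie_curve (G : set 'M[C]_n) : \sum_i P i = 1%:M -> (forall z, nzv z -> G (curve z)) ->
  forall b : {additive 'rV[int]_d -> C}, Lie G (\sum_i b (cl i) *: P i).
Proof.
move=> P1 Hc b p Hp.
rewrite -/(dird p 1%:M _) (laurent_pfun P1 (pfun_mxeval p) (l := [::])) ?big_nil //.
by move=> z nz; rewrite big_nil Hp //; exact: Hc.
Qed.
End LaurentCurves.

Section TorusCharacters.
Variable R : realType.
Local Notation C := R[i].
Variables (n : nat) (T : set 'M[C]_n) (r : nat) (e : 'I_r -> 'M[C]_n -> C).
Hypothesis Ttorus : torus T.
Hypothesis Te : char_basis T e.

Let sT : subgroup_GL T. Proof. by case: Ttorus => -[]. Qed.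
Let T1 : T 1%:M. Proof. by case: sT. Qed.
Let TM s t : T s -> T t -> T (s *m t). Proof. by case: sT => _ _ H _; exact: H. Qed.
Let Tunit t : T t -> t \in unitmx. Proof. by case: sT => H _ _ _ /H. Qed.
Let det0 t : T t -> \det t != 0. Proof. by move=> /Tunit; rewrite unitmxE unitfE. Qed.
Let e0 t : T t -> nzv (fun i => e i t).
Proof. by move=> Tt i; case: Te => /(_ i)[H _ _] _; exact: H. Qed.
Let eM i s t : T s -> T t -> e i (s *m t) = e i s * e i t.
Proof. by move=> Ts Tt; case: Te => /(_ i)[_ H _] _; exact: H. Qed.

Lemma char_ofE v t : char_of e v t = mon (fun i => e i t) v.
Proof. by []. Qed.
Lemma char_of_neq0 v t : T t -> char_of e v t != 0.
Proof. by move=> Tt; exact/mon_neq0/e0. Qed.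
Lemma char_ofM v s t : T s -> T t -> char_of e v (s *m t) = char_of e v s * char_of e v t.
Proof.
move=> Ts Tt; rewrite !char_ofE -mon_mull.
by congr (mon _ v); apply: funext => i; rewrite eM.
Qed.
Lemma char_ofD v w t : T t -> char_of e (v + w) t = char_of e v t * char_of e w t.
Proof. by move=> Tt; apply/monD/e0. Qed.

Lemma regular_const c : regular T (fun=> c).
Proof.
by exists c%:MP, 0 => g _; rewrite /mxeval mevalC expr0 divr1.
Qed.
Lemma regular_mul f g : regular T f -> regular T g -> regular T (fun t => f t * g t).
Proof.
move=> [p [k Hp]] [q [l Hq]]; exists (p * q), (k + l)%N => t Tt.
by rewrite Hp // Hq // /mxeval mevalM exprD invfM mulrACA.
Qed.
Lemma regular_exp f k : regular T f -> regular T (fun t => f t ^+ k).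
Proof.
move=> rf; elim: k => [|k IH].
  exact: regular_const.
have [p [d H]] := regular_mul rf IH; exists p, d => t Tt.
by rewrite -H // exprS.
Qed.

Lemma regular_prod (I : Type) (s : seq I) (F : I -> 'M[C]_n -> C) :
  (forall i, regular T (F i)) -> regular T (fun t => \prod_(i <- s) F i t).
Proof.
move=> H; elim: s => [|i s IH].
  by have [p [d E]] := regular_const 1; exists p, d => t Tt; rewrite big_nil -E.
by have [p [d E]] := regular_mul (H i) IH; exists p, d => t Tt; rewrite big_cons -E.
Qed.

Lemma char_of_alg (v : 'rV[int]_r) : (forall i, 0 <= v 0 i) -> alg_character T (char_of e v).
Proof.
move=> v0; split; [exact: char_of_neq0 | exact: char_ofM |].
apply: regular_prod => i; have := v0 i; case: (v 0 i) => // k _.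
by apply: regular_exp; case: Te => /(_ i)[].
Qed.

Lemma char_of_inj v w : (forall t, T t -> char_of e v t = char_of e w t) -> v = w.
Proof.
(* Uniqueness of exponents is given for algebraic characters, and [char_of_alg] covers nonnegative
   exponents only. Both sides are therefore multiplied by the same character u, large enough to make
   all exponents nonnegative. *)
move=> H; pose u : 'rV[int]_r := \row_i (`|v 0 i| + `|w 0 i|).
have pos x : (x = v \/ x = w) -> forall i, 0 <= (x + u) 0 i.
  move=> xvw i; rewrite !mxE; have := ler_norm (- x 0 i); rewrite normrN.
  by case: xvw => ->; have := normr_ge0 (v 0 i); have := normr_ge0 (w 0 i); lra.
have [_ uq] := Te.
have [y [Hy1 Hy2]] := uq _ (char_of_alg (pos v (or_introl erefl))).
have E1 := Hy2 (v + u) (fun t _ => erefl).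
have E2 : y = w + u.
  by apply: Hy2 => t Tt; rewrite !char_ofD // H.
by apply: (addIr u); rewrite -E1 E2.
Qed.

Lemma alg_char_ofP chi : alg_character T chi -> exists v, forall t, T t -> chi t = char_of e v t.
Proof. by case: Te => _ H /H[v [Hv _]]; exists v. Qed.

Lemma char_functional (l : seq (C * 'rV[int]_r)) :
  (forall t, T t -> \sum_(u <- l) u.1 * char_of e u.2 t = 0) ->
  forall phi : 'rV[int]_r -> C, \sum_(u <- l) u.1 * phi u.2 = 0.
Proof.
apply: (@artin_functional C _ (fun s t => s *m t) T _ (fun v t => char_of e v t)).
- exact: TM.
- exact: char_ofM.
- by move=> v; exists 1%:M => //; exact: char_of_neq0.
- exact: char_of_inj.
Qed.

Definition chspan (f : 'M[C]_n -> C) := exists l : seq (C * 'rV[int]_r),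
  forall t, T t -> f t = \sum_(u <- l) u.1 * char_of e u.2 t.

Lemma chspan_ext f g : (forall t, T t -> f t = g t) -> chspan f -> chspan g.
Proof. by move=> E [l Hl]; exists l => t Tt; rewrite -E // Hl. Qed.
Lemma chspan_char c v : chspan (fun t => c * char_of e v t).
Proof. by exists [:: (c, v)] => t _; rewrite big_seq1. Qed.
Lemma chspan_const c : chspan (fun=> c).
Proof. by apply: chspan_ext (chspan_char c 0) => t _; rewrite char_ofE mon0 mulr1. Qed.
Lemma chspanD f g : chspan f -> chspan g -> chspan (fun t => f t + g t).
Proof. by move=> [l Hl] [k Hk]; exists (l ++ k) => t Tt; rewrite big_cat Hl // Hk. Qed.
Lemma chspanM f g : chspan f -> chspan g -> chspan (fun t => f t * g t).
Proof.
move=> [l Hl] [k Hk]; exists [seq (u.1 * w.1, u.2 + w.2) | u <- l, w <- k] => t Tt.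
rewrite Hl // Hk // big_allpairs_dep mulr_suml; apply: eq_bigr => u _.
by rewrite mulr_sumr; apply: eq_bigr => w _ /=; rewrite char_ofD // mulrACA.
Qed.
Lemma chspan_mxeval m (A : 'M[C]_n -> 'M[C]_m) : (forall i j, chspan (fun t => A t i j)) ->
  forall p, chspan (fun t => mxeval p (A t)).
Proof.
move=> HA p; elim/mpoly_ring_ind: p => [c|k|p q Hp Hq|p q Hp Hq].
- by apply: chspan_ext (chspan_const c) => t _; rewrite /mxeval mevalC.
- case/mxvec_indexP: k => i j; apply: chspan_ext (HA i j) => t _.
  by rewrite /mxeval mevalXU mxvecE.
- by apply: chspan_ext (chspanD Hp Hq) => t _; rewrite /mxeval mevalD.
- by apply: chspan_ext (chspanM Hp Hq) => t _; rewrite /mxeval mevalM.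
Qed.

Lemma alg_char_inv_exp chi k : alg_character T chi -> chspan (fun t => (chi t ^+ k)^-1).
Proof.
move=> /alg_char_ofP[v Hv]; apply: chspan_ext (chspan_char 1 (- (v *+ k))) => t Tt.
by rewrite Hv // mul1r !char_ofE monN ?monMn //; exact: e0.
Qed.

Lemma det_char : alg_character T (fun t => \det t).
Proof.
split; [exact: det0 | by move=> s t _ _; rewrite det_mulmx |].
have [dF [p [Hp _]]] := @isp_det R n.
by exists p, 0 => t _; rewrite Hp expr0 divr1.
Qed.

Lemma chspan_regular_coords : (forall i j, chspan (fun t => t i j)) ->
  forall f, regular T f -> chspan f.
Proof.
move=> H f [p [k Hp]].
apply: chspan_ext (chspanM (chspan_mxeval H p) (alg_char_inv_exp k det_char)) => t Tt.
by rewrite -Hp.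
Qed.

Section Param.
Variables (r0 : nat) (f : 'M[C]_n -> 'M[C]_r0) (g : 'M[C]_r0 -> 'M[C]_n).
Hypothesis fmor : alg_morphism T (@diagGL R r0) f.
Hypothesis gmor : alg_morphism (@diagGL R r0) T g.
Hypothesis gf : forall t, T t -> g (f t) = t.

Lemma diagGL_diag (z : 'I_r0 -> C) : nzv z -> diagGL (diag_mx (\row_j z j)).
Proof.
move=> nz; split; last exact: diag_mx_is_diag.
by rewrite unitmxE unitfE det_diag; apply/prodf_neq0 => j _; rewrite mxE.
Qed.
Lemma diagGLE (A : 'M[C]_r0) : diagGL A -> A = diag_mx (\row_j A j j) /\ nzv (fun j => A j j).
Proof.
move=> [uA /is_diag_mxP dA].
have E : A = diag_mx (\row_j A j j).
  apply/matrixP => i j; rewrite !mxE; case: eqVneq => [->|ij]; first by rewrite mulr1n.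
  by rewrite mulr0n dA.
split=> // j; move: uA; rewrite {1}E unitmxE unitfE det_diag => /prodf_neq0/(_ j isT).
by rewrite mxE.
Qed.

Lemma coord_char j : alg_character T (fun t => f t j j).
Proof.
have [f1 f2 f3] := fmor; split=> [t Tt|s t Ts Tt|]; last exact: f3.
  by have [_] := diagGLE (f1 _ Tt); exact.
have [E1 _] := diagGLE (f1 _ Ts); have [E2 _] := diagGLE (f1 _ Tt).
rewrite f2 // {1}E1 {1}E2 mulmx_diag !mxE eqxx mulr1n //.
Qed.

Lemma chspan_coord i j : chspan (fun t => t i j).
Proof.
have [f1 f2 f3] := fmor; have [g1 g2 g3] := gmor.
have Hf k l : chspan (fun t => f t k l).
  have [v Hv] := alg_char_ofP (coord_char k).
  case: (eqVneq k l) => [<-|kl].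
    by apply: chspan_ext (chspan_char 1 v) => t Tt; rewrite mul1r -Hv.
  apply: chspan_ext (chspan_const 0) => t Tt.
  by have [_ /is_diag_mxP ->] := f1 _ Tt.
have [p [d Hp]] := g3 i j.
have Hd : chspan (fun t => (\det (f t) ^+ d)^-1).
  apply: alg_char_inv_exp; split=> [t Tt|s t Ts Tt|].
  - by have [] := f1 _ Tt; rewrite unitmxE unitfE.
  - by rewrite f2 // det_mulmx.
  have rp : regular T (fun t => \prod_j f t j j) by apply: regular_prod => k; exact: f3.
  have [q [dd Hq]] := rp; exists q, dd => t Tt; rewrite -Hq //.
  have [E _] := diagGLE (f1 _ Tt); rewrite {1}E det_diag.
  by apply: eq_bigr => k _; rewrite mxE.
apply: chspan_ext (chspanM (chspan_mxeval Hf p) Hd) => t Tt.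
by rewrite -Hp ?gf //; exact: f1.
Qed.

(** The e i along the diagonal parametrization, and the diagonal coordinates in terms of the e i,
    are all monomials, with exponents [Nn] and [M]. Since g after f is the identity of T, the
    exponents compose to the identity, so z^M fed into g has the prescribed values of the e i. *)
Lemma torus_paramP : exists th : ('I_r -> C) -> 'M[C]_n,
  forall z, nzv z -> T (th z) /\ forall i, e i (th z) = z i.
Proof.
have [f1 f2 f3] := fmor; have [g1 g2 g3] := gmor.
pose D (z : 'I_r0 -> C) := diag_mx (\row_j z j).
have DM z z' : D (fun i => z i * z' i) = D z *m D z'.
  by rewrite mulmx_diag; congr diag_mx; apply/rowP => j; rewrite !mxE.
have detD z : \det (D z) = mon z (const_mx 1).
  by rewrite det_diag; apply: eq_bigr => j _; rewrite !mxE expr1z.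
pose ls (F : ('I_r0 -> C) -> C) := exists l : seq (C * 'rV[int]_r0),
  forall z, nzv z -> F z = \sum_(u <- l) u.1 * mon z u.2.
have lsM F1 F2 : ls F1 -> ls F2 -> ls (fun z => F1 z * F2 z).
  move=> [l Hl] [k Hk]; exists [seq (u.1 * w.1, u.2 + w.2) | u <- l, w <- k] => z nz.
  rewrite Hl // Hk // big_allpairs_dep mulr_suml; apply: eq_bigr => u _.
  by rewrite mulr_sumr; apply: eq_bigr => w _ /=; rewrite monD // mulrACA.
have ls_mx m (A : ('I_r0 -> C) -> 'M[C]_m) : (forall i j, ls (fun z => A z i j)) ->
    forall p, ls (fun z => mxeval p (A z)).
  move=> HA p; elim/mpoly_ring_ind: p => [c|k|p q [l Hl] [l' Hl']|p q Hp Hq].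
  - by exists [:: (c, 0)] => z nz; rewrite big_seq1 /= mon0 mulr1 /mxeval mevalC.
  - case/mxvec_indexP: k => i j; have [l Hl] := HA i j; exists l => z nz.
    by rewrite /mxeval mevalXU mxvecE Hl.
  - by exists (l ++ l') => z nz; rewrite big_cat /= -Hl // -Hl' // /mxeval mevalD.
  - by have [l Hl] := lsM _ _ Hp Hq; exists l => z nz; rewrite -Hl // /mxeval mevalM.
have lsD i j : ls (fun z => D z i j).
  case: (eqVneq i j) => [->|ij].
    by exists [:: (1, delta_mx 0 j)] => z nz; rewrite big_seq1 /= mon_delta mul1r !mxE eqxx mulr1n.
  by exists [::] => z nz; rewrite big_nil !mxE (negPf ij) mulr0n.
have ls_mon k v : ls (fun z => (mon z v ^+ k)^-1).
  exists [:: (1, - (v *+ k))] => z nz.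
  by rewrite big_seq1 /= mul1r monN // monMn.
have lsg i j : ls (fun z => g (D z) i j).
  have [p [k Hp]] := g3 i j.
  have [l Hl] := lsM _ _ (ls_mx _ D lsD p) (ls_mon k (const_mx 1)).
  by exists l => z nz; rewrite -Hl // Hp ?detD //; exact: diagGL_diag.
have [w Hw] : exists w, forall z, nzv z -> \det (g (D z)) = mon z w.
  have [dF [p [Hp _]]] := @isp_det R n.
  have [l Hl] := ls_mx _ (fun z => g (D z)) lsg p.
  apply: (laurent_mult_mon (l := l)) => [z nz|z z' nz nz'|z nz].
  - by rewrite -Hl // Hp.
  - by rewrite DM g2 ?det_mulmx //; exact: diagGL_diag.
  - by apply/det0/g1/diagGL_diag.
have /choice[Nn HN] i : exists v, forall z, nzv z -> e i (g (D z)) = mon z v.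
  have [ei0 eiM [p [k Hp]]] : alg_character T (e i) by case: Te.
  have [l Hl] := lsM _ _ (ls_mx _ _ lsg p) (ls_mon k w).
  apply: (laurent_mult_mon (l := l)) => [z nz|z z' nz nz'|z nz].
  - by rewrite -Hl // Hp ?Hw //; exact/g1/diagGL_diag.
  - by rewrite DM g2 ?eiM //; try exact: diagGL_diag; apply/g1/diagGL_diag.
  - by apply/ei0/g1/diagGL_diag.
have /choice[M HM] j : exists v, forall t, T t -> f t j j = char_of e v t.
  exact: alg_char_ofP (coord_char j).
have fD t : T t -> f t = D (fun j => mon (fun i => e i t) (M j)).
  move=> Tt; have [E _] := diagGLE (f1 _ Tt); rewrite {1}E; congr diag_mx.
  by apply/rowP => j; rewrite !mxE HM.
have NM i : \sum_j Nn i 0 j *: M j = delta_mx 0 i.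
  apply: char_of_inj => t Tt; rewrite !char_ofE mon_delta -mon_mon; last exact: e0.
  rewrite -HN; last exact/nzv_mon/e0.
  by rewrite -fD // gf.
exists (fun z => g (D (fun j => mon z (M j)))) => z nz; split.
  by apply/g1/diagGL_diag; exact: nzv_mon.
by move=> i; rewrite HN; [rewrite mon_mon // NM mon_delta | exact: nzv_mon].
Qed.
End Param.

Lemma torus_param : exists th : ('I_r -> C) -> 'M[C]_n,
  forall z, nzv z -> T (th z) /\ forall i, e i (th z) = z i.
Proof. by case: Ttorus => _ [r0 [f [g [fm gm gf _]]]]; exact: torus_paramP fm gm gf. Qed.

Lemma chspan_regular f : regular T f -> chspan f.
Proof.
apply: chspan_regular_coords => i j.
by case: Ttorus => _ [r0 [f' [g [fm gm gf _]]]]; exact: chspan_coord fm gm gf i j.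
Qed.

(** The entries of rho are combinations of characters, and P v collects the coefficients of v.
    Comparing coefficients in rho (s t) = rho s rho t, by independence of characters, makes the P v
    orthogonal idempotents. *)
Lemma torus_rep_decomp m (rho : 'M[C]_n -> 'M[C]_m) : alg_morphism T (@GL R m) rho ->
  exists (ws : seq 'rV[int]_r) (P : 'rV[int]_r -> 'M[C]_m),
  [/\ uniq ws, forall t, T t -> rho t = \sum_(v <- ws) char_of e v t *: P v,
      {in ws &, forall v w, P v *m P w = if v == w then P v else 0},
      \sum_(v <- ws) P v = 1%:M & forall v, v \notin ws -> P v = 0].
Proof.
move=> [r1 rM rreg].
have /choice[l Hl] (ij : 'I_m * 'I_m) : exists l : seq (C * 'rV[int]_r),
    forall t, T t -> rho t ij.1 ij.2 = \sum_(u <- l) u.1 * char_of e u.2 t.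
  exact: chspan_regular (rreg ij.1 ij.2).
pose ws := undup (flatten [seq map snd (l ij) | ij <- enum {: 'I_m * 'I_m}]).
pose P v : 'M[C]_m := if v \in ws then \matrix_(i, j) \sum_(u <- l (i, j) | u.2 == v) u.1 else 0.
have uw : uniq ws by exact: undup_uniq.
have rhoE t : T t -> rho t = \sum_(v <- ws) char_of e v t *: P v.
  move=> Tt; apply/matrixP => i j; rewrite (Hl (i, j)) // summxE.
  under [RHS]eq_big_seq => v vws do rewrite mxE /P vws mxE mulrC mulr_suml big_mkcond.
  rewrite exchange_big /=; apply: eq_big_seq => u ul.
  have us : u.2 \in ws.
    rewrite mem_undup; apply/flattenP; exists (map snd (l (i, j))); last exact: map_f.
    by apply/map_f; rewrite mem_enum.
  rewrite (bigD1_seq u.2) //= eqxx big1 ?addr0 // => v.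
  by rewrite eq_sym => /negPf->.
have ind (A B : 'rV[int]_r -> 'M[C]_m) :
    (forall t, T t -> \sum_(v <- ws) char_of e v t *: A v = \sum_(v <- ws) char_of e v t *: B v) ->
    {in ws, A =1 B}.
  move=> H v vws; apply/matrixP => i j; apply/eqP; rewrite -subr_eq0; apply/eqP.
  have := @char_functional [seq ((A w i j - B w i j), w) | w <- ws] _ (fun w => (w == v)%:R).
  rewrite big_map (bigD1_seq v) //= eqxx mulr1 big1 ?addr0; last first.
    by move=> w /negPf->; rewrite mulr0.
  apply=> t Tt; rewrite big_map /=.
  have := H t Tt => /matrixP/(_ i j); rewrite !summxE => /eqP; rewrite -subr_eq0 -sumrB => /eqP E.
  by apply: etrans E; apply: eq_bigr => w _; rewrite !mxE mulrBl mulrC (mulrC (B w i j)).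
have rho1 : rho 1%:M = 1%:M.
  have u1 : rho 1%:M \in unitmx := r1 _ T1.
  by apply: (can_inj (mulKmx u1)); rewrite -rM // mulmx1 mulmx1.
have PP s v : T s -> v \in ws -> rho s *m P v = char_of e v s *: P v.
  move=> Ts; apply: (ind (fun v => rho s *m P v) (fun v => char_of e v s *: P v)) => t Tt.
  transitivity (rho (s *m t)).
    by rewrite rM // (rhoE t) // mulmx_sumr; apply: eq_bigr => w _; rewrite -scalemxAr.
  rewrite rhoE; last exact: TM.
  by apply: eq_bigr => w _; rewrite char_ofM // scalerA mulrC.
exists ws, P; split=> //.
- move=> v w vws wws.
  have := ind (fun v => P v *m P w) (fun v => if v == w then P v else 0) _ v vws; apply=> t Tt.
  rewrite [RHS](bigD1_seq w) //= eqxx [X in _ + X]big1 ?addr0; last first.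
    by move=> u /negPf->; rewrite scaler0.
  rewrite -PP // rhoE // mulmx_suml.
  by apply: eq_bigr => u _; rewrite -scalemxAl.
- rewrite -rho1 rhoE //; apply: eq_bigr => v _.
  suff -> : char_of e v 1%:M = 1 by rewrite scale1r.
  apply: (mulIf (char_of_neq0 v T1)); rewrite mul1r -char_ofM // mulmx1 //.
- by move=> v /negPf vws; rewrite /P vws.
Qed.
End TorusCharacters.

(** * Jordan decompositions in algebraic groups *)

Section ExponentialPolynomials.
Variable F : numFieldType.
Implicit Types (p q : {poly F}).

(* With [A sigma p = p' + sigma p] (resp. [sigma p(x+1)]), P stands for the
   function sum_sigma P_sigma(t) e^(sigma t) (resp. sum_sigma P_sigma(t) sigma^t). *)
Lemma exp_poly_indep (s : seq F) (A : F -> {poly F} -> {poly F}) (P : F -> {poly F}) :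
  uniq s ->
  (forall sg a p q, A sg (a *: p + q) = a *: A sg p + A sg q) ->
  (forall sg p, sg \in s -> p != 0 -> (size (A sg p - sg *: p)%R < size p)%N) ->
  (forall sg p, sg \in s -> A sg p = sg *: p -> (size p <= 1)%N) ->
  (forall k, \sum_(sg <- s) (iter k (A sg) (P sg)).[0] = 0) ->
  {in s, forall sg, P sg = 0}.
Proof.
move=> us Alin Asz Acst.
have A0 sg : A sg 0 = 0.
  by have := Alin sg (-1) 0 0; rewrite scaler0 add0r scaleN1r addNr.
have iterlin k sg a p q : iter k (A sg) (a *: p + q) = a *: iter k (A sg) p + iter k (A sg) q.
  by elim: k => //= k ->; rewrite Alin.
have [N] := ubnP (\sum_(sg <- s) size (P sg)).
elim: N P => // N IH P HN HP.
apply: contrapT => nz; have [sg0 s0 P0] : exists2 sg0, sg0 \in s & P sg0 != 0.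
  apply: contrapT => H; apply: nz => sg sgs; apply/eqP/negPn/negP => Psg.
  by apply: H; exists sg.
(* Differentiation (or the shift) minus the scalar sg0 applied to the whole sum: the component at
   sg0 loses degree and no other component gains any, so the total size decreases. *)
pose P' sg := A sg (P sg) - sg0 *: P sg.
have P'E sg : P' sg = (A sg (P sg) - sg *: P sg) + (sg - sg0) *: P sg.
  by rewrite scalerBl addrA subrK.
have szle sg : sg \in s -> (size (P' sg) <= size (P sg))%N.
  move=> sgs; have [E|nE] := eqVneq (P sg) 0; first by rewrite /P' E A0 scaler0 subrr.
  rewrite P'E (leq_trans (size_polyD _ _)) // geq_max (ltnW (Asz _ _ _ _)) //.
  exact: size_scale_leq.
have sz0 : (size (P' sg0) < size (P sg0))%N by exact: Asz.
have {}IH : {in s, forall sg, P' sg = 0}.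
  apply: IH.
    rewrite ltnS in HN; apply: leq_trans HN.
    rewrite (bigD1_seq sg0) //= [X in (_ < X)%N](bigD1_seq sg0) //= -addSn leq_add //.
    rewrite big_seq_cond [X in (_ <= X)%N]big_seq_cond; apply: leq_sum => i /andP[is_ _]; exact: szle.
  move=> k; have := HP k; have := HP k.+1 => E1 E0.
  transitivity (\sum_(sg <- s) ((iter k.+1 (A sg) (P sg)).[0] - sg0 * (iter k (A sg) (P sg)).[0])).
    apply: eq_bigr => sg _; rewrite /P' addrC -scaleNr iterlin -iterSr hornerD hornerZ.
    by rewrite mulNr addrC.
  by rewrite sumrB -mulr_sumr E1 E0 mulr0 subrr.
have other sg : sg \in s -> sg != sg0 -> P sg = 0.
  move=> sgs ne; apply/eqP/negPn/negP => Psg.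
  have := IH sg sgs; rewrite P'E => /eqP; rewrite addr_eq0 => /eqP E.
  have := Asz sg _ sgs Psg; rewrite E -scaleNr size_scale ?ltnn //.
  by rewrite opprB subr_eq0 eq_sym.
have := IH sg0 s0; rewrite /P' => /eqP; rewrite subr_eq0 => /eqP /(Acst _ _ s0) sz1.
have := HP 0; rewrite (bigD1_seq sg0) //= big_seq_cond big1 ?addr0; last first.
  by move=> i /andP[is_ ne]; rewrite other // horner0.
move: P0; rewrite (size1_polyC sz1) hornerC polyC_eq0 => /negP H /eqP; exact: H.
Qed.

Definition Aexp sg p := p^`() + sg *: p.
Definition Ashift sg p := sg *: (p \Po ('X + 1%:P)).

Lemma Aexp_lin sg a p q : Aexp sg (a *: p + q) = a *: Aexp sg p + Aexp sg q.
Proof. by rewrite /Aexp derivD derivZ !scalerDr !scalerA mulrC addrACA. Qed.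
Lemma Aexp_size sg p : p != 0 -> (size (Aexp sg p - sg *: p)%R < size p)%N.
Proof. by rewrite /Aexp addrK; exact: lt_size_deriv. Qed.
Lemma Aexp_const sg p : Aexp sg p = sg *: p -> (size p <= 1)%N.
Proof.
rewrite /Aexp => /eqP; rewrite -subr_eq0 addrK => /eqP dp; apply/leq_sizeP => j j1.
have /polyP/(_ j.-1) := dp; rewrite coef_deriv coef0 prednK //.
by move/eqP; rewrite mulrn_eq0 eqn0Ngt j1 /= => /eqP.
Qed.
Lemma Ashift_lin sg a p q : Ashift sg (a *: p + q) = a *: Ashift sg p + Ashift sg q.
Proof. by rewrite /Ashift comp_polyD comp_polyZ !scalerDr !scalerA mulrC. Qed.
Lemma size_shift_sub p : p != 0 -> (size ((p \Po ('X + 1%:P)) - p)%R < size p)%N.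
Proof.
move=> p0; have s2 : size ('X + 1%:P : {poly F}) = 2 by rewrite size_XaddC.
have sc : size (p \Po ('X + 1%:P)) = size p by rewrite size_comp_poly2.
have p1 : (0 < size p)%N by rewrite lt0n size_poly_eq0.
rewrite -(prednK p1) ltnS; apply/leq_sizeP => j; rewrite leq_eqVlt => /orP[/eqP<-|jp].
  rewrite coefB -lead_coefE -{1}sc -lead_coefE lead_coef_comp ?s2 //.
  by rewrite lead_coefXaddC expr1n mulr1 subrr.
by rewrite coefB !nth_default ?subrr // ?sc -(prednK p1).
Qed.
Lemma Ashift_size sg p : sg != 0 -> p != 0 -> (size (Ashift sg p - sg *: p)%R < size p)%N.
Proof. by move=> sg0 p0; rewrite /Ashift -scalerBr size_scale // size_shift_sub. Qed.
Lemma Ashift_const sg p : sg != 0 -> Ashift sg p = sg *: p -> (size p <= 1)%N.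
Proof.
move=> sg0 /(scalerI sg0) E.
have per k : p.[k%:R] = p.[0].
  by elim: k => // k <-; rewrite -[in RHS]E horner_comp !hornerE -natr1.
have : p - p.[0]%:P = 0.
  apply/eqP/negPn/negP => nz.
  have := @max_poly_roots _ (p - p.[0]%:P) [seq k%:R | k <- iota 0 (size (p - p.[0]%:P))] nz.
  rewrite size_map size_iota ltnn => H.
  have : false by apply: H; [apply/allP => x /mapP[k _ ->]; rewrite /root !hornerE per subrr
    | rewrite map_inj_uniq ?iota_uniq // => i j /eqP; rewrite eqr_nat => /eqP].
  by [].
by move/eqP; rewrite subr_eq0 => /eqP->; exact: size_polyC_leq1.
Qed.
Lemma iter_Ashift k sg p x : (iter k (Ashift sg) p).[x] = sg ^+ k * p.[x + k%:R].
Proof.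
elim: k x => [|k IH] x; first by rewrite expr0 mul1r addr0.
rewrite iterS {1}/Ashift hornerZ horner_comp !hornerE IH exprS -mulrA.
by rewrite -addrA (addrC 1) natr1.
Qed.

(** Exponents v with the same value [sg v] give the same exponential, so a one-parameter family
    cannot separate them: only the sum of their coefficients is determined. *)
Definition fibre_sum N (sg : 'rV[int]_N -> F) (l : seq ({poly F} * 'rV[int]_N)) (c : F) :=
  \sum_(u <- l | sg u.2 == c) u.1.

Lemma fibre_sum_zero N (sg : 'rV[int]_N -> F) l (g : 'rV[int]_N -> F) :
  (forall c, fibre_sum sg l c = 0) -> (forall v w, sg v = sg w -> g v = g w) ->
  \sum_(u <- l) g u.2 *: u.1 = 0.
Proof.
move=> H Hg; pose s := undup [seq sg u.2 | u <- l].
transitivity (\sum_(c <- s) \sum_(u <- l | sg u.2 == c) g u.2 *: u.1).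
  under [RHS]eq_bigr do rewrite big_mkcond.
  rewrite exchange_big /=; apply: eq_big_seq => u ul.
  rewrite (bigD1_seq (sg u.2)) ?undup_uniq //=; last first.
    by rewrite mem_undup; apply/mapP; exists u.
  rewrite eqxx big1 ?addr0 // => c.
  by rewrite eq_sym => /negPf->.
rewrite big_seq big1 // => c; rewrite mem_undup => /mapP[u0 _ ->].
rewrite (eq_bigr (fun u : {poly F} * 'rV[int]_N => g u0.2 *: u.1)); last first.
  by move=> u /eqP /Hg->.
by rewrite -scaler_sumr -/(fibre_sum sg l (sg u0.2)) H scaler0.
Qed.

Lemma fibre_sums_vanish N (sg : 'rV[int]_N -> F) l (A : F -> {poly F} -> {poly F}) :
  (forall sg a p q, A sg (a *: p + q) = a *: A sg p + A sg q) ->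
  (forall v p, p != 0 -> (size (A (sg v) p - sg v *: p)%R < size p)%N) ->
  (forall v p, A (sg v) p = sg v *: p -> (size p <= 1)%N) ->
  (forall k, \sum_(u <- l) (iter k (A (sg u.2)) u.1).[0] = 0) ->
  forall c, fibre_sum sg l c = 0.
Proof.
move=> Alin Asz Acst H c; pose s := undup [seq sg u.2 | u <- l].
have A0 c' : A c' 0 = 0.
  by have := Alin c' (-1) 0 0; rewrite scaler0 add0r scaleN1r addNr.
have iterlin k c' p q : iter k (A c') (p + q) = iter k (A c') p + iter k (A c') q.
  by elim: k => //= k ->; rewrite -[X in A c' (X + _)]scale1r Alin scale1r.
have iter0 k c' : iter k (A c') 0 = 0 by elim: k => //= k ->.
have itersum k c' (r : seq ({poly F} * 'rV[int]_N)) (Q : pred ({poly F} * 'rV[int]_N)) :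
    iter k (A c') (\sum_(u <- r | Q u) u.1) = \sum_(u <- r | Q u) iter k (A c') u.1.
  elim: r => [|u r IH]; first by rewrite !big_nil iter0.
  by rewrite !big_cons; case: (Q u); rewrite ?iterlin IH.
case: (boolP (c \in s)) => cs; last first.
  rewrite /fibre_sum big_seq_cond big1 // => u /andP[ul /eqP E].
  by move: cs; rewrite mem_undup -E map_f.
apply: (@exp_poly_indep s A (fibre_sum sg l) (undup_uniq _) Alin _ _ _ c cs).
- by move=> sg' p; rewrite mem_undup => /mapP[u _ ->]; exact: Asz.
- by move=> sg' p; rewrite mem_undup => /mapP[u _ ->]; exact: Acst.
move=> k; apply: etrans (H k).
transitivity (\sum_(c' <- s) \sum_(u <- l | sg u.2 == c') (iter k (A c') u.1).[0]).
  by apply: eq_bigr => c' _; rewrite /fibre_sum itersum horner_sum.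
under eq_bigr do rewrite big_mkcond.
rewrite exchange_big /=; apply: eq_big_seq => u ul.
rewrite (bigD1_seq (sg u.2)) ?undup_uniq //=; last first.
  by rewrite mem_undup; apply/mapP; exists u.
rewrite eqxx big1 ?addr0 // => c'.
by rewrite eq_sym => /negPf->.
Qed.
End ExponentialPolynomials.

Section Families.
Variable R : realType.
Local Notation C := R[i].
Variables (n N J : nat) (w : nat -> {poly C}) (M : 'I_N -> nat -> 'M[C]_n).

(** With M i j = P_i Y^j, for P_i the spectral projections and Y nilpotent, this contains the formal
    exponential exp (x X) (y_i standing for e^(s_i x), w_j for x^j / j!) and the powers g^x of a
    group element (y_i for s_i^x, w_j for a binomial coefficient). Here y and x become independent
    variables. *)
Definition fam (y : 'I_N -> C) (x : C) : 'M[C]_n :=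
  \sum_i \sum_(j < J) (y i * (w j).[x]) *: M i j.
(* The derivative of [fam] at (y, x) in the direction ((b_i y_i)_i, nu). *)
Definition dfam (b : 'I_N -> C) (nu : C) (y : 'I_N -> C) (x : C) : 'M[C]_n :=
  \sum_i \sum_(j < J) (y i * (b i * (w j).[x] + nu * (w j)^`().[x])) *: M i j.
Definition lin (b : 'I_N -> C) (v : 'rV[int]_N) : C := \sum_i (v 0 i)%:~R * b i.

Definition expands (p : {mpoly C[n * n]}) (l : seq ({poly C} * 'rV[int]_N)) :=
  forall y x, nzv y -> mxeval p (fam y x) = \sum_(u <- l) mon y u.2 * u.1.[x].

Lemma lin_delta b i : lin b (delta_mx 0 i) = b i.
Proof.
rewrite /lin (bigD1 i) //= mxE !eqxx mul1r big1 ?addr0 // => j ji.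
by rewrite mxE (negPf ji) andbF mul0r.
Qed.
Lemma linD b v v' : lin b (v + v') = lin b v + lin b v'.
Proof. by rewrite /lin -big_split; apply: eq_bigr => i _; rewrite mxE intrD mulrDl. Qed.

Lemma fam_expand p : exists2 l, expands p l & forall b nu y x, nzv y ->
  dird p (fam y x) (dfam b nu y x) =
  \sum_(u <- l) mon y u.2 * (lin b u.2 * u.1.[x] + nu * u.1^`().[x]).
Proof.
elim/mpoly_ring_ind: p => [c|k|p q [l Hl1 Hl2] [l' Hl'1 Hl'2]|p q [l Hl1 Hl2] [l' Hl'1 Hl'2]].
- exists [:: (c%:P, 0)] => [y x ny|b nu y x ny]; rewrite big_seq1 /=.
    by rewrite mon0 mul1r hornerC /mxeval mevalC.
  rewrite dirdC derivC horner0 hornerC mulr0 addr0 mon0 mul1r /lin big1 ?mul0r // => i _.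
  by rewrite mxE mul0r.
- case/mxvec_indexP: k => a b'.
  pose l := [seq (\sum_(j < J) M i j a b' *: w j, delta_mx 0 i : 'rV[int]_N) | i <- index_enum 'I_N].
  exists l => [y x ny|b nu y x ny]; rewrite big_map.
    rewrite /mxeval mevalXU mxvecE /fam summxE; apply: eq_bigr => i _.
    rewrite summxE mon_delta horner_sum mulr_sumr; apply: eq_bigr => j _.
    by rewrite mxE hornerZ; ring.
  rewrite dirdX mxvecE /dfam summxE; apply: eq_bigr => i _ /=.
  rewrite summxE mon_delta lin_delta horner_sum raddf_sum /= horner_sum !mulr_sumr.
  rewrite -big_split mulr_sumr; apply: eq_bigr => j _ /=.
  by rewrite mxE !hornerZ derivZ hornerZ; ring.
- exists (l ++ l') => [y x ny|b nu y x ny]; rewrite big_cat /=.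
    by rewrite -Hl1 // -Hl'1 // /mxeval mevalD.
  by rewrite dirdD Hl2 // Hl'2.
exists [seq (u.1 * v.1, u.2 + v.2) | u <- l, v <- l'] => [y x ny|b nu y x ny].
  rewrite /mxeval mevalM -!/(mxeval _ _) Hl1 // Hl'1 // big_allpairs_dep mulr_suml.
  apply: eq_bigr => u _; rewrite mulr_sumr; apply: eq_bigr => v _ /=.
  by rewrite monD // hornerM mulrACA.
rewrite dirdM Hl2 // Hl'2 // Hl1 // Hl'1 // big_allpairs_dep !mulr_suml -big_split.
apply: eq_bigr => u _; rewrite !mulr_sumr -big_split; apply: eq_bigr => v _ /=.
by rewrite monD // linD derivM hornerD !hornerM; ring.
Qed.

Lemma expands_uniq p l l' : expands p l -> expands p l' -> forall g : 'rV[int]_N -> C,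
  \sum_(u <- l) g u.2 *: u.1 = \sum_(u <- l') g u.2 *: u.1.
Proof.
move=> H H' g; apply/eqP; rewrite -subr_eq0; apply/eqP.
set q := (X in X = 0); have qx x : q.[x] = 0.
  have := @laurent_functional _ _ ([seq (u.1.[x], u.2) | u <- l] ++ [seq (- u.1.[x], u.2) | u <- l']) _ g.
  rewrite big_cat !big_map /= => E.
  rewrite /q hornerD hornerN !horner_sum -sumrN.
  transitivity (\sum_(j <- l) j.1.[x] * g j.2 + \sum_(j <- l') - j.1.[x] * g j.2).
    by congr (_ + _); apply: eq_bigr => u _; rewrite hornerZ mulrC // mulNr.
  apply: E => y ny; rewrite big_cat !big_map /=.
  transitivity (\sum_(u <- l) mon y u.2 * u.1.[x] - \sum_(u <- l') mon y u.2 * u.1.[x]).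
    by rewrite -sumrN; congr (_ + _); apply: eq_bigr => u _; rewrite mulrC // mulrN.
  by rewrite -H // -H' // subrr.
apply/eqP/negPn/negP => nz.
have := @max_poly_roots _ q [seq k%:R | k <- iota 0 (size q)] nz.
rewrite size_map size_iota ltnn => E; suff : false by [].
apply: E; first by apply/allP => x _; rewrite /root qx.
by rewrite map_inj_uniq ?iota_uniq // => i j /eqP; rewrite eqr_nat => /eqP.
Qed.

Lemma expands_deriv p l : expands p l -> forall b nu y x, nzv y ->
  dird p (fam y x) (dfam b nu y x) =
  \sum_(u <- l) mon y u.2 * (lin b u.2 * u.1.[x] + nu * u.1^`().[x]).
Proof.
move=> H b nu y x ny; have [l' H' ->] // := fam_expand p.
have E1 := expands_uniq H' H (fun v => mon y v * lin b v).
have E2 := expands_uniq H' H (fun v => mon y v).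
have split_ l0 : \sum_(u <- l0) mon y u.2 * (lin b u.2 * u.1.[x] + nu * u.1^`().[x]) =
   (\sum_(u <- l0) (mon y u.2 * lin b u.2) *: u.1).[x] +
   nu * (\sum_(u <- l0) mon y u.2 *: u.1)^`().[x].
  rewrite horner_sum raddf_sum /= horner_sum mulr_sumr -big_split; apply: eq_bigr => u _ /=.
  by rewrite derivZ !hornerZ; ring.
by rewrite !split_ E1 E2.
Qed.


Section Consequences.
Variables (sg : 'rV[int]_N -> C) (p : {mpoly C[n * n]}) (l : seq ({poly C} * 'rV[int]_N)).
Hypothesis Hl : expands p l.
Hypothesis Hsg : forall c, fibre_sum sg l c = 0.

(** This is what separating y from x achieves: a polynomial known to vanish along the one-parameter
    family vanishes for every x and every y that respects the relations recorded by the fibres of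
    [sg]. *)
Lemma fibre_value y x : nzv y -> (forall v v', sg v = sg v' -> mon y v = mon y v') ->
  mxeval p (fam y x) = 0.
Proof.
move=> ny cy; rewrite Hl //; have := fibre_sum_zero Hsg cy => /(congr1 (fun q => q.[x])).
by rewrite horner0 horner_sum => E; rewrite -[RHS]E; apply: eq_bigr => u _; rewrite hornerZ.
Qed.
Lemma fibre_deriv b nu : (forall v v', sg v = sg v' -> lin b v = lin b v') ->
  dird p (fam (fun=> 1) 0) (dfam b nu (fun=> 1) 0) = 0.
Proof.
move=> cb; have n1 : nzv (fun _ : 'I_N => 1 : C) by move=> i; exact: oner_neq0.
rewrite (expands_deriv Hl) //.
have E1 := fibre_sum_zero Hsg cb.
have E2 := fibre_sum_zero (g := fun=> 1) Hsg (fun _ _ _ => erefl).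
transitivity ((\sum_(u <- l) lin b u.2 *: u.1).[0] + nu * (\sum_(u <- l) (1 : C) *: u.1)^`().[0]).
  rewrite horner_sum raddf_sum /= horner_sum mulr_sumr -big_split; apply: eq_bigr => u _ /=.
  by rewrite mon_one mul1r scale1r hornerZ.
by rewrite E1 E2 deriv0 !horner0 mulr0 addr0.
Qed.
End Consequences.
End Families.

Section JordanDecomposition.
Variable F : numClosedFieldType.

Lemma prod_XsubC_exp_dvd (s : seq F) K (f : {poly F}) : uniq s ->
  (forall z, z \in s -> ('X - z%:P) ^+ K %| f) -> \prod_(z <- s) ('X - z%:P) ^+ K %| f.
Proof.
elim: s => [|z s IH] /=; first by rewrite big_nil dvd1p.
move=> /andP[zs us] H; rewrite big_cons Gauss_dvdp ?H ?inE ?eqxx //=.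
  by apply: IH => // y ys; apply: H; rewrite inE ys orbT.
apply: coprimep_expl; rewrite coprimep_sym coprimep_XsubC rootE.
rewrite horner_prod prodf_seq_neq0; apply/allP => y ys /=.
rewrite horner_exp hornerXsubC expf_neq0 // subr_eq0.
by apply: contraNneq zs => ->.
Qed.

(** The projections are polynomials in X, obtained by Chinese remainders modulo powers of X - z, so
    they commute with whatever commutes with X. *)
Lemma jordan n (X : 'M[F]_n) : exists (N : nat) (s : 'I_N -> F) (P : 'I_N -> 'M[F]_n) (Z : 'M[F]_n),
  [/\ X = \sum_i s i *: P i + Z, \sum_i P i = 1%:M,
      (forall i j, P i *m P j = if i == j then P i else 0),
      (exists d, Z ^+ d = 0) & injective s] /\
  ((forall Y i, Y *m X = X *m Y -> Y *m P i = P i *m Y) /\ forall i, root (char_poly X) (s i)).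
Proof.
case: n X => [|n] X.
  exists 0, (fun=> 0), (fun=> 0), 0; do !split; try by case.
  - by rewrite big_ord0 addr0; apply/matrixP => -[].
  - by apply/matrixP => -[].
  - by exists 1; rewrite expr1.
  - by move=> Y [].
have [rs Hrs] := closed_field_poly_normal (char_poly X).
rewrite (monicP (char_poly_monic X)) scale1r in Hrs.
pose s := undup rs; pose K := n.+1.
have us : uniq s by exact: undup_uniq.
have szrs : size rs = n.+1.
  by have := size_char_poly X; rewrite Hrs size_prod_XsubC => -[].
have D0 f : (forall z, z \in s -> ('X - z%:P) ^+ K %| f) -> horner_mx X f = 0.
  move=> H; have : char_poly X %| f.
    apply: dvdp_trans (prod_XsubC_exp_dvd us H).
    rewrite /s Hrs -prodr_undup_exp_count; elim: (undup rs) => [|z t IH]; first by rewrite !big_nil dvdpp.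
    rewrite !big_cons dvdp_mul // dvdp_exp2l // -/K /K -szrs; exact: count_size.
  by move=> /dvdpP[q ->]; rewrite rmorphM /= Cayley_Hamilton mulr0.
have D1 (f g : {poly F}) : (forall z, z \in s -> ('X - z%:P) ^+ K %| f - g) -> horner_mx X f = horner_mx X g.
  by move=> /D0; rewrite (rmorphB (horner_mx X)) => /eqP; rewrite subr_eq0 => /eqP.
have /choice[q Hq] (z : F) : exists q : {poly F}, ('X - z%:P) ^+ K %| 1 - q /\
    forall y, y \in s -> y != z -> ('X - y%:P) ^+ K %| q.
  (* The polynomial r takes the value 1 at z and is divisible by the other prime powers. Passing to
     1 - (1 - r)^K keeps that divisibility and achieves congruence to 1 modulo (X - z)^K. *)
  pose r : {poly F} := \prod_(y <- s | y != z) (((z - y)^-1 *: ('X - y%:P)) ^+ K).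
  exists (1 - (1 - r) ^+ K); split.
    rewrite subKr; apply: dvdp_exp2r; rewrite -root_factor_theorem rootE !hornerE.
    rewrite /r horner_prod big1 ?subrr // => y yz.
    by rewrite horner_exp hornerZ hornerXsubC mulVf ?expr1n // subr_eq0 eq_sym.
  move=> y ys yz; have ry : ('X - y%:P) ^+ K %| r.
    rewrite /r -big_filter (bigD1_seq y) ?mem_filter ?yz ?filter_uniq //= dvdp_mulr // exprZn dvdpZr ?dvdpp //.
    by rewrite expf_neq0 // invr_eq0 subr_eq0 eq_sym.
  apply: dvdp_trans ry _; rewrite -{1}(expr1n _ K) subrXX subKr.
  exact: dvdp_mulr.
have sz : (0 < K)%N by [].
pose Q z := horner_mx X (q z).
have QQ y z : y \in s -> z \in s -> Q y *m Q z = if y == z then Q y else 0.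
  move=> ys zs; have -> : Q y *m Q z = horner_mx X (q y * q z) by rewrite rmorphM.
  case: eqVneq => [<-|yz].
    apply: D1 => x xs; have -> : q y * q y - q y = - (q y * (1 - q y)) by ring.
    rewrite dvdpNr.
    have [->|xy] := eqVneq x y; first by apply: dvdp_mull; have [] := Hq y.
    by apply: dvdp_mulr; have [_] := Hq y; apply.
  rewrite D0 // => x xs; have [->|xy] := eqVneq x y.
    by apply: dvdp_mull; have [_] := Hq z; apply.
  by apply: dvdp_mulr; have [_] := Hq y; apply.
have sumQ : \sum_(z <- s) Q z = 1%:M.
  have -> : \sum_(z <- s) Q z = horner_mx X (\sum_(z <- s) q z) by rewrite rmorph_sum.
  have -> : 1%:M = horner_mx X 1 by apply/esym; exact: (rmorph1 (horner_mx X)).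
  apply: D1 => x xs; rewrite (bigD1_seq x) //= addrAC dvdp_add //.
    by rewrite -(opprB 1 (q x)) dvdpNr; have [] := Hq x.
  elim/big_ind: _ => [|a b|z zx]; [exact: dvdp0 | exact: dvdp_add |].
  by have [_] := Hq z; apply; rewrite // eq_sym.
pose f := 'X - \sum_(z <- s) z *: q z.
pose Z := horner_mx X f.
have ZK : Z ^+ K = 0.
  have -> : Z ^+ K = horner_mx X (f ^+ K) by rewrite rmorphXn.
  apply: D0 => x xs; apply: dvdp_exp2r.
  have d1 g : ('X - x%:P) ^+ K %| g -> 'X - x%:P %| g.
    by apply: dvdp_trans; rewrite /K exprS dvdp_mulr.
  rewrite /f (bigD1_seq x) //= opprD addrA dvdp_add //; last first.
    rewrite dvdpNr; elim/big_ind: _ => [|a b|z zx]; [exact: dvdp0 | exact: dvdp_add |].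
    by rewrite -mul_polyC; apply: dvdp_mull; apply: d1; have [_] := Hq z; apply; rewrite // eq_sym.
  have -> : 'X - x *: q x = ('X - x%:P) + x *: (1 - q x).
    by rewrite scalerBr alg_polyC addrA subrK.
  by rewrite dvdp_add // -mul_polyC dvdp_mull // d1 //; have [] := Hq x.
exists (size s), (fun i => nth 0 s i), (fun i => Q (nth 0 s i)), Z.
have tosum (E : F -> 'M[F]_n.+1) : \sum_(i < size s) E (nth 0 s i) = \sum_(z <- s) E z.
  by rewrite (big_nth 0) big_mkord.
do !split.
- rewrite (tosum (fun z => z *: Q z)) /Z /f rmorphB /= horner_mx_X rmorph_sum /=.
  by under [X in _ = _ + (_ - X)]eq_bigr do rewrite linearZ; rewrite addrC subrK.
- by rewrite (tosum Q).
- move=> i j; rewrite QQ ?mem_nth // nth_uniq //.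
- by exists K.
- by move=> i j /eqP; rewrite nth_uniq // => /eqP /val_inj.
- by move=> Y i YX; exact: comm_mx_horner.
- move=> i; rewrite Hrs root_prod_XsubC.
  by have := mem_nth 0 (ltn_ord i); rewrite mem_undup.
Qed.

Lemma mxtrace_nilpotent n (Z : 'M[F]_n) d : Z ^+ d = 0 -> \tr Z = 0.
Proof.
case: n Z => [|n] Z Zd; first by rewrite /mxtrace big_ord0.
have [rs Hrs] := closed_field_poly_normal (char_poly Z).
rewrite (monicP (char_poly_monic Z)) scale1r in Hrs.
have r0 x : x \in rs -> x = 0.
  move=> xr; have : root (mxminpoly Z) x by rewrite root_mxminpoly Hrs root_prod_XsubC.
  have /dvdpP[q Hq] : mxminpoly Z %| 'X^d.
    by apply: mxminpoly_min; rewrite rmorphXn /= horner_mx_X.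
  rewrite rootE => /eqP E; have : ('X^d).[x] = 0 :> F by rewrite Hq hornerM E mulr0.
  by rewrite hornerXn => /eqP; rewrite expf_eq0 => /andP[_ /eqP].
have : char_poly Z = 'X^(size rs).
  rewrite Hrs; elim: rs r0 {Hrs} => [|x rs IH] r0; first by rewrite big_nil expr0.
  rewrite big_cons /= exprS IH; last by move=> y yr; apply: r0; rewrite inE yr orbT.
  by rewrite (r0 x) ?inE ?eqxx // subr0.
move=> E; have := char_poly_trace Z (ltn0Sn n).
have sr : size rs = n.+1 by have := size_char_poly Z; rewrite E size_polyXn => -[].
by rewrite E sr coefXn /= eqn_leq ltnn andbF => /eqP; rewrite eq_sym oppr_eq0 => /eqP.
Qed.

Lemma mxtrace_idempotent n (P : 'M[F]_n) : P *m P = P -> \tr P = (\rank P)%:R.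
Proof.
move=> PP; rewrite -{1}(mulmx_base P) mxtrace_mulC.
suff -> : row_base P *m col_base P = 1%:M by rewrite mxtrace1.
have := PP; rewrite -{1 2 3}(mulmx_base P) mulmxA -(mulmxA (col_base P)) => E.
have rf : row_free (row_base P) by exact: row_base_free.
have cf : row_full (col_base P) by exact: col_base_full.
have {}E := row_free_inj rf E.
by apply: (row_full_inj cf); rewrite mulmx1.
Qed.

Lemma nilpotentM n (Z Y : 'M[F]_n) d : Z ^+ d = 0 -> Z *m Y = Y *m Z -> (Z *m Y) ^+ d = 0.
Proof. by move=> Zd ZY; rewrite -[Z *m Y]/(Z * Y) exprMn_comm // Zd mul0r. Qed.

Lemma mxtrace_nilpotentM n (Z Y : 'M[F]_n) d : Z ^+ d = 0 -> Z *m Y = Y *m Z -> \tr (Z *m Y) = 0.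
Proof. by move=> Zd ZY; exact: mxtrace_nilpotent (nilpotentM Zd ZY). Qed.

(** The trace of a power is the sum of the powers of the s i weighted by the ranks of the
    projections. Independence of the distinct characters k -> s i ^+ k kills every nonzero
    eigenvalue. *)
Lemma nilpotent_of_traces n (X : 'M[F]_n) : (forall k, \tr (X ^+ k.+1) = 0) ->
  exists d, X ^+ d = 0.
Proof.
have [N [s [P [Z [[XE P1 PP [d Zd] sinj] [Pc _]]]]]] := jordan X.
move=> H; have XP i : X *m P i = P i *m X by apply: Pc.
have PX i : X *m P i = s i *: P i + Z *m P i.
  rewrite {1}XE mulmxDl mulmx_suml (bigD1 i) //= -scalemxAl PP eqxx big1 ?addr0 // => j ji.
  by rewrite -scalemxAl PP (negPf ji) scaler0.
have ZE : Z = X - \sum_i s i *: P i by rewrite XE addrC addKr.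
have XZ : X *m Z = Z *m X.
  rewrite ZE mulmxBr mulmxBl mulmx_sumr mulmx_suml; congr (_ - _); apply: eq_bigr => i _.
  by rewrite -scalemxAr -scalemxAl XP.
have ZP i : Z *m P i = P i *m Z.
  rewrite ZE mulmxBr mulmxBl XP mulmx_sumr mulmx_suml; congr (_ - _); apply: eq_bigr => j _.
  by rewrite -scalemxAr -scalemxAl !PP eq_sym; case: eqP => [->|].
have tk k i : \tr (X ^+ k *m P i) = s i ^+ k * \tr (P i).
  suff [Y YZ ->] : exists2 Y, Z *m Y = Y *m Z & X ^+ k *m P i = s i ^+ k *: P i + Z *m Y.
    by rewrite mxtraceD mxtraceZ (mxtrace_nilpotentM Zd YZ) addr0.
  elim: k => [|k [Y YZ IH]].
    by exists 0; rewrite ?mulmx0 ?mul0mx // addr0 expr0 scale1r mul1mx.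
  exists (s i ^+ k *: P i + X *m Y).
    rewrite mulmxDr mulmxDl -scalemxAr -scalemxAl ZP; congr (_ + _).
    by rewrite mulmxA -XZ -mulmxA YZ mulmxA.
  rewrite exprS -mulmxE -mulmxA IH mulmxDr -scalemxAr PX scalerDr scalerA -exprSr.
  by rewrite -addrA mulmxDr -scalemxAr mulmxA XZ -mulmxA.
have sum0 k : \sum_(i <- index_enum 'I_N) (s i * \tr (P i)) * s i ^+ k = 0.
  apply: etrans (H k); rewrite -[X ^+ k.+1]mulmx1 -P1 mulmx_sumr raddf_sum /=; apply: eq_bigr => i _.
  by rewrite tk exprS; ring.
have c0 : {in index_enum 'I_N, forall i, s i * \tr (P i) = 0}.
  apply: (@artin_independence F nat addn (fun=> True) 'I_N (fun i k => s i ^+ k)) => //.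
  - by move=> i x y _ _; rewrite exprD.
  - by move=> i; exists 0 => //; rewrite expr0 oner_neq0.
  - exact: index_enum_uniq.
  - by move=> i j _ _ /(_ 1%N I); rewrite !expr1 => /sinj.
have sP i : s i *: P i = 0.
  have := c0 i (mem_index_enum i) => /eqP; rewrite mulf_eq0 => /orP[/eqP->|]; first by rewrite scale0r.
  by rewrite mxtrace_idempotent ?PP ?eqxx // pnatr_eq0 mxrank_eq0 => /eqP->; rewrite scaler0.
by exists d; rewrite XE big1 ?add0r // => i _; exact: sP.
Qed.
End JordanDecomposition.

Lemma exists_minimal (P : nat -> Prop) k : P k -> exists2 d, P d & forall j, (j < d)%N -> ~ P j.
Proof.
move=> Pk; have ex : exists k, `[< P k >] by exists k; apply/asboolP.
case: (ex_minnP ex) => d /asboolP Pd min; exists d => // j jd /asboolP /min.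
by rewrite leqNgt jd.
Qed.

(** * Integral relations between eigenvalues *)

Section Lattices.
Variable R : realType.
Local Notation C := R[i].

Lemma lin_sum N d (s : 'I_N -> C) (gam : 'I_d -> C) (a : 'I_N -> 'rV[int]_d) v :
  (forall i, s i = lin gam (a i)) -> lin s v = lin gam (\sum_i v 0 i *: a i).
Proof.
move=> E; rewrite /lin; under eq_bigr do rewrite E /lin mulr_sumr.
rewrite exchange_big; apply: eq_bigr => k _; rewrite summxE raddf_sum /= mulr_suml.
by apply: eq_bigr => i _; rewrite mxE intrM mulrA.
Qed.

Lemma additive_lattice N (s : 'I_N -> C) :
  exists d (gam : 'I_d -> C) (a : 'I_N -> 'rV[int]_d),
    (forall i, s i = lin gam (a i)) /\ (forall c, lin gam c = 0 -> c = 0).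
Proof.
pose P d := exists (gam : 'I_d -> C) (a : 'I_N -> 'rV[int]_d), forall i, s i = lin gam (a i).
have PN : P N by exists s, (fun i => delta_mx 0 i) => i; rewrite lin_delta.
have [d [gam [a Ha]] dmin] := exists_minimal PN.
exists d, gam, a; split=> // c Hc; apply/rowP => k0; rewrite [RHS]mxE.
apply/eqP/negPn/negP => ck0.
case: d gam a Ha dmin c Hc k0 ck0 => [|d] gam a Ha dmin c Hc k0 ck0; first by case: k0 ck0.
have ck : (c 0 k0)%:~R != 0 :> C by rewrite intr_eq0.
apply: (dmin d (ltnSn d)).
exists (fun k => gam (lift k0 k) / (c 0 k0)%:~R),
  (fun i => \row_k (c 0 k0 * a i 0 (lift k0 k) - c 0 (lift k0 k) * a i 0 k0)) => i.
have big_lift (f : 'I_d.+1 -> C) : \sum_k f k = f k0 + \sum_(k < d) f (lift k0 k).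
  by rewrite (bigD1_ord k0).
apply: (mulfI ck); rewrite Ha /lin [in LHS]big_lift mulrDr mulrCA.
have : (c 0 k0)%:~R * gam k0 = - \sum_(k < d) (c 0 (lift k0 k))%:~R * gam (lift k0 k).
  by move: Hc; rewrite /lin big_lift => /eqP; rewrite addr_eq0 => /eqP.
move=> ->; rewrite mulrN !mulr_sumr addrC -sumrB; apply: eq_bigr => k _.
by rewrite mxE intrB !intrM; field.
Qed.

(** As in the additive case, except that dividing a generator by c is replaced by raising the z i to
    the power c. The exponent m accumulates these powers and absorbs the roots of unity among the
    relations. *)
Lemma multiplicative_lattice N (z : 'I_N -> C) : nzv z ->
  exists d (tau : 'I_d -> C) (a : 'I_N -> 'rV[int]_d) (m : nat),
    [/\ (0 < m)%N, nzv tau, forall i, z i ^+ m = mon tau (a i) &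
        forall c, mon tau c = 1 -> c = 0].
Proof.
move=> nz.
pose P d := exists (tau : 'I_d -> C) (a : 'I_N -> 'rV[int]_d) (m : nat),
    [/\ (0 < m)%N, nzv tau & forall i, z i ^+ m = mon tau (a i)].
have PN : P N.
  by exists z, (fun i => delta_mx 0 i), 1%N; split=> // i; rewrite mon_delta expr1.
have [d [tau [a [m [m0 nt Ha]]]] dmin] := exists_minimal PN.
exists d, tau, a, m; split=> // c Hc; apply/rowP => k0; rewrite [RHS]mxE.
apply/eqP/negPn/negP => ck0.
case: d tau a nt Ha dmin c Hc k0 ck0 => [|d] tau a nt Ha dmin c Hc k0 ck0; first by case: k0 ck0.
apply: (dmin d (ltnSn d)).
wlog cpos : c Hc ck0 / 0 < c 0 k0.
  move=> H; have [c0|c0] := ltP 0 (c 0 k0); first exact: (H c).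
  apply: (H (- c)); rewrite ?mxE ?oppr_eq0 ?oppr_gt0 ?lt_neqAle ?ck0 //.
  by rewrite monN // Hc invr1.
have [q cq] : exists q : nat, c 0 k0 = q%:Z by exists (absz (c 0 k0)); rewrite gez0_abs // ltW.
have q0 : (0 < q)%N by rewrite -ltz_nat -cq.
have big_lift (f : 'I_d.+1 -> C) : \prod_k f k = f k0 * \prod_(k < d) f (lift k0 k).
  by rewrite (bigD1_ord k0).
exists (fun k => tau (lift k0 k)),
  (fun i => \row_k (q%:Z * a i 0 (lift k0 k) - c 0 (lift k0 k) * a i 0 k0)), (m * q)%N.
split; [by rewrite muln_gt0 m0 | by move=> k; exact: nt |] => i.
rewrite exprM Ha /mon !big_lift exprMn.
have E : tau k0 ^ q%:Z = (\prod_(k < d) tau (lift k0 k) ^ (c 0 (lift k0 k)))^-1.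
  have pn0 : \prod_(k < d) tau (lift k0 k) ^ (c 0 (lift k0 k)) != 0.
    by apply/prodf_neq0 => k _; rewrite expfz_neq0 //; apply: nt.
  by apply: (mulIf pn0); rewrite mulVf // -cq -[RHS]Hc /mon big_lift.
have -> : (tau k0 ^ a i 0 k0) ^+ q = (tau k0 ^ q%:Z) ^ (a i 0 k0).
  by rewrite exprnP !exprz_exp mulrC.
rewrite E -prodfV; elim/big_rec3: _ => [|k y1 y2 y3 _ H].
  by rewrite exp1rz expr1n mulr1.
rewrite expfzMl exprMn mulrACA H mxE; congr (_ * _).
rewrite invr_expz exprnP !exprz_exp -expfzDr //; congr (_ ^ _); ring.
Qed.
End Lattices.

Lemma unit_add1_nilpotent (F : fieldType) n (Z : 'M[F]_n) d : Z ^+ d = 0 -> 1%:M + Z \in unitmx.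
Proof.
move=> Zd; have := subrXX_comm d (commr_sym (commr1 (- Z))).
rewrite exprNn Zd mulr0 expr1n subr0 opprK => E.
by have [] := mulmx1_unit (esym E).
Qed.

Lemma sum_ord_trunc (V : nmodType) (F : nat -> V) a b : (a <= b)%N ->
  (forall i, (a <= i)%N -> F i = 0) -> \sum_(i < b) F i = \sum_(i < a) F i.
Proof.
move=> ab H; rewrite -!(big_mkord xpredT F) (big_cat_nat _ ab) //=.
by rewrite [X in _ + X]big_nat_cond [X in _ + X]big1 ?addr0 // => i /andP[/andP[ai _] _]; exact: H.
Qed.

(** * Families of matrices contained in a closed group or its Lie algebra *)

Section ClosedFamilies.
Variable R : realType.
Local Notation C := R[i].

Definition vanish n (G : set 'M[C]_n) p := forall g, G g -> mxeval p g = 0.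

Lemma closed_mem n (G : set 'M[C]_n) A : zariski_closed G -> A \in unitmx ->
  (forall p, vanish G p -> mxeval p A = 0) -> G A.
Proof.
move=> [S GE] uA H; rewrite GE; split=> // p Sp; apply: H => g.
by rewrite GE => -[_]; apply.
Qed.

(** The coefficients of Y^j in exp (x Y) and in (1 + Y)^x, as polynomials in x. *)
Definition wexp j : {poly C} := (j`!%:R)^-1 *: 'X^j.
Definition wbin j : {poly C} := (j`!%:R)^-1 *: \prod_(l < j) ('X - l%:R%:P).

Lemma fact_neq0 j : j`!%:R != 0 :> C.
Proof. by rewrite pnatr_eq0 -lt0n fact_gt0. Qed.
Lemma wexp0 : wexp 0 = 1. Proof. by rewrite /wexp invr1 scale1r expr0. Qed.
Lemma wbin0 : wbin 0 = 1. Proof. by rewrite /wbin invr1 scale1r big_ord0. Qed.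
Lemma wexp_at0 j : (wexp j.+1).[0] = 0.
Proof. by rewrite /wexp hornerZ hornerXn expr0n mulr0. Qed.
Lemma wbin_nat j k : (wbin j).[k%:R] = 'C(k, j)%:R.
Proof.
have E : (\prod_(l < j) ('X - l%:R%:P)).[k%:R] = (k ^_ j)%:R :> C.
  elim: j => [|j IH]; first by rewrite big_ord0 hornerC.
  rewrite big_ord_recr hornerM IH hornerXsubC ffactnSr natrM /=.
  have [jk|kj] := leqP j k; first by rewrite natrB.
  by rewrite ffact_small // !mul0r.
by rewrite /wbin hornerZ E -bin_ffact natrM mulrC mulfK ?fact_neq0.
Qed.
Lemma wbin_at0 j : (wbin j.+1).[0] = 0.
Proof. by have := wbin_nat j.+1 0; rewrite bin0n. Qed.
Lemma deriv_wexp j : (wexp j.+1)^`() = wexp j.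
Proof.
have j0 := fact_neq0 j; have j1 : j.+1%:R != 0 :> C by rewrite pnatr_eq0.
by rewrite /wexp derivZ derivXn /= -[_ *+ j.+1]scaler_nat scalerA factS natrM invfM mulrAC mulVf ?mul1r.
Qed.

Section Fam.
Variables (n N J : nat) (P : 'I_N -> 'M[C]_n) (Y : 'M[C]_n).
Hypothesis P1 : \sum_i P i = 1%:M.
Hypothesis PP : forall i j, P i *m P j = if i == j then P i else 0.
Hypothesis YP : forall i, Y *m P i = P i *m Y.
Hypothesis YJ : Y ^+ J.+1 = 0.
Let M i j := P i *m Y ^+ j.

Lemma dsum_mul (y : 'I_N -> C) i : (\sum_k y k *: P k) *m P i = y i *: P i.
Proof.
rewrite mulmx_suml (bigD1 i) //= -scalemxAl PP eqxx big1 ?addr0 // => j ji.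
by rewrite -scalemxAl PP (negPf ji) scaler0.
Qed.
Lemma dsumM (y y' : 'I_N -> C) :
  (\sum_k y k *: P k) *m (\sum_k y' k *: P k) = \sum_k (y k * y' k) *: P k.
Proof.
rewrite mulmx_sumr; apply: eq_bigr => i _; rewrite -scalemxAr dsum_mul scalerA.
by rewrite mulrC.
Qed.
Lemma dsum1 : \sum_k (1 : C) *: P k = 1%:M.
Proof. by rewrite -P1; apply: eq_bigr => k _; rewrite scale1r. Qed.
Lemma dsum_unit y : nzv y -> \sum_k y k *: P k \in unitmx.
Proof.
move=> ny; suff /mulmx1_unit[] : (\sum_k y k *: P k) *m (\sum_k (y k)^-1 *: P k) = 1%:M by [].
by rewrite dsumM -dsum1; apply: eq_bigr => k _; rewrite mulfV.
Qed.
Lemma dsum_comm y : Y *m (\sum_k y k *: P k) = (\sum_k y k *: P k) *m Y.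
Proof.
by rewrite mulmx_sumr mulmx_suml; apply: eq_bigr => k _; rewrite -scalemxAr -scalemxAl YP.
Qed.
Lemma famE w y x : fam J.+1 w M y x = (\sum_k y k *: P k) *m (\sum_(j < J.+1) (w j).[x] *: Y ^+ j).
Proof.
rewrite mulmx_suml; apply: eq_bigr => i _; rewrite mulmx_sumr; apply: eq_bigr => j _.
by rewrite -scalemxAl -scalemxAr scalerA.
Qed.
Lemma fam_unit w y x : w 0 = 1 -> nzv y -> fam J.+1 w M y x \in unitmx.
Proof.
move=> w0 ny; rewrite famE unitmx_mul dsum_unit //= big_ord_recl w0 hornerC scale1r expr0.
have -> : \sum_(i < J) (w (lift ord0 i)).[x] *: Y ^+ lift ord0 i =
    Y *m (\sum_(i < J) (w i.+1).[x] *: Y ^+ i).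
  by rewrite mulmx_sumr; apply: eq_bigr => i _; rewrite -scalemxAr lift0 exprS.
apply: (@unit_add1_nilpotent _ _ _ J.+1); apply: nilpotentM => //.
rewrite mulmx_sumr mulmx_suml; apply: eq_bigr => i _.
by rewrite -scalemxAr -scalemxAl mulmxE -exprS -exprSr.
Qed.
Lemma fam_at0 w y : w 0 = 1 -> (forall j, (w j.+1).[0] = 0) -> fam J.+1 w M y 0 = \sum_k y k *: P k.
Proof.
move=> w0 wS; rewrite famE big_ord_recl w0 hornerC scale1r expr0 [X in 1 + X]big1 ?addr0 ?mulmx1 // => j _.
by rewrite lift0 wS scale0r.
Qed.
Lemma fam_one w x : fam J.+1 w M (fun=> 1) x = \sum_(j < J.+1) (w j).[x] *: Y ^+ j.
Proof. by rewrite famE dsum1 mul1mx. Qed.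
Lemma dfam_at0 w b nu : w 0 = 1 -> (forall j, (w j.+1).[0] = 0) ->
  dfam J.+1 w M b nu (fun=> 1) 0 =
  \sum_k b k *: P k + nu *: \sum_(j < J.+1) (w j)^`().[0] *: Y ^+ j.
Proof.
move=> w0 wS; rewrite /dfam.
transitivity (\sum_i (b i *: P i + nu *: (P i *m \sum_(j < J.+1) (w j)^`().[0] *: Y ^+ j))).
  apply: eq_bigr => i _; rewrite mulmx_sumr scaler_sumr.
  rewrite big_ord_recl [in RHS]big_ord_recl addrA; congr (_ + _).
    by rewrite w0 hornerC -scalemxAr scalerA mul1r mulr1 scalerDl /M expr0 mulmx1.
  by apply: eq_bigr => j _; rewrite lift0 wS -scalemxAr scalerA mul1r mulr0 add0r.
by rewrite big_split /= -scaler_sumr -mulmx_suml P1 mul1mx.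
Qed.

Section LieFamilies.
Variables (G : set 'M[C]_n) (s : 'I_N -> C).
Hypothesis cG : closed_subgroup G.
Hypothesis LX : Lie G (\sum_i s i *: P i + Y).
Let X := \sum_i s i *: P i + Y.
Let sG : subgroup_GL G. Proof. by case: cG. Qed.

(** The differential equation F' = X F of the exponential: multiplication by X is the derivative in
    the direction where each y_i grows at rate s i and x at rate 1. *)
Lemma exp_fam_deriv y x : X *m fam J.+1 wexp M y x = dfam J.+1 wexp M s 1 y x.
Proof.
rewrite /fam /dfam mulmx_sumr; apply: eq_bigr => i _.
have E j : X *m M i j = s i *: M i j + M i j.+1.
  by rewrite /X /M mulmxDl !mulmxA dsum_mul -scalemxAl YP exprS -mulmxE mulmxA.
have MJ : M i J.+1 = 0 by rewrite /M YJ mulmx0.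
rewrite mulmx_sumr.
transitivity (\sum_(j < J.+1) (y i * (s i * (wexp j).[x])) *: M i j +
  \sum_(j < J.+1) (y i * (wexp j).[x]) *: M i j.+1).
  rewrite -big_split; apply: eq_bigr => j _ /=; rewrite -scalemxAr E scalerDr scalerA.
  by congr (_ *: _ + _); ring.
transitivity (\sum_(j < J.+1) (y i * (s i * (wexp j).[x])) *: M i j +
  \sum_(j < J.+1) (y i * (wexp j)^`().[x]) *: M i j).
  congr (_ + _); rewrite big_ord_recr /= MJ scaler0 addr0 [in RHS]big_ord_recl wexp0 -polyC1 derivC.
  rewrite horner0 mulr0 scale0r add0r; apply: eq_bigr => j _.
  by rewrite lift0 deriv_wexp.
by rewrite -big_split; apply: eq_bigr => j _ /=; rewrite -scalerDl; congr (_ *: _); ring.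
Qed.

(** If q vanishes on G, so does its derivative along the right invariant field of X. Iterating k
    times and evaluating at 1 gives the k-th Taylor coefficient of p along the formal exponential,
    and all of these vanish. *)
Lemma lie_fibres p : vanish G p -> exists2 l, expands J.+1 wexp M p l &
  forall c, fibre_sum (lin s) l c = 0.
Proof.
move=> Vp; have [l Hl _] := fam_expand J.+1 wexp M p; exists l => //.
have n1 : nzv (fun _ : 'I_N => 1 : C) by move=> i; exact: oner_neq0.
have step k : exists2 q, vanish G q &
    expands J.+1 wexp M q [seq (iter k (Aexp (lin s u.2)) u.1, u.2) | u <- l].
  elim: k => [|k [q Vq Hq]].
    by exists p => // y x ny; rewrite Hl // big_map.
  have [q' [Hq' _]] := pfun_dird_right q X; exists q' => [g Gg|y x ny].
    by rewrite Hq'; exact: (lie_right sG).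
  rewrite Hq' exp_fam_deriv (expands_deriv Hq) // !big_map; apply: eq_bigr => u _ /=.
  by rewrite /Aexp hornerD hornerZ mul1r addrC.
apply: (fibre_sums_vanish (A := @Aexp C)).
- exact: Aexp_lin.
- by move=> v q; exact: Aexp_size.
- by move=> v q; exact: Aexp_const.
move=> k; have [q Vq /(_ (fun=> 1) 0 n1)] := step k.
rewrite fam_at0 ?wexp0 //; last exact: wexp_at0.
rewrite dsum1 Vq; last by case: sG.
by move=> /esym E; apply: etrans E; rewrite big_map; apply: eq_bigr => u _; rewrite mon_one mul1r.
Qed.

Lemma lie_fam_mem y x : nzv y -> (forall v v', lin s v = lin s v' -> mon y v = mon y v') ->
  G (fam J.+1 wexp M y x).
Proof.
move=> ny cy; apply: closed_mem; first by case: cG.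
  by apply: fam_unit => //; exact: wexp0.
by move=> p /lie_fibres[l Hl H0]; exact: (fibre_value Hl H0).
Qed.
(** Chevalley's replicas: the Lie algebra contains every semisimple element with the eigenspaces of
    X whose eigenvalues satisfy the integral relations between those of X. *)
Lemma lie_replica b : (forall v v', lin s v = lin s v' -> lin b v = lin b v') ->
  Lie G (\sum_i b i *: P i).
Proof.
move=> cb p /lie_fibres[l Hl H0]; have := fibre_deriv Hl H0 0 cb.
rewrite fam_at0 ?wexp0 ?dfam_at0 ?wexp0 //; try exact: wexp_at0.
by rewrite dsum1 scale0r addr0.
Qed.
End LieFamilies.

Section GroupFamilies.
Variables (G : set 'M[C]_n) (sg : 'I_N -> C).
Hypothesis cG : closed_subgroup G.
Hypothesis nsg : nzv sg.
Let g := (\sum_i sg i *: P i) *m (1%:M + Y).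
Hypothesis Gg : G g.
Let sG : subgroup_GL G. Proof. by case: cG. Qed.

Lemma bin_pow k : (1%:M + Y) ^+ k = \sum_(j < J.+1) (wbin j).[k%:R] *: Y ^+ j.
Proof.
pose f j := 'C(k, j)%:R *: Y ^+ j : 'M[C]_n.
transitivity (\sum_(j < k.+1) f j).
  by rewrite addrC exprD1n; apply: eq_bigr => j _; rewrite /f scaler_nat.
transitivity (\sum_(j < (J + k).+1) f j).
  apply/esym/sum_ord_trunc => [|i ki]; first by rewrite ltnS leq_addl.
  by rewrite /f bin_small ?scale0r.
transitivity (\sum_(j < J.+1) f j); last by apply: eq_bigr => j _; rewrite wbin_nat.
apply: sum_ord_trunc => [|i Ji]; first by rewrite ltnS leq_addr.
by rewrite /f -(subnK Ji) exprD YJ mulr0 scaler0.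
Qed.

Lemma bin_fam_pow k : fam J.+1 wbin M (fun i => sg i ^+ k) k%:R = g ^+ k.
Proof.
rewrite famE -[g]/((\sum_i sg i *: P i) * (1%:M + Y)) exprMn_comm; last first.
  by rewrite /GRing.comm -!mulmxE mulmxDl mulmxDr mul1mx mulmx1 dsum_comm.
rewrite -mulmxE bin_pow; congr (_ *m _).
elim: k => [|k IH]; first by rewrite expr0 -[RHS]dsum1; apply: eq_bigr => i _; rewrite expr0.
by rewrite exprS -IH -mulmxE dsumM; apply: eq_bigr => i _; rewrite exprS.
Qed.

Lemma group_pow k : G (g ^+ k).
Proof.
have [_ G1 GM _] := sG.
by elim: k => [|k IH]; [rewrite expr0 | rewrite exprS; exact: GM].
Qed.

Lemma grp_fibres p : vanish G p -> exists2 l, expands J.+1 wbin M p l &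
  forall c, fibre_sum (mon sg) l c = 0.
Proof.
move=> Vp; have [l Hl _] := fam_expand J.+1 wbin M p; exists l => //.
apply: (fibre_sums_vanish (A := @Ashift C)).
- exact: Ashift_lin.
- by move=> v q; apply: Ashift_size; exact: mon_neq0.
- by move=> v q; apply: Ashift_const; exact: mon_neq0.
move=> k; have := Vp _ (group_pow k); rewrite -bin_fam_pow Hl; last first.
  by move=> i; rewrite expf_neq0.
move=> E; apply: etrans E; apply: eq_bigr => u _; rewrite iter_Ashift add0r; congr (_ * _).
by rewrite /mon -prodrXl; apply: eq_bigr => i _; rewrite exprnP exprz_exp mulrC -exprz_exp.
Qed.

Lemma grp_fam_mem y x : nzv y -> (forall v v', mon sg v = mon sg v' -> mon y v = mon y v') ->
  G (fam J.+1 wbin M y x).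
Proof.
move=> ny cy; apply: closed_mem; first by case: cG.
  by apply: fam_unit => //; exact: wbin0.
by move=> p /grp_fibres[l Hl H0]; exact: (fibre_value Hl H0).
Qed.
(** The sum is the derivative at x = 0 of (1 + Y)^x, that is the logarithm of 1 + Y. *)
Lemma grp_log : Lie G (\sum_(j < J.+1) (wbin j)^`().[0] *: Y ^+ j).
Proof.
move=> p /grp_fibres[l Hl H0].
have l0 v : lin (fun _ : 'I_N => 0 : C) v = 0 by rewrite /lin big1 // => i _; rewrite mulr0.
have := fibre_deriv (b := fun=> 0) Hl H0 1 (fun v v' _ => etrans (l0 v) (esym (l0 v'))).
rewrite fam_at0 ?wbin0 ?dfam_at0 ?wbin0 //; try exact: wbin_at0.
rewrite dsum1 scale1r [X in dird p _ (X + _)]big1 ?add0r; last by move=> i _; rewrite scale0r.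
by [].
Qed.
End GroupFamilies.
End Fam.
End ClosedFamilies.

Lemma dim_add_line (K : fieldType) (V : vectType K) (U : {vspace V}) x : x \notin U ->
  \dim (U + <[x]>) = (\dim U).+1.
Proof.
move=> xU; have x0 : x != 0 by apply: contraNneq xU => ->; exact: mem0v.
rewrite dimv_disjoint_sum ?dim_vline ?x0 ?addn1 //; apply/eqP.
rewrite -subv0; apply/subvP => y; rewrite memv_cap memv0 => /andP[yU /vlineP[k yk]].
rewrite yk in yU *; case: (eqVneq k 0) => [->|k0]; first by rewrite scale0r.
by move: xU; rewrite -[x](scalerK k0) memvZ ?yU.
Qed.

Lemma vspace_of_set (K : fieldType) (V : vectType K) (S : V -> Prop) :
  S 0 -> (forall a x y, S x -> S y -> S (a *: x + y)) ->
  exists U : {vspace V}, forall x, x \in U <-> S x.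
Proof.
move=> S0 Sl; pose good d := exists2 U : {vspace V}, (forall x, x \in U -> S x) & \dim U = d.
suff H m (U : {vspace V}) : (forall x, x \in U -> S x) -> (\dim {:V} - \dim U <= m)%N ->
    exists U : {vspace V}, forall x, x \in U <-> S x.
  by apply: (H (\dim {:V}) 0%VS) => [x|]; [rewrite memv0 => /eqP-> | exact: leq_subr].
elim: m U => [|m IH] U US dU.
  exists U => x; split=> [/US //|_]; suff -> : U = fullv by exact: memvf.
  by apply/eqP; rewrite eqEdim subvf /= -subn_eq0 -leqn0.
case: (pselect (exists2 x, S x & x \notin U)) => [[x Sx xU]|H]; last first.
  exists U => x; split=> [/US //|Sx]; apply/negPn/negP => xU; apply: H; by exists x.
apply: (IH (U + <[x]>)%VS).
  move=> y /memv_addP[u uU [v /vlineP[k ->] ->]]; rewrite addrC; exact: Sl (US _ uU).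
rewrite dim_add_line //.
by rewrite subnS -subn1 leq_subLR add1n.
Qed.

(** * Nondegeneracy of the trace form *)

Section Engel.
Variables (F : fieldType) (n : nat).
Implicit Types (A B C x y : 'M[F]_n) (K L : {vspace 'M[F]_n}).
Local Notation br x y := (x *m y - y *m x).

Definition wd (s : seq 'M[F]_n) := foldr mulmx 1%:M s.
Lemma wd_cat s t : wd (s ++ t) = wd s *m wd t.
Proof. by elim: s => [|x s IH] /=; rewrite ?mul1mx // IH mulmxA. Qed.
Lemma wd_rcons s x : wd (rcons s x) = wd s *m x.
Proof. by rewrite -cats1 wd_cat /= mulmx1. Qed.

(* lk, rk: A is killed on the left (right) by all words of length j in K. *)
Definition lk K j A := forall s, size s = j -> {subset s <= K} -> wd s *m A = 0.
Definition rk K j A := forall s, size s = j -> {subset s <= K} -> A *m wd s = 0.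

Lemma lk0 K A : lk K 0 A <-> A = 0.
Proof.
split=> [/(_ [::] erefl (fun _ h => False_ind _ (notF h))) | -> s _ _]; last exact: mulmx0.
by rewrite mul1mx.
Qed.
Lemma rk0 K A : rk K 0 A -> A = 0.
Proof. by move=> /(_ [::] erefl (fun _ h => False_ind _ (notF h))); rewrite mulmx1. Qed.
Lemma lkS K j A : lk K j.+1 A <-> forall x, x \in K -> lk K j (x *m A).
Proof.
split=> [H x xK s ss sK|H s].
  rewrite mulmxA -wd_rcons; apply: H; first by rewrite size_rcons ss.
  by move=> y; rewrite mem_rcons inE => /orP[/eqP->|/sK].
case/lastP: s => // s x; rewrite size_rcons => -[ss] sK; rewrite wd_rcons -mulmxA.
apply: H => // [|y ys]; first by apply: sK; rewrite mem_rcons inE eqxx.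
by apply: sK; rewrite mem_rcons inE ys orbT.
Qed.
Lemma rkS K j A : rk K j.+1 A -> forall x, x \in K -> rk K j (A *m x).
Proof.
move=> H x xK s ss sK; rewrite -mulmxA; apply: (H (x :: s)); first by rewrite /= ss.
by move=> y; rewrite inE => /orP[/eqP->|/sK].
Qed.
Lemma lk_lin K j a A B : lk K j A -> lk K j B -> lk K j (a *: A + B).
Proof. by move=> HA HB s ss sK; rewrite mulmxDr -scalemxAr HA // HB // scaler0 addr0. Qed.
Lemma lk_mono K j A : lk K j A -> lk K j.+1 A.
Proof.
move=> H [|x s] //= [ss] sK; rewrite -mulmxA H ?mulmx0 // => y ys.
by apply: sK; rewrite inE ys orbT.
Qed.

Fixpoint nil2 K m B := if m is m'.+1 then
  forall x, x \in K -> nil2 K m' (x *m B) /\ nil2 K m' (B *m x) else B = 0.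
Lemma nil2_0 K m : nil2 K m 0.
Proof. by elim: m => //= m IH x _; rewrite mulmx0 mul0mx. Qed.
Lemma nil2B K m B C : nil2 K m B -> nil2 K m C -> nil2 K m (B - C).
Proof.
elim: m B C => [|m IH] B C /=; first by move=> -> ->; rewrite subrr.
move=> HB HC x xK; have [B1 B2] := HB x xK; have [C1 C2] := HC x xK.
by rewrite mulmxBr mulmxBl; split; apply: IH.
Qed.
(** Of i + j one-sided multiplications, at least i fall on the left or at least j on the right. *)
Lemma nil2_word K m i j A B C : (i + j = m)%N -> lk K i A -> rk K j C -> nil2 K m (A *m B *m C).
Proof.
elim: m i j A C => [|m IH] [|i] [|j] A C // E HA HC;
  try (move/lk0: HA => ->; rewrite !mul0mx; exact: nil2_0);
  try (move/rk0: HC => ->; rewrite mulmx0; exact: nil2_0).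
move=> x xK; split.
  rewrite 2!mulmxA; apply: (IH i j.+1) => //; last by move/lkS: HA; apply.
  by move: E; rewrite addSn => -[].
rewrite -2!mulmxA mulmxA; apply: (IH i.+1 j) => //; last exact: (rkS HC).
by move: E; rewrite addnS => -[].
Qed.

(** Engel's theorem in the form that long words vanish. A subalgebra K for which this is known is
    enlarged by one element y of L that normalizes it, until it is L. *)
Lemma engel L : {in L &, forall x y, br x y \in L} -> {in L, forall x, exists d, x ^+ d = 0} ->
  exists N, forall s, size s = N -> {subset s <= L} -> wd s = 0.
Proof.
move=> Lbr Lnil.
suff H m K : (K <= L)%VS -> {in K &, forall x y, br x y \in K} -> (exists N, lk K N 1%:M) ->
    (\dim L - \dim K <= m)%N -> exists N, lk L N 1%:M.
  have [|x y|||N HN] := H (\dim L) 0%VS.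
  - exact: sub0v.
  - by rewrite !memv0 => /eqP-> /eqP->; rewrite !mul0mx subrr.
  - exists 1 => -[|x []] //= _ s0; rewrite mulmx1 mulmx1; apply/eqP; rewrite -memv0.
    by apply: s0; rewrite inE.
  - exact: leq_subr.
  by exists N => s ss sL; rewrite -[LHS]mulmx1 HN.
elim: m K => [|m IH] K KL Kbr [N HN] dK.
  exists N; suff -> : L = K by [].
  by apply/eqP; rewrite eq_sym eqEdim KL /= -subn_eq0 -leqn0.
case: (pselect (exists2 y, y \in L & y \notin K)) => [[y0 y0L y0K]|nex]; last first.
  exists N; suff -> : L = K by [].
  apply/eqP; rewrite eqEsubv KL andbT; apply/subvP => y yL.
  by apply/negPn/negP => yK; apply: nex; exists y.
have KinL x : x \in K -> x \in L by apply/subvP.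
(* Multiplications by K on either side are nilpotent. Among the elements of L outside K, take y
   killed by the fewest of them; its brackets with K are killed by fewer still, so they lie in K. *)
have [y [yL yK ybr]] : exists y, [/\ y \in L, y \notin K & {in K, forall x, br x y \in K}].
  pose P i := exists y, [/\ y \in L, y \notin K & nil2 K i y].
  have PN : P (N + N)%N.
    exists y0; split=> //; rewrite -[y0]mulmx1 -[y0]mul1mx; apply: nil2_word erefl (HN) _.
    by move=> s ss sK; rewrite mul1mx -[LHS]mulmx1 HN.
  have [[|i] [y [yL yK Hy]] imin] := exists_minimal PN.
    by move: yK; rewrite Hy mem0v.
  exists y; split=> // x xK; apply/negPn/negP => bK; apply: (imin i (ltnSn i)).
  exists (br x y); split=> //; first by apply: Lbr => //; exact: KinL.
  by have [H1 H2] := Hy x xK; exact: nil2B.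
have [d yd] := Lnil y yL.
pose K' := (K + <[y]>)%VS.
have K'P x : x \in K' -> exists a c, a \in K /\ x = a + c *: y.
  by move=> /memv_addP[a aK [b /vlineP[c ->] ->]]; exists a, c.
have brD (a b : 'M[F]_n) c c' : br (a + c *: y) (b + c' *: y) = br a b + c' *: br a y - c *: br b y.
  rewrite !mulmxDl !mulmxDr -!scalemxAl -!scalemxAr.
  move: (a *m b) (b *m a) (a *m y) (y *m b) (y *m y) (b *m y) (y *m a) => u v w z t p q.
  by apply/matrixP => i j; rewrite !mxE; ring.
apply: (IH K').
- by apply/subvP => x /K'P[a [c [aK ->]]]; rewrite memvD ?memvZ // KinL.
- move=> x x' /K'P[a [c [aK ->]]] /K'P[b [c' [bK ->]]]; rewrite brD.
  have /subvP H : (K <= K')%VS by exact: addvSl.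
  by apply: H; apply: memvB; [apply: memvD; [exact: Kbr | apply/memvZ/ybr] | apply/memvZ/ybr].
(* As y normalizes K, it preserves the matrices killed by words of length j in K. Since y is
   nilpotent, at most d letters y can pass before a word in K and y drops to the next smaller j. *)
- have ystab j A : lk K j A -> lk K j (y *m A).
    elim: j A => [|j IHj] A; first by rewrite !lk0 => ->; rewrite mulmx0.
    rewrite !lkS => HA x xK; have -> : x *m (y *m A) = 1 *: (y *m (x *m A)) + br x y *m A.
      by rewrite scale1r mulmxBl !mulmxA addrC subrK.
    by apply: lk_lin; [apply: IHj; exact: HA | apply: HA; exact: ybr].
  have ystabX i j A : lk K j A -> lk K j (y ^+ i *m A).
    move=> HA; elim: i => [|i IHi]; first by rewrite expr0 mul1mx.
    by rewrite exprS -mulmxE -mulmxA; exact: ystab.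
  suff : forall j, exists k, forall A, lk K j A -> lk K' k A by move=> /(_ N)[k Hk]; exists k; exact: Hk.
  elim=> [|j [k Hk]]; first by exists 0 => A /lk0 ->; apply/lk0.
  exists (k + d)%N; suff H i A : lk K j.+1 A -> lk K j (y ^+ i *m A) -> lk K' (k + i) A.
    by move=> A HA; apply: H => //; rewrite yd mul0mx => s _ _; rewrite mulmx0.
  elim: i A => [|i IHi] A HA HyA; first by rewrite addn0; apply: Hk; rewrite expr0 mul1mx in HyA.
  rewrite addnS; apply/lkS => _ /K'P[a [c [aK ->]]].
  rewrite mulmxDl -scalemxAl addrC; apply: IHi.
    by apply: lk_lin; [exact: ystab | apply: lk_mono; move/lkS: HA; exact].
  rewrite mulmxDr -scalemxAr; apply: lk_lin; last by apply: ystabX; move/lkS: HA; exact.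
  by rewrite mulmxA mulmxE -exprSr.
rewrite dim_add_line //.
by rewrite subnS -subn1 leq_subLR add1n.
Qed.
End Engel.

Lemma poly0_nat (F : numFieldType) (q : {poly F}) : (forall k : nat, q.[k%:R] = 0) -> q = 0.
Proof.
move=> H; apply/eqP/negPn/negP => nz.
have := @max_poly_roots _ q [seq k%:R | k <- iota 0 (size q)] nz.
rewrite size_map size_iota ltnn => E; suff : false by [].
apply: E; first by apply/allP => x /mapP[k _ ->]; rewrite /root H.
by rewrite map_inj_uniq ?iota_uniq // => i j /eqP; rewrite eqr_nat => /eqP.
Qed.

Section UnipotentRadical.
Variable R : realType.
Local Notation C := R[i].


Lemma zariski_closedI n (U : set 'M[C]_n) : (forall A, U A -> A \in unitmx) ->
  (forall A, A \in unitmx -> (forall p, vanish U p -> mxeval p A = 0) -> U A) -> zariski_closed U.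
Proof.
move=> U1 U2; exists (vanish U); apply/seteqP; split=> A.
  by move=> UA; split=> [|p]; [exact: U1 | exact].
by move=> [uA H]; exact: U2.
Qed.

Definition evpm n (f : 'M[{poly C}]_n) (x : C) : 'M[C]_n := map_mx (fun q => q.[x]) f.

Lemma mxeval_evpm n (f : 'M[{poly C}]_n) p : exists q : {poly C}, forall x, q.[x] = mxeval p (evpm f x).
Proof.
elim/mpoly_ring_ind: p => [c|l|p q [p' Hp] [q' Hq]|p q [p' Hp] [q' Hq]].
- by exists c%:P => x; rewrite hornerC /mxeval mevalC.
- by case/mxvec_indexP: l => i j; exists (f i j) => x; rewrite /mxeval mevalXU mxvecE mxE.
- by exists (p' + q') => x; rewrite hornerD Hp Hq /mxeval mevalD.
- by exists (p' * q') => x; rewrite hornerM Hp Hq /mxeval mevalM.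
Qed.

(** If u lay in the other piece, take p vanishing on A but not at u and q vanishing on B but not at
    1. Along a polynomial curve from 1 to u the product of p and q vanishes, hence one factor does
    identically, contradicting its value at an end. *)
Lemma curve_connected n (U : set 'M[C]_n) : U 1%:M ->
  (forall u, U u -> exists f, [/\ forall x, U (evpm f x), evpm f 0 = 1%:M & evpm f 1 = u]) ->
  zariski_connected U.
Proof.
move=> U1 Hc A B; wlog A1 : A B / A 1%:M.
  move=> H cA cB AB dAB; have : (A `|` B) 1%:M by rewrite AB.
  case=> [A1|B1]; first exact: (H A B).
  by case: (H B A) => //; rewrite 1?setUC 1?setIC //; [right | left].
move=> cA cB AB dAB; right; apply/seteqP; split=> // u Bu; exfalso.
have uG : u \in unitmx by case: cB Bu => S -> [].
have oG : 1%:M \in @unitmx C n by exact: unitmx1.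
have Uu : U u by rewrite -AB; right.
have disj x : A x -> B x -> False by move=> Ax Bx; have : (A `&` B) x by []; rewrite dAB.
have [p Vp pu] : exists2 p, vanish A p & mxeval p u != 0.
  apply: contrapT => H; apply: (disj u) => //; apply: closed_mem => // p Vp.
  by apply/eqP/negPn/negP => pu; apply: H; exists p.
have [q Vq q1] : exists2 q, vanish B q & mxeval q 1%:M != 0.
  apply: contrapT => H; apply: (disj 1%:M) => //; apply: closed_mem => // q Vq.
  by apply/eqP/negPn/negP => qu; apply: H; exists q.
have [f [fU f0 f1]] := Hc u Uu.
have [p' Hp] := mxeval_evpm f p; have [q' Hq] := mxeval_evpm f q.
have : p' * q' = 0.
  apply: poly0_nat => k; rewrite hornerM Hp Hq.
  have : (A `|` B) (evpm f k%:R) by rewrite AB.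
  by case=> [/Vp->|/Vq->]; rewrite ?mul0r ?mulr0.
move/eqP; rewrite mulf_eq0 => /orP[/eqP E|/eqP E].
  by move: pu; rewrite -f1 -Hp E horner0 eqxx.
by move: q1; rewrite -f0 -Hq E horner0 eqxx.
Qed.

Section OneParameter.
Variables (n : nat) (G : set 'M[C]_n).
Hypothesis cG : closed_subgroup G.
Variables (J : nat) (Y : 'M[C]_n).
Hypothesis YJ : Y ^+ J.+1 = 0.
Let P (i : 'I_1) : 'M[C]_n := 1%:M.
Let P1 : \sum_i P i = 1%:M. Proof. by rewrite big_ord1. Qed.
Let PP (i j : 'I_1) : P i *m P j = if i == j then P i else 0.
Proof. by rewrite !ord1 eqxx mulmx1. Qed.
Let YP i : Y *m P i = P i *m Y. Proof. by rewrite mulmx1 mul1mx. Qed.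

Definition expY (x : C) : 'M[C]_n := \sum_(j < J.+1) (wexp R j).[x] *: Y ^+ j.
Definition binY (x : C) : 'M[C]_n := \sum_(j < J.+1) (wbin R j).[x] *: Y ^+ j.

Lemma lie_exp x : Lie G Y -> G (expY x).
Proof.
move=> LY; have := @lie_fam_mem _ _ 1 J P Y P1 PP YP YJ G (fun=> 0) cG _ (fun=> 1) x _ _.
rewrite (fam_one J Y P1) big1 ?add0r; last by move=> i _; rewrite scale0r.
by apply=> // [i|v v' _]; [exact: oner_neq0 | rewrite !mon_one].
Qed.
Lemma group_bin : G (1%:M + Y) ->
  (forall x, G (binY x)) /\ Lie G (\sum_(j < J.+1) (wbin R j)^`().[0] *: Y ^+ j).
Proof.
move=> GY; have n1 : nzv (fun _ : 'I_1 => 1 : C) by move=> i; exact: oner_neq0.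
have Gg : G ((\sum_i (1 : C) *: P i) *m (1%:M + Y)) by rewrite big_ord1 scale1r mul1mx.
split=> [x|]; last exact: (grp_log P1 PP YP YJ cG n1 Gg).
have := @grp_fam_mem _ _ 1 J P Y P1 PP YP YJ G (fun=> 1) cG n1 Gg (fun=> 1) x n1.
by rewrite (fam_one J Y P1); apply=> v v' _; rewrite !mon_one.
Qed.
Lemma binY0 : binY 0 = 1%:M.
Proof.
rewrite /binY big_ord_recl wbin0 hornerC scale1r expr0 big1 ?addr0 // => j _.
by rewrite lift0 wbin_at0 scale0r.
Qed.
Lemma binY_nat k : binY k%:R = (1%:M + Y) ^+ k.
Proof. by rewrite (bin_pow YJ). Qed.
Lemma binY_evpm : exists f, forall x, evpm f x = binY x.
Proof.
exists (\matrix_(a, b) \sum_(j < J.+1) (Y ^+ j) a b *: wbin R j) => x.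
apply/matrixP => a b; rewrite !mxE horner_sum summxE; apply: eq_bigr => j _.
by rewrite hornerZ mxE mulrC.
Qed.
End OneParameter.

Lemma unipotent_connected n (U : set 'M[C]_n) : closed_subgroup U -> unipotent U -> zariski_connected U.
Proof.
move=> cU uU; apply: curve_connected; first by case: cU => _ [].
move=> u Uu; have [d Hd] := uU u Uu.
have YJ : (u - 1%:M) ^+ d.+1 = 0 by rewrite exprS Hd mulr0.
have [f Hf] := binY_evpm d (u - 1%:M); exists f; rewrite !Hf; split.
- move=> x; rewrite Hf; apply: (group_bin cU YJ _).1; by rewrite addrC subrK.
- exact: binY0.
- by have := binY_nat YJ 1; rewrite expr1 (addrC 1%:M) subrK.
Qed.

Definition trace_radical n (G : set 'M[C]_n) X := Lie G X /\ forall Y, Lie G Y -> \tr (X *m Y) = 0.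

(** The argument of Cartan's criterion: complex conjugation respects integral relations, so the
    conjugate eigenvalues define a replica Y in the Lie algebra. The trace of X Y is then a sum of
    squared moduli weighted by ranks. *)
Lemma trace_radical_nilpotent n (G : set 'M[C]_n) X : closed_subgroup G -> trace_radical G X ->
  exists d, X ^+ d = 0.
Proof.
move=> cG [LX HX].
have [N [s [P [Z [[XE P1 PP [d Zd] sinj] [Pc _]]]]]] := jordan X.
have XP i : X *m P i = P i *m X by apply: Pc.
have ZE : Z = X - \sum_i s i *: P i by rewrite XE addrC addKr.
have ZP i : Z *m P i = P i *m Z.
  rewrite ZE mulmxBr mulmxBl XP mulmx_sumr mulmx_suml; congr (_ - _); apply: eq_bigr => j _.
  by rewrite -scalemxAr -scalemxAl !PP eq_sym; case: eqP => [->|].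
have ZJ : Z ^+ d.+1 = 0 by rewrite exprS Zd mulr0.
pose b i := Num.conj (s i).
have LY : Lie G (\sum_i b i *: P i).
  apply: (@lie_replica _ _ _ _ _ _ P1 PP ZP ZJ G s cG); first by rewrite -XE.
  move=> v v' E; have H w : lin b w = Num.conj (lin s w).
    by rewrite /lin rmorph_sum; apply: eq_bigr => i _; rewrite rmorphM rmorph_int.
  by rewrite !H E.
have := HX _ LY; rewrite {1}XE mulmxDl mxtraceD (mxtrace_nilpotentM Zd); last exact: dsum_comm.
rewrite (dsumM PP) addr0 raddf_sum /= => /psumr_eq0P H.
have {}H i : s i * b i * \tr (P i) = 0.
  have := H _ i isT; rewrite mxtraceZ; apply=> j _; rewrite mxtraceZ -normCK mulr_ge0 ?exprn_ge0 //.
  by rewrite mxtrace_idempotent ?PP ?eqxx // ler0n.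
have sP i : s i *: P i = 0.
  move/eqP: (H i); rewrite !mulf_eq0 conjC_eq0 orbb => /orP[/eqP->|]; first by rewrite scale0r.
  by rewrite mxtrace_idempotent ?PP ?eqxx // pnatr_eq0 mxrank_eq0 => /eqP->; rewrite scaler0.
by exists d; rewrite XE big1 ?add0r.
Qed.
Section Reductive.
Variables (n : nat) (G : set 'M[C]_n).
Hypothesis rG : connected_reductive G.
Let cG : closed_subgroup G. Proof. by case: rG. Qed.
Let sG : subgroup_GL G. Proof. by case: cG. Qed.
Let G1 : G 1%:M. Proof. by case: sG. Qed.
Let GM g h : G g -> G h -> G (g *m h). Proof. by case: sG => _ _ H _; exact: H. Qed.
Let GV g : G g -> G (invmx g). Proof. by case: sG => _ _ _; exact. Qed.
Let Gu g : G g -> g \in unitmx. Proof. exact: G_unit. Qed.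

(* U is unipotent, as tr (g^k) = n for all its elements g and all k. *)
Let U : set 'M[C]_n := [set g | G g /\ forall h, G h -> \tr (g *m h) = \tr h].

Lemma trace_kernel_closed : closed_subgroup U.
Proof.
split; last split.
- apply: zariski_closedI => [A [/Gu //]|A uA H]; split.
    by apply: closed_mem => //; [case: cG | move=> p Vp; apply: H => g [Gg _]; exact: Vp].
  move=> h Gh; have := pfun_sum (index_enum 'I_n) (fun i => pfun_mul 1%:M h (@pfun_id R n) i i).
  move=> /pfunB/(_ (pfun_const n (\tr h)))[p [Hp _]].
  have trE g : mxeval p g = \tr (g *m h) - \tr h by rewrite Hp mul1mx.
  by apply/eqP; rewrite -subr_eq0 -trE H // => g [_ Ug]; rewrite trE Ug // subrr.
- by move=> g [/Gu].
- by split=> // h _; rewrite mul1mx.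
- by move=> g h [Gg Hg] [Gh Hh]; split=> [|k Gk]; [exact: GM | rewrite -mulmxA Hg ?Hh //; exact: GM].
- move=> g [Gg Hg]; split=> [|h Gh]; first exact: GV.
  by rewrite -[LHS]Hg ?mulKVmx ?Gu //; apply: GM => //; exact: GV.
Qed.

Lemma trace_kernel_trivial : U = [set 1%:M].
Proof.
have uU : unipotent U.
  move=> u [Gu' Uu]; apply: nilpotent_of_traces => k.
  suff H h : G h -> \tr ((u - 1%:M) ^+ k.+1 *m h) = 0 by have := H _ G1; rewrite mulmx1.
  elim: k h => [|k IH] h Gh; first by rewrite expr1 mulmxBl mul1mx raddfB /= Uu // subrr.
  rewrite exprSr -mulmxE -mulmxA mulmxBl mul1mx mulmxBr raddfB /= !IH ?subrr //.
  exact: GM.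
case: rG => _ _; apply.
- exact: trace_kernel_closed.
- exact: unipotent_connected trace_kernel_closed uU.
- exact: uU.
split=> [g [] //|g u Gg [Gu' Uu]]; split=> [|h Gh]; first exact: (GM (GM Gg Gu') (GV Gg)).
rewrite -!mulmxA mxtrace_mulC -!mulmxA Uu; last by apply: GM; [exact: GV | exact: GM].
by rewrite mxtrace_mulC -mulmxA mulmxV ?mulmx1 // Gu.
Qed.

(** The radical consists of nilpotent matrices and is a Lie algebra stable under conjugation, so by
    Engel its long words vanish. Moving factors h of G to the right turns a power of X^(j+1) h into
    such a word times a power of h, so these matrices have trace 0. Hence exp (x X) lies in U, which
    is trivial. *)
Lemma trace_radical0 X : trace_radical G X -> X = 0.
Proof.
have [L HL] : exists L : {vspace 'M[C]_n}, forall X, X \in L <-> trace_radical G X.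
  apply: vspace_of_set; first by split=> [|Y _]; [exact: lie0 | rewrite mul0mx mxtrace0].
  move=> a A B [LA HA] [LB HB]; split=> [|Y LY]; first exact: lie_lin.
  by rewrite mulmxDl -scalemxAl mxtraceD mxtraceZ HA // HB // mulr0 addr0.
have [N HN] : exists N, forall s, size s = N -> {subset s <= L} -> wd s = 0.
  apply: engel => [A B /HL[LA HA] /HL[LB HB]|A /HL rA]; last exact: trace_radical_nilpotent cG rA.
  apply/HL; split=> [|Y LY]; first exact: (lie_bracket sG).
  have := HA _ (lie_bracket sG LB LY).
  by rewrite mulmxBr mulmxBl !raddfB /= !mulmxA [\tr (A *m Y *m B)]mxtrace_mulC mulmxA.
have Ad g A : G g -> A \in L -> g *m A *m invmx g \in L.
  move=> Gg /HL[LA HA]; apply/HL; split=> [|Y LY]; first exact: (lie_Ad sG).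
  have := HA _ (lie_Ad sG (GV Gg) LY); rewrite invmxK => E.
  by rewrite -!mulmxA mxtrace_mulC -!mulmxA -[RHS]E !mulmxA.
move=> rX; have XL : X \in L by apply/HL.
have [d Xd] := trace_radical_nilpotent cG rX.
have XJ : X ^+ d.+1 = 0 by rewrite exprS Xd mulr0.
have tr0 j h : G h -> \tr (X ^+ j.+1 *m h) = 0.
  move=> Gh; apply: (@mxtrace_nilpotent _ _ _ N).
  have wX k : wd (nseq k X) = X ^+ k.
    by elim: k => [|k IH] //; rewrite exprS -IH.
  have wAd s : h *m wd s = wd [seq h *m A *m invmx h | A <- s] *m h.
    elim: s => [|A s IH] /=; first by rewrite mulmx1 mul1mx.
    by rewrite -[in RHS]mulmxA -IH !mulmxA mulmxKV ?Gu.
  have [s [ss sL ->]] : exists s, [/\ (N <= size s)%N, {subset s <= L} &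
      (X ^+ j.+1 *m h) ^+ N = wd s *m h ^+ N].
    elim: N {HN} => [|k [s [ss sL IH]]]; first by exists [::]; split=> //; rewrite mulmx1.
    exists (nseq j.+1 X ++ [seq h *m A *m invmx h | A <- s]); split.
    - by rewrite size_cat size_nseq size_map addSn ltnS (leq_trans ss) ?leq_addl.
    - move=> A; rewrite mem_cat => /orP[/nseqP[-> _] //|/mapP[B /sL BL ->]]; exact: Ad.
    - rewrite [LHS]exprS IH wd_cat wX [h ^+ k.+1]exprS -!mulmxE.
      transitivity (X ^+ j.+1 *m (h *m wd s) *m h ^+ k); first by rewrite !mulmxA.
      by rewrite wAd !mulmxA.
  rewrite -(cat_take_drop N s) wd_cat HN ?mul0mx // ?size_takel //.
  by move=> A /mem_take /sL.
have UX x : U (expY d X x).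
  split=> [|h Gh]; first by apply: lie_exp => //; case: rX.
  rewrite mulmx_suml raddf_sum /= big_ord_recl wexp0 hornerC scale1r expr0 mul1mx.
  by rewrite big1 ?addr0 // => j _; rewrite lift0 -scalemxAl mxtraceZ tr0 // mulr0.
have {}UX : expY d X 1 = 1%:M by have := UX 1; rewrite trace_kernel_trivial.
case: d Xd XJ UX => [|d] Xd XJ UX; first by rewrite -[LHS]expr1 XJ.
(* The equation exp X = 1 reads X (1 + X W) = 0, and 1 + X W is invertible because X is nilpotent
   and commutes with W. *)
pose W := \sum_(i < d) (wexp R i.+2).[1] *: X ^+ i.
have w1 : (wexp R 1).[1] = 1 by rewrite /wexp hornerZ hornerXn expr1n mulr1 factS fact0 muln1 invr1.
have XV : X *m (1%:M + X *m W) = 0.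
  move: UX; rewrite /expY 2!big_ord_recl wexp0 hornerC scale1r expr0 => /eqP.
  rewrite -subr_eq0 addrAC subrr add0r => /eqP E; rewrite -[RHS]E mulmxDr mulmx1; congr (_ + _).
    by rewrite lift0 w1 scale1r expr1.
  rewrite /W !mulmx_sumr; apply: eq_bigr => i _.
  by rewrite !lift0 -!scalemxAr !mulmxE -!exprS.
have XW : X *m W = W *m X.
  by rewrite mulmx_sumr mulmx_suml; apply: eq_bigr => i _; rewrite -scalemxAr -scalemxAl !mulmxE -exprS -exprSr.
have uV := unit_add1_nilpotent (nilpotentM Xd XW).
by rewrite -[X](mulmxK uV) XV mul0mx.
Qed.
End Reductive.
End UnipotentRadical.

(** * The centralizer of a maximal torus *)

Section ImageTorus.
Variable R : realType.
Local Notation C := R[i].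

Lemma zroot (u : C) (d : int) : u != 0 -> d != 0 -> exists2 w : C, w != 0 & w ^ d = u.
Proof.
move=> u0; case: d => [[|k] //|k] _.
  exists (k.+1.-root u); last by rewrite -exprnP rootCK.
  by rewrite rootC_eq0.
exists (k.+1.-root u)^-1; first by rewrite invr_eq0 rootC_eq0.
by rewrite NegzE -exprz_inv invrK -exprnP rootCK.
Qed.

(** The Smith normal form with its nonzero entries d only, placed in the rows [iota] and columns
    [tau]. *)
Lemma int_diagonal_form m n (M : 'M[int]_(m, n)) : exists k (iota : 'I_k -> 'I_m)
    (L Li : 'M[int]_m) (S : 'M[int]_(m, n)) (Ri : 'M[int]_n) (tau : 'I_k -> 'I_n) (d : 'I_k -> int),
  [/\ L *m Li = 1%:M, Li *m L = 1%:M, injective iota, injective tau & forall j, d j != 0] /\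
  [/\ M = L *m S, forall s, (forall j, iota j != s) -> row s S = 0 &
      forall j, row (iota j) S *m Ri = d j *: delta_mx 0 (tau j)].
Proof.
have [L uL [Q uQ [d _ ->]]] := int_Smith_normal_form M.
set D := \matrix_(i, j) _.
pose I0 := [pred i : 'I_m | (i < n)%N && (d`_i != 0)].
have lt (j : 'I_#|I0|) : (enum_val j < n)%N.
  by have := enum_valP j; rewrite inE => /andP[].
exists #|I0|, (@enum_val _ I0), L, (invmx L), (D *m Q), (invmx Q),
  (fun j => Ordinal (lt j)), (fun j => d`_(@enum_val _ I0 j)); split; split.
- exact: mulmxV.
- exact: mulVmx.
- exact: enum_val_inj.
- by move=> i j /(congr1 val) /= /val_inj /enum_val_inj.
- by move=> j; have := enum_valP j; rewrite inE => /andP[].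
- by rewrite mulmxA.
- move=> s sI; rewrite row_mul; suff -> : row s D = 0 by rewrite mul0mx.
  apply/rowP => j; rewrite !mxE; case: eqP => // sj; rewrite mulr1n.
  apply/eqP/negPn/negP => ds.
  have sI0 : s \in I0 by rewrite inE ds andbT sj.
  by have := sI (enum_rank_in sI0 s); rewrite enum_rankK_in ?eqxx.
- move=> j; rewrite -row_mul -mulmxA mulmxV // mulmx1; apply/rowP => t; rewrite !mxE /=.
  by rewrite eq_sym -val_eqE /=; case: eqP => _; rewrite ?mulr1n ?mulr1 ?mulr0n ?mulr0.
Qed.

Lemma big_codom (T : Type) (idx : T) (op : Monoid.com_law idx) m k (io : 'I_k -> 'I_m) (F : 'I_m -> T) :
  injective io -> (forall s, (forall j, io j != s) -> F s = idx) ->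
  \big[op/idx]_s F s = \big[op/idx]_j F (io j).
Proof.
move=> ioI F0; rewrite (bigID (fun s => s \in [set io j | j in [set: 'I_k]]%SET)) /=.
rewrite [X in op _ X]big1 ?Monoid.mulm1.
  rewrite big_imset /=; last by move=> a b _ _ /ioI.
  by apply: eq_bigl => j; rewrite finset.in_setT.
move=> s sI; apply: F0 => j; apply: contraNneq sI => <-.
by rewrite imset_f ?finset.in_setT.
Qed.

Lemma mon_ext k (y y' : 'I_k -> C) v : (forall i, y i = y' i) -> mon y v = mon y' v.
Proof. by move=> E; apply: eq_bigr => i _; rewrite E. Qed.

Definition posz (v : int) := if v is Posz k then k else 0%N.
(** Splitting exponents into positive and negative parts turns a monomial relation into an equation
    between polynomials, as needed for Zariski closedness. *)
Lemma mon_posneg k (y : 'I_k -> C) (v : 'rV[int]_k) : nzv y ->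
  \prod_i y i ^+ posz (v 0 i) = mon y v * \prod_i y i ^+ posz (- v 0 i).
Proof.
move=> ny; rewrite -big_split; apply: eq_bigr => i _ /=; case: (v 0 i) => [[|q]|q] /=.
- by rewrite expr0 expr0z mulr1.
- by rewrite mulr1.
- by rewrite NegzE -exprz_inv -exprnP exprVn mulVf ?expr0 // expf_neq0.
Qed.

Section Regular.
Variables (n : nat) (T : set 'M[C]_n).
Hypothesis Tu : T `<=` @GL R n.
Lemma regular_add f g : regular T f -> regular T g -> regular T (fun t => f t + g t).
Proof.
move=> [p [k Hp]] [q [l Hq]]; have [dF [D [HD _]]] := @isp_det R n.
exists (p * D ^+ l + q * D ^+ k), (k + l)%N => t Tt.
have d0 : \det t != 0 by have := Tu Tt; rewrite /GL /= unitmxE unitfE.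
rewrite Hp // Hq // /mxeval mevalD !mevalM !rmorphXn /= -/(mxeval p t) -/(mxeval q t) -/(mxeval D t) HD exprD.
by field; rewrite !expf_neq0.
Qed.
Lemma regular_sum (I : Type) (s : seq I) (F : I -> 'M[C]_n -> C) :
  (forall i, regular T (F i)) -> regular T (fun t => \sum_(i <- s) F i t).
Proof.
move=> H; elim: s => [|i s IH].
  by have [p [d E]] := regular_const T 0; exists p, d => t Tt; rewrite big_nil -E.
by have [p [d E]] := regular_add (H i) IH; exists p, d => t Tt; rewrite big_cons -E.
Qed.
Lemma regular_poly F dF : pfun F dF -> regular T F.
Proof. by move=> [p [Hp _]]; exists p, 0 => t _; rewrite Hp expr0 divr1. Qed.
Lemma regular_ext f g : (forall t, T t -> f t = g t) -> regular T f -> regular T g.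
Proof. by move=> E [p [k H]]; exists p, k => t Tt; rewrite -E // H. Qed.
Lemma regular_inv i j : regular T (fun t => invmx t i j).
Proof.
exists ((\adj (\matrix_(a, b) 'X_(mxvec_index a b))) i j), 1%N => t Tt.
rewrite /invmx (Tu Tt) mxE expr1 mulrC /mxeval; congr (_ / _).
have := map_mx_adj (meval (mxvec t 0)) (\matrix_(a, b) 'X_(mxvec_index a b)).
move=> /(congr1 (fun M : 'M_n => M i j)); rewrite mxE => ->; congr (\adj _ i j).
by apply/matrixP => a b; rewrite !mxE /= mevalXU mxvecE.
Qed.
Lemma regular_mon k (y : 'I_k -> 'M[C]_n -> C) v :
  (forall i, regular T (y i)) -> (forall i, regular T (fun t => (y i t)^-1)) ->
  regular T (fun t => mon (fun i => y i t) v).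
Proof.
move=> H H'; apply: regular_prod => i; case: (v 0 i) => q; first exact: regular_exp.
apply: regular_ext (regular_exp q.+1 (H' i)) => t _.
by rewrite NegzE -exprz_inv -exprnP.
Qed.
End Regular.

Lemma monV k (u : 'I_k -> C) v : nzv u -> mon (fun i => (u i)^-1) v = (mon u v)^-1.
Proof.
by move=> nu; rewrite /mon -prodfV; apply: eq_bigr => i _; rewrite exprz_inv invr_expz.
Qed.

Section Image.
Variables (n N D : nat) (Q : 'I_N -> 'M[C]_n) (c : 'I_N -> 'rV[int]_D).
Hypothesis Q1 : \sum_i Q i = 1%:M.
Hypothesis QQ : forall i j, Q i *m Q j = if i == j then Q i else 0.
Hypothesis Qn0 : forall i, Q i != 0.

(** By the Smith form the same image is described by exponents [cl] for which the parameters u can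
    be read off from the eigenvalues as monomials [cu]. The elementary divisors disappear because
    complex numbers have roots of every order. *)
Lemma image_torus : exists T' : set 'M[C]_n,
  [/\ torus T', forall z, nzv z -> T' (curve Q c z) &
      forall A, T' A -> exists2 z, nzv z & A = curve Q c z].
Proof.
have [k [io [L [Li [S [Ri [tau [d [[LLi LiL ioI tauI d0] [ME S0 SR]]]]]]]]]] :=
  int_diagonal_form (\matrix_i c i).
pose cl i : 'rV[int]_k := \row_j L i (io j).
pose cu j : 'rV[int]_N := row (io j) Li.
pose y (A : 'M[C]_n) i := \tr (A *m Q i) / \tr (Q i).
pose T' : set 'M[C]_n := [set A | exists2 u : 'I_k -> C, nzv u & A = curve Q cl u].
have trQ i : \tr (Q i) != 0.
  by rewrite mxtrace_idempotent ?QQ ?eqxx // pnatr_eq0 mxrank_eq0.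
have curveQ D' (c' : 'I_N -> 'rV[int]_D') z i : curve Q c' z *m Q i = mon z (c' i) *: Q i.
  rewrite mulmx_suml (bigD1 i) //= -scalemxAl QQ eqxx big1 ?addr0 // => j ji.
  by rewrite -scalemxAl QQ (negPf ji) scaler0.
have yc D' (c' : 'I_N -> 'rV[int]_D') z i : y (curve Q c' z) i = mon z (c' i).
  by rewrite /y curveQ mxtraceZ mulfK.
have curveM D' (c' : 'I_N -> 'rV[int]_D') z z' :
    curve Q c' (fun i => z i * z' i) = curve Q c' z *m curve Q c' z'.
  rewrite /curve mulmx_sumr; apply: eq_bigr => i _.
  by rewrite -scalemxAr curveQ scalerA mon_mull mulrC.
have curve1 D' (c' : 'I_N -> 'rV[int]_D') : curve Q c' (fun=> 1) = 1%:M.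
  by rewrite -Q1; apply: eq_bigr => i _; rewrite mon_one scale1r.
have curveV D' (c' : 'I_N -> 'rV[int]_D') z : nzv z ->
    curve Q c' z *m curve Q c' (fun i => (z i)^-1) = 1%:M.
  move=> nz; rewrite -curveM -(curve1 _ c'); apply: eq_bigr => i _; congr (_ *: _).
  by apply: mon_ext => j; rewrite mulfV.
have nV D' (z : 'I_D' -> C) : nzv z -> nzv (fun i => (z i)^-1).
  by move=> nz i; rewrite invr_eq0.
have curveU D' (c' : 'I_N -> 'rV[int]_D') z : nzv z -> curve Q c' z \in unitmx /\
    invmx (curve Q c' z) = curve Q c' (fun i => (z i)^-1).
  move=> nz; have E := curveV _ c' z nz; have [u _] := mulmx1_unit E; split=> //.
  by rewrite -[RHS](mulKmx u) E mulmx1.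
have cuE u j : nzv u -> mon (fun i => mon u (cl i)) (cu j) = u j.
  move=> nu; rewrite mon_mon // -[RHS](mon_delta u); congr (mon u _).
  apply/rowP => j'; rewrite summxE mxE /=.
  have := congr1 (fun M : 'M_N => M (io j) (io j')) LiL; rewrite !mxE.
  rewrite (inj_eq ioI) eq_sym => <-.
  by apply: eq_bigr => i _; rewrite !mxE.
have cE i : c i = \sum_j cl i 0 j *: row (io j) S.
  have -> : c i = row i (\matrix_i c i) by rewrite rowK.
  rewrite ME row_mul mulmx_sum_row (big_codom _ ioI) => [|s sI]; last by rewrite S0 // scaler0.
  by apply: eq_bigr => j _; rewrite !mxE.
exists T'; split; last first.
- move=> A [u nu ->].
  have /choice[wj Hw] j : exists w : C, w != 0 /\ w ^ d j = u j.
    by have [w w0 E] := zroot (nu j) (d0 j); exists w.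
  pose w t := if [pick j | tau j == t] is Some j then wj j else 1.
  have nw : nzv w.
    by move=> t; rewrite /w; case: pickP => [j _|_]; [case: (Hw j) | exact: oner_neq0].
  have wt j : w (tau j) = wj j.
    rewrite /w; case: pickP => [j' /eqP /tauI -> //|/(_ j)]; by rewrite eqxx.
  exists (fun j' => mon w (row j' Ri)); first exact: nzv_mon.
  apply: eq_bigr => i _; congr (_ *: _); rewrite cE -mon_mon; last exact: nzv_mon.
  apply: mon_ext => j.
  by rewrite mon_mon // -mulmx_sum_row SR monMz // mon_delta wt (Hw j).2.
- move=> z nz; exists (fun j => mon z (row (io j) S)); first exact: nzv_mon.
  by apply: eq_bigr => i _; rewrite mon_mon // -cE.
have ypol i : exists dF, pfun (fun A => y A i) dF.
  have := pfun_sum (index_enum 'I_n) (fun a => pfun_mul 1%:M (Q i) (@pfun_id R n) a a).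
  move=> /(pfunZ (\tr (Q i))^-1) H; eexists; apply: pfun_ext H => A; last by [].
  by rewrite mul1mx mulrC.
have T'u : T' `<=` @GL R n by move=> A [u nu ->]; exact: (curveU _ _ _ nu).1.
have T'c : closed_subgroup T'.
  split; last split=> //.
  (* Equations of the image: A is the combination of the Q i with its own eigenvalues [y A i] as
     coefficients, and these eigenvalues satisfy the monomial relations given by the rows of [Li]
     outside [io]. *)
  - apply: zariski_closedI => [A /T'u //|A uA H].
    have me p B : mxeval p B = meval (mxvec B 0) p by [].
    have /choice[yp Hyp] i : exists p, forall B, mxeval p B = y B i.
      have [dF [p [Hp _]]] := ypol i; by exists p.
    have AE : A = \sum_i y A i *: Q i.
      apply/matrixP => a b; apply/eqP; rewrite -subr_eq0 summxE; apply/eqP.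
      pose p := 'X_(mxvec_index a b) - \sum_i yp i * (Q i a b)%:MP.
      have pE B : mxeval p B = B a b - \sum_i (y B i *: Q i) a b.
        rewrite /p me mevalB mevalXU mxvecE rmorph_sum; congr (_ - _); apply: eq_bigr => i _.
        by rewrite rmorphM /= -me Hyp mevalC mxE.
      rewrite -pE; apply: H => _ [u nu ->]; rewrite pE -summxE.
      by apply/eqP; rewrite subr_eq0; apply/eqP; congr (fun_of_matrix _ a b);
        apply: eq_bigr => i _; rewrite yc.
    have AQ i : A *m Q i = y A i *: Q i.
      rewrite {1}AE mulmx_suml (bigD1 i) //= -scalemxAl QQ eqxx big1 ?addr0 // => j ji.
      by rewrite -scalemxAl QQ (negPf ji) scaler0.
    have ny : nzv (y A).
      move=> i; apply: contraNneq (Qn0 i) => E.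
      by rewrite -[Q i](mulKmx uA) AQ E scale0r mulmx0.
    have y1 s : (forall j, io j != s) -> mon (y A) (row s Li) = 1.
      move=> sI; have pn0 : \prod_i y A i ^+ posz (- (row s Li) 0 i) != 0.
        by apply/prodf_neq0 => i _; rewrite expf_neq0.
      apply: (mulIf pn0); rewrite mul1r -mon_posneg //; apply/eqP; rewrite -subr_eq0; apply/eqP.
      pose p := \prod_i yp i ^+ posz ((row s Li) 0 i) - \prod_i yp i ^+ posz (- (row s Li) 0 i).
      have pE B : mxeval p B = \prod_i y B i ^+ posz ((row s Li) 0 i)
                             - \prod_i y B i ^+ posz (- (row s Li) 0 i).
        rewrite /p me mevalB !rmorph_prod; congr (_ - _); apply: eq_bigr => i _;
        by rewrite rmorphXn /= -me Hyp.
      rewrite -pE; apply: H => _ [u nu ->]; rewrite pE.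
      have nyu : nzv (y (curve Q cl u)) by move=> i; rewrite yc; exact: mon_neq0.
      rewrite mon_posneg // [X in X * _](_ : _ = 1) ?mul1r ?subrr //.
      transitivity (mon (fun i => mon u (cl i)) (row s Li)); first by apply: eq_bigr => i _; rewrite yc.
      rewrite mon_mon // -[RHS](mon0 u); congr (mon u _); apply/rowP => j; rewrite summxE mxE.
      have := congr1 (fun M : 'M_N => M s (io j)) LiL; rewrite !mxE eq_sym (negPf (sI j)) => E; apply: etrans E.
      by apply: eq_bigr => i _; rewrite !mxE.
    exists (fun j => mon (y A) (cu j)); first exact: nzv_mon.
    rewrite {1}AE; apply: eq_bigr => i _; congr (_ *: _).
    rewrite -(mon_delta (y A)); have -> : delta_mx 0 i = row i (L *m Li).
      by rewrite LLi; apply/rowP => j; rewrite !mxE eqxx eq_sym.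
    rewrite row_mul mulmx_sum_row mon_sum // (big_codom _ ioI) => [|s sI].
      by apply: eq_bigr => j _; rewrite monMz // !mxE.
    by rewrite monMz // y1 // exp1rz.
  - by exists (fun=> 1); [move=> i; exact: oner_neq0 | rewrite curve1].
  - move=> _ _ [u nu ->] [u' nu' ->]; exists (fun i => u i * u' i); last by rewrite curveM.
    by move=> i; rewrite mulf_neq0.
  - by move=> _ [u nu ->]; exists (fun i => (u i)^-1); [exact: nV | exact: (curveU _ _ _ nu).2].
pose fT (A : 'M[C]_n) : 'M[C]_k := diag_mx (\row_j mon (y A) (cu j)).
split=> //; exists k, fT,
  (fun B => curve Q cl (fun j => B j j)).
have fE u : nzv u -> fT (curve Q cl u) = diag_mx (\row_j u j).
  move=> nu; congr diag_mx; apply/rowP => j; rewrite !mxE -[RHS](cuE _ u) //.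
  by apply: mon_ext => i; rewrite yc.
split.
- split=> [A [u nu ->]|A B [u nu ->] [v nv ->]|i j].
  + by rewrite fE //; exact: diagGL_diag.
  + have nuv : nzv (fun i => u i * v i) by move=> i; rewrite mulf_neq0.
    have := fE _ nuv; rewrite curveM => ->.
    rewrite (fE _ nu).
    rewrite (fE _ nv).
    by rewrite mulmx_diag; congr diag_mx; apply/rowP => j; rewrite !mxE.
  + apply: (@regular_ext _ _ (fun A => (i == j)%:R * mon (y A) (cu i))).
      by move=> A _; rewrite /fT mxE mxE; case: eqP => [->|_]; rewrite ?mul1r ?mulr1n ?mul0r ?mulr0n.
    apply: regular_mul; first exact: regular_const.
    apply: regular_mon => i'; first by have [dF H] := ypol i'; exact: regular_poly H.
    apply: (@regular_ext _ _ (fun A => (\sum_a \sum_b invmx A a b * Q i' b a) * (\tr (Q i'))^-1)).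
      move=> A [u nu ->]; have [uA ->] := curveU _ cl u nu.
      rewrite -/(y (curve Q cl u) i') yc -monV // -(yc _ cl) /y; congr (_ * _); apply: eq_bigr => a _.
      by rewrite [RHS]mxE.
    apply: regular_mul; last exact: regular_const.
    apply: (@regular_sum _ _ T'u _ _ (fun a t => \sum_b invmx t a b * Q i' b a)) => a.
    apply: (@regular_sum _ _ T'u _ _ (fun b t => invmx t a b * Q i' b a)) => b.
    apply: regular_mul; last exact: regular_const.
    exact: regular_inv.
- split=> [B /diagGLE[_ nB]|A B /diagGLE[EA nA] /diagGLE[EB nB]|i j].
  + by exists (fun j => B j j).
  + rewrite -curveM; congr curve; apply: funext => j.
    by rewrite {1}EA {1}EB mulmx_diag !mxE eqxx mulr1n.
  + have dU : @diagGL R k `<=` @GL R k by move=> B [].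
    apply: (@regular_ext _ _ (fun B => \sum_l mon (fun j => B j j) (cl l) * Q l i j)).
      by move=> B _; rewrite summxE; apply: eq_bigr => l _; rewrite mxE.
    apply: (@regular_sum _ _ dU _ _ (fun l B => mon (fun j => B j j) (cl l) * Q l i j)) => l.
    apply: regular_mul; last exact: regular_const.
    apply: (@regular_mon _ _ _ (fun j B => B j j)) => j'; first exact: regular_poly (@pfun_entry R k j' j').
    apply: (@regular_ext _ _ (fun B => invmx B j' j')); last exact: regular_inv.
    move=> B dB; have [uB _] := dB; have [EB nB] := diagGLE dB.
    have := congr1 (fun M : 'M_k => M j' j') (mulmxV uB).
    rewrite {1}EB mul_diag_mx !mxE eqxx => E; apply: (mulfI (nB j')).
    by rewrite E mulfV.
- move=> A [u nu ->]; rewrite (fE _ nu); congr curve; apply: funext => j.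
  by rewrite !mxE eqxx mulr1n.
- by move=> B /diagGLE[EB nB]; rewrite (fE _ nB) -EB.
Qed.
End Image.
End ImageTorus.

Section TorusCentralizer.
Variable R : realType.
Local Notation C := R[i].

Lemma lin_zmod N (b : 'I_N -> C) : zmod_morphism (lin b).
Proof.
by move=> v w; rewrite linD; congr (_ + _); rewrite /lin -sumrN; apply: eq_bigr => i _;
  rewrite mxE intrN mulNr.
Qed.
HB.instance Definition _ N (b : 'I_N -> C) := GRing.isZmodMorphism.Build _ _ (lin b) (lin_zmod b).

Lemma mon_functional2 (I J : finType) d (v : I -> 'rV[int]_d) (w : J -> 'rV[int]_d) p q
    (A : I -> 'M[C]_(p, q)) (B : J -> 'M[C]_(p, q)) :
  (forall z : 'I_d -> C, nzv z -> \sum_i mon z (v i) *: A i = \sum_j mon z (w j) *: B j) ->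
  forall phi : 'rV[int]_d -> C, \sum_i phi (v i) *: A i = \sum_j phi (w j) *: B j.
Proof.
move=> H phi; apply/matrixP => a b; apply/eqP; rewrite -subr_eq0 !summxE; apply/eqP.
pose l := [seq (A i a b, v i) | i <- index_enum I] ++ [seq (- B j a b, w j) | j <- index_enum J].
have E (psi : 'rV[int]_d -> C) : \sum_(u <- l) u.1 * psi u.2 =
    \sum_i (psi (v i) *: A i) a b - \sum_j (psi (w j) *: B j) a b.
  rewrite big_cat !big_map -sumrN; congr (_ + _); apply: eq_bigr => i _ /=;
    by rewrite mxE mulrC ?mulrN.
rewrite -E; apply: laurent_functional => z nz.
by rewrite E -!summxE H // subrr.
Qed.
Lemma mon_functional (I : finType) d (v : I -> 'rV[int]_d) p q (A : I -> 'M[C]_(p, q)) :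
  (forall z : 'I_d -> C, nzv z -> \sum_i mon z (v i) *: A i = 0) ->
  forall phi : 'rV[int]_d -> C, \sum_i phi (v i) *: A i = 0.
Proof.
move=> H phi; have := @mon_functional2 I 'I_0 d v (fun=> 0) p q A (fun=> 0) _ phi.
by rewrite big_ord0; apply=> z nz; rewrite big_ord0 H.
Qed.

Variables (n : nat) (T : set 'M[C]_n) (r : nat) (e : 'I_r -> 'M[C]_n -> C).
Hypothesis tT : torus T.
Hypothesis Te : char_basis T e.

Lemma torus_weights m (rho : 'M[C]_n -> 'M[C]_m) : alg_morphism T (@GL R m) rho ->
  exists N (chi : 'I_N -> 'rV[int]_r) (P : 'I_N -> 'M[C]_m),
  [/\ injective chi, forall t, T t -> rho t = \sum_i char_of e (chi i) t *: P i,
      \sum_i P i = 1%:M, forall i j, P i *m P j = if i == j then P i else 0 & forall i, P i != 0].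
Proof.
move=> rhoM; have [ws [P [uws rhoE PP P1 Pout]]] := torus_rep_decomp tT Te rhoM.
pose s := [seq v <- ws | P v != 0].
have us : uniq s by exact: filter_uniq.
have sumE (E : 'rV[int]_r -> 'M[C]_m) : (forall v, P v = 0 -> E v = 0) ->
    \sum_(i < size s) E (nth 0 s i) = \sum_(v <- ws) E v.
  move=> E0; rewrite -(big_mkord xpredT (fun i => E (nth 0 s i))) -(big_nth 0 xpredT E).
  rewrite big_filter [RHS](bigID (fun v => P v != 0)) /= [X in _ = _ + X]big1 ?addr0 // => v.
  by rewrite negbK => /eqP /E0.
have mems i : (i < size s)%N -> nth 0 s i \in ws /\ P (nth 0 s i) != 0.
  by move=> /(mem_nth 0); rewrite mem_filter => /andP[].
exists (size s), (fun i => nth 0 s i), (fun i => P (nth 0 s i)); split.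
- by move=> i j /eqP; rewrite nth_uniq // => /eqP /val_inj.
- move=> t Tt; rewrite rhoE // (sumE (fun v => char_of e v t *: P v)) // => v ->.
  by rewrite scaler0.
- by rewrite (sumE P).
- move=> i j; rewrite PP; try by case: (mems _ (ltn_ord i)); case: (mems _ (ltn_ord j)).
  by rewrite nth_uniq.
- by move=> i; case: (mems _ (ltn_ord i)).
Qed.

Lemma char_curve z t v : (forall i, e i t = z i) -> char_of e v t = mon z v.
Proof. by move=> E; rewrite char_ofE; exact: mon_ext. Qed.

Section Weights.
Variables (N : nat) (chi : 'I_N -> 'rV[int]_r) (P : 'I_N -> 'M[C]_n).
Hypothesis chiI : injective chi.
Hypothesis TE : forall t, T t -> t = \sum_i char_of e (chi i) t *: P i.
Hypothesis P1 : \sum_i P i = 1%:M.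
Hypothesis PP : forall i j, P i *m P j = if i == j then P i else 0.
Hypothesis Pn0 : forall i, P i != 0.

Lemma e_nzv t : T t -> nzv (fun i => e i t).
Proof. by move=> Tt i; have [/(_ i)[H _ _] _] := Te; exact: H. Qed.
Lemma torus_curve z : nzv z -> T (curve P chi z) /\ forall i, e i (curve P chi z) = z i.
Proof.
move=> nz; have [th /(_ z nz) [Tth eth]] := torus_param tT Te.
suff -> : curve P chi z = th z by [].
rewrite [RHS](TE Tth); apply: eq_bigr => i _.
by rewrite (char_curve (chi i) eth).
Qed.
Lemma torus_curveE t : T t -> exists2 z, nzv z & t = curve P chi z.
Proof.
move=> Tt; exists (fun i => e i t); first exact: e_nzv.
by rewrite {1}(TE Tt); apply: eq_bigr => i _; rewrite char_ofE.
Qed.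

(** The element of Lie T with coordinates x in the basis dual to e; on the weight chi i it has
    eigenvalue [lin x (chi i)]. *)
Definition Hx (x : 'I_r -> C) : 'M[C]_n := \sum_i lin x (chi i) *: P i.

(** The derivative at 1 of e k in the direction [Hx x] is x k. As e k is only a quotient of a
    polynomial by a power of det, the exponent w of det on T is differentiated first. *)
Lemma Hx_eq0 x : Hx x = 0 -> x =1 fun=> 0.
Proof.
move=> H0 k; have Tu t : T t -> \det t != 0.
  by case: tT => -[_ [+ _ _ _]] _ Tt; move=> /(_ t Tt); rewrite /GL /= unitmxE unitfE.
pose del : 'rV[int]_r := \sum_i chi i *+ \rank (P i).
have [dF [q Hq]] := @isp_det R n.
have detl z : nzv z -> \det (curve P chi z) != 0 by move=> nz; apply: Tu; exact: (torus_curve nz).1.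
have curveM z z' : curve P chi (fun i => z i * z' i) = curve P chi z *m curve P chi z'.
  have := dsumM PP (fun i => mon z (chi i)) (fun i => mon z' (chi i)).
  by rewrite -/(curve P chi z) => ->; apply: eq_bigr => i _; rewrite mon_mull.
have [w Hw] : exists w, forall z, nzv z -> \det (curve P chi z) = mon z w.
  have [l [Hl _]] := laurent_expand P chi q.
  apply: (@laurent_mult_mon _ _ _ l) => [z nz|z z' nz nz'|z nz].
  - by rewrite -Hl // Hq.1.
  - by rewrite curveM det_mulmx.
  - exact: detl.
have dq : mxeval q 1%:M = 1 by rewrite Hq.1 det1.
have [/(_ k)[_ _ [p [m Hp]]] _] := Te.
have pE z : nzv z -> mxeval p (curve P chi z) = mon z (delta_mx 0 k + w *+ m).
  move=> nz; have [Tc /(_ k)] := torus_curve nz; rewrite Hp // Hw // => E.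
  rewrite monD // mon_delta monMn // -E mulfVK // expf_neq0 //; exact: mon_neq0.
have e1 := @laurent_pfun R n r N P chi _ _ [:: (1, w)] P1 (pfun_mxeval q).
have e2 := @laurent_pfun R n r N P chi _ _ [:: (1, delta_mx 0 k + w *+ m)] P1 (pfun_mxeval p).
have {e1} E1 : lin x w = 0.
  have := e1 _ (lin x); rewrite -/(Hx x) H0 /dird big1; last by move=> l _; rewrite linear0 mxE mulr0.
  by rewrite big_seq1 mul1r => <- // z nz; rewrite big_seq1 mul1r Hq.1 Hw.
have := e2 _ (lin x); rewrite -/(Hx x) H0 /dird big1; last by move=> l _; rewrite linear0 mxE mulr0.
rewrite big_seq1 mul1r raddfD raddfMn /= E1 mul0rn addr0 lin_delta => <- //.
by move=> z nz; rewrite big_seq1 mul1r pE.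
Qed.

Lemma trHx x X : \tr (X *m Hx x) = \sum_i lin x (chi i) * \tr (X *m P i).
Proof.
by rewrite mulmx_sumr raddf_sum; apply: eq_bigr => i _; rewrite -scalemxAr /= mxtraceZ.
Qed.
Lemma HxP x i : Hx x *m P i = lin x (chi i) *: P i.
Proof. exact: dsum_mul. Qed.
Lemma PHx x i : P i *m Hx x = lin x (chi i) *: P i.
Proof.
rewrite mulmx_sumr (bigD1 i) //= -scalemxAr PP eqxx big1 ?addr0 // => j ji.
by rewrite -scalemxAr PP eq_sym (negPf ji) scaler0.
Qed.
Lemma trHxHx x y : \tr (Hx x *m Hx y) = \sum_i lin x (chi i) * lin y (chi i) * (\rank (P i))%:R.
Proof.
rewrite trHx; apply: eq_bigr => i _; rewrite HxP mxtraceZ mxtrace_idempotent ?PP ?eqxx //.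
by rewrite mulrA (mulrC (lin y _)).
Qed.
(** Pairing with the conjugate of x gives a sum of squared moduli of eigenvalues weighted by ranks,
    because the weights are integral. *)
Lemma trHx_nondeg x : (forall y, \tr (Hx x *m Hx y) = 0) -> x =1 fun=> 0.
Proof.
move=> H; apply: Hx_eq0; have := H (fun i => Num.conj (x i)); rewrite trHxHx.
have cE v : lin (fun i => Num.conj (x i)) v = Num.conj (lin x v).
  by rewrite /lin rmorph_sum; apply: eq_bigr => i _; rewrite rmorphM /= rmorph_int.
under eq_bigr do rewrite cE -normCK.
move=> /psumr_eq0P H0; rewrite /Hx big1 // => i _.
have : `|lin x (chi i)| ^+ 2 * (\rank (P i))%:R = 0.
  by apply: H0 => // j _; rewrite mulr_ge0 ?exprn_ge0 ?ler0n.
move=> /eqP; rewrite mulf_eq0 expf_eq0 /= normr_eq0 pnatr_eq0 mxrank_eq0 (negPf (Pn0 i)) orbF.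
by move=> /eqP->; rewrite scale0r.
Qed.
End Weights.
End TorusCentralizer.

Section MaximalTorus.
Variable R : realType.
Local Notation C := R[i].
Variables (n : nat) (G T : set 'M[C]_n) (r : nat) (e : 'I_r -> 'M[C]_n -> C).
Hypothesis rG : connected_reductive G.
Hypothesis mT : maximal_torus G T.
Hypothesis Te : char_basis T e.
Variables (N : nat) (chi : 'I_N -> 'rV[int]_r) (P : 'I_N -> 'M[C]_n).
Hypothesis chiI : injective chi.
Hypothesis TE : forall t, T t -> t = \sum_i char_of e (chi i) t *: P i.
Hypothesis P1 : \sum_i P i = 1%:M.
Hypothesis PP : forall i j, P i *m P j = if i == j then P i else 0.
Hypothesis Pn0 : forall i, P i != 0.
Let cG : closed_subgroup G. Proof. by case: rG. Qed.
Let sG : subgroup_GL G. Proof. by case: cG. Qed.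
Let tT : torus T. Proof. by case: mT. Qed.
Let TG : T `<=` G. Proof. by case: mT. Qed.
Let GM g h : G g -> G h -> G (g *m h). Proof. by case: sG => _ _ H _; exact: H. Qed.
Let Tcurve z := torus_curve tT Te TE (z := z).

Lemma dird_sum (I : finType) p (c : I -> C) (X : I -> 'M[C]_n) :
  dird p 1%:M (\sum_i c i *: X i) = \sum_i c i * dird p 1%:M (X i).
Proof.
elim/big_rec2: _ => [|i y1 y2 _ E]; first by rewrite /dird big1 // => l _; rewrite linear0 mxE mulr0.
by rewrite dird_lin E.
Qed.

Lemma curveMV (M : nat) d (Q : 'I_M -> 'M[C]_n) (c : 'I_M -> 'rV[int]_d) z :
  \sum_i Q i = 1%:M -> (forall i j, Q i *m Q j = if i == j then Q i else 0) ->
  nzv z -> curve Q c z \in unitmx /\ invmx (curve Q c z) = curve Q c (fun i => (z i)^-1).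
Proof.
move=> Q1 QQ nz; have E : curve Q c z *m curve Q c (fun i => (z i)^-1) = 1%:M.
  rewrite (dsumM QQ) -Q1; apply: eq_bigr => i _.
  by rewrite monV // mulfV ?scale1r //; exact: mon_neq0.
have [u _] := mulmx1_unit E; split=> //.
by rewrite -[RHS](mulKmx u) E mulmx1.
Qed.

Definition comp (a : 'rV[int]_r) X : 'M[C]_n :=
  \sum_p (chi p.1 - chi p.2 == a)%:R *: (P p.1 *m X *m P p.2).

Lemma conj_curve z X : nzv z -> curve P chi z *m X *m invmx (curve P chi z) =
  \sum_p mon z (chi p.1 - chi p.2) *: (P p.1 *m X *m P p.2).
Proof.
move=> nz; have [_ ->] := curveMV chi P1 PP nz.
rewrite -(pair_bigA _ (fun i j => mon z (chi i - chi j) *: (P i *m X *m P j))) /=.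
rewrite !mulmx_suml; apply: eq_bigr => i _; rewrite mulmx_sumr; apply: eq_bigr => j _.
by rewrite -!scalemxAl -scalemxAr scalerA monD // monN // monV.
Qed.

(** Conjugation by T preserves the linear conditions that define Lie G, and independence of
    characters separates the weight components in each of them. *)
Lemma lie_comp X a : Lie G X -> Lie G (comp a X).
Proof.
move=> LX p Vp; rewrite -/(dird p 1%:M _) dird_sum.
have := @mon_functional R _ r (fun p : 'I_N * 'I_N => chi p.1 - chi p.2) 1 1
  (fun q => (dird p 1%:M (P q.1 *m X *m P q.2))%:M) _ (fun v => (v == a)%:R).
move=> H; have {}H := congr1 (fun M : 'M_1 => M 0 0) (H _).
rewrite summxE mxE in H; apply: etrans (H _).
  by apply: eq_bigr => q _; rewrite !mxE eqxx mulr1n.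
move=> z nz; apply/matrixP => i j; rewrite !ord1 summxE mxE.
have := lie_Ad sG (TG (Tcurve nz).1) LX Vp; rewrite conj_curve // -/(dird p 1%:M _) dird_sum.
by move=> E; rewrite -[RHS]E; apply: eq_bigr => q _; rewrite !mxE eqxx mulr1n.
Qed.

Lemma lie_Hx x : Lie G (Hx chi P x).
Proof. by apply: (lie_curve P1 _ (lin x)) => z nz; apply: TG; exact: (Tcurve nz).1. Qed.

Section SemisimplePart.
Variables (N' d : nat) (s : 'I_N' -> C) (Q : 'I_N' -> 'M[C]_n) (gam : 'I_d -> C) (a : 'I_N' -> 'rV[int]_d).
Hypothesis Q1 : \sum_i Q i = 1%:M.
Hypothesis QQ : forall i j, Q i *m Q j = if i == j then Q i else 0.
Hypothesis PQ : forall i j, P i *m Q j = Q j *m P i.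
Hypothesis SG : forall z, nzv z -> G (curve Q a z).

(** T and the curve commute, so the nonzero products P i Q j diagonalize both. The group they
    generate is a torus by [image_torus], lies in G and contains T, so it equals T by maximality. *)
Lemma commuting_torus z : nzv z -> T (curve Q a z).
Proof.
move=> nz; pose A := [pred p : 'I_N * 'I_N' | P p.1 *m Q p.2 != 0].
pose F k : 'M[C]_n := P (@enum_val _ A k).1 *m Q (@enum_val _ A k).2.
pose c k : 'rV[int]_(r + d) := row_mx (chi (@enum_val _ A k).1) (a (@enum_val _ A k).2).
pose jn (z : 'I_r -> C) (z' : 'I_d -> C) (i : 'I_(r + d)) := match split i with inl j => z j | inr j => z' j end.
have jl z1 z2 j : jn z1 z2 (lshift d j) = z1 j by rewrite /jn (unsplitK (inl j)).
have jr z1 z2 j : jn z1 z2 (rshift r j) = z2 j by rewrite /jn (unsplitK (inr j)).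
have monj w u v : mon w (row_mx u v) = mon (fun j => w (lshift d j)) u * mon (fun j => w (rshift r j)) v.
  by rewrite /mon big_split_ord; congr (_ * _); apply: eq_bigr => j _; rewrite ?row_mxEl ?row_mxEr.
have sumA (E : 'I_N * 'I_N' -> C) :
    \sum_k E (@enum_val _ A k) *: F k = \sum_i \sum_j E (i, j) *: (P i *m Q j).
  rewrite -(big_enum_val (A := A) (fun p => E p *: (P p.1 *m Q p.2))).
  rewrite (pair_bigA _ (fun i j => E (i, j) *: (P i *m Q j))) /= [RHS](bigID (mem A)) /=.
  rewrite [X in _ = _ + X]big1 ?addr0; first by apply: eq_bigr => -[i j] _.
  by move=> [i j]; rewrite inE negbK => /eqP /= ->; rewrite scaler0.
have curveE w : curve F c w =
    curve P chi (fun j => w (lshift d j)) *m curve Q a (fun j => w (rshift r j)).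
  rewrite /curve (sumA (fun p => mon w (row_mx (chi p.1) (a p.2)))) mulmx_suml.
  apply: eq_bigr => i _; rewrite mulmx_sumr; apply: eq_bigr => j _.
  by rewrite -scalemxAl -scalemxAr scalerA monj.
have F1 : \sum_k F k = 1%:M.
  have := sumA (fun=> 1); under eq_bigr do rewrite scale1r.
  move=> ->; rewrite -[RHS]mulmx1 -{1}P1 -Q1 mulmx_suml; apply: eq_bigr => i _.
  by rewrite mulmx_sumr; apply: eq_bigr => j _; rewrite scale1r.
have FF k l : F k *m F l = if k == l then F k else 0.
  rewrite /F -(inj_eq (@enum_val_inj _ A)); move: (enum_val k) (enum_val l) => [i j] [i' j'] /=.
  rewrite mulmxA -[P i *m Q j *m P i']mulmxA -PQ mulmxA PP -mulmxA QQ xpair_eqE.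
  by case: eqP => _; case: eqP => _; rewrite ?mul0mx ?mulmx0.
have Fn0 k : F k != 0 by have := enum_valP k; rewrite inE.
have [T' [tT' T'c T'e]] := image_torus c F1 FF Fn0.
have one D : nzv (fun _ : 'I_D => 1 : C) by move=> i; exact: oner_neq0.
have njn z1 z2 : nzv z1 -> nzv z2 -> nzv (jn z1 z2).
  by move=> n1 n2 i; rewrite /jn; case: (split i).
have jnE z1 z2 : nzv z1 -> nzv z2 -> T' (curve P chi z1 *m curve Q a z2).
  move=> n1 n2; have := T'c _ (njn _ _ n1 n2); rewrite curveE.
  have -> : (fun j => jn z1 z2 (lshift d j)) = z1 by apply: funext => j; exact: jl.
  by have -> : (fun j => jn z1 z2 (rshift r j)) = z2 by apply: funext => j; exact: jr.
have curve1 D K (E : 'I_K -> 'M[C]_n) (b : 'I_K -> 'rV[int]_D) : \sum_i E i = 1%:M ->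
    curve E b (fun=> 1) = 1%:M.
  by move=> <-; apply: eq_bigr => i _; rewrite mon_one scale1r.
have <- : T' = T.
  case: mT => _ _; apply=> // [t Tt|A' /T'e[w nw ->]].
    have [z' nz' ->] := torus_curveE Te TE Tt.
    by have := jnE _ _ nz' (one d); rewrite (curve1 _ _ Q) // mulmx1.
  rewrite curveE; apply: GM; last by apply: SG => j; exact: nw.
  by apply: TG; exact: (@Tcurve _ _).1.
by have := jnE _ _ (one r) nz; rewrite (curve1 _ _ P) // mul1mx.
Qed.

Lemma commuting_Hx : exists x, \sum_j lin gam (a j) *: Q j = Hx chi P x.
Proof.
have curveM z z' : curve Q a (fun i => z i * z' i) = curve Q a z *m curve Q a z'.
  by rewrite (dsumM QQ); apply: eq_bigr => i _; rewrite mon_mull.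
have nM z z' : nzv z -> nzv z' -> nzv (fun i : 'I_d => z i * z' i :> C).
  by move=> n1 n2 i; rewrite mulf_neq0.
have Tu t : T t -> \det t != 0.
  by case: tT => -[_ [+ _ _ _]] _ Tt; move=> /(_ t Tt); rewrite /GL /= unitmxE unitfE.
have [w Hw] : exists w, forall z, nzv z -> \det (curve Q a z) = mon z w.
  have [dF [q [Hq _]]] := @isp_det R n; have [l [Hl _]] := laurent_expand Q a q.
  apply: (@laurent_mult_mon _ _ _ l) => [z nz|z z' nz nz'|z nz].
  - by rewrite -Hl // Hq.
  - by rewrite curveM det_mulmx.
  - by apply: Tu; exact: commuting_torus.
have /choice[be Hbe] k : exists v, forall z, nzv z -> e k (curve Q a z) = mon z v.
  have [/(_ k)[e0 eM [p [m Hp]]] _] := Te.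
  have [l [Hl _]] := laurent_expand Q a p.
  apply: (@laurent_mult_mon _ _ _ [seq (u.1, u.2 - w *+ m) | u <- l]) => [z nz|z z' nz nz'|z nz].
  - rewrite Hp ?Hw ?Hl //; last exact: commuting_torus.
    rewrite big_map mulr_suml; apply: eq_bigr => u _ /=.
    by rewrite monD // monN // monMn // mulrA.
  - by rewrite curveM eM //; exact: commuting_torus.
  - by apply: e0; exact: commuting_torus.
exists (fun k => lin gam (be k)).
rewrite (@mon_functional2 R 'I_N' 'I_N d a (fun i => \sum_k chi i 0 k *: be k) n n Q P _ (lin gam)).
  by apply: eq_bigr => i _; congr (_ *: _); apply/esym; exact: lin_sum.
move=> z nz; rewrite -/(curve Q a z) [LHS](TE (commuting_torus nz)); apply: eq_bigr => i _.
by rewrite (@char_curve _ _ _ _ (fun k => mon z (be k))) ?mon_mon // => k; rewrite Hbe.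
Qed.
End SemisimplePart.

(** The eigenvalues of X are expressed in an integral basis without relations; exponentiating that
    basis freely gives a curve in G that commutes with T. Hence the curve lies in T and its
    derivative, the semisimple part of X, in Lie T. *)
Lemma semisimple_part X : Lie G X -> (forall i, P i *m X = X *m P i) ->
  exists x Z, [/\ X = Hx chi P x + Z, Lie G Z, forall i, P i *m Z = Z *m P i & exists d, Z ^+ d = 0].
Proof.
move=> LX PX; have [N' [s [Q [Z [[XE Q1 QQ [d Zd] sinj] [Qc _]]]]]] := jordan X.
have XQ i : X *m Q i = Q i *m X by apply: Qc.
have ZE : Z = X - \sum_i s i *: Q i by rewrite XE addrC addKr.
have ZQ i : Z *m Q i = Q i *m Z.
  rewrite ZE mulmxBr mulmxBl XQ mulmx_sumr mulmx_suml; congr (_ - _); apply: eq_bigr => j _.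
  by rewrite -scalemxAr -scalemxAl !QQ eq_sym; case: eqP => [->|].
have ZJ : Z ^+ d.+1 = 0 by rewrite exprS Zd mulr0.
have [D [gam [a [sa gam0]]]] := additive_lattice s.
have [x Hx_] : exists x, \sum_j lin gam (a j) *: Q j = Hx chi P x.
  apply: commuting_Hx => // [i j|z nz]; first exact: Qc.
  have LX' : Lie G (\sum_i s i *: Q i + Z) by rewrite -XE.
  have := lie_fam_mem Q1 QQ ZQ ZJ cG LX' (y := fun j => mon z (a j)) 0 (nzv_mon _ nz).
  rewrite fam_at0 ?wexp0 //; last exact: wexp_at0.
  apply=> v v'; rewrite !(lin_sum _ sa) => /eqP; rewrite -subr_eq0 -raddfB => /eqP /gam0 /eqP.
  by rewrite subr_eq0 => /eqP E; rewrite !mon_mon // E.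
have XE' : X = Hx chi P x + Z.
  by rewrite {1}XE -Hx_; congr (_ + _); apply: eq_bigr => i _; rewrite sa.
have ZE' : Z = X - Hx chi P x by rewrite XE' addrC addKr.
exists x, Z; split=> //; last by exists d.
  by rewrite ZE'; apply: lieB => //; exact: lie_Hx.
move=> i; rewrite ZE' mulmxBr mulmxBl PX; congr (_ - _).
by rewrite (PHx chi PP) (HxP chi PP).
Qed.

(** Elements of the centralizer orthogonal to Lie T are nilpotent and form a Lie algebra, so by
    Engel products of two of them have trace 0. Such an element is orthogonal to Lie T and to
    nilpotent parts, hence to the weight 0 part of Lie G and so to all of Lie G; nondegeneracy makes
    it 0. *)
Lemma centralizer_torus X : Lie G X -> (forall i, P i *m X = X *m P i) -> exists x, X = Hx chi P x.
Proof.
pose k0 (X : 'M[C]_n) := [/\ Lie G X, forall i, P i *m X = X *m P i & forall x, \tr (X *m Hx chi P x) = 0].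
have trZ Z d x : Z ^+ d = 0 -> (forall i, P i *m Z = Z *m P i) -> \tr (Z *m Hx chi P x) = 0.
  move=> Zd PZ; apply: mxtrace_nilpotentM Zd _; rewrite mulmx_sumr mulmx_suml.
  by apply: eq_bigr => i _; rewrite -scalemxAr -scalemxAl PZ.
have [K HK] : exists K : {vspace 'M[C]_n}, forall X, X \in K <-> k0 X.
  apply: vspace_of_set; first split=> [|i|x]; first exact: lie0.
  - by rewrite mulmx0 mul0mx.
  - by rewrite mul0mx mxtrace0.
  move=> a A B [LA PA trA] [LB PB trB]; split=> [|i|x]; first exact: lie_lin.
    by rewrite mulmxDr mulmxDl -scalemxAr -scalemxAl PA PB.
  by rewrite mulmxDl -scalemxAl mxtraceD mxtraceZ trA trB mulr0 addr0.
have knil A : A \in K -> exists d, A ^+ d = 0.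
  move=> /HK[LA PA trA]; have [x [Z [AE LZ PZ [d Zd]]]] := semisimple_part LA PA.
  exists d; suff x0 : x =1 fun=> 0.
    rewrite AE [Hx _ _ _]big1 ?add0r // => i _; rewrite /lin big1 ?scale0r // => l _.
    by rewrite x0 mulr0.
  apply: (trHx_nondeg tT Te TE P1 PP Pn0) => y; have := trA y.
  by rewrite AE mulmxDl mxtraceD (trZ Z d y) // addr0.
have [M HM] : exists M, forall s, size s = M -> {subset s <= K} -> wd s = 0.
  apply: engel => [A B /HK[LA PA trA] /HK[LB PB trB]|A /knil //]; apply/HK; split=> [|i|x].
  - exact: (lie_bracket sG).
  - by rewrite mulmxBr mulmxBl !mulmxA PA PB -!mulmxA PA PB.
  - have E : Hx chi P x *m B = B *m Hx chi P x.
      by rewrite mulmx_sumr mulmx_suml; apply: eq_bigr => i _; rewrite -scalemxAr -scalemxAl PB.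
    by rewrite mulmxBl raddfB /= -!mulmxA -E [\tr (B *m _)]mxtrace_mulC !mulmxA subrr.
have kk A B : A \in K -> B \in K -> \tr (A *m B) = 0.
  move=> AK BK; apply: (@mxtrace_nilpotent _ _ _ M).
  have [s [ss sK ->]] : exists s, [/\ (M <= size s)%N, {subset s <= K} & (A *m B) ^+ M = wd s].
    elim: M {HM} => [|m [s [ss sK IH]]]; first by exists [::].
    exists (A :: B :: s); split; first by rewrite /= ltnS (leq_trans ss).
      by move=> x; rewrite !inE => /or3P[/eqP->|/eqP->|/sK].
    by rewrite exprS IH /= mulmxA.
  by rewrite -(cat_take_drop M s) wd_cat HM ?mul0mx // ?size_takel // => x /mem_take /sK.
have k0K Z : k0 Z -> Z = 0.
  move=> kZ; have [LZ PZ trZ0] := kZ; apply: (trace_radical0 rG); split=> // Y LY.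
  pose Y0 := comp 0 Y.
  have Y0E : Y0 = \sum_i P i *m Y *m P i.
    rewrite /Y0 /comp -(pair_bigA _ (fun i j => (chi i - chi j == 0)%:R *: (P i *m Y *m P j))) /=.
    apply: eq_bigr => i _; rewrite (bigD1 i) //= subrr eqxx scale1r big1 ?addr0 // => j ji.
    by rewrite subr_eq0 (inj_eq chiI) eq_sym (negPf ji) scale0r.
  have -> : \tr (Z *m Y) = \tr (Z *m Y0).
    rewrite Y0E mulmx_sumr raddf_sum /= -{1}[Z *m Y]mulmx1 -P1 mulmx_sumr raddf_sum /=.
    apply: eq_bigr => i _; transitivity (\tr (Z *m P i *m Y)); first by rewrite mxtrace_mulC mulmxA PZ.
    by rewrite !mulmxA [RHS]mxtrace_mulC !mulmxA PZ -(mulmxA Z (P i) (P i)) PP eqxx.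
  have LY0 : Lie G Y0 by exact: lie_comp.
  have PY0 i : P i *m Y0 = Y0 *m P i.
    rewrite Y0E mulmx_sumr mulmx_suml (bigD1 i) //= [RHS](bigD1 i) //= !mulmxA PP eqxx.
    rewrite -[P i *m Y *m P i *m P i]mulmxA PP eqxx !big1 // => j ji.
      by rewrite -mulmxA PP (negPf ji) mulmx0.
    by rewrite !mulmxA PP eq_sym (negPf ji) !mul0mx.
  have [x [Z' [-> LZ' PZ' [d Zd]]]] := semisimple_part LY0 PY0.
  rewrite mulmxDr mxtraceD trZ0 add0r; apply: kk; apply/HK => //.
  by split=> // y; exact: trZ Zd PZ'.
move=> LX PX; have [x [Z [-> LZ PZ [d Zd]]]] := semisimple_part LX PX.
by exists x; rewrite (k0K Z) ?addr0 //; split=> // y; exact: trZ Zd PZ.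
Qed.
End MaximalTorus.

(** * Roots *)

Section SL2.
Variables (F : numFieldType) (V : lmodType F) (E L : V -> V).
(** The usual computation of E on successive images of v0 under the lowering operator L, with q in
    place of the eigenvalue 2. At the last nonzero vector, reached after k steps, the coefficient (k
    + 1) (m - q k / 2) must vanish. *)
Lemma sl2_string (v0 : V) (m q : F) K :
  (forall c v, L (c *: v) = c *: L v) -> E 0 = 0 -> E v0 = 0 ->
  (forall k, E (L (iter k L v0)) = L (E (iter k L v0)) + (m - k%:R * q) *: iter k L v0) ->
  v0 != 0 -> iter K L v0 = 0 -> exists j : nat, 2 * m = j%:R * q.
Proof.
move=> LZ E0 Ev0 H v0n vK.
have L0 : L 0 = 0 by have := LZ 0 0; rewrite !scale0r.
pose c k := k.+1%:R * m - q * (k * k.+1)%:R / 2.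
have Ec k : E (iter k.+1 L v0) = c k *: iter k L v0.
  elim: k => [|k IH]; first by rewrite /= (H 0) Ev0 L0 add0r /c; congr (_ *: _); rewrite mul0n; field.
  rewrite [iter k.+2 L v0]iterS (H k.+1) IH LZ -iterS -scalerDl; congr (_ *: _).
  by rewrite /c !natrM -!natr1; field.
have [k0 vk0 kmin] := exists_minimal (P := fun k => iter k L v0 = 0) vK.
case: k0 vk0 kmin => [vk0|k vk0 kmin]; first by rewrite -vk0 eqxx in v0n.
exists k; have := Ec k; rewrite vk0 E0 => /esym/eqP; rewrite scaler_eq0.
move=> /orP[/eqP|/eqP vk]; last by case: (kmin k (ltnSn k)).
have k1 : k.+1%:R != 0 :> F by rewrite pnatr_eq0.
rewrite /c natrM => E1; apply: (mulfI k1); apply/eqP; rewrite -subr_eq0; apply/eqP.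
by rewrite -[RHS](mulr0 2) -[in RHS]E1; field.
Qed.
End SL2.

Section ExpAdjoint.
Variables (R : realType) (n : nat).
Local Notation C := R[i].
Local Notation br X Y := (X *m Y - Y *m X).
Implicit Types (X Y D : 'M[C]_n).

Definition ek X k : 'M[C]_n := (k`!%:R)^-1 *: X ^+ k.
(** Conjugation by exp X is the exponential of the bracket with X, which stops at the second order
    here. The identity is checked on the terms X^k / k! by the recursion [rec]. *)
Lemma exp_adjoint X Y D1 D2 J : X ^+ J.+1 = 0 -> br X Y = D1 -> br X D1 = D2 -> br X D2 = 0 ->
  expY J X 1 *m Y = (Y + D1 + 2^-1 *: D2) *m expY J X 1.
Proof.
move=> XJ H1 H2 H3.
have XY : X *m Y = Y *m X + D1 by rewrite -H1 addrC subrK.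
have XD1 : X *m D1 = D1 *m X + D2 by rewrite -H2 addrC subrK.
have XD2 : X *m D2 = D2 *m X by apply/eqP; rewrite -subr_eq0 H3.
have expE K : (J <= K)%N -> expY J X 1 = \sum_(j < K.+1) ek X j.
  move=> JK; transitivity (\sum_(j < J.+1) ek X j).
    by apply: eq_bigr => j _; rewrite /wexp hornerZ hornerXn expr1n mulr1.
  apply/esym/sum_ord_trunc => // i Ji.
  by rewrite /ek -(subnK Ji) exprD XJ mulr0 scaler0.
have ekS k : X *m ek X k = k.+1%:R *: ek X k.+1.
  have f0 := @fact_neq0 R k; have k1 : k.+1%:R != 0 :> C by rewrite pnatr_eq0.
  rewrite /ek -scalemxAr mulmxE -exprS scalerA factS natrM invfM mulrA mulfV // mul1r //.
have ek0 : ek X 0 = 1%:M by rewrite /ek fact0 invr1 scale1r expr0.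
have rec k : ek X k.+2 *m Y = Y *m ek X k.+2 + D1 *m ek X k.+1 + 2^-1 *: (D2 *m ek X k).
  elim: k => [|k IH].
    have e1 : ek X 1 = X by rewrite /ek factS fact0 muln1 invr1 scale1r expr1.
    have e2 : ek X 2 = 2^-1 *: (X *m X) by rewrite /ek.
    rewrite e2 e1 ek0 mulmx1 -scalemxAl -scalemxAr -mulmxA XY mulmxDr mulmxA XY mulmxDl XD1.
    rewrite -mulmxA !scalerDr addrA -!addrA; congr (_ + _).
    rewrite addrA; congr (_ + _).
    by rewrite -scalerDl -[RHS]scale1r; congr (_ *: _); field.
  have k3 : k.+3%:R != 0 :> C by rewrite pnatr_eq0.
  have A1 : X *m (Y *m ek X k.+2) = k.+3%:R *: (Y *m ek X k.+3) + D1 *m ek X k.+2.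
    by rewrite mulmxA XY mulmxDl -mulmxA ekS -scalemxAr.
  have A2 : X *m (D1 *m ek X k.+1) = k.+2%:R *: (D1 *m ek X k.+2) + D2 *m ek X k.+1.
    by rewrite mulmxA XD1 mulmxDl -mulmxA ekS -scalemxAr.
  have A3 : X *m (D2 *m ek X k) = k.+1%:R *: (D2 *m ek X k.+1).
    by rewrite mulmxA XD2 -mulmxA ekS -scalemxAr.
  apply: (scalerI k3); rewrite scalemxAl -ekS -mulmxA IH !mulmxDr -[X *m (2^-1 *: _)]scalemxAr A1 A2 A3.
  move: (Y *m ek X k.+3) (D1 *m ek X k.+2) (D2 *m ek X k.+1) => u v w.
  by apply/matrixP => a b; rewrite !mxE -!natr1; field.
pose S i := \sum_(j < J.+1) ek X (j + i).
have S0 : expY J X 1 = S 0 by rewrite (expE J) //; apply: eq_bigr => j _; rewrite addn0.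
have S1 : expY J X 1 = 1%:M + S 1.
  rewrite (expE J.+1) // big_ord_recl ek0; congr (_ + _).
  by apply: eq_bigr => j _; rewrite lift0 addn1.
have S2 : expY J X 1 = 1%:M + (X + S 2).
  rewrite (expE J.+2) ?leqW // 2!big_ord_recl ek0; congr (_ + (_ + _)).
    by rewrite lift0 /ek factS fact0 muln1 invr1 scale1r expr1.
  by apply: eq_bigr => j _; rewrite !lift0 addn2.
have SY : S 2 *m Y = Y *m S 2 + D1 *m S 1 + 2^-1 *: (D2 *m S 0).
  rewrite !mulmx_suml !mulmx_sumr scaler_sumr -!big_split; apply: eq_bigr => j _ /=.
  by rewrite addn2 addn1 addn0 rec.
rewrite {1}S2 !mulmxDl -scalemxAl {1}S2 {1}S1 S0 SY XY.
rewrite !mulmxDr mul1mx !mulmx1.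
move: (Y *m X) (Y *m S 2) (D1 *m S 1) (2^-1 *: (D2 *m S 0)) => u v w t.
by apply/matrixP => a b; rewrite !mxE; ring.
Qed.
End ExpAdjoint.

Section RootVectors.
Variable R : realType.
Local Notation C := R[i].
Local Notation br X Y := (X *m Y - Y *m X).
Variables (n r N : nat) (chi : 'I_N -> 'rV[int]_r) (P : 'I_N -> 'M[C]_n).
Hypothesis P1 : \sum_i P i = 1%:M.
Hypothesis PP : forall i j, P i *m P j = if i == j then P i else 0.
Local Notation HT := (Hx chi P).
Local Notation comp := (comp chi P).

(* X is a weight vector of weight a for the adjoint action of the torus; comp a X
   is the component of weight a of X. *)
Definition hw (a : 'rV[int]_r) (X : 'M[C]_n) := forall x, br (HT x) X = lin x a *: X.

Lemma lin_coord k (v : 'rV[int]_r) : lin (fun l => (l == k)%:R : C) v = (v 0 k)%:~R.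
Proof.
rewrite /lin (bigD1 k) //= eqxx mulr1 big1 ?addr0 // => l lk.
by rewrite (negPf lk) mulr0.
Qed.
Lemma lin_inj (v w : 'rV[int]_r) : (forall x : 'I_r -> C, lin x v = lin x w) -> v = w.
Proof.
move=> H; apply/rowP => k; have := H (fun l => (l == k)%:R); rewrite !lin_coord.
by move/eqP; rewrite eqr_int => /eqP.
Qed.

Lemma brHxP x X i j : P i *m br (HT x) X *m P j = lin x (chi i - chi j) *: (P i *m X *m P j).
Proof.
rewrite mulmxBr mulmxBl !mulmxA (PHx chi PP) -!scalemxAl -!mulmxA (HxP chi PP).
by rewrite -!scalemxAr raddfB scalerBl.
Qed.
Lemma hw_out a X i j : hw a X -> chi i - chi j != a -> P i *m X *m P j = 0.
Proof.
move=> HX ne; apply/eqP/negPn/negP => nz; move/eqP: ne; apply; apply: lin_inj => x.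
have := brHxP x X i j; rewrite HX -scalemxAr -scalemxAl => /eqP.
by rewrite -subr_eq0 -scalerBl scaler_eq0 (negPf nz) orbF subr_eq0 => /eqP.
Qed.
Lemma PXP X : X = \sum_p P p.1 *m X *m P p.2.
Proof.
rewrite -(pair_bigA _ (fun i j => P i *m X *m P j)) /= -{1}[X]mul1mx -{1}[1%:M *m X]mulmx1 -{1 2}P1.
rewrite mulmx_suml mulmx_suml; apply: eq_bigr => i _; rewrite mulmx_sumr; exact: eq_bigr.
Qed.
Lemma hw_lin a c X Y : hw a X -> hw a Y -> hw a (c *: X + Y).
Proof.
move=> HX HY x; rewrite mulmxDr mulmxDl -scalemxAr -scalemxAl opprD addrACA HY -scalerBr HX.
by rewrite !scalerDr !scalerA mulrC.
Qed.
Lemma hw0 a : hw a 0. Proof. by move=> x; rewrite mulmx0 mul0mx subrr scaler0. Qed.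
Lemma hwB a X Y : hw a X -> hw a Y -> hw a (X - Y).
Proof. by move=> HX HY; rewrite addrC -scaleN1r; exact: hw_lin. Qed.
Lemma hwZ a c X : hw a X -> hw a (c *: X).
Proof. by move=> HX; rewrite -[_ *: _]addr0; apply: hw_lin => //; exact: hw0. Qed.
Lemma comp_hw a X : hw a (comp a X).
Proof.
have -> : comp a X = \sum_(p <- index_enum ('I_N * 'I_N)%type | chi p.1 - chi p.2 == a) P p.1 *m X *m P p.2.
  rewrite /comp [RHS]big_mkcond; apply: eq_bigr => p _.
  by case: (_ == a); rewrite ?scale1r ?scale0r.
elim/big_rec: _ => [|[i j] Y /eqP ij HY]; first exact: hw0.
rewrite -[P _ *m X *m _]scale1r; apply: hw_lin => // x /=.
rewrite !mulmxA (HxP chi PP) -!mulmxA (PHx chi PP) -!scalemxAl -!scalemxAr !mulmxA -scalerBl.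
by rewrite -raddfB ij.
Qed.
Lemma hwM a b X Y : hw a X -> hw b Y -> hw (a + b) (X *m Y).
Proof.
move=> HX HY x; rewrite linD scalerDl scalemxAl -HX scalemxAr -HY mulmxBl mulmxBr !mulmxA.
by rewrite addrA subrK.
Qed.
Lemma hw_br a b X Y : hw a X -> hw b Y -> hw (a + b) (br X Y).
Proof. by move=> HX HY; apply: hwB; [exact: hwM | rewrite addrC; exact: hwM]. Qed.
Lemma hw_tr0 a X : a != 0 -> hw a X -> \tr X = 0.
Proof.
move=> a0 HX; apply/eqP/negPn/negP => nz; move/eqP: a0; apply; apply: lin_inj => x.
have := HX x => /(congr1 mxtrace); rewrite raddfB /= mxtrace_mulC subrr mxtraceZ => /esym/eqP.
by rewrite mulf_eq0 (negPf nz) orbF => /eqP->; rewrite raddf0.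
Qed.

Definition diffs := undup [seq chi i - chi j | i <- enum 'I_N, j <- enum 'I_N].
Lemma mem_diffs i j : chi i - chi j \in diffs.
Proof. by rewrite mem_undup; apply: allpairs_f; rewrite mem_enum. Qed.
Lemma comp_sum X : X = \sum_(a <- diffs) comp a X.
Proof.
rewrite exchange_big /= {1}[X]PXP; apply: eq_bigr => -[i j] _ /=.
rewrite (bigD1_seq _ (mem_diffs i j)) ?undup_uniq //= eqxx scale1r big1 ?addr0 // => a ne.
by rewrite eq_sym (negPf ne) scale0r.
Qed.
Lemma hw_notin a X : hw a X -> a \notin diffs -> X = 0.
Proof.
move=> HX aS; rewrite [X]PXP big1 // => p _; apply: (hw_out HX).
by apply: contraNneq aS => <-; exact: mem_diffs.
Qed.
(** Nonzero weight vectors have weights among the finitely many differences of the chi i, whereas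
    the a + k b are pairwise distinct. *)
Lemma hw_string (f : nat -> 'M[C]_n) a b : b != 0 -> (forall k, hw (a + b *+ k) (f k)) ->
  exists K, f K = 0.
Proof.
move=> b0 H; apply: contrapT => nz.
have inS k : a + b *+ k \in diffs.
  by apply/negPn/negP => /(hw_notin (H k)) E; apply: nz; exists k.
have := @uniq_leq_size _ [seq a + b *+ k | k <- iota 0 (size diffs).+1] diffs.
rewrite size_map size_iota ltnn => E; suff : false by [].
apply: E; last by move=> x /mapP[k _ ->].
rewrite map_inj_uniq ?iota_uniq // => i j /addrI /rowP H'.
have [k bk] : exists k, b 0 k != 0.
  apply: contrapT => H0; move/eqP: b0; apply; apply/rowP => k; rewrite mxE.
  by apply/eqP/negPn/negP => bk; apply: H0; exists k.
have := H' k; rewrite !mulmxnE => /eqP; rewrite -[_ *+ i]mulr_natr -[_ *+ j]mulr_natr.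
by rewrite -subr_eq0 -mulrBr mulf_eq0 (negPf bk) /= subr_eq0 eqr_nat => /eqP.
Qed.
Lemma hw_nilpotent a X : a != 0 -> hw a X -> exists d, X ^+ d = 0.
Proof.
move=> a0 HX; apply: (@hw_string (fun k => X ^+ k) 0 a a0) => k; rewrite add0r.
elim: k => [|k IH]; last by rewrite mulrS exprS; exact: hwM.
by move=> x; rewrite expr0 mulmx1 mul1mx subrr mulr0n raddf0 scale0r.
Qed.
End RootVectors.

(** The conjugation by exp E exp f exp E, which lifts a reflection; A and B stand for the two
    exponentials, H for a torus element and S for its reflection. *)
Lemma reflection_calc (F : comNzRingType) n (A B H S E h f : 'M[F]_n) al :
  A *m H = (H - al *: E) *m A -> A *m S = (S + al *: E) *m A -> B *m H = (H + al *: f) *m B ->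
  B *m E = (E + h + f) *m B -> A *m E = E *m A -> S = H - al *: h ->
  A *m B *m A *m H = S *m (A *m B *m A).
Proof.
move=> AH AS BH BE AE SE.
have BHE : B *m (H - al *: E) = (S - al *: E) *m B.
  rewrite mulmxBr -scalemxAr BH BE scalemxAl -mulmxBl; congr (_ *m _).
  by rewrite SE !scalerDr; apply/matrixP => i j; rewrite !mxE; ring.
have ASE : A *m (S - al *: E) = S *m A.
  by rewrite mulmxBr AS -scalemxAr AE scalemxAl -mulmxBl addrK.
by rewrite -(mulmxA (A *m B)) AH (mulmxA (A *m B)) -(mulmxA A) BHE (mulmxA A) ASE !mulmxA.
Qed.

Section Roots.
Variable R : realType.
Local Notation C := R[i].
Local Notation br X Y := (X *m Y - Y *m X).
Variables (n : nat) (G T : set 'M[C]_n) (r : nat) (e : 'I_r -> 'M[C]_n -> C).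
Hypothesis rG : connected_reductive G.
Hypothesis mT : maximal_torus G T.
Hypothesis Te : char_basis T e.
Variables (N : nat) (chi : 'I_N -> 'rV[int]_r) (P : 'I_N -> 'M[C]_n).
Hypothesis chiI : injective chi.
Hypothesis TE : forall t, T t -> t = \sum_i char_of e (chi i) t *: P i.
Hypothesis P1 : \sum_i P i = 1%:M.
Hypothesis PP : forall i j, P i *m P j = if i == j then P i else 0.
Hypothesis Pn0 : forall i, P i != 0.
Let cG : closed_subgroup G. Proof. by case: rG. Qed.
Let sG : subgroup_GL G. Proof. by case: cG. Qed.
Let tT : torus T. Proof. by case: mT. Qed.
Let TG : T `<=` G. Proof. by case: mT. Qed.
Let GM g h : G g -> G h -> G (g *m h). Proof. by case: sG => _ _ H _; exact: H. Qed.
Local Notation HT := (Hx chi P).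
Local Notation comp := (comp chi P).
Local Notation hw := (hw chi P).
Local Notation diffs := (diffs chi).

Definition toR (v : 'rV[int]_r) : 'rV[R]_r := map_mx intr v.
(** The matrix of the trace form on Lie T in the coordinates x of [Hx]. Its inverse defines the form
    [ip] on the real span of X^*(T), positive definite since the weights are integral. *)
Definition gram : 'M[R]_r := \matrix_(k, l)
  \sum_i (chi i 0 k)%:~R * (chi i 0 l)%:~R * (\rank (P i))%:R.
Definition ip (u v : 'rV[R]_r) : R := (u *m invmx gram *m v^T) 0 0.
Definition rC (u : 'rV[R]_r) k : C := (u 0 k)%:C.
(* Hx (wt a) is the element of Lie T that represents a for the trace form. *)
Definition wt a : 'I_r -> C := rC (toR a *m invmx gram).

Lemma lin_rC u v : lin (rC u) v = ((u *m (toR v)^T) 0 0)%:C.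
Proof.
rewrite mxE rmorph_sum; apply: eq_bigr => k _.
by rewrite !mxE rmorphM /= mulrC; congr (_ * _); rewrite rmorph_int.
Qed.
Lemma trHx_gram u y : \tr (HT (rC u) *m HT y) = \sum_l ((u *m gram) 0 l)%:C * y l.
Proof.
rewrite (trHxHx chi PP); under [RHS]eq_bigr do rewrite mxE rmorph_sum mulr_suml.
rewrite exchange_big /=; under [RHS]eq_bigr => k _ do
  (under eq_bigr => l _ do rewrite mxE rmorphM rmorph_sum mulr_sumr mulr_suml; rewrite exchange_big /=).
rewrite exchange_big /=; apply: eq_bigr => i _; rewrite /lin mulr_suml mulr_suml.
apply: eq_bigr => k _; rewrite mulr_sumr mulr_suml; apply: eq_bigr => l _.
by rewrite /rC !rmorphM !rmorph_int rmorph_nat /=; ring.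
Qed.
Lemma rC_eq0 u : rC u =1 (fun=> 0) -> u = 0.
Proof. by move=> H; apply/rowP => k; rewrite mxE; have := H k; rewrite /rC => /eqP; rewrite fmorph_eq0 => /eqP. Qed.

Lemma gram_unit : gram \in unitmx.
Proof.
rewrite -row_free_unit -kermx_eq0; apply/rowV0P => u /sub_kermxP H.
apply: rC_eq0; apply: (trHx_nondeg tT Te TE P1 PP Pn0) => y.
by rewrite trHx_gram H big1 // => l _; rewrite mxE mul0r.
Qed.
Lemma lin_wt a b : lin (wt a) b = (ip (toR a) (toR b))%:C.
Proof. by rewrite lin_rC. Qed.
Lemma trHx_wt a y : \tr (HT (wt a) *m HT y) = lin y a.
Proof.
rewrite trHx_gram mulmxKV ?gram_unit //; apply: eq_bigr => l _.
by rewrite mxE rmorph_int.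
Qed.

Lemma ipDl u v w : ip (u + v) w = ip u w + ip v w.
Proof. by rewrite /ip !mulmxDl mxE. Qed.
Lemma ipZl c u w : ip (c *: u) w = c * ip u w.
Proof. by rewrite /ip -!scalemxAl mxE. Qed.
Lemma gramE : gram = \sum_i (\rank (P i))%:R *: ((toR (chi i))^T *m toR (chi i)).
Proof.
apply/matrixP => k l; rewrite mxE summxE; apply: eq_bigr => i _.
by rewrite mxE mxE big_ord1 !mxE mulrC.
Qed.
Lemma gramT : gram^T = gram.
Proof.
by apply/matrixP => k l; rewrite !mxE; apply: eq_bigr => i _; rewrite (mulrC (_%:~R)).
Qed.
Lemma ipC u v : ip u v = ip v u.
Proof.
have sT (A : 'M[R]_1) : A 0 0 = A^T 0 0 by rewrite mxE.
by rewrite /ip sT !trmx_mul trmxK trmx_inv gramT mulmxA.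
Qed.
Lemma ip_gt0 u : u != 0 -> 0 < ip u u.
Proof.
move=> u0; pose w := u *m invmx gram.
have iE : ip u u = \sum_i (\rank (P i))%:R * (w *m (toR (chi i))^T) 0 0 ^+ 2.
  have uE : u^T = gram *m w^T by rewrite -{1}gramT -trmx_mul mulmxKV ?gram_unit.
  rewrite /ip -/w uE mulmxA gramE mulmx_sumr mulmx_suml summxE; apply: eq_bigr => i _.
  rewrite -scalemxAr -scalemxAl mxE mulmxA -(mulmxA (w *m _)) [X in _ * X]mxE big_ord1 expr2; congr (_ * (_ * _)).
  by rewrite -[w^T]/((w)^T) -[toR (chi i)]trmxK -trmx_mul trmxK mxE.
have t0 i : 0 <= (\rank (P i))%:R * (w *m (toR (chi i))^T) 0 0 ^+ 2.
  by rewrite mulr_ge0 ?ler0n ?sqr_ge0.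
rewrite lt_neqAle eq_sym iE sumr_ge0 // andbT; apply: contra_neqN u0 => /eqP H.
have w0 : w = 0.
  apply: rC_eq0; apply: (Hx_eq0 tT Te TE P1 PP).
  rewrite /Hx big1 // => i _; rewrite lin_rC.
  move: (psumr_eq0P (fun i _ => t0 i) H) => /(_ i isT) /eqP.
  rewrite mulf_eq0 expf_eq0 pnatr_eq0 mxrank_eq0 (negPf (Pn0 i)) /= => /eqP->.
  by rewrite scale0r.
by rewrite -[u](mulmxKV gram_unit) -/w w0 mul0mx.
Qed.

Definition rs a X := Lie G X /\ hw a X.
Lemma rs_torus a X : Lie G X -> (hw a X <-> forall t, T t -> t *m X *m invmx t = char_of e a t *: X).
Proof.
move=> LX; split=> [HX t Tt|H x].
  have [z nz tz] := torus_curveE Te TE Tt.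
  rewrite {1 2}tz (conj_curve chi P1 PP X nz) {2}(PXP P1 X) scaler_sumr; apply: eq_bigr => p _.
  have [<-|ne] := eqVneq (chi p.1 - chi p.2) a; last by rewrite (hw_out PP HX ne) !scaler0.
  rewrite (char_curve _ (z := z)) // => i.
  by rewrite tz; exact: (torus_curve tT Te TE nz).2.
have E : br (HT x) X = \sum_p lin x (chi p.1 - chi p.2) *: (P p.1 *m X *m P p.2).
  by rewrite [LHS](PXP P1); apply: eq_bigr => p _; rewrite (brHxP chi PP).
rewrite E; have := @mon_functional2 R ('I_N * 'I_N)%type 'I_1 r (fun p => chi p.1 - chi p.2)
  (fun=> a) n n (fun p => P p.1 *m X *m P p.2) (fun=> X) _ (lin x).
rewrite big_ord1; apply=> z nz; rewrite big_ord1 -(conj_curve chi P1 PP X nz).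
have [Tc ec] := torus_curve tT Te TE nz.
by have := H _ Tc; rewrite (char_curve a ec).
Qed.


(** The trace form pairs weight a with weight - a only, so by nondegeneracy the component of weight
    - a of some Y already pairs nontrivially with E. *)
Lemma rs_dual a E : rs a E -> E != 0 -> exists2 F, rs (- a) F & \tr (E *m F) = 1.
Proof.
move=> [LE HE] E0.
have [Y LY tY] : exists2 Y, Lie G Y & \tr (E *m Y) != 0.
  apply: contrapT => H; move/eqP: E0; apply; apply: (trace_radical0 rG); split=> // Y LY.
  by apply/eqP/negPn/negP => tY; apply: H; exists Y.
have tE : \tr (E *m Y) = \tr (E *m comp (- a) Y).
  rewrite {1}(comp_sum chi P1 Y) mulmx_sumr raddf_sum /=.
  have t0 b : b != - a -> \tr (E *m comp b Y) = 0.
    move=> ba; apply: (@hw_tr0 _ _ _ _ chi P (a + b)).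
      by rewrite addrC addr_eq0.
    by apply: hwM => //; exact: comp_hw.
  have [aS|aS] := boolP (- a \in diffs).
    by rewrite (bigD1_seq (- a)) ?undup_uniq //= big1 ?addr0 // => b; exact: t0.
  rewrite (hw_notin P1 PP (comp_hw chi PP (- a) Y) aS) mulmx0 mxtrace0 big_seq big1 // => b bS.
  by apply: t0; apply: contraNneq aS => <-.
exists ((\tr (E *m comp (- a) Y))^-1 *: comp (- a) Y).
  split; last by apply: hwZ; exact: comp_hw.
  by apply: lieZ; apply: (lie_comp rG mT Te TE P1 PP).
by rewrite -scalemxAr mxtraceZ mulVf // -tE.
Qed.

(** The bracket has weight 0, so it lies in Lie T. Invariance of the trace gives its pairing with
    each [HT y] as [lin y a] times tr (E F), which identifies it. *)
Lemma rs_bracket a E F : rs a E -> rs (- a) F -> br E F = \tr (E *m F) *: HT (wt a).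
Proof.
move=> [LE HE] [LF HF].
have H0 : hw 0 (br E F) by rewrite -(subrr a); exact: hw_br.
have [z Hz] : exists z, br E F = HT z.
  apply: (centralizer_torus rG mT Te chiI TE P1 PP Pn0) => [|i]; first exact: (lie_bracket sG).
  apply/eqP; rewrite eq_sym -subr_eq0; apply/eqP.
  have out j k : j != k -> P j *m br E F *m P k = 0.
    by move=> jk; apply: (hw_out PP H0); rewrite subr_eq0 (inj_eq chiI).
  rewrite -[X in X - _]mul1mx -[X in _ - X]mulmx1 -P1 mulmx_suml mulmx_sumr (bigD1 i) //=.
  rewrite [X in _ - X](bigD1 i) //= mulmxA opprD addrACA subrr add0r -sumrN -big_split big1 // => j ji.
  by rewrite /= mulmxA (out j i) // (out i j) 1?eq_sym // subrr.
rewrite Hz; set c := \tr _.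
have HB x y k : HT (fun l => x l - k * y l) = HT x - k *: HT y.
  rewrite /Hx scaler_sumr -sumrB; apply: eq_bigr => i _; rewrite scalerA -scalerBl; congr (_ *: _).
  by rewrite /lin mulr_sumr -sumrB; apply: eq_bigr => l _; ring.
apply/eqP; rewrite -subr_eq0 -HB; apply/eqP.
suff E0 : (fun l => z l - c * wt a l) =1 (fun=> 0).
  by rewrite /Hx big1 // => i _; rewrite /lin big1 ?scale0r // => l _; rewrite E0 mulr0.
apply: (trHx_nondeg tT Te TE P1 PP Pn0) => y.
rewrite HB mulmxBl raddfB /= -scalemxAl mxtraceZ trHx_wt -Hz.
have := HF y => /(congr1 (fun X => \tr (E *m X))).
rewrite -scalemxAr mxtraceZ -/c raddfN mulmxBr raddfB /= mulmxBl raddfB /= !mulmxA.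
rewrite [\tr (F *m E *m _)]mxtrace_mulC !mulmxA [\tr (HT y *m F *m E)]mxtrace_mulC !mulmxA.
by move=> E1; rewrite -[X in X - _]opprB E1 mulNr opprK mulrC subrr.
Qed.

(** Normalized by tr (E F) = 1 instead of eigenvalue 2, so that E and F are dual for the trace form,
    as the Casimir element requires, and their bracket represents a. *)
Definition sl2pair a E F := [/\ a != 0, rs a E, rs (- a) F & \tr (E *m F) = 1].
Lemma sl2pairN a E F : sl2pair a E F -> sl2pair (- a) F E.
Proof. by case=> a0 rE rF tEF; split; rewrite ?oppr_eq0 ?opprK // mxtrace_mulC. Qed.
Lemma sl2pair_exists a E : a != 0 -> rs a E -> E != 0 -> exists F, sl2pair a E F.
Proof. by move=> a0 rE E0; have [F rF tF] := rs_dual rE E0; exists F. Qed.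
Lemma sl2pair_br a E F : sl2pair a E F -> br E F = HT (wt a).
Proof. by case=> a0 rE rF tEF; rewrite (rs_bracket rE rF) tEF scale1r. Qed.
Lemma toR_inj : injective toR.
Proof. by move=> v w /rowP H; apply/rowP => k; have := H k; rewrite !mxE => /eqP; rewrite eqr_int => /eqP. Qed.
Lemma toR_neq0 a : a != 0 -> toR a != 0.
Proof. by apply: contra_neq => H; apply: toR_inj; rewrite H; apply/rowP => k; rewrite !mxE. Qed.
Lemma ip_pos a : a != 0 -> 0 < ip (toR a) (toR a).
Proof. by move=> /toR_neq0; exact: ip_gt0. Qed.
Lemma toRD a b : toR (a + b) = toR a + toR b.
Proof. by apply/rowP => k; rewrite !mxE intrD. Qed.
Lemma toRN a : toR (- a) = - toR a.
Proof. by apply/rowP => k; rewrite !mxE intrN. Qed.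
Lemma toRZ c a : toR (c *: a) = c%:~R *: toR a.
Proof. by apply/rowP => k; rewrite !mxE intrM. Qed.
Lemma toRMn a k : toR (a *+ k) = k%:R *: toR a.
Proof. by apply/rowP => l; rewrite mxE mulmxnE raddfMn /= !mxE mulr_natl. Qed.
Lemma ipNl u v : ip (- u) v = - ip u v.
Proof. by rewrite -scaleN1r ipZl mulN1r. Qed.
Lemma ipDr u v w : ip u (v + w) = ip u v + ip u w.
Proof. by rewrite ipC ipDl !(ipC _ u). Qed.
Lemma ipZr c u v : ip u (c *: v) = c * ip u v.
Proof. by rewrite ipC ipZl ipC. Qed.
Lemma ipNr u v : ip u (- v) = - ip u v.
Proof. by rewrite ipC ipNl ipC. Qed.

Lemma br_string a E F b D k : sl2pair a E F -> hw b D ->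
  hw (b + (- a) *+ k) (iter k (fun X => br F X) D).
Proof.
move=> [_ _ [_ HF] _] HD; elim: k => [|k IH]; first by rewrite mulr0n addr0.
by rewrite iterS mulrS addrCA; exact: hw_br.
Qed.
Lemma string_nat a E F b D : sl2pair a E F -> hw b D -> D != 0 -> br E D = 0 ->
  exists j : nat, 2 * ip (toR a) (toR b) = j%:R * ip (toR a) (toR a).
Proof.
move=> s HD D0 ED; have [a0 _ _ _] := s.
have Na0 : - a != 0 by rewrite oppr_eq0.
have [K HK] := hw_string P1 PP Na0 (fun k => br_string k s HD).
have [|||j Hj] := @sl2_string C 'M[C]_n (fun X => br E X) (fun X => br F X) D
  (ip (toR a) (toR b))%:C (ip (toR a) (toR a))%:C K _ _ ED _ D0 HK.
- by move=> c v; rewrite -scalemxAr -scalemxAl scalerBr.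
- by rewrite mulmx0 mul0mx subrr.
- move=> k; set X := iter k _ D; have HX := br_string k s HD; rewrite -/X in HX.
  have := HX (wt a); rewrite -(sl2pair_br s) lin_wt toRD toRMn toRN ipDr ipZr ipNr.
  rewrite mulrN rmorphB rmorphM /= rmorph_nat => <-.
  rewrite !mulmxBr !mulmxBl !mulmxA.
  move: (E *m F *m X) (E *m X *m F) (F *m X *m E) (X *m F *m E) (F *m E *m X) (X *m E *m F).
  move=> u1 u2 u3 u4 u5 u6; apply/matrixP => i j; rewrite !mxE; ring.
exists j; apply: (@complexI R); move: Hj; rewrite !rmorphM /= !rmorph_nat //.
Qed.

Lemma lowest0 a E F b D : sl2pair a E F -> hw b D -> br F D = 0 ->
  0 < ip (toR a) (toR b) -> D = 0.
Proof.
move=> s HD FD ab; apply/eqP/negPn/negP => D0; have [a0 _ _ _] := s.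
have [j] := string_nat (sl2pairN s) HD D0 FD; rewrite toRN !ipNl ipNr opprK => E1.
have : 0 <= j%:R * ip (toR a) (toR a) by apply: mulr_ge0 => //; exact/ltW/ip_pos.
by rewrite -E1 mulrN oppr_ge0 leNgt mulr_gt0.
Qed.

(** After subtraction of the right multiple of E, the difference is orthogonal to F, so F
    annihilates it by [rs_bracket]; a lowest vector cannot have the positive weight a. *)
Lemma rs_dim1 a E F E' : sl2pair a E F -> rs a E' -> E' = \tr (E' *m F) *: E.
Proof.
move=> s [LE' HE']; have [a0 [LE HE] rF tEF] := s.
apply/eqP; rewrite -subr_eq0; apply/eqP.
have HD : hw a (E' - \tr (E' *m F) *: E) by apply: hwB => //; exact: hwZ.
apply: (lowest0 s HD); last exact: ip_pos.
have rD : rs a (E' - \tr (E' *m F) *: E) by split=> //; apply: lieB => //; exact: lieZ.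
have t0 : \tr ((E' - \tr (E' *m F) *: E) *m F) = 0.
  by rewrite mulmxBl raddfB /= -scalemxAl mxtraceZ tEF mulr1 subrr.
by rewrite -opprB (rs_bracket rD rF) t0 scale0r oppr0.
Qed.

(** The bracket of F and D has weight a, so it is a multiple of E. The coefficient is the trace of
    (F D - D F) F, which is 0, and D would be a lowest vector of positive weight. *)
Lemma rs_double0 a E F D : sl2pair a E F -> rs (a + a) D -> D = 0.
Proof.
move=> s [LD HD]; have [a0 [LE HE] [LF HF] tEF] := s.
apply: (lowest0 s HD); last by rewrite toRD ipDr addr_gt0 ?ip_pos.
have rFD : rs a (br F D).
  split; first exact: (lie_bracket sG).
  by have := hw_br HF HD; rewrite addKr.
rewrite (rs_dim1 s rFD) [\tr _](_ : _ = 0) ?scale0r //.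
by rewrite mulmxBl raddfB /= -mulmxA mxtrace_mulC subrr.
Qed.

Definition isroot a := a != 0 /\ exists2 X, rs a X & X != 0.
Lemma rootP a : Defs.root G T e a <-> isroot a.
Proof.
split=> -[a0]; [move=> [X [LX X0] H] | move=> [X [LX H] X0]]; split=> //; exists X => //.
  by split=> //; apply/rs_torus.
exact/rs_torus.
Qed.
Lemma isrootN a : isroot a -> isroot (- a).
Proof.
move=> [a0 [X rX X0]]; have [F rF tF] := rs_dual rX X0; split; first by rewrite oppr_eq0.
exists F => //; apply: contra_eq_neq tF => ->; rewrite mulmx0 mxtrace0.
by rewrite eq_sym oner_neq0.
Qed.

(** At the top of the a-string through b, k steps up, the coroot pairing is a natural number j; each
    step back subtracts 2. *)
Lemma cartan_int a b : isroot a -> isroot b -> exists m : int,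
  2 * ip (toR b) (toR a) / ip (toR a) (toR a) = m%:~R.
Proof.
move=> [a0 [E rE E0]] [b0 [X [LX HX] X0]]; have [F s] := sl2pair_exists a0 rE E0.
have ap := ip_pos a0.
have HW k : hw (b + a *+ k) (iter k (fun Y => br E Y) X).
  elim: k => [|k IH]; first by rewrite mulr0n addr0.
  by rewrite iterS mulrS addrCA; apply: hw_br => //; case: rE.
have [K HK] := hw_string P1 PP a0 HW.
have [k vk kmin] := exists_minimal (P := fun k => iter k (fun Y => br E Y) X = 0) HK.
case: k vk kmin => [/= E1|k vk kmin]; first by rewrite E1 eqxx in X0.
have vk0 : iter k (fun Y => br E Y) X != 0 by apply/eqP; exact: kmin.
have [j Hj] := string_nat s (HW k) vk0 vk.
exists (j%:Z - 2 * k%:Z); move: Hj; rewrite toRD toRMn ipDr ipZr (ipC (toR b)) => Hj.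
have -> : 2 * ip (toR a) (toR b) = (j%:R - 2 * k%:R) * ip (toR a) (toR a) by lra.
by rewrite mulfK ?gt_eqF // intrB intrM.
Qed.

(** The reflection dual to that of a, acting on the coordinates x of Lie T. *)
Definition srefl a (x : 'I_r -> C) k :=
  x k - lin x a * (2 / ip (toR a) (toR a))%:C * wt a k.
Lemma lin_srefl a x v : lin (srefl a x) v =
  lin x v - lin x a * (2 * ip (toR a) (toR v) / ip (toR a) (toR a))%:C.
Proof.
have -> : 2 * ip (toR a) (toR v) / ip (toR a) (toR a) =
   (2 / ip (toR a) (toR a)) * ip (toR a) (toR v) by ring.
rewrite rmorphM /= -lin_wt mulrA /srefl; set t := lin x a.
by rewrite /lin mulr_sumr -sumrB; apply: eq_bigr => k _; ring.
Qed.

Lemma reflection_element a : isroot a -> exists2 w, G w &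
  forall x, HT x *m w = w *m HT (srefl a x).
Proof.
move=> [a0 [E rE E0]]; have [F s] := sl2pair_exists a0 rE E0.
have [_ [LE HE] [LF HF] tEF] := s.
have ap := ip_pos a0; pose c : C := (2 / ip (toR a) (toR a))%:C.
(* The factor c rescales to a standard triple, in which h has eigenvalue 2 on E. The minus sign in f
   is that of the classical lift exp e exp (- f) exp e of a reflection. *)
have ca : c * (ip (toR a) (toR a))%:C = 2.
  by rewrite -rmorphM /= mulfVK ?gt_eqF // rmorph_nat.
pose f := - (c *: F); pose h := c *: HT (wt a).
have LfF : Lie G f by rewrite /f -scaleNr; apply: lieZ.
have Hf : hw (- a) f by rewrite /f -scaleNr; apply: hwZ.
have [d Ed] := hw_nilpotent P1 PP a0 HE.
have Na0 : - a != 0 by rewrite oppr_eq0.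
have [d' fd] := hw_nilpotent P1 PP Na0 Hf.
have EJ : E ^+ (d + d').+1 = 0 by rewrite -addnS exprD Ed mul0r.
have fJ : f ^+ (d + d').+1 = 0 by rewrite addnC -addnS exprD fd mul0r.
set J := (d + d')%N in EJ fJ.
pose eE := expY J E 1; pose ef := expY J f 1.
have GE : G eE by exact: (lie_exp cG EJ).
have Gf : G ef by exact: (lie_exp cG fJ).
exists (eE *m ef *m eE); first by apply: GM => //; exact: GM.
have HxE x : HT x *m E = E *m HT x + lin x a *: E by rewrite -HE addrC subrK.
have Hxf x : HT x *m f = f *m HT x - lin x a *: f by rewrite -[- _]scaleNr -raddfN -Hf addrC subrK.
have Ef : br E f = - h.
  by rewrite /f /h mulmxN mulNmx -scalemxAl -scalemxAr -(sl2pair_br s) scalerBr opprK opprB addrC.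
have hE : br h E = 2 *: E.
  by rewrite /h -scalemxAl -scalemxAr -scalerBr HE lin_wt scalerA ca.
have hf : br h f = - (2 *: f).
  have lN : lin (wt a) (- a) = - (ip (toR a) (toR a))%:C by rewrite raddfN /= lin_wt.
  by rewrite /h -scalemxAl -scalemxAr -scalerBr Hf lN scalerA mulrN ca scaleNr.
(* Ad (exp E) on H, E and h; Ad (exp f) on H, E. *)
have eH x : eE *m HT x = (HT x - lin x a *: E) *m eE.
  rewrite (exp_adjoint EJ (D1 := - (lin x a *: E)) (D2 := 0)) ?scaler0 ?addr0 //.
  - by rewrite -HE opprB.
  - by rewrite mulmxN mulNmx -scalemxAr -scalemxAl subrr.
  - by rewrite mulmx0 mul0mx subrr.
have fH x : ef *m HT x = (HT x + lin x a *: f) *m ef.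
  rewrite (exp_adjoint fJ (D1 := lin x a *: f) (D2 := 0)) ?scaler0 ?addr0 //.
  - by rewrite Hxf opprB addrCA subrr addr0.
  - by rewrite -scalemxAr -scalemxAl subrr.
  - by rewrite mulmx0 mul0mx subrr.
have fE : ef *m E = (E + h + f) *m ef.
  rewrite (exp_adjoint fJ (D1 := h) (D2 := 2 *: f)).
  - by rewrite scalerA mulVf ?pnatr_eq0 // scale1r.
  - by rewrite -opprB Ef opprK.
  - by rewrite -opprB hf opprK.
  - by rewrite -scalemxAr -scalemxAl subrr.
have eEE : eE *m E = E *m eE.
  rewrite /eE /expY mulmx_suml mulmx_sumr; apply: eq_bigr => j _.
  by rewrite -scalemxAl -scalemxAr !mulmxE -exprS -exprSr.
have hHx x : HT (srefl a x) = HT x - lin x a *: h.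
  rewrite /Hx /h scalerA scaler_sumr -sumrB; apply: eq_bigr => i _.
  rewrite scalerA -scalerBl; congr (_ *: _); rewrite /srefl /lin mulr_sumr -sumrB.
  by apply: eq_bigr => k _; rewrite /c; ring.
clearbody eE ef h f.
have la x : lin (srefl a x) a = - lin x a.
  by rewrite lin_srefl mulfK ?gt_eqF // rmorph_nat; ring.
have key x : eE *m ef *m eE *m HT x = HT (srefl a x) *m (eE *m ef *m eE).
  apply: (reflection_calc (eH x) _ (fH x) fE eEE (hHx x)).
  have e2 := eH (srefl a x); rewrite la in e2.
  rewrite scaleNr in e2. rewrite opprK in e2.
  exact: e2.
move=> x; rewrite key; congr (_ *m _); congr Hx; apply: funext => k.
by rewrite [RHS]/srefl la /srefl; ring.
Qed.
End Roots.

(** * Derivatives of representations *)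

Section RepDerivative.
Variable R : realType.
Local Notation C := R[i].
Local Notation br X Y := (X *m Y - Y *m X).

Lemma laurent_matrix d m (F : ('I_d -> C) -> 'M[C]_m) :
  (forall i j, exists l : seq (C * 'rV[int]_d), forall z, nzv z ->
     F z i j = \sum_(u <- l) u.1 * mon z u.2) ->
  exists (M : nat) (v : 'I_M -> 'rV[int]_d) (B : 'I_M -> 'M[C]_m),
    injective v /\ forall z, nzv z -> F z = \sum_i mon z (v i) *: B i.
Proof.
move=> H; have /choice[l Hl] (ij : 'I_m * 'I_m) := H ij.1 ij.2.
pose ws := undup (flatten [seq map snd (l ij) | ij <- enum {: 'I_m * 'I_m}]).
pose B v : 'M[C]_m := \matrix_(i, j) \sum_(u <- l (i, j) | u.2 == v) u.1.
exists (size ws), (fun i => nth 0 ws i), (fun i => B (nth 0 ws i)); split.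
  by move=> i j /eqP; rewrite nth_uniq ?undup_uniq // => /eqP /val_inj.
move=> z nz; rewrite -(big_mkord xpredT (fun i => mon z (nth 0 ws i) *: B (nth 0 ws i))).
rewrite -(big_nth 0 xpredT (fun v => mon z v *: B v)).
apply/matrixP => i j; rewrite (Hl (i, j)) // summxE.
under [RHS]eq_bigr do rewrite mxE mxE mulrC mulr_suml big_mkcond.
rewrite exchange_big /=; apply: eq_big_seq => u ul.
have us : u.2 \in ws.
  rewrite mem_undup; apply/flattenP; exists (map snd (l (i, j))); last exact: map_f.
  by apply/map_f; rewrite mem_enum.
rewrite (bigD1_seq u.2) ?undup_uniq //= eqxx big1 ?addr0 // => v.
by rewrite eq_sym => /negPf->.
Qed.

Section PolyRep.
Variables (n m : nat) (G : set 'M[C]_n) (P dP : 'M[C]_n -> 'M[C]_m).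
Hypothesis cG : closed_subgroup G.
Hypothesis pP : forall i j, pfun (fun A => P A i j) (fun X => dP X i j).
Hypothesis PM : forall g h, G g -> G h -> P (g *m h) = P g *m P h.
Hypothesis P1 : P 1%:M = 1%:M.
Variable A : 'M[C]_m.
Hypothesis AdP : forall X, Lie G X -> A *m dP X = dP X *m A.

(** Along the curve, P is a combination of monomials z^(v k) with matrix coefficients B k, on which
    the derivative D b acts by the scalar [lin b (v k)]. Some b separates two distinct v k, so a
    matrix commuting with every D b commutes with every B k. *)
Lemma comm_semisimple N d (Q : 'I_N -> 'M[C]_n) (a : 'I_N -> 'rV[int]_d) z :
  \sum_i Q i = 1%:M -> (forall i j, Q i *m Q j = if i == j then Q i else 0) ->
  (forall z, nzv z -> G (curve Q a z)) -> nzv z ->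
  A *m P (curve Q a z) = P (curve Q a z) *m A.
Proof.
move=> Q1 QQ SG; move: z.
have [M [v [B [vI FE]]]] : exists (M : nat) (v : 'I_M -> 'rV[int]_d) (B : 'I_M -> 'M[C]_m),
    injective v /\ forall z, nzv z -> P (curve Q a z) = \sum_i mon z (v i) *: B i.
  apply: laurent_matrix => i j; have [p [Hp _]] := pP i j.
  by have [l [Hl _]] := laurent_expand Q a p; exists l => z nz; rewrite -Hp Hl.
have curveM z z' : curve Q a (fun i => z i * z' i) = curve Q a z *m curve Q a z'.
  by rewrite (dsumM QQ); apply: eq_bigr => i _; rewrite mon_mull.
have n1 : nzv (fun _ : 'I_d => 1 : C) by move=> i; exact: oner_neq0.
have B1 : \sum_i B i = 1%:M.
  rewrite -P1 -Q1; have := FE _ n1; under eq_bigr do rewrite mon_one scale1r.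
  by move=> <-; congr P; apply: eq_bigr => i _; rewrite mon_one scale1r.
have pick1 (E : 'I_M -> 'M[C]_m) k : \sum_i (v i == v k)%:R *: E i = E k.
  rewrite (bigD1 k) //= eqxx scale1r big1 ?addr0 // => i ne.
  by rewrite (inj_eq vI) (negPf ne) scale0r.
have BF z k : nzv z -> B k *m P (curve Q a z) = mon z (v k) *: B k /\
    P (curve Q a z) *m B k = mon z (v k) *: B k.
  move=> nz; have mz (z' : 'I_d -> C) : nzv z' -> nzv (fun i => z' i * z i).
    by move=> nz' i; rewrite mulf_neq0.
  have PE z' : nzv z' -> P (curve Q a (fun i => z' i * z i)) = \sum_i mon z' (v i) *: (mon z (v i) *: B i).
    move=> nz'; rewrite FE; last exact: mz.
    by apply: eq_bigr => i _; rewrite mon_mull scalerA.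
  split.
    have := @mon_functional2 R 'I_M 'I_M d v v m m (fun i => B i *m P (curve Q a z))
      (fun i => mon z (v i) *: B i) _ (fun w => (w == v k)%:R).
    rewrite (pick1 (fun i => B i *m P (curve Q a z))) (pick1 (fun i => mon z (v i) *: B i)); apply=> z' nz'.
    have E := PE z' nz'; rewrite curveM (PM (SG _ nz') (SG _ nz)) (FE z' nz') mulmx_suml in E.
    by rewrite -E; apply: eq_bigr => i _; rewrite scalemxAl.
  have := @mon_functional2 R 'I_M 'I_M d v v m m (fun i => P (curve Q a z) *m B i)
    (fun i => mon z (v i) *: B i) _ (fun w => (w == v k)%:R).
  rewrite (pick1 (fun i => P (curve Q a z) *m B i)) (pick1 (fun i => mon z (v i) *: B i)); apply=> z' nz'.
  have E := PE z' nz'.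
  have zz : (fun i => z' i * z i) = (fun i => z i * z' i) by apply: funext => i; rewrite mulrC.
  rewrite zz curveM (PM (SG _ nz) (SG _ nz')) (FE z' nz') mulmx_sumr in E.
  by rewrite -E; apply: eq_bigr => i _; rewrite scalemxAr.
pose D b := \sum_i lin b (v i) *: B i.
have DE b : dP (\sum_i lin b (a i) *: Q i) = D b.
  apply/matrixP => i j; pose l := [seq (B k i j, v k) | k <- index_enum 'I_M].
  rewrite (@laurent_pfun R n d N Q a _ _ l Q1 (pP i j) _ (lin b)).
    by rewrite big_map summxE; apply: eq_bigr => k _; rewrite mxE mulrC.
  by move=> z nz; rewrite FE // big_map summxE; apply: eq_bigr => k _; rewrite mxE mulrC.
have LD b : Lie G (\sum_i lin b (a i) *: Q i) by exact: (lie_curve Q1 SG (lin b)).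
have BD b k : B k *m D b = lin b (v k) *: B k /\ D b *m B k = lin b (v k) *: B k.
  split.
    have := @mon_functional2 R 'I_M 'I_1 d v (fun=> v k) m m (fun i => B k *m B i) (fun=> B k) _ (lin b).
    rewrite big_ord1 => <-; first by rewrite mulmx_sumr; apply: eq_bigr => i _; rewrite scalemxAr.
    move=> z nz; rewrite big_ord1 -(BF z k nz).1 FE // mulmx_sumr.
    by apply: eq_bigr => i _; rewrite scalemxAr.
  have := @mon_functional2 R 'I_M 'I_1 d v (fun=> v k) m m (fun i => B i *m B k) (fun=> B k) _ (lin b).
  rewrite big_ord1 => <-; first by rewrite mulmx_suml; apply: eq_bigr => i _; rewrite scalemxAl.
  move=> z nz; rewrite big_ord1 -(BF z k nz).2 FE // mulmx_suml.
  by apply: eq_bigr => i _; rewrite scalemxAl.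
have BAB k l : k != l -> B k *m A *m B l = 0.
  move=> kl; apply/eqP/negPn/negP => nz; move/eqP: kl; apply; apply: vI; apply: lin_inj => b.
  have E : D b *m A = A *m D b by rewrite -DE AdP //; exact: LD.
  have : B k *m (D b *m A) *m B l = B k *m (A *m D b) *m B l by rewrite E.
  rewrite mulmxA (BD b k).1 -!mulmxA (BD b l).2 -scalemxAl -!scalemxAr => /eqP.
  by rewrite mulmxA -subr_eq0 -scalerBl scaler_eq0 (negPf nz) orbF subr_eq0 => /eqP.
have AB k : A *m B k = B k *m A.
  transitivity (B k *m A *m B k).
    rewrite -[A in LHS]mul1mx -B1 !mulmx_suml (bigD1 k) //= big1 ?addr0 // => l lk.
    exact: BAB.
  rewrite -[A in RHS]mulmx1 -B1 !mulmx_sumr (bigD1 k) //= mulmxA big1 ?addr0 // => l lk.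
  by rewrite mulmxA BAB // eq_sym.
move=> z nz; rewrite FE // mulmx_sumr mulmx_suml; apply: eq_bigr => k _.
by rewrite -scalemxAr -scalemxAl AB.
Qed.

(** F x = P ((1 + Y)^x) is a polynomial one-parameter group, by extension of its addition law from
    natural numbers. Its derivative is F times the image of log (1 + Y), so the commutator of A with
    F solves a linear differential equation with initial value 0, and its coefficients vanish one
    after another. *)
Lemma comm_unipotent Y J : Y ^+ J.+1 = 0 -> G (1%:M + Y) -> A *m P (1%:M + Y) = P (1%:M + Y) *m A.
Proof.
move=> YJ GY; have [GB LN] := group_bin cG YJ GY; set Nn := \sum_(j < _) _ in LN.
have [f Hf] := binY_evpm J Y.
have /choice[q Hq] (ij : 'I_m * 'I_m) : exists q : {poly C},
    (forall x, q.[x] = P (binY J Y x) ij.1 ij.2) /\ q^`().[0] = dP Nn ij.1 ij.2.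
  have [p [Hp1 Hp2]] := pP ij.1 ij.2.
  pose Q (i : 'I_1) : 'M[C]_n := 1%:M.
  have Q1 : \sum_i Q i = 1%:M by rewrite big_ord1.
  have [l Hl Hl'] := fam_expand J.+1 (wbin R) (fun (i : 'I_1) j => Q i *m Y ^+ j) p.
  have n1 : nzv (fun _ : 'I_1 => 1 : C) by move=> i; exact: oner_neq0.
  exists (\sum_(u <- l) u.1); split=> [x|].
    rewrite -Hp1 -[binY J Y x](fam_one J Y Q1 (wbin R) x) Hl // horner_sum; apply: eq_bigr => u _.
    by rewrite mon_one mul1r.
  have := Hl' (fun=> 0) 1 (fun=> 1) 0 n1.
  rewrite fam_at0 ?wbin0 ?dfam_at0 ?wbin0 //; try exact: wbin_at0.
  rewrite big_ord1 scale1r big_ord1 scale0r add0r scale1r Hp2 => ->.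
  rewrite raddf_sum horner_sum; apply: eq_bigr => u _ /=.
  by rewrite mon_one !mul1r /lin big_ord1 mulr0 mul0r add0r.
pose F x := P (binY J Y x).
have addx x y : F (x + y) = F x *m F y.
  have nat_add (k l : nat) : F (k%:R + l%:R) = F k%:R *m F l%:R.
    have E i : binY J Y i%:R = (1%:M + Y) ^+ i := binY_nat YJ i.
    by rewrite /F -PM // -natrD !E exprD.
  have poly_ext (g h : C -> C) : (exists q1 : {poly C}, forall x, g x = q1.[x]) ->
      (exists q2 : {poly C}, forall x, h x = q2.[x]) -> (forall k : nat, g k%:R = h k%:R) -> forall x, g x = h x.
    move=> [q1 E1] [q2 E2] E3 x'; rewrite E1 E2; congr horner; apply/eqP; rewrite -subr_eq0.
    by apply/eqP/poly0_nat => k; rewrite hornerD hornerN -E1 -E2 E3 subrr.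
  have FE i j x' : F x' i j = (q (i, j)).[x'] by rewrite (Hq (i, j)).1.
  apply/matrixP => i j.
  apply: (poly_ext (fun y => F (x + y) i j) (fun y => (F x *m F y) i j)) => [||l].
  - by exists (q (i, j) \Po ('X + x%:P)) => y'; rewrite FE horner_comp !hornerE addrC.
  - exists (\sum_k (F x i k) *: q (k, j)) => y'; rewrite mxE horner_sum; apply: eq_bigr => k _.
    by rewrite hornerZ -FE.
  apply: (poly_ext (fun x => F (x + l%:R) i j) (fun x => (F x *m F l%:R) i j)) => [||k].
  - by exists (q (i, j) \Po ('X + l%:R%:P)) => y'; rewrite FE horner_comp !hornerE.
  - exists (\sum_k (F l%:R k j) *: q (i, k)) => y'; rewrite mxE horner_sum; apply: eq_bigr => k _.
    by rewrite hornerZ -FE mulrC.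
  by rewrite nat_add.
have dq i j x : (q (i, j))^`().[x] = (F x *m dP Nn) i j.
  have E : q (i, j) \Po ('X + x%:P) = \sum_k (F x i k) *: q (k, j).
    apply/eqP; rewrite -subr_eq0; apply/eqP/poly0_nat => k.
    have -> : (q (i, j) \Po ('X + x%:P) - \sum_k F x i k *: q (k, j)).[k%:R] =
       (F x *m F k%:R) i j - (\sum_k F x i k *: q (k, j)).[k%:R].
      by rewrite hornerD hornerN horner_comp !hornerE (Hq (i, j)).1 -/(F _) (addrC _ x) addx.
    rewrite mxE horner_sum -sumrB big1 // => l _.
    by rewrite hornerZ (Hq (l, j)).1 subrr.
  have := congr1 (fun p => p^`().[0]) E; rewrite deriv_comp !hornerE horner_comp !hornerE.
  rewrite derivD derivX derivC addr0 hornerC mulr1 => ->.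
  rewrite raddf_sum horner_sum mxE; apply: eq_bigr => k _ /=.
  by rewrite derivZ hornerZ (Hq (k, j)).2.
pose h i j := \sum_k (A i k *: q (k, j) - A k j *: q (i, k)).
have hE i j x : (h i j).[x] = (A *m F x - F x *m A) i j.
  rewrite horner_sum !mxE -sumrB; apply: eq_bigr => k _.
  by rewrite hornerD hornerN !hornerZ (Hq (k, j)).1 (Hq (i, k)).1 (mulrC (A k j)).
have AN : A *m dP Nn = dP Nn *m A by exact: AdP.
have dh i j : (h i j)^`() = \sum_k dP Nn k j *: h i k.
  apply/eqP; rewrite -subr_eq0; apply/eqP/poly0_nat => l; rewrite hornerD hornerN.
  move: (l%:R : C) => x.
  have -> : (h i j)^`().[x] = (A *m (F x *m dP Nn) - (F x *m dP Nn) *m A) i j.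
    rewrite /h raddf_sum horner_sum !mxE -sumrB; apply: eq_bigr => k _ /=.
    by rewrite derivB !derivZ hornerD hornerN !hornerZ !dq (mulrC (A k j)).
  have -> : (\sum_k dP Nn k j *: h i k).[x] = ((A *m F x - F x *m A) *m dP Nn) i j.
    by rewrite horner_sum mxE; apply: eq_bigr => k _; rewrite hornerZ hE mulrC.
  by rewrite mulmxBl -(mulmxA (F x)) -AN !mulmxA subrr.
clearbody h.
have h0 k : forall i j, (h i j)`_k = 0.
  elim: k => [|k IH] i j.
    by rewrite -horner_coef0 hE /F binY0 P1 mulmx1 mul1mx subrr mxE.
  have := congr1 (fun p : {poly C} => p`_k) (dh i j); rewrite coef_deriv coef_sum => /eqP.
  rewrite [X in _ == X]big1 => [|l _]; last by rewrite coefZ IH mulr0.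
  by rewrite mulrn_eq0 => /eqP.
have bin1 : binY J Y 1 = 1%:M + Y by have := binY_nat YJ 1; rewrite expr1.
apply/eqP; rewrite -subr_eq0 -bin1; apply/eqP/matrixP => i j; rewrite -hE mxE.
have -> : h i j = 0 by apply/polyP => k; rewrite h0 coef0.
by rewrite horner0.
Qed.
End PolyRep.

Section RationalRep.
Variables (n m : nat) (G T : set 'M[C]_n) (r : nat) (e : 'I_r -> 'M[C]_n -> C).
Variable rho : 'M[C]_n -> 'M[C]_m.
Hypothesis cG : closed_subgroup G.
Hypothesis rhoG : alg_rep G rho.
Let sG : subgroup_GL G. Proof. by case: cG. Qed.

Lemma rep1 : rho 1%:M = 1%:M.
Proof.
have [r1 rM _] := rhoG; have [_ G1 _ _] := sG.
have u := r1 _ G1; have := rM _ _ G1 G1; rewrite mulmx1 => E.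
by rewrite -[LHS](mulKmx u) -E mulVmx.
Qed.

Lemma rep_polynomial : exists (d : nat) (P dP : 'M[C]_n -> 'M[C]_m),
  (forall i j, pfun (fun A => P A i j) (fun X => dP X i j)) /\
  forall g, G g -> P g = \det g ^+ d *: rho g.
Proof.
have [r1 rM rr] := rhoG.
have /choice[pk Hpk] (ij : 'I_m * 'I_m) : exists pk : {mpoly C[n * n]} * nat,
    forall g, G g -> rho g ij.1 ij.2 = mxeval pk.1 g / \det g ^+ pk.2.
  by have [p [k H]] := rr ij.1 ij.2; exists (p, k).
pose d := (\sum_ij (pk ij).2)%N.
have [dF [q [Hq _]]] := @isp_det R n.
pose pp ij := (pk ij).1 * q ^+ (d - (pk ij).2).
exists d, (fun A => \matrix_(i, j) mxeval (pp (i, j)) A), (fun X => \matrix_(i, j) dird (pp (i, j)) 1%:M X).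
split=> [i j|g Gg]; first by apply: pfun_ext (pfun_mxeval (pp (i, j))) => A; rewrite mxE.
have d0 : \det g != 0 by have := G_unit sG Gg; rewrite unitmxE unitfE.
apply/matrixP => i j; rewrite !mxE (Hpk (i, j)) // /pp /mxeval mevalM rmorphXn /=.
rewrite -!/(mxeval _ _) Hq.
have kd : ((pk (i, j)).2 <= d)%N by rewrite /d (bigD1 (i, j)) //= leq_addr.
by rewrite -{2}(subnK kd) exprD; field; rewrite expf_neq0.
Qed.

(** The representation is twisted by det^d to make it polynomial, and the scalar derivative of det^d
    is subtracted afterwards. That scalar vanishes on brackets and is invariant under conjugation,
    so the correction disturbs neither identity. *)
Lemma rep_derivative : exists drho : 'M[C]_n -> 'M[C]_m,
  [/\ forall a X Y, drho (a *: X + Y) = a *: drho X + drho Y,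
      forall g X, G g -> Lie G X -> rho g *m drho X = drho (g *m X *m invmx g) *m rho g,
      forall X Y, Lie G X -> Lie G Y -> drho (br X Y) = br (drho X) (drho Y) &
      forall N (chi : 'I_N -> 'rV[int]_r) (P : 'I_N -> 'M[C]_n) M (mu : 'I_M -> 'rV[int]_r) Q,
        \sum_i P i = 1%:M -> (forall i j, P i *m P j = if i == j then P i else 0) ->
        (forall z, nzv z -> G (curve P chi z) /\ rho (curve P chi z) = curve Q mu z) ->
        forall x, drho (Hx chi P x) = Hx mu Q x] /\
  forall A, (forall X, Lie G X -> A *m drho X = drho X *m A) ->
  [/\ forall N d (Q : 'I_N -> 'M[C]_n) (a : 'I_N -> 'rV[int]_d) z,
        \sum_i Q i = 1%:M -> (forall i j, Q i *m Q j = if i == j then Q i else 0) ->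
        (forall z, nzv z -> G (curve Q a z)) -> nzv z ->
        A *m rho (curve Q a z) = rho (curve Q a z) *m A &
      forall Y J, Y ^+ J.+1 = 0 -> G (1%:M + Y) -> A *m rho (1%:M + Y) = rho (1%:M + Y) *m A].
Proof.
have [d [P [dP [pP PE]]]] := rep_polynomial; have [r1 rM rr] := rhoG; have [_ G1 GM _] := sG.
have PM g h : G g -> G h -> P (g *m h) = P g *m P h.
  by move=> Gg Gh; rewrite !PE ?rM //; [rewrite det_mulmx exprMn -scalemxAl -scalemxAr scalerA | exact: GM].
have P1 : P 1%:M = 1%:M by rewrite PE // det1 expr1n scale1r rep1.
have [dD HD] := isp_exp d (@isp_det R n).
pose D (A : 'M[C]_n) : 'M[C]_1 := (\det A ^+ d)%:M.
pose dD' X : 'M[C]_1 := (dD X)%:M.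
have pD i j : pfun (fun A => D A i j) (fun X => dD' X i j).
  by apply: pfun_ext HD => A; rewrite !ord1 mxE eqxx mulr1n.
have DM g h : G g -> G h -> D (g *m h) = D g *m D h.
  by move=> _ _; rewrite /D det_mulmx exprMn scalar_mxM.
have D1 : D 1%:M = 1%:M by rewrite /D det1 expr1n.
have det0 g : G g -> \det g ^+ d != 0.
  by move=> Gg; rewrite expf_neq0 //; have := G_unit sG Gg; rewrite unitmxE unitfE.
have dDconj g X : G g -> Lie G X -> dD (g *m X *m invmx g) = dD X.
  move=> Gg LX; have := dP_conj sG pD DM Gg LX => /(congr1 (fun M : 'M_1 => M 0 0)).
  rewrite !mxE !big_ord1 !mxE !eqxx !mulr1n mulrC => E.
  by apply: (mulIf (det0 g Gg)).
have dDbr X Y : Lie G X -> Lie G Y -> dD (br X Y) = 0.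
  move=> LX LY; have := dP_bracket pD DM LX LY => /(congr1 (fun M : 'M_1 => M 0 0)).
  by rewrite /dD' !mxE !big_ord1 !mxE eqxx mulr1n mulrC subrr.
exists (fun X => dP X - dD X *: 1%:M); split; first split.
- move=> a X Y; rewrite (dP_lin pP) (pfun_lin _ _ _ HD) scalerBr scalerA.
  by rewrite scalerDl opprD addrACA.
- move=> g X Gg LX; rewrite mulmxBr mulmxBl dDconj // -scalemxAr -scalemxAl mulmx1 mul1mx.
  congr (_ - _); apply: (scalerI (det0 g Gg)); rewrite scalemxAl -PE // (dP_conj sG pP PM) //.
  by rewrite PE // scalemxAr.
- move=> X Y LX LY; rewrite (dP_bracket pP PM) // dDbr // scale0r subr0.
  rewrite !mulmxBl !mulmxBr -!scalemxAl -!scalemxAr !mulmx1 !mul1mx.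
  move: (dP X *m dP Y) (dP Y *m dP X) (dP X) (dP Y) (1%:M : 'M[C]_m) => u v w t o.
  by apply/matrixP => i j; rewrite !mxE; ring.
- move=> N chi K M mu Q K1 KK Hc x.
  have n1 : nzv (fun _ : 'I_r => 1 : C) by move=> i; exact: oner_neq0.
  have Q1 : \sum_i Q i = 1%:M.
    have [_] := Hc _ n1; have -> : curve K chi (fun=> 1) = 1%:M.
      by rewrite -K1; apply: eq_bigr => i _; rewrite mon_one scale1r.
    by rewrite rep1 => ->; apply: eq_bigr => i _; rewrite mon_one scale1r.
  have [w Hw] : exists w, forall z, nzv z -> \det (curve K chi z) = mon z w.
    have [dF [q [Hq _]]] := @isp_det R n; have [l [Hl _]] := laurent_expand K chi q.
    apply: (@laurent_mult_mon _ _ _ l) => [z nz|z z' nz nz'|z nz].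
    - by rewrite -Hl // Hq.
    - rewrite -det_mulmx (dsumM KK); congr (\det _).
      by apply: eq_bigr => i _; rewrite mon_mull.
    - by have := G_unit sG (Hc z nz).1; rewrite unitmxE unitfE.
  have dDH : dD (Hx chi K x) = lin x (w *+ d).
    have := @laurent_pfun R n r N K chi _ _ [:: (1, w *+ d)] K1 HD _ (lin x).
    by rewrite big_seq1 mul1r => <- // z nz; rewrite big_seq1 mul1r Hw // monMn.
  have dPH : dP (Hx chi K x) = \sum_i lin x (mu i + w *+ d) *: Q i.
    apply/matrixP => i j; pose l := [seq (Q k i j, mu k + w *+ d) | k <- index_enum 'I_M].
    have := @laurent_pfun R n r N K chi _ _ l K1 (pP i j) _ (lin x); rewrite big_map summxE => ->.
      by apply: eq_bigr => k _; rewrite mxE mulrC.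
    move=> z nz; have [Gc rc] := Hc z nz; rewrite PE // rc Hw // -monMn // mxE big_map summxE mulr_sumr.
    by apply: eq_bigr => k _; rewrite mxE monD //=; ring.
  rewrite dDH dPH -Q1 scaler_sumr -sumrB; apply: eq_bigr => k _.
  by rewrite -scalerBl linD addrK.
move=> A HA; have AdP X : Lie G X -> A *m dP X = dP X *m A.
  move=> LX; have := HA X LX; rewrite mulmxBr mulmxBl -scalemxAr -scalemxAl mulmx1 mul1mx.
  by move/addIr.
split=> [N d' Q a z Q1 QQ SG nz|Y J YJ GY].
  have := comm_semisimple pP PM P1 AdP Q1 QQ SG nz; rewrite PE; last exact: SG.
  by rewrite -scalemxAr -scalemxAl => /(scalerI (det0 _ (SG _ nz))).
have := comm_unipotent cG pP PM P1 AdP YJ GY; rewrite PE //.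
by rewrite -scalemxAr -scalemxAl => /(scalerI (det0 _ GY)).
Qed.
End RationalRep.
End RepDerivative.

(** * Matrices commuting with the Lie algebra commute with the group *)

Section HilbertBasis.

Definition lspan (A : comNzRingType) (f : nat -> A) N (x : A) :=
  exists c : nat -> A, x = \sum_(i < N) c i * f i.
(** The ascending chain condition for the ideals generated by initial segments of a sequence, stated
    without ideals. *)
Definition noeth (A : comNzRingType) := forall f : nat -> A, exists N, lspan f N (f N).

Lemma noeth_field (F : fieldType) : noeth F.
Proof.
move=> f; have [f0|f0] := eqVneq (f 0%N) 0; first by exists 0, (fun=> 0); rewrite f0 big_ord0.
by exists 1, (fun=> f 1 / f 0); rewrite big_ord1 mulfVK.
Qed.
Lemma noeth_surj (A B : comNzRingType) (phi : {rmorphism A -> B}) :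
  (forall b, exists a, phi a = b) -> noeth A -> noeth B.
Proof.
move=> /choice[psi Hpsi] nA f; have [N [c E]] := nA (fun i => psi (f i)).
exists N, (fun i => phi (c i)); rewrite -{1}(Hpsi (f N)) E rmorph_sum.
by apply: eq_bigr => i _; rewrite rmorphM /= Hpsi.
Qed.
Lemma sequence_of (B : Type) (next : seq B -> B) :
  exists g : nat -> B, forall k, g k = next (mkseq g k).
Proof.
pose L k := iter k (fun s => rcons s (next s)) [::]; exists (fun k => next (L k)) => k.
congr next; elim: k => //= k IH.
by rewrite mkseqS -IH.
Qed.

Lemma mkseq_mem (B : eqType) (g : nat -> B) k y : y \in mkseq g k -> exists2 i, (i < k)%N & y = g i.
Proof. by case/seq.mapP=> i; rewrite mem_iota add0n => ik ->; exists i. Qed.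

(** Hilbert's argument: in the ideal I generated by f, let g k be of least size outside the span of
    its predecessors. A relation between leading coefficients yields [g'], still outside that span
    but of smaller size. *)
Lemma noeth_poly (A : comNzRingType) : noeth A -> noeth {poly A}.
Proof.
move=> nA f; apply: contrapT => H.
have {}H N (c : nat -> {poly A}) : f N <> \sum_(i < N) c i * f i by move=> E; apply: H; exists N, c.
pose I x := exists N, lspan f N x.
have I0 : I 0 by exists 0, (fun=> 0); rewrite big_ord0.
have widen N M x : (N <= M)%N -> lspan f N x -> lspan f M x.
  move=> NM [c ->]; exists (fun i => if (i < N)%N then c i else 0).
  rewrite (sum_ord_trunc (F := fun i => (if (i < N)%N then c i else 0) * f i) NM).
    by apply: eq_bigr => i _; rewrite ltn_ord.
  by move=> i; rewrite leqNgt => /negPf->; rewrite mul0r.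
have ID x y : I x -> I y -> I (x + y).
  move=> [N Hx] [M Hy]; have [c ->] := widen _ _ _ (leq_maxl N M) Hx.
  have [d ->] := widen _ _ _ (leq_maxr N M) Hy; exists (maxn N M), (fun i => c i + d i).
  by rewrite -big_split; apply: eq_bigr => i _; rewrite mulrDl.
have IM a x : I x -> I (a * x).
  move=> [N [c ->]]; exists N, (fun i => a * c i).
  by rewrite mulr_sumr; apply: eq_bigr => i _; rewrite mulrA.
have If i : I (f i).
  exists i.+1, (fun j => (j == i)%:R); rewrite big_ord_recr /= eqxx mul1r big1 ?add0r // => j _.
  by rewrite ltn_eqF ?mul0r.
have sumI N (c : nat -> {poly A}) (g : nat -> {poly A}) : (forall i, (i < N)%N -> I (g i)) ->
    I (\sum_(i < N) c i * g i).
  by move=> Hg; elim/big_rec: _ => [|i x _ Ix] //; apply: ID => //; apply/IM/Hg.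
pose sp (s : seq {poly A}) x := lspan (fun i => nth 0 s i) (size s) x.
have /choice[next Hnext] (s : seq {poly A}) : exists x, (forall y, y \in s -> I y) ->
    [/\ I x, ~ sp s x & forall y, I y -> ~ sp s y -> (size x <= size y)%N].
  case: (pselect (forall y, y \in s -> I y)) => [Is|nI]; last by exists 0.
  have [x0 Ix0 nx0] : exists2 x, I x & ~ sp s x.
    apply: contrapT => nex.
    have all_s x : I x -> sp s x by move=> Ix; apply: contrapT => nsx; apply: nex; exists x.
    have [N HN] : exists N, forall y, y \in s -> lspan f N y.
      elim: s Is {nex all_s} => [|y s IH] Is; first by exists 0.
      have [|N HN] := IH; first by move=> z zs; apply: Is; rewrite inE zs orbT.
      have [M HM] := Is y (mem_head _ _); exists (maxn N M) => z.
      rewrite inE => /orP[/eqP->|zs]; first exact: widen (leq_maxr _ _) HM.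
      exact: widen (leq_maxl _ _) (HN _ zs).
    have [c Ec] := all_s _ (If N).
    have /choice[d Hd] (i : 'I_(size s)) : exists d : nat -> {poly A}, nth 0 s i = \sum_(j < N) d j * f j.
      by have [d ->] := HN _ (mem_nth 0 (ltn_ord i)); exists d.
    apply: (H N (fun j => \sum_(i < size s) c i * d i j)); rewrite Ec.
    under eq_bigr do rewrite Hd mulr_sumr; rewrite exchange_big /=; apply: eq_bigr => j _.
    by rewrite mulr_suml; apply: eq_bigr => i _; rewrite mulrA.
  pose Q k := exists x, [/\ I x, ~ sp s x & size x = k].
  have Q0 : Q (size x0) by exists x0.
  have [k [x [Ix nx sx]] kmin] := exists_minimal Q0.
  exists x => _; split=> // y Iy ny; rewrite sx leqNgt; apply/negP => /kmin.
  by apply; exists y.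
have [g Hg] := sequence_of next.
have Ig k : I (g k).
  have [K] := ubnP k; elim: K k => // K IH k; rewrite ltnS => kK.
  have [] // := Hnext (mkseq g k).
    by move=> y yg; have [i ik ->] := mkseq_mem yg; apply: IH; apply: leq_trans ik kK.
  by rewrite -Hg.
have gP k : ~ lspan g k (g k) /\ forall y, I y -> ~ lspan g k y -> (size (g k) <= size y)%N.
  have [|Ik nk mk] := Hnext (mkseq g k); first by move=> y yg; have [i _ ->] := mkseq_mem yg.
  have E y : sp (mkseq g k) y <-> lspan g k y.
    rewrite /sp size_mkseq; split=> -[c ->]; exists c; apply: eq_bigr => i _;
    by rewrite nth_mkseq.
  by rewrite Hg; split=> [/E //|y Iy ny]; apply: mk => // /E.
have [N [c Ec]] := nA (fun k => lead_coef (g k)).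
have gmono i : (i < N)%N -> (size (g i) <= size (g N))%N.
  move=> iN; apply: (gP i).2 => // -[d E]; apply: (gP N).1.
  exists (fun j => if (j < i)%N then d j else 0); rewrite E.
  rewrite [RHS](sum_ord_trunc (F := fun j => (if (j < i)%N then d j else 0) * g j) (ltnW iN)).
    by apply: eq_bigr => j _; rewrite ltn_ord.
  by move=> j; rewrite leqNgt => /negPf->; rewrite mul0r.
pose d i := (c i)%:P * 'X^(size (g N) - size (g i)).
pose g' := g N - \sum_(i < N) d i * g i.
have Ig' : I g'.
  rewrite /g' -mulN1r -[g N]addr0 addrC; apply: ID; last by rewrite addr0.
  by apply: IM; apply: sumI => i _.
have nsg' : ~ lspan g N g'.
  move=> [b E]; apply: (gP N).1; exists (fun i => b i + d i).
  under eq_bigr do rewrite mulrDl; rewrite big_split /= -E /g'.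
  by rewrite subrK.
have := (gP N).2 _ Ig' nsg'; rewrite leqNgt => /negP; apply.
have gN0 : g N != 0.
  by apply/eqP => E; apply: (gP N).1; exists (fun=> 0); rewrite E big1 // => i _; rewrite mul0r.
have s0 : (0 < size (g N))%N by rewrite size_poly_gt0.
rewrite -(prednK s0) ltnS; apply/leq_sizeP => j; rewrite leq_eqVlt => /orP[/eqP<-|jN].
  rewrite coefB -lead_coefE Ec coef_sum; apply/eqP; rewrite subr_eq0; apply/eqP.
  apply: eq_bigr => i _; rewrite /d -mulrA coefCM coefXnM; congr (_ * _).
  have gi := gmono _ (ltn_ord i).
  have [E|gi0] := eqVneq (g i) 0; first by rewrite E lead_coef0 coef0; case: ifP.
  have si : (0 < size (g i))%N by rewrite size_poly_gt0.
  rewrite ifN -?leqNgt; first by rewrite lead_coefE; congr nth; move: gi si s0; lia.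
  by move: gi si s0; lia.
rewrite coefB nth_default ?sub0r; last by rewrite -(prednK s0).
apply/eqP; rewrite oppr_eq0 coef_sum; apply/eqP; rewrite big1 // => i _.
rewrite /d -mulrA coefCM coefXnM; case: ifP => _; first by rewrite mulr0.
have ar a b : (0 < b -> a <= b -> b.-1 < j -> a <= j - (b - a))%N by lia.
by rewrite nth_default ?mulr0 //; apply: ar => //; apply: gmono.
Qed.

Lemma noeth_mpoly (F : fieldType) n : noeth {mpoly F[n]}.
Proof.
suff /(_ n (leqnn n)) [A [phi [nA H]]] : forall k, (k <= n)%N ->
    exists (A : comNzRingType) (phi : {rmorphism A -> {mpoly F[n]}}), noeth A /\
    ((forall c, exists a, phi a = c%:MP) /\ forall i : 'I_n, (i < k)%N -> exists a, phi a = 'X_i).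
  apply: (noeth_surj (phi := phi)) => // p.
  elim/mpoly_ring_ind: p => [c|i|p q [a <-] [b <-]|p q [a <-] [b <-]].
  - exact: H.1.
  - exact: H.2.
  - by exists (a + b); rewrite rmorphD.
  - by exists (a * b); rewrite rmorphM.
elim=> [_|k IH kn].
  exists F, (@mpolyC n F : {rmorphism F -> {mpoly F[n]}}); split; first exact: noeth_field.
  by split=> // c; exists c.
have [A [phi [nA [H1 H2]]]] := IH (ltnW kn).
have cfu : commr_rmorph phi ('X_(Ordinal kn) : {mpoly F[n]}) by move=> x; rewrite /GRing.comm mulrC.
exists {poly A}, (horner_morph cfu); split; first exact: noeth_poly.
split=> [c|i]; first by have [a <-] := H1 c; exists a%:P; rewrite /= horner_morphC.
rewrite ltnS leq_eqVlt => /orP[/eqP ik|ik].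
  by exists 'X; rewrite /= horner_morphX; congr 'X_(_); apply: val_inj.
by have [a <-] := H2 i ik; exists a%:P; rewrite /= horner_morphC.
Qed.

Lemma finite_zero_set (F : fieldType) n (S : {mpoly F[n]} -> Prop) :
  exists2 s : seq {mpoly F[n]}, (forall p, p \in s -> S p) &
    forall v, (forall p, p \in s -> p.@[v] = 0) -> forall p, S p -> p.@[v] = 0.
Proof.
apply: contrapT => H.
have /choice[next Hnext] (s : seq {mpoly F[n]}) : exists p, (forall q, q \in s -> S q) ->
    S p /\ exists2 v, (forall q, q \in s -> q.@[v] = 0) & p.@[v] != 0.
  case: (pselect (forall q, q \in s -> S q)) => [Ss|nS]; last by exists 0.
  apply: contrapT => nex; apply: H; exists s => // v Hv p Sp.
  by apply/eqP/negPn/negP => pv; apply: nex; exists p => _; split=> //; exists v.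
have [g Hg] := sequence_of next.
have Sg k : S (g k).
  have [K] := ubnP k; elim: K k => // K IH k; rewrite ltnS => kK.
  have [] // := Hnext (mkseq g k).
    by move=> y yg; have [i ik ->] := mkseq_mem yg; apply: IH; apply: leq_trans ik kK.
  by rewrite -Hg.
have [N [c E]] := noeth_mpoly g.
have [|_ [v Hv]] := Hnext (mkseq g N); first by move=> q qg; have [i _ ->] := mkseq_mem qg.
rewrite -Hg E rmorph_sum big1 ?eqxx // => i _.
have gi : g i \in mkseq g N by apply: (seq.map_f g); rewrite mem_iota add0n ltn_ord.
by rewrite rmorphM /= (Hv _ gi) mulr0.
Qed.
End HilbertBasis.

(** * Definable sets of values and bounded regular functions *)

Section BoundedRegular.
Variable R : realType.
Local Notation C := R[i].

(** An equation in one variable holds everywhere or at finitely many points, so a Boolean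
    combination of equations is constant off a finite set. *)
Lemma qf_finite (f : GRing.formula C) : GRing.qf_form f -> GRing.rformula f ->
  exists (s : seq C) (b : bool), forall c, c \notin s -> GRing.qf_eval [:: c] f = b.
Proof.
have term t : GRing.rterm t -> exists p : {poly C}, forall c, GRing.eval [:: c] t = p.[c].
  elim: t => //=.
  - move=> [|i] _; first by exists 'X => c; rewrite hornerX.
    by exists 0 => c; rewrite horner0 nth_default.
  - by move=> x _; exists x%:P => c; rewrite hornerC.
  - by move=> k _; exists k%:R%:P => c; rewrite hornerC.
  - move=> t1 IH1 t2 IH2 /andP[/IH1[p Hp] /IH2[q Hq]].
    by exists (p + q) => c; rewrite hornerD Hp Hq.
  - by move=> t IH /IH[p Hp]; exists (- p) => c; rewrite hornerN Hp.
  - by move=> t IH k /IH[p Hp]; exists (p *+ k) => c; rewrite hornerMn Hp.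
  - move=> t1 IH1 t2 IH2 /andP[/IH1[p Hp] /IH2[q Hq]].
    by exists (p * q) => c; rewrite hornerM Hp Hq.
  - by move=> t IH k /IH[p Hp]; exists (p ^+ k) => c; rewrite horner_exp Hp.
elim: f => //=.
- by move=> b _ _; exists [::], b.
- move=> t1 t2 _ /andP[/term[p Hp] /term[q Hq]].
  have [E|nz] := eqVneq (p - q) 0.
    exists [::], true => c _; rewrite Hp Hq; apply/eqP.
    by move/eqP: E; rewrite subr_eq0 => /eqP->.
  have [rs Hrs] := closed_field_poly_normal (p - q).
  exists rs, false => c cs; rewrite Hp Hq -subr_eq0 -hornerN -hornerD Hrs hornerZ.
  apply/negbTE; rewrite mulf_neq0 ?lead_coef_eq0 //.
  by have := root_prod_XsubC rs c; rewrite (negPf cs) rootE => ->.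
- move=> f IHf g IHg /andP[qf qg] /andP[rf rg].
  have [s [b Hb]] := IHf qf rf; have [t [b' Hb']] := IHg qg rg.
  exists (s ++ t), (b && b') => c; rewrite mem_cat negb_or => /andP[cs ct].
  by rewrite Hb // Hb'.
- move=> f IHf g IHg /andP[qf qg] /andP[rf rg].
  have [s [b Hb]] := IHf qf rf; have [t [b' Hb']] := IHg qg rg.
  exists (s ++ t), (b || b') => c; rewrite mem_cat negb_or => /andP[cs ct].
  by rewrite Hb // Hb'.
- move=> f IHf g IHg /andP[qf qg] /andP[rf rg].
  have [s [b Hb]] := IHf qf rf; have [t [b' Hb']] := IHg qg rg.
  exists (s ++ t), (b ==> b') => c; rewrite mem_cat negb_or => /andP[cs ct].
  by rewrite Hb // Hb'.
- move=> f IHf qf rf; have [s [b Hb]] := IHf qf rf.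
  by exists s, (~~ b) => c cs; rewrite Hb.
Qed.

(** Variable 0 is reserved for the value of the function, so coordinate l becomes variable l + 1;
    variable K + 1 will be the inverse of q. *)
Lemma mpoly_term K (p : {mpoly C[K]}) : exists t : GRing.term C, GRing.rterm t /\
  forall e, GRing.eval e t = p.@[fun l => nth 0 e l.+1].
Proof.
elim/mpoly_ring_ind: p => [c|l|p q [t [rt Ht]] [u [ru Hu]]|p q [t [rt Ht]] [u [ru Hu]]].
- by exists (GRing.Const c); split=> // e; rewrite mevalC.
- by exists (GRing.Var _ l.+1); split=> // e; rewrite mevalXU.
- by exists (GRing.Add t u); split=> [|e] /=; rewrite ?rt // mevalD Ht Hu.
- by exists (GRing.Mul t u); split=> [|e] /=; rewrite ?rt // mevalM Ht Hu.
Qed.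

(* The set of values is definable, so by elimination of quantifiers it is finite
   or cofinite. *)
Lemma bounded_values K (s : seq {mpoly C[K]}) (f q : {mpoly C[K]}) k (B : nat) :
  (forall v, (forall p, p \in s -> p.@[v] = 0) -> q.@[v] != 0 -> `|f.@[v] / q.@[v] ^+ k| <= B%:R) ->
  exists vs : seq C, forall v, (forall p, p \in s -> p.@[v] = 0) -> q.@[v] != 0 ->
    f.@[v] / q.@[v] ^+ k \in vs.
Proof.
move=> Bd; have /choice[tm Htm] := @mpoly_term K.
pose y := GRing.Var C K.+1.
pose eqs := [seq GRing.Equal (tm p) (GRing.Const 0) | p <- s].
pose body := foldr GRing.And (GRing.And (GRing.Equal (GRing.Mul (tm q) y) (GRing.Const 1))
  (GRing.Equal (GRing.Mul (tm f) (GRing.Exp y k)) (GRing.Var C 0))) eqs.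
pose phi := foldr GRing.Exists body (iota 1 K.+1).
have rphi : GRing.rformula phi.
  have rE (I : seq nat) : GRing.rformula (foldr GRing.Exists body I) = GRing.rformula body.
    by elim: I => //= i I ->.
  rewrite rE /body /eqs; elim: s {Bd rE phi body eqs} => [|p s IH] /=.
    by rewrite !(Htm _).1.
  by rewrite (Htm _).1.
pose qe := GRing.quantifier_elim (@closed_field.ClosedFieldQE.ex_elim C) phi.
have qeP c : reflect (GRing.holds [:: c] phi) (GRing.qf_eval [:: c] qe).
  apply: GRing.quantifier_elim_rformP => //; first exact: closed_field.ClosedFieldQE.wf_ex_elim.
  exact: closed_field.ClosedFieldQE.holds_ex_elim (@complex_acf_axiom R).
have [qq rq] := andP (GRing.quantifier_elim_wf (@closed_field.ClosedFieldQE.wf_ex_elim C) rphi).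
have bodyP e : GRing.holds e body <-> [/\ forall p, p \in s -> p.@[fun l => nth 0 e l.+1] = 0,
    q.@[fun l => nth 0 e l.+1] * nth 0 e K.+1 = 1 &
    f.@[fun l => nth 0 e l.+1] * nth 0 e K.+1 ^+ k = nth 0 e 0].
  rewrite /body /eqs; elim: s {Bd phi body eqs rphi qe qeP qq rq} => [|p s IH] /=.
    by rewrite !(Htm _).2; split=> [[]|[]].
  rewrite (Htm _).2; split=> [[H1 /IH[H2 H3 H4]]|[H1 H2 H3]].
    by split=> // p'; rewrite inE => /orP[/eqP->|/H2].
  split; first by apply: H1; rewrite mem_head.
  by apply/IH; split=> // p' ps; apply: H1; rewrite inE ps orbT.
have phiP c : GRing.holds [:: c] phi <-> exists v, [/\ forall p, p \in s -> p.@[v] = 0,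
    q.@[v] != 0 & f.@[v] / q.@[v] ^+ k = c].
  split=> [/GRing.foldExistsP[e' se /bodyP[H1 H2 H3]]|[v [H1 H2 H3]]].
    have q0 : q.@[fun l => nth 0 e' l.+1] != 0.
      by apply/eqP => E; move: H2; rewrite E mul0r => /eqP; rewrite eq_sym oner_eq0.
    exists (fun l => nth 0 e' l.+1); split=> //.
    have <- : nth 0 e' 0 = c by have /se : 0%N \in [predC iota 1 K.+1] by rewrite !inE mem_iota.
    rewrite -H3; congr (_ * _); rewrite -exprVn; congr (_ ^+ _).
    by apply: (mulfI q0); rewrite mulfV.
  apply/GRing.foldExistsP; exists (c :: rcons [seq v l | l <- enum 'I_K] (q.@[v])^-1).
    move=> [|i] //; rewrite !inE mem_iota => Ki0; have {Ki0} Ki : (K < i)%N by move: Ki0; lia.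
    by rewrite /GRing.same_env /= nth_nil nth_default // size_rcons size_map size_enum_ord.
  have E (l : 'I_K) : nth 0 (c :: rcons [seq v l | l <- enum 'I_K] (q.@[v])^-1) l.+1 = v l :> C.
    rewrite /= nth_rcons size_map size_enum_ord ltn_ord (nth_map l) ?size_enum_ord //.
    by rewrite nth_ord_enum.
  have Ep p : p.@[fun l => nth 0 (c :: rcons [seq v l | l <- enum 'I_K] (q.@[v])^-1) l.+1] = p.@[v].
    by apply: meval_eq => l; exact: E.
  have Ey : nth 0 (c :: rcons [seq v l | l <- enum 'I_K] (q.@[v])^-1) K.+1 = (q.@[v])^-1.
    by rewrite /= nth_rcons size_map size_enum_ord ltnn eqxx.
  apply/bodyP; rewrite !Ep Ey; split=> [p ps||]; first by rewrite Ep H1.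
    by rewrite mulfV.
  by rewrite exprVn H3.
have [vs [b Hb]] := qf_finite qq rq.
(* If the set of values were cofinite, it would contain a natural number larger than the bound B. *)
have b0 : b = false.
  apply/negP => bT; pose big := [seq j%:R : C | j <- iota B.+1 (size vs).+1].
  have : ~~ all (mem vs) big.
    apply/negP => /allP sub; have := @uniq_leq_size _ big vs.
    rewrite size_map size_iota ltnn => E; suff : false by [].
    apply: E => //; rewrite map_inj_uniq ?iota_uniq // => i j /eqP.
    by rewrite eqr_nat => /eqP.
  move=> /allPn[c /mapP[j]]; rewrite mem_iota => /andP[Bj _] -> nvs.
  have := Hb _ nvs; rewrite bT => /qeP/phiP[v [H1 H2 H3]].
  by have := Bd v H1 H2; rewrite H3 normr_nat ler_nat leqNgt Bj.
exists vs => v Hv qv; apply/negPn/negP => nvs; have := Hb _ nvs; rewrite b0 => /negP; apply.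
by apply/qeP/phiP; exists v.
Qed.

Lemma regular_bounded_const n (G : set 'M[C]_n) (tau : 'M[C]_n -> C) (B : nat) :
  closed_subgroup G -> zariski_connected G -> regular G tau -> (forall g, G g -> `|tau g| <= B%:R) ->
  forall g, G g -> tau g = tau 1%:M.
Proof.
move=> [zG sG] conG [f [k Hf]] Bd; have [Sset GE] := zG.
have [s sS Hs] := finite_zero_set (fun p => Sset p).
have [dF [q [Hq _]]] := @isp_det R n.
have G1 : G 1%:M by case: sG.
have mem v : (forall p, p \in s -> p.@[v] = 0) -> q.@[v] != 0 ->
    G (vec_mx (\row_l v l)) /\ tau (vec_mx (\row_l v l)) = f.@[v] / q.@[v] ^+ k.
  move=> Hv qv; have ev p : mxeval p (vec_mx (\row_l v l)) = p.@[v].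
    by rewrite /mxeval vec_mxK; apply: meval_eq => l; rewrite mxE.
  have Gv : G (vec_mx (\row_l v l)).
    rewrite GE; split=> [|p Sp]; first by rewrite /GL /= unitmxE unitfE -Hq ev.
    by rewrite ev; exact: Hs.
  by split=> //; rewrite (Hf _ Gv) -Hq !ev.
have [vs Hvs] : exists vs : seq C, forall v, (forall p, p \in s -> p.@[v] = 0) -> q.@[v] != 0 ->
    f.@[v] / q.@[v] ^+ k \in vs.
  apply: (bounded_values (B := B)) => v Hv qv; have [Gv <-] := mem v Hv qv; exact: Bd.
have det0 g : G g -> \det g != 0.
  by move=> Gg; have := G_unit sG Gg; rewrite unitmxE unitfE.
have tvs g : G g -> tau g \in vs.
  move=> Gg; rewrite Hf // -Hq; apply: Hvs; last by rewrite -/(mxeval q g) Hq det0.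
  by move=> p ps; move: Gg; rewrite GE => -[_]; apply; exact: sS.
pose c1 := tau 1%:M.
pose vs' := [seq c <- vs | c != c1].
pose A : set 'M[C]_n := [set g | G g /\ tau g = c1].
pose B' : set 'M[C]_n := [set g | G g /\ tau g \in vs'].
have pcl (Q : 'M[C]_n -> Prop) p : (forall g, G g -> Q g <-> mxeval p g = 0) ->
    zariski_closed [set g | G g /\ Q g].
  move=> H; apply: zariski_closedI => [g [Gg _]|g ug Hg]; first exact: (G_unit sG Gg).
  have Gg : G g by apply: closed_mem => // p' Vp'; apply: Hg => h [Gh _]; exact: Vp'.
  by split=> //; apply/H => //; apply: Hg => h [Gh /H]; exact.
have tE g c : G g -> (tau g == c) = (mxeval (f - c%:MP * q ^+ k) g == 0).
  move=> Gg; rewrite Hf // /mxeval mevalB mevalM mevalC rmorphXn /= -!/(mxeval _ _) Hq subr_eq0.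
  by rewrite -(inj_eq (mulIf (expf_neq0 k (det0 g Gg)))) divfK // expf_neq0 // det0.
have cA : zariski_closed A.
  apply: (pcl _ (f - c1%:MP * q ^+ k)) => g Gg; split=> [/eqP|/eqP]; first by rewrite tE // => /eqP.
  by rewrite -tE // => /eqP.
have cB : zariski_closed B'.
  apply: (pcl _ (\prod_(c <- vs') (f - c%:MP * q ^+ k))) => g Gg.
  have -> : mxeval (\prod_(c <- vs') (f - c%:MP * q ^+ k)) g = \prod_(c <- vs') mxeval (f - c%:MP * q ^+ k) g.
    by rewrite /mxeval rmorph_prod.
  split=> [tv|/eqP].
    by apply/eqP; rewrite prodf_seq_eq0; apply/hasP; exists (tau g); rewrite //= -tE.
  by rewrite prodf_seq_eq0 => /hasP[c cv /=]; rewrite -tE // => /eqP->.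
have AB : A `|` B' = G.
  apply/seteqP; split=> [g [[]|[]]//|g Gg].
  have [E|ne] := eqVneq (tau g) c1; [by left | right; split=> //].
  by rewrite mem_filter ne tvs.
have dAB : A `&` B' = set0.
  apply/seteqP; split=> // g [[_ E] [_]]; by rewrite mem_filter E eqxx.
have [E|E] := conG A B' cA cB AB dAB; first by have : A 1%:M by []; rewrite E.
by move=> g; rewrite -AB E => -[[]|[]].
Qed.
End BoundedRegular.

(** * Matrices of finite order and the commutant of the Lie algebra *)

Section FiniteOrder.
Variable F : numClosedFieldType.

Lemma finite_order_trace q (S : 'M[F]_q) k : (0 < k)%N -> S ^+ k = 1 -> `|\tr S| <= q%:R.
Proof.
move=> k0 Sk; have [N [s [P [Z [[SE P1 PP [d Zd] _] [_ sroot]]]]]] := jordan S.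
have s1 i : `|s i| = 1.
  have : eigenvalue S (s i) by rewrite eigenvalue_root_char.
  move=> /eigenvalueP[v vS v0]; have vk j : v *m S ^+ j = s i ^+ j *: v.
    elim: j => [|j IH]; first by rewrite !expr0 mulmx1 scale1r.
    by rewrite exprSr mulmxA IH -scalemxAl vS scalerA -exprSr.
  have := vk k; rewrite Sk mulmx1 => /eqP; rewrite eq_sym -subr_eq0 -{2}[v]scale1r -scalerBl.
  rewrite scaler_eq0 (negPf v0) orbF subr_eq0 => /eqP sk.
  apply/eqP; rewrite -(@pexpr_eq1 _ _ k) // -normrX sk normr1 //.
have idP i : P i *m P i = P i by rewrite PP eqxx.
have -> : \tr S = \sum_i s i * (\rank (P i))%:R.
  rewrite {1}SE mxtraceD (mxtrace_nilpotent Zd) addr0 raddf_sum; apply: eq_bigr => i _.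
  by rewrite /= mxtraceZ mxtrace_idempotent.
apply: le_trans (ler_norm_sum _ _ _) _.
under eq_bigr do rewrite normrM s1 mul1r normr_nat -mxtrace_idempotent //.
by rewrite -raddf_sum P1 /= mxtrace1.
Qed.

(** The mean E of the powers of S is a projection onto fixed vectors; its trace q is its rank, so E
    = 1. *)
Lemma finite_order_trace1 q (S : 'M[F]_q) k : (0 < k)%N -> S ^+ k = 1 ->
  (forall j, \tr (S ^+ j) = q%:R) -> S = 1.
Proof.
move=> k0 Sk trS; pose E := k%:R^-1 *: \sum_(j < k) S ^+ j.
have kn0 : k%:R != 0 :> F by rewrite pnatr_eq0 -lt0n.
have SE : S * E = E.
  rewrite -[S * E]/(S *m E) /E -scalemxAr; congr (_ *: _).
  rewrite mulmx_sumr; case: k k0 Sk {E kn0} => // k _ Sk.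
  rewrite big_ord_recr [RHS]big_ord_recl /= -[S *m S ^+ k]/(S * S ^+ k) -exprS Sk expr0 addrC.
  congr (_ + _).
  by apply: eq_bigr => i _; rewrite -[RHS]/(S ^+ i.+1) exprS.
have SjE j : S ^+ j * E = E.
  by elim: j => [|j IH]; rewrite ?expr0 ?mul1r // exprSr -mulrA SE.
have EE : E *m E = E.
  rewrite -[RHS]scale1r -(mulVf kn0) -scalerA {1}/E -scalemxAl; congr (_ *: _).
  rewrite mulmx_suml; under eq_bigr do rewrite -[_ *m _]/(_ * _) SjE.
  by rewrite sumr_const card_ord scaler_nat.
have : \tr E = q%:R.
  rewrite /E mxtraceZ raddf_sum /=; under eq_bigr do rewrite trS.
  by rewrite sumr_const card_ord -(mulr_natl q%:R k) mulrA mulVf // mul1r.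
rewrite mxtrace_idempotent // => /eqP; rewrite eqr_nat => Efull.
have Eu : E \in unitmx by rewrite -row_free_unit.
have E1 : E = 1 by rewrite -[LHS](mulKmx Eu) EE mulVmx.
by move: SE; rewrite E1 mulr1.
Qed.
End FiniteOrder.

Section Commutant.
Variable R : realType.
Local Notation C := R[i].
Local Notation br X Y := (X *m Y - Y *m X).

(** In g = S (1 + Y) the unipotent factor lies in G. The eigenvalues of S may be related by roots of
    unity, so it is S^k, with k from [multiplicative_lattice], that lies on a torus contained in
    G. *)
Lemma group_element_power n (G : set 'M[C]_n) g : closed_subgroup G -> G g ->
  exists N d (P : 'I_N -> 'M[C]_n) (a : 'I_N -> 'rV[int]_d) (tau : 'I_d -> C) Y J k,
  [/\ (0 < k)%N, \sum_i P i = 1%:M, forall i j, P i *m P j = if i == j then P i else 0,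
      (forall z, nzv z -> G (curve P a z)) & nzv tau] /\
  [/\ Y ^+ J.+1 = 0, G (1%:M + Y) & g ^+ k = curve P a tau *m (1%:M + Y) ^+ k].
Proof.
move=> cG Gg; have [_ sG] := cG; have gu := G_unit sG Gg.
have [N [s [P [Z [[gE P1 PP [d0 Zd] sI] [cP sroot]]]]]] := jordan g.
have nzs : nzv s.
  move=> i; apply/eqP => s0; have : eigenvalue g (s i) by rewrite eigenvalue_root_char.
  move=> /eigenvalueP[v vg /negP]; apply; apply/eqP.
  by rewrite -[v](mulmxK gu) vg s0 scale0r mul0mx.
have ZP i : Z *m P i = P i *m Z.
  have gP : g *m P i = P i *m g by apply: cP.
  have SP : (\sum_k s k *: P k) *m P i = P i *m (\sum_k s k *: P k).
    rewrite mulmx_suml mulmx_sumr; apply: eq_bigr => k _.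
    by rewrite -scalemxAl -scalemxAr !PP eq_sym; case: eqP => [->|].
  by have := gP; rewrite {1 2}gE mulmxDl mulmxDr SP => /addrI.
pose Si := \sum_k (s k)^-1 *: P k; pose S := \sum_k s k *: P k.
have SSi : S *m Si = 1%:M.
  rewrite (dsumM PP) -P1; apply: eq_bigr => k _; by rewrite mulfV ?scale1r.
have ZSi : Z *m Si = Si *m Z.
  by rewrite mulmx_suml mulmx_sumr; apply: eq_bigr => k _; rewrite -scalemxAl -scalemxAr ZP.
pose Y := Z *m Si.
have YJ : Y ^+ d0.+1 = 0 by rewrite exprS (nilpotentM Zd ZSi) mulr0.
have YP i : Y *m P i = P i *m Y.
  rewrite /Y mulmxA -ZP -!mulmxA; congr (_ *m _).
  rewrite mulmx_suml mulmx_sumr; apply: eq_bigr => k _.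
  by rewrite -scalemxAl -scalemxAr !PP eq_sym; case: eqP => [->|].
have gSY : g = S *m (1%:M + Y) by rewrite gE mulmxDr mulmx1 /Y ZSi mulmxA SSi mul1mx.
have Gg' : G ((\sum_i s i *: P i) *m (1%:M + Y)) by rewrite -gSY.
have mem := grp_fam_mem P1 PP YP YJ cG nzs Gg'.
have [d [tau [a [k [k0 nzt sE taui]]]]] := multiplicative_lattice nzs.
exists N, d, P, a, tau, Y, d0, k; split; split=> //.
- move=> z nz; have := mem (fun i => mon z (a i)) 0; rewrite fam_at0 ?wbin0 //; last exact: wbin_at0.
  apply=> [i|v v' E]; first exact: mon_neq0.
  have E' : mon tau (\sum_i v 0 i *: a i) = mon tau (\sum_i v' 0 i *: a i).
    rewrite -!mon_mon // -!(mon_ext _ sE).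
    have monX w : mon (fun i => s i ^+ k) w = mon s w ^+ k.
      by rewrite /mon -prodrXl; apply: eq_bigr => i _; rewrite !exprnP exprzAC.
    by rewrite !monX E.
  rewrite !mon_mon //; congr mon; apply/eqP; rewrite -subr_eq0; apply/eqP/taui.
  by rewrite monD // monN // E' mulfV // mon_neq0.
- have := mem (fun=> 1) 1; rewrite fam_one //.
  have := bin_pow YJ 1; rewrite expr1 => <-; apply=> [i|v v' _]; first exact: oner_neq0.
  by rewrite !mon_one.
- have cSY : S *m (1%:M + Y) = (1%:M + Y) *m S.
    by rewrite mulmxDl mulmxDr mulmx1 mul1mx -(dsum_comm YP).
  rewrite gSY [in LHS]exprMn_comm //; congr (_ *m _).
  have dX j : S ^+ j = \sum_i s i ^+ j *: P i.
    elim: j => [|j IH]; first by under eq_bigr do rewrite expr0 scale1r; rewrite P1.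
    rewrite exprS IH -[_ * _]/(S *m _) (dsumM PP); apply: eq_bigr => i _; by rewrite exprS.
  by rewrite dX; apply: eq_bigr => i _; rewrite sE.
Qed.

Lemma regular_invmx n (G : set 'M[C]_n) f : subgroup_GL G -> regular G f ->
  regular G (fun g => f (invmx g)).
Proof.
move=> sG [p [d Hf]]; have [_ _ _ GV] := sG.
have GL1 : G `<=` @GL R n by move=> g; exact: (G_unit sG).
have [dF pd] := isp_exp d (@isp_det R n).
have rp : regular G (fun g => mxeval p (invmx g)).
  elim/mpoly_ring_ind: p {Hf} => [c|l|p q Hp Hq|p q Hp Hq].
  - apply: regular_ext (regular_const G c) => g _; by rewrite /mxeval mevalC.
  - have [[i j] E] : exists ij : 'I_n * 'I_n, l = mxvec_index ij.1 ij.2.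
      by case/mxvec_indexP: l => i j; exists (i, j).
    apply: regular_ext (regular_inv GL1 i j) => g _; by rewrite /mxeval mevalXU E mxvecE.
  - by apply: regular_ext (regular_add GL1 Hp Hq) => g _; rewrite /mxeval mevalD.
  - by apply: regular_ext (regular_mul Hp Hq) => g _; rewrite /mxeval mevalM.
apply: regular_ext (regular_mul rp (regular_poly G pd)) => g Gg.
rewrite Hf; last exact: GV.
by rewrite det_inv exprVn invrK.
Qed.

Lemma commutant_group n m (G : set 'M[C]_n) (rho drho : 'M[C]_n -> 'M[C]_m) :
  closed_subgroup G -> zariski_connected G -> alg_rep G rho ->
  (forall g X, G g -> Lie G X -> rho g *m drho X = drho (g *m X *m invmx g) *m rho g) ->
  (forall A, (forall X, Lie G X -> A *m drho X = drho X *m A) ->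
   [/\ forall N d (Q : 'I_N -> 'M[C]_n) (a : 'I_N -> 'rV[int]_d) z,
        \sum_i Q i = 1%:M -> (forall i j, Q i *m Q j = if i == j then Q i else 0) ->
        (forall z, nzv z -> G (curve Q a z)) -> nzv z ->
        A *m rho (curve Q a z) = rho (curve Q a z) *m A &
      forall Y J, Y ^+ J.+1 = 0 -> G (1%:M + Y) -> A *m rho (1%:M + Y) = rho (1%:M + Y) *m A]) ->
  forall A, (forall X, Lie G X -> A *m drho X = drho X *m A) -> forall g, G g -> A *m rho g = rho g *m A.
Proof.
move=> cG conG rhoG Hconj Hcomm; have [_ sG] := cG; have [r1 rM rr] := rhoG.
have [_ G1 GM GV] := sG.
have [K HK] : exists K : {vspace 'M[C]_m}, forall A, A \in K <->
    forall X, Lie G X -> A *m drho X = drho X *m A.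
  apply: vspace_of_set => [X _|a x y Hx Hy X LX]; first by rewrite mul0mx mulmx0.
  by rewrite mulmxDl mulmxDr -scalemxAl -scalemxAr Hx ?Hy.
suff main : forall g A, G g -> A \in K -> A *m rho g = rho g *m A by move=> A /HK HA g Gg; exact: main.
have KJ g A : G g -> A \in K -> rho (invmx g) *m A *m rho g \in K.
  move=> Gg /HK HA; apply/HK => X LX; have Gi := GV g Gg.
  rewrite -(mulmxA _ (rho g)) Hconj // mulmxA -(mulmxA _ A) HA; last exact: lie_Ad.
  rewrite (mulmxA (rho (invmx g)) (drho _) A) Hconj //; last exact: lie_Ad.
  have -> : invmx g *m (g *m X *m invmx g) *m invmx (invmx g) = X.
    by rewrite invmxK !mulmxA mulVmx ?(G_unit sG) // mul1mx mulmxKV ?(G_unit sG).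
  by rewrite !mulmxA.
pose q := \dim K; pose b := vbasis K.
have bK i : b`_i \in K.
  have [iq|qi] := ltnP i q; last by rewrite nth_default ?mem0v // size_tuple.
  by apply: vbasis_mem; rewrite mem_nth // size_tuple.
have bc A : A \in K -> A = \sum_(i < q) coord b i A *: b`_i by exact: coord_vbasis.
have bf : free b by exact: basis_free (vbasisP K).
(* The matrix of conjugation by rho g on the commutant K of the Lie algebra. Its j-th power having
   trace q for all j, together with finite order, will force it to be 1. *)
pose sg g : 'M[C]_q := \matrix_(i, j) coord b j (rho (invmx g) *m b`_i *m rho g).
have rV1 g : G g -> rho g *m rho (invmx g) = 1%:M.
  by move=> Gg; rewrite -rM ?mulmxV ?(rep1 cG rhoG) ?(G_unit sG) //; exact: GV.
have sgM g h : G g -> G h -> sg (g *m h) = sg g *m sg h.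
  move=> Gg Gh; apply/matrixP => i j; rewrite !mxE.
  have -> : invmx (g *m h) = invmx h *m invmx g.
    have gu := G_unit sG Gg; have hu := G_unit sG Gh.
    have ghu : g *m h \in unitmx by rewrite unitmx_mul gu.
    by rewrite -[RHS]mulmx1 -(mulmxV ghu) !mulmxA mulmxKV // mulVmx // mul1mx.
  rewrite !rM //; try exact: GV.
  have -> : rho (invmx h) *m rho (invmx g) *m b`_i *m (rho g *m rho h) =
      rho (invmx h) *m (rho (invmx g) *m b`_i *m rho g) *m rho h by rewrite !mulmxA.
  rewrite [rho (invmx g) *m _ *m _]bc; last by apply: KJ.
  rewrite mulmx_sumr mulmx_suml raddf_sum; apply: eq_bigr => k _ /=.
  by rewrite -scalemxAr -scalemxAl linearZ /= !mxE.
have sg1 : sg 1%:M = 1%:M.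
  apply/matrixP => i j; rewrite !mxE invmx1 (rep1 cG rhoG) mul1mx mulmx1.
  by rewrite coord_free // eq_sym.
have sgX g k : G g -> G (g ^+ k) /\ sg (g ^+ k) = sg g ^+ k.
  move=> Gg; elim: k => [|k [IH1 IH2]]; first by rewrite !expr0.
  by rewrite !exprS; split; [exact: GM | rewrite [LHS]sgM // IH2].
have comm_sg g : G g -> (forall A, A \in K -> A *m rho g = rho g *m A) <-> sg g = 1%:M.
  move=> Gg; split=> [H|H A AK].
    apply/matrixP => i j; rewrite !mxE -mulmxA H // mulmxA.
    rewrite -rM ?mulVmx ?(rep1 cG rhoG) ?(G_unit sG) ?mul1mx //; last exact: GV.
    by rewrite coord_free // eq_sym.
  have bi i : (i < q)%N -> b`_i *m rho g = rho g *m b`_i.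
    move=> iq; have : rho (invmx g) *m b`_i *m rho g = b`_i.
      rewrite [LHS]bc; last exact: KJ.
      rewrite (bigD1 (Ordinal iq)) //= big1 ?addr0 => [|j ji].
        by have /matrixP/(_ (Ordinal iq) (Ordinal iq)) := H; rewrite !mxE eqxx => ->; rewrite scale1r.
      have /matrixP/(_ (Ordinal iq) j) := H; rewrite !mxE eq_sym (negPf ji) => ->.
      by rewrite scale0r.
    by move=> {2}<-; rewrite !mulmxA rV1 // mul1mx.
  rewrite (bc A AK) mulmx_suml mulmx_sumr; apply: eq_bigr => i _.
  by rewrite -scalemxAl -scalemxAr bi.
have fin g : G g -> exists2 k, (0 < k)%N & sg g ^+ k = 1.
  move=> Gg; have [N [d [P [a [tau [Y [J [k [[k0 P1 PP SG nzt] [YJ GY gk]]]]]]]]]] := group_element_power cG Gg.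
  exists k => //; have [Ggk <-] := sgX g k Gg; apply/comm_sg => // A /HK/Hcomm[H1 H2].
  have [GYk _] := sgX _ k GY.
  have H2k : A *m rho ((1%:M + Y) ^+ k) = rho ((1%:M + Y) ^+ k) *m A.
    elim: (k) => [|j IH]; first by rewrite expr0 (rep1 cG rhoG) mulmx1 mul1mx.
    have [GYj _] := sgX _ j GY.
    have E : rho ((1%:M + Y) ^+ j.+1) = rho (1%:M + Y) *m rho ((1%:M + Y) ^+ j).
      by rewrite exprS [LHS]rM.
    by rewrite E mulmxA (H2 _ _ YJ GY) -[LHS]mulmxA IH mulmxA.
  rewrite gk rM //; last exact: SG.
  by rewrite mulmxA (H1 _ _ _ _ _ P1 PP SG nzt) -[LHS]mulmxA H2k mulmxA.
have regtr : regular G (fun g => \tr (sg g)).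
  have GL1 : G `<=` @GL R n by move=> g; exact: (G_unit sG).
  apply: (regular_sum GL1) => i.
  pose cf (kl : 'I_m * 'I_m) : C := coord b i (delta_mx kl.1 kl.2).
  have E g : sg g i i = \sum_kl cf kl * (\sum_u (\sum_v rho (invmx g) kl.1 v * b`_i v u) * rho g u kl.2).
    rewrite mxE [in LHS](matrix_sum_delta (rho (invmx g) *m b`_i *m rho g)) pair_bigA /=.
    rewrite raddf_sum /=; apply: eq_bigr => kl _; rewrite linearZ /= mulrC; congr (_ * _).
    by rewrite mxE; apply: eq_bigr => u _; rewrite mxE.
  apply: (regular_ext (f := fun g => \sum_kl cf kl * (\sum_u (\sum_v rho (invmx g) kl.1 v * b`_i v u) * rho g u kl.2))).
    by move=> g _; rewrite E.
  apply: (regular_sum GL1) => kl; apply: regular_mul; first exact: regular_const.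
  apply: (regular_sum GL1) => u; apply: regular_mul; last exact: rr.
  apply: (regular_sum GL1) => v; apply: regular_mul; last exact: regular_const.
  by apply: (regular_invmx (f := fun g => rho g kl.1 v)).
have trc g : G g -> \tr (sg g) = q%:R.
  move=> Gg; rewrite (regular_bounded_const cG conG regtr (B := q)) ?sg1 ?mxtrace1 // => h Gh.
  by have [k k0 E] := fin h Gh; apply: finite_order_trace E.
move=> g A Gg; apply: ((comm_sg g Gg).2 _ A).
have [k k0 E] := fin g Gg; apply: (finite_order_trace1 k0 E) => j.
by have [Gj <-] := sgX g j Gg; exact: trc.
Qed.
End Commutant.

(** * Highest weight spaces *)

Section Simplicity.
Variable R : realType.
Local Notation C := R[i].
Local Notation br X Y := (X *m Y - Y *m X).
Variables (n m : nat) (G : set 'M[C]_n) (rho drho : 'M[C]_n -> 'M[C]_m).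
Hypothesis cG : closed_subgroup G.
Hypothesis irr : irreducible_rep G rho.
Hypothesis drho_conj : forall g X, G g -> Lie G X ->
  rho g *m drho X = drho (g *m X *m invmx g) *m rho g.
Hypothesis commG : forall A, (forall X, Lie G X -> A *m drho X = drho X *m A) ->
  forall g, G g -> A *m rho g = rho g *m A.
Let sG : subgroup_GL G. Proof. by case: cG. Qed.
Let rhoG : alg_rep G rho. Proof. by case: irr. Qed.

Lemma schur A : (forall X, Lie G X -> A *m drho X = drho X *m A) -> exists c, A = c%:M.
Proof.
move=> HA; have cA := commG HA; have [_ m0 Hirr] := irr.
have [c rc] : exists c, root (char_poly A^T) c.
  by apply/closed_rootP; rewrite size_char_poly; case: (m) m0.
have : eigenvalue A^T c by rewrite eigenvalue_root_char.
move=> /eigenvalueP[v vA v0].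
have [U HU] : exists U : {vspace 'cV[C]_m}, forall u, u \in U <-> A *m u = c *: u.
  apply: vspace_of_set => [|a x y Hx Hy]; first by rewrite mulmx0 scaler0.
  by rewrite mulmxDr -scalemxAr Hx Hy scalerDr !scalerA mulrC.
have [g u Gg /HU Hu|U0|UT] := Hirr U.
- by apply/HU; rewrite mulmxA cA // -mulmxA Hu -scalemxAr.
- have : v^T \in U by apply/HU; rewrite -[A]trmxK -trmx_mul vA linearZ.
  by rewrite U0 memv0 -trmx0 (inj_eq trmx_inj) (negPf v0).
- exists c; apply/matrixP => i j; have : delta_mx j (0 : 'I_1) \in U by rewrite UT memvf.
  move=> /HU/matrixP/(_ i 0); rewrite -colE !mxE => ->.
  by rewrite eqxx andbT mulr_natr.
Qed.

Definition lie_stable (W : {vspace 'cV[C]_m}) :=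
  forall X u, Lie G X -> u \in W -> drho X *m u \in W.

(* Clifford's argument: V is the sum of the translates of a minimal stable S, so
   S has a stable complement, and the projection onto S is a scalar. *)
Lemma lie_simple W : lie_stable W -> W = 0%VS \/ W = fullv.
Proof.
have [_ m0 Hirr] := irr; have [_ G1 GM GV] := sG.
have full (U : {vspace 'cV[C]_m}) : (forall u, u \in U) -> U = fullv.
  by move=> H; apply/eqP; rewrite eqEsubv subvf; apply/subvP => u _; exact: H.
have stD U V : lie_stable U -> lie_stable V -> lie_stable (U + V)%VS.
  move=> HU HV X _ LX /memv_addP[u uU [v vV ->]].
  by rewrite mulmxDr memv_add ?HU ?HV.
have stI U V : lie_stable U -> lie_stable V -> lie_stable (U :&: V)%VS.
  by move=> HU HV X u LX; rewrite !memv_cap => /andP[uU uV]; rewrite HU ?HV.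
pose im g (U : {vspace 'cV[C]_m}) := (linfun (mulmx (rho g)) @: U)%VS.
have imP g U u : u \in im g U -> exists2 v, v \in U & u = rho g *m v.
  by move=> /memv_imgP[v vU ->]; exists v => //; rewrite lfunE.
have imI g (U : {vspace 'cV[C]_m}) v : v \in U -> rho g *m v \in im g U.
  by move=> vU; have := memv_img (linfun (mulmx (rho g))) vU; rewrite lfunE.
have stM g U : G g -> lie_stable U -> lie_stable (im g U).
  move=> Gg HU X _ LX /imP[v vU ->].
  have E : drho X *m rho g = rho g *m drho (invmx g *m X *m g).
    have := drho_conj Gg (lie_Ad sG (GV _ Gg) LX); rewrite invmxK.
    have -> : g *m (invmx g *m X *m g) *m invmx g = X.
      by rewrite !mulmxA mulmxV ?(G_unit sG) // mul1mx mulmxK ?(G_unit sG).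
    by move=> <-.
  rewrite mulmxA E -mulmxA; apply/imI/HU => //.
  by have := lie_Ad sG (GV _ Gg) LX; rewrite invmxK.
pose Q k := exists U, [/\ lie_stable U, U != 0%VS & \dim U = k].
have Qm : Q (\dim (@fullv _ 'cV[C]_m)).
  exists fullv; split=> //; first by move=> X u _ _; exact: memvf.
  by rewrite -dimv_eq0 dimvf /dim /= muln1; case: (m) m0.
have [k [S [stS S0 dS]] kmin] := exists_minimal Qm.
have minS U : lie_stable U -> U != 0%VS -> (\dim S <= \dim U)%N.
  by move=> HU U0; rewrite dS leqNgt; apply/negP => /kmin; apply; exists U.
suff Sf : S = fullv.
  move=> stW; have [->|W0] := eqVneq W 0%VS; first by left.
  right; apply/eqP; rewrite eqEdim subvf /= -Sf; exact: minS.
(* U is chosen of largest dimension among the stable subspaces that meet S trivially. *)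
pose Q' k := exists U, [/\ lie_stable U, (U :&: S = 0)%VS & (m - \dim U)%N = k].
have Q'm : Q' m.
  exists 0%VS; rewrite cap0v dimv0 subn0; split=> // X u _; rewrite !memv0 => /eqP->.
  by rewrite mulmx0.
have [k' [U [stU US dU]] kmin'] := exists_minimal Q'm.
(* A translate of S has dimension at most that of S, so by minimality it lies in S + U or meets it
   trivially. In the second case adding it to U would give a larger subspace meeting S trivially,
   unless the translate is zero. *)
have SU g : G g -> (im g S <= S + U)%VS.
  move=> Gg; pose W' := (im g S :&: (S + U))%VS.
  have stW' : lie_stable W' by apply: stI; [exact: stM | exact: stD].
  have dim_im : (\dim (im g S) <= \dim S)%N by rewrite -(limg_ker_dim (linfun (mulmx (rho g))) S) leq_addl.
  have [W0|Wn] := eqVneq W' 0%VS; last first.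
    have : W' == im g S by rewrite eqEdim capvSl (leq_trans dim_im) // minS.
    by move=> /eqP <-; exact: capvSr.
  have [i0|inz] := eqVneq (im g S) 0%VS; first by rewrite i0 sub0v.
  have sU : lie_stable (U + im g S)%VS by apply: stD => //; exact: stM.
  have disj : ((U + im g S) :&: S = 0)%VS.
    apply/eqP; rewrite -subv0; apply/subvP => x; rewrite memv_cap => /andP[/memv_addP[u uU [y yS ->]] xS].
    have yW : y \in W'.
      rewrite memv_cap yS /=; apply/memv_addP; exists (u + y) => //; exists (- u); rewrite ?memvN //.
      by rewrite addrAC subrr add0r.
    rewrite W0 memv0 in yW; move: xS; rewrite (eqP yW) addr0 => uS.
    by rewrite -US memv_cap uU.
  have dimU : (\dim (U + im g S) = \dim U + \dim (im g S))%N.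
    rewrite dimv_disjoint_sum //; apply/eqP; rewrite -subv0; apply/subvP => x.
    rewrite memv_cap => /andP[xU xS]; rewrite -W0 memv_cap xS /=.
    by apply: (subvP (addvSr _ _)).
  have dm : (\dim (U + im g S) <= m)%N.
    by have := dimvS (subvf (U + im g S)); rewrite dimvf /dim /= muln1.
  have ipos : (0 < \dim (im g S))%N by rewrite lt0n dimv_eq0.
  exfalso; apply: (kmin' (m - \dim (U + im g S))%N); last by exists (U + im g S)%VS.
  by rewrite -dU dimU; move: dm ipos; rewrite dimU; lia.
have [Z HZ] : exists Z : {vspace 'cV[C]_m}, forall u, u \in Z <-> forall g, G g -> rho g *m u \in (S + U)%VS.
  apply: vspace_of_set => [g _|a x y Hx Hy g Gg]; first by rewrite mulmx0 mem0v.
  by rewrite mulmxDr -scalemxAr memvD ?memvZ ?Hx ?Hy.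
have ZT : Z = fullv.
  have [g u Gg /HZ Hu|Z0|//] := Hirr Z.
    by apply/HZ => h Gh; have [_ rM _] := rhoG; rewrite mulmxA -rM //; apply/Hu/GM.
  move: S0; rewrite -subv0 => /negP[]; apply/subvP => u uS; rewrite -Z0; apply/HZ => g Gg.
  by apply: (subvP (SU g Gg)); exact: imI.
have SUT : (S + U = fullv)%VS.
  apply: full => u; have : u \in Z by rewrite ZT memvf.
  by move=> /HZ/(_ _ G1); rewrite (rep1 cG rhoG) mul1mx.
have dxSU : (S :&: U = 0)%VS by rewrite capvC.
pose pi := daddv_pi S U.
have piS u : u \in S -> pi u = u by move=> uS; rewrite /pi daddv_pi_id.
have piU u : u \in U -> pi u = 0.
  move=> uU; have uSU : u \in (S + U)%VS by rewrite SUT memvf.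
  have E1 := daddv_pi_add dxSU uSU; have E2 := daddv_pi_id US uU.
  by apply: (addIr (daddv_pi U S u)); rewrite add0r E2 in E1 *; rewrite [LHS]E1.
have piSU s u : s \in S -> u \in U -> pi (s + u) = s by move=> /piS Es /piU Eu; rewrite raddfD /= Es Eu addr0.
pose A := \matrix_(i, j) (pi (delta_mx j 0) : 'cV[C]_m) i 0.
have AE u : A *m u = pi u.
  have {2}-> : u = \sum_j u j 0 *: delta_mx j 0.
    rewrite {1}(matrix_sum_delta u); apply: eq_bigr => j _; by rewrite big_ord1.
  rewrite raddf_sum; apply/matrixP => i j; rewrite !ord1 mxE summxE; apply: eq_bigr => l _.
  by rewrite /= linearZ /= !mxE mulrC.
have [c Ac] : exists c, A = c%:M.
  apply: schur => X LX; apply/matrixP => i j.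
  suff E (u : 'cV[C]_m) : A *m (drho X *m u) = drho X *m (A *m u).
    have := E (delta_mx j 0); rewrite !mulmxA -!colE => /matrixP/(_ i 0).
    by rewrite !mxE.
  have : u \in (S + U)%VS by rewrite SUT memvf.
  move=> /memv_addP[s sS [w wU ->]]; rewrite !AE mulmxDr !piSU //; first exact: stS.
  exact: stU.
have [u0 u0S un0] : exists2 u, u \in S & u != 0.
  by exists (vpick S); rewrite ?memv_pick // vpick0.
have c1 : c = 1.
  have := piS u0 u0S; rewrite -AE Ac mul_scalar_mx => /eqP.
  rewrite -subr_eq0 -{2}[u0]scale1r -scalerBl scaler_eq0 (negPf un0) orbF subr_eq0.
  by move/eqP.
apply: full => u.
have <- : pi u = u by rewrite -AE Ac c1 mul1mx.
by rewrite memv_pi.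
Qed.
End Simplicity.

Definition dot r (h a : 'rV[int]_r) : int := \sum_(i < r) a 0 i * h 0 i.
Lemma dotD r (h a b : 'rV[int]_r) : dot h (a + b) = dot h a + dot h b.
Proof. by rewrite -big_split; apply: eq_bigr => i _; rewrite mxE mulrDl. Qed.
Lemma dotN r (h a : 'rV[int]_r) : dot h (- a) = - dot h a.
Proof. by rewrite -sumrN; apply: eq_bigr => i _; rewrite mxE mulNr. Qed.
Lemma dot0 r (h : 'rV[int]_r) : dot h 0 = 0.
Proof. by rewrite /dot big1 // => i _; rewrite mxE mul0r. Qed.
Lemma dotMn r (h a : 'rV[int]_r) k : dot h (a *+ k) = dot h a *+ k.
Proof. by elim: k => [|k IH]; rewrite ?mulr0n ?dot0 // !mulrS dotD IH. Qed.

Section HighestWeightSpace.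
Variable R : realType.
Local Notation C := R[i].
Local Notation br X Y := (X *m Y - Y *m X).
Variables (n : nat) (G T : set 'M[C]_n) (r : nat) (e : 'I_r -> 'M[C]_n -> C).
Hypothesis rG : connected_reductive G.
Hypothesis mT : maximal_torus G T.
Hypothesis Te : char_basis T e.
Variables (N : nat) (chi : 'I_N -> 'rV[int]_r) (P : 'I_N -> 'M[C]_n).
Hypothesis chiI : injective chi.
Hypothesis TE : forall t, T t -> t = \sum_i char_of e (chi i) t *: P i.
Hypothesis P1 : \sum_i P i = 1%:M.
Hypothesis PP : forall i j, P i *m P j = if i == j then P i else 0.
Hypothesis Pn0 : forall i, P i != 0.
Let cG : closed_subgroup G. Proof. by case: rG. Qed.
Let sG : subgroup_GL G. Proof. by case: cG. Qed.
Local Notation rs := (rs G chi P).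
Local Notation isroot := (isroot G chi P).

Lemma lie_root_or0 a X : Lie G X -> hw chi P a X -> a != 0 -> X != 0 -> isroot a.
Proof. by move=> LX hX a0 X0; split=> //; exists X. Qed.

Variables (m : nat) (rho drho : 'M[C]_n -> 'M[C]_m).
Variables (M : nat) (mu : 'I_M -> 'rV[int]_r) (Q : 'I_M -> 'M[C]_m).
Hypothesis irr : irreducible_rep G rho.
Hypothesis drho_lin : forall a X Y, drho (a *: X + Y) = a *: drho X + drho Y.
Hypothesis drho_conj : forall g X, G g -> Lie G X ->
  rho g *m drho X = drho (g *m X *m invmx g) *m rho g.
Hypothesis drho_br : forall X Y, Lie G X -> Lie G Y -> drho (br X Y) = br (drho X) (drho Y).
Hypothesis drho_H : forall x, drho (Hx chi P x) = Hx mu Q x.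
Hypothesis commG : forall A, (forall X, Lie G X -> A *m drho X = drho X *m A) ->
  forall g, G g -> A *m rho g = rho g *m A.
Hypothesis muI : injective mu.
Hypothesis Q1 : \sum_i Q i = 1%:M.
Hypothesis QQ : forall i j, Q i *m Q j = if i == j then Q i else 0.
Hypothesis Qn0 : forall i, Q i != 0.

Lemma drho0 : drho 0 = 0.
Proof.
have := drho_lin (-1) 0 0; rewrite scaleN1r oppr0 addr0 => ->.
by rewrite scaleN1r addNr.
Qed.
Lemma drhoZ a X : drho (a *: X) = a *: drho X.
Proof. by have := drho_lin a X 0; rewrite !addr0 drho0 addr0. Qed.
Lemma drhoD X Y : drho (X + Y) = drho X + drho Y.
Proof. by have := drho_lin 1 X Y; rewrite !scale1r. Qed.
Lemma drho_sum (I : Type) (s : seq I) (F : I -> 'M[C]_n) :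
  drho (\sum_(i <- s) F i) = \sum_(i <- s) drho (F i).
Proof. by elim/big_rec2: _ => [|i y1 y2 _ <-]; rewrite ?drho0 ?drhoD. Qed.

Lemma hw_drho a X : Lie G X -> hw chi P a X -> hw mu Q a (drho X).
Proof.
move=> LX hX x; have LH := lie_Hx mT Te TE P1 x.
by rewrite -drho_H -drho_br // hX drhoZ.
Qed.

Lemma lie_decomp X : Lie G X -> exists x (S : seq 'rV[int]_r),
  X = Hx chi P x + \sum_(a <- S) comp chi P a X /\
  forall a, a \in S -> rs a (comp chi P a X) /\ (comp chi P a X = 0 \/ isroot a).
Proof.
move=> LX; have h0 : hw chi P 0 (comp chi P 0 X) := comp_hw chi PP 0 X.
have rsa a : rs a (comp chi P a X).
  by split; [exact: (lie_comp rG mT Te TE P1 PP) | exact: comp_hw].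
have [x Hx0] : exists x, comp chi P 0 X = Hx chi P x.
  apply: (centralizer_torus rG mT Te chiI TE P1 PP Pn0); first by case: (rsa 0).
  move=> i; have out j : j != i -> P i *m comp chi P 0 X *m P j = 0 /\ P j *m comp chi P 0 X *m P i = 0.
    by move=> ji; split; apply: (hw_out PP h0); rewrite subr_eq0 (inj_eq chiI) // eq_sym.
  transitivity (P i *m comp chi P 0 X *m P i).
    rewrite -[LHS]mulmx1 -P1 mulmx_sumr (bigD1 i) //= big1 ?addr0 // => j ji.
    by have [] := out j ji.
  rewrite -[RHS]mul1mx -P1 mulmx_suml (bigD1 i) //= mulmxA big1 ?addr0 // => j ji.
  by rewrite mulmxA; have [] := out j ji.
exists x, [seq a <- diffs chi | a != 0]; split=> [|a].
  rewrite {1}(comp_sum chi P1 X) -Hx0 big_filter.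
  have [z0|z0] := boolP (0 \in diffs chi); first by rewrite (bigD1_seq 0) //= undup_uniq.
  rewrite (hw_notin P1 PP h0 z0) add0r [RHS]big_seq_cond [LHS]big_seq_cond; apply: eq_bigl => a /=.
  by rewrite andbT; case: eqP => [->|]; rewrite ?(negPf z0) // andbT.
rewrite mem_filter => /andP[a0 _]; split=> //.
have [->|X0] := eqVneq (comp chi P a X) 0; [by left | right].
by have [LC hC] := rsa a; exact: lie_root_or0 LC hC a0 X0.
Qed.

Variables (Phi : seq 'rV[int]_r) (h : 'rV[int]_r).
Hypothesis hroot : forall a, isroot a -> dot h a != 0.
Hypothesis hPhi : forall a, a \in Phi <-> isroot a /\ 0 < dot h a.
Variable i0 : 'I_M.
Hypothesis hwt : forall j, exists c : 'rV[int]_r -> nat, mu i0 - mu j = \sum_(a <- Phi) a *+ c a.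

Lemma root_sign a : isroot a -> a \in Phi \/ - a \in Phi.
Proof.
move=> ra; have := hroot ra; rewrite neq_lt => /orP[n0|p0]; last by left; apply/hPhi.
right; apply/hPhi; rewrite dotN oppr_gt0; split=> //.
exact: (isrootN rG mT Te TE P1 PP).
Qed.

Lemma highest_out a j : a \in Phi -> mu j - mu i0 != a.
Proof.
move=> /hPhi[_ a0]; apply/eqP => E; have [c Hc] := hwt j.
have : 0 <= dot h (mu i0 - mu j).
  rewrite Hc; elim: {Hc}(Phi : seq _) (fun b => (hPhi b).1) => [|b s IH] Hs; first by rewrite big_nil dot0.
  rewrite big_cons dotD dotMn addr_ge0 //; last by apply: IH => b' b's; apply: Hs; rewrite inE b's orbT.
  by rewrite mulrn_wge0 // ltW //; case: (Hs b); rewrite ?mem_head.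
by rewrite -opprB E dotN oppr_ge0 leNgt a0.
Qed.

(* The span of the F_1 .. F_k v, for negative root vectors F_i, is stable under
   Lie G, and meets the weight space of v in a line. *)
Inductive word (v : 'cV[C]_m) : nat -> 'cV[C]_m -> Prop :=
| word_scale k c : word v k (c *: v)
| word_add k u w : word v k u -> word v k w -> word v k (u + w)
| word_step k u a F : a \in Phi -> rs (- a) F -> word v k u -> word v k.+1 (drho F *m u)
| word_mono k u : word v k u -> word v k.+1 u.

Lemma word0 v k : word v k 0.
Proof. by rewrite -(scale0r v); exact: word_scale. Qed.
Lemma wordZ v k u c : word v k u -> word v k (c *: u).
Proof.
move=> H; elim: k u / H => [k c'|k u w _ IH1 _ IH2|k u a F aP rF _ IH|k u _ IH].
- by rewrite scalerA; exact: word_scale.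
- by rewrite scalerDr; exact: word_add.
- by rewrite scalemxAr; exact: word_step rF IH.
- exact: word_mono.
Qed.
Lemma word_le v k l u : (k <= l)%N -> word v k u -> word v l u.
Proof. by move=> /subnK <- H; elim: (l - k)%N => //= j IH; rewrite addSn; exact: word_mono. Qed.

Lemma word_stable_step v k u : word v k u ->
  (forall x, word v k (drho (Hx chi P x) *m u)) ->
  (forall a X, a \in Phi -> rs a X -> word v k (drho X *m u)) ->
  forall X, Lie G X -> word v k.+1 (drho X *m u).
Proof.
move=> wu H1 H2 X LX; have [x [S [XE HS]]] := lie_decomp LX.
rewrite XE drhoD drho_sum mulmxDl; apply: word_add; first exact/word_mono/H1.
rewrite mulmx_suml big_seq; elim/big_rec: _ => [|a w aS IH]; first exact: word0.
apply: word_add => //; have [rC [->|/root_sign[aP|aP]]] := HS a aS.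
- by rewrite drho0 mul0mx; exact: word0.
- exact/word_mono/(H2 a).
- by apply: word_step aP _ wu; rewrite opprK.
Qed.

(** Induction on the word, by X F u = F X u + [X, F] u, where the bracket lies in Lie G again and
    acts on a shorter word. Positive root vectors kill v because no weight exceeds the highest one
    by a positive root. *)
Lemma word_stable v k u : v = Q i0 *m v -> word v k u ->
  (forall x, word v k (drho (Hx chi P x) *m u)) /\
  (forall a X, a \in Phi -> rs a X -> word v k (drho X *m u)).
Proof.
move=> Qv H; elim: k u / H => [k c|k u w wu [H1 H2] ww [H3 H4]|k u b F bP rF wu [H1 H2]|k u wu [H1 H2]].
- split=> [x|a X aP [LX hX]].
    have Hv : Hx mu Q x *m v = lin x (mu i0) *: v by rewrite {1}Qv mulmxA (HxP mu QQ) -scalemxAl -Qv.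
    by rewrite drho_H -scalemxAr Hv scalerA; exact: word_scale.
  suff -> : drho X *m (c *: v) = 0 by exact: word0.
  rewrite Qv -scalemxAr mulmxA -[drho X]mul1mx -Q1 !mulmx_suml big1 ?scaler0 // => j _.
  by rewrite (hw_out QQ (hw_drho LX hX)) ?mul0mx // highest_out.
- split=> [x|a X aP rX]; rewrite mulmxDr; apply: word_add; [exact: H1 | exact: H3 | |].
    exact: H2 aP rX.
  exact: H4 aP rX.
- have brw X : Lie G X -> word v k (drho X *m u) -> word v k.+1 (drho X *m (drho F *m u)).
    move=> LX wX; have [LF _] := rF.
    have -> : drho X *m (drho F *m u) = drho F *m (drho X *m u) + drho (br X F) *m u.
      by rewrite drho_br // mulmxBl !mulmxA addrC subrK.
    apply: word_add; first exact: word_step bP rF wX.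
    by apply: (word_stable_step wu H1 H2); exact: lie_bracket.
  split=> [x|a X aP rX]; apply: brw; [exact: (lie_Hx mT Te TE P1) | exact: H1 | by case: rX | exact: H2 aP rX].
- by split=> [x|a X aP rX]; apply: word_mono; [exact: H1 | exact: H2 aP rX].
Qed.

Lemma word_coef v k u : v = Q i0 *m v -> word v k u -> exists c, Q i0 *m u = c *: v.
Proof.
move=> Qv H; elim: k u / H => [k c|k u w _ [c Hc] _ [d Hd]|k u a F aP [LF hF] _ _|//].
- by exists c; rewrite -scalemxAr -Qv.
- by exists (c + d); rewrite mulmxDr Hc Hd scalerDl.
exists 0; rewrite scale0r mulmxA -[X in X *m _]mulmx1 -Q1 mulmx_sumr mulmx_suml big1 // => j _.
rewrite (hw_out QQ (hw_drho LF hF)) ?mul0mx //.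
by apply/eqP => E; have := highest_out j aP; rewrite -[a]opprK -E opprB eqxx.
Qed.

Lemma highest_rank1 : \rank (Q i0) = 1%N.
Proof.
have [j Qj] : exists j, col j (Q i0) != 0.
  apply: contrapT => nex; move: (Qn0 i0); rewrite -trmx_eq0 => /negP[]; apply/eqP/row_matrixP => j.
  by rewrite row0 -tr_col; apply/eqP; rewrite trmx_eq0; apply/negPn/negP => H; apply: nex; exists j.
pose v := col j (Q i0).
have Qv : v = Q i0 *m v by rewrite /v colE mulmxA QQ eqxx.
have [W HW] : exists W : {vspace 'cV[C]_m}, forall u, u \in W <-> exists k, word v k u.
  apply: vspace_of_set => [|a x y [k wx] [l wy]]; first by exists 0%N; exact: word0.
  exists (maxn k l); apply: word_add; first by apply/wordZ/(word_le (leq_maxl k l)).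
  exact: (word_le (leq_maxr k l)).
have [X u LX /HW[k wu]|W0|WT] := lie_simple cG irr drho_conj commG (W := W).
- by apply/HW; exists k.+1; have [H1 H2] := word_stable Qv wu; exact: word_stable_step wu H1 H2 X LX.
- have : v \in W by apply/HW; exists 0%N; have := word_scale v 0 1; rewrite scale1r.
  by rewrite W0 memv0 (negPf Qj).
have /choice[c Hc] l : exists c, col l (Q i0) = c *: v.
  have : delta_mx l 0 \in W by rewrite WT memvf.
  by move=> /HW[k /(word_coef Qv)[c]]; rewrite -colE; exists c.
have QE : Q i0 = v *m (\row_l c l).
  apply/matrixP => i l; rewrite mxE big_ord1.
  by have /matrixP/(_ i 0) := Hc l; rewrite !mxE mulrC.
by apply/eqP; rewrite eqn_leq lt0n mxrank_eq0 Qn0 andbT QE mulmx_max_rank.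
Qed.
End HighestWeightSpace.

(** * Weyl group symmetry and the Casimir element *)

Section WeightReflections.
Variable R : realType.
Local Notation C := R[i].
Local Notation br X Y := (X *m Y - Y *m X).
Variables (n : nat) (G T : set 'M[C]_n) (r : nat) (e : 'I_r -> 'M[C]_n -> C).
Hypothesis rG : connected_reductive G.
Hypothesis mT : maximal_torus G T.
Hypothesis Te : char_basis T e.
Variables (N : nat) (chi : 'I_N -> 'rV[int]_r) (P : 'I_N -> 'M[C]_n).
Hypothesis chiI : injective chi.
Hypothesis TE : forall t, T t -> t = \sum_i char_of e (chi i) t *: P i.
Hypothesis P1 : \sum_i P i = 1%:M.
Hypothesis PP : forall i j, P i *m P j = if i == j then P i else 0.
Hypothesis Pn0 : forall i, P i != 0.
Let cG : closed_subgroup G. Proof. by case: rG. Qed.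
Let sG : subgroup_GL G. Proof. by case: cG. Qed.
Local Notation rs := (rs G chi P).
Local Notation isroot := (isroot G chi P).

Local Notation toR := (@toR R r).
Local Notation ip := (@ip R n r N chi P).
Local Notation refl := (reflection ip).
Local Notation srefl := (srefl chi P).
Let ipDl := @ipDl R n r N chi P.
Let ipZl := @ipZl R n r N chi P.
Let ipC := @ipC R n r N chi P.
Let ip_gt0 := @ip_gt0 R n G T r e mT Te N chi P TE P1 PP Pn0.

Lemma refl_of_lin a (u v : 'rV[int]_r) :
  (forall z, lin z u = lin (srefl a z) v) -> toR u = refl (toR a) (toR v).
Proof.
move=> H; apply/rowP => k; have := H (fun l => (l == k)%:R); rewrite lin_srefl !lin_coord => E.
apply: complexI; rewrite /reflection !mxE rmorphB rmorphM /= !rmorph_int E (ipC (toR v)).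
by rewrite mulrC.
Qed.

Section Intertwiner.
Variables (m M : nat) (mu : 'I_M -> 'rV[int]_r) (Q : 'I_M -> 'M[C]_m).
Hypothesis Q1 : \sum_i Q i = 1%:M.
Hypothesis QQ : forall i j, Q i *m Q j = if i == j then Q i else 0.
Hypothesis Qn0 : forall i, Q i != 0.

(** Indexed by all real vectors, and 0 off the weights, because the difference operators evaluate
    multiplicities at points displaced by half roots. *)
Definition wproj (x : 'rV[R]_r) : 'M[C]_m := \sum_j (toR (mu j) == x)%:R *: Q j.
Definition wmult (x : 'rV[R]_r) : R := \sum_j (toR (mu j) == x)%:R * (\rank (Q j))%:R.

Lemma tr_wproj x : \tr (wproj x) = (wmult x)%:C.
Proof.
rewrite /wproj /wmult !raddf_sum; apply: eq_bigr => j _ /=.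
by rewrite mxtraceZ (mxtrace_idempotent (P := Q j)) ?QQ ?eqxx // rmorphM /= !rmorph_nat.
Qed.

Lemma wproj_move (D : 'M[C]_m) x y :
  (forall i j, Q i *m D *m Q j != 0 -> (toR (mu i) == x) = (toR (mu j) == y)) ->
  wproj x *m D = D *m wproj y.
Proof.
move=> H.
have -> : wproj x *m D = \sum_i \sum_j (toR (mu i) == x)%:R *: (Q i *m D *m Q j).
  rewrite mulmx_suml; apply: eq_bigr => i _.
  by rewrite -scaler_sumr -mulmx_sumr Q1 mulmx1 scalemxAl.
have -> : D *m wproj y = \sum_i \sum_j (toR (mu j) == y)%:R *: (Q i *m D *m Q j).
  rewrite exchange_big mulmx_sumr; apply: eq_bigr => j _ /=.
  by rewrite -scaler_sumr -!mulmx_suml Q1 mul1mx scalemxAr.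
apply: eq_bigr => i _; apply: eq_bigr => j _.
by have [->|nz] := eqVneq (Q i *m D *m Q j) 0; rewrite ?scaler0 // (H i j nz).
Qed.

Variables (a : 'rV[int]_r) (W : 'M[C]_m).
Hypothesis a0 : a != 0.
Hypothesis Wu : W \in unitmx.
Hypothesis HW : forall z, Hx mu Q z *m W = W *m Hx mu Q (srefl a z).

Lemma intertwine i j : Q i *m W *m Q j != 0 -> toR (mu i) = refl (toR a) (toR (mu j)).
Proof.
move=> nz; apply: refl_of_lin => z.
have : Q i *m (Hx mu Q z *m W) *m Q j = Q i *m (W *m Hx mu Q (srefl a z)) *m Q j by rewrite HW.
rewrite mulmxA (PHx mu QQ) -!mulmxA (HxP mu QQ) -scalemxAl -!scalemxAr !mulmxA => /eqP.
by rewrite -subr_eq0 -scalerBl scaler_eq0 (negPf nz) orbF subr_eq0 => /eqP.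
Qed.

Lemma refl_weight j : exists i, toR (mu i) = refl (toR a) (toR (mu j)).
Proof.
apply: contrapT => nex; move: (Qn0 j); rewrite -[Q j](mulKmx Wu) -[W *m Q j]mul1mx -Q1.
rewrite mulmx_suml big1 ?mulmx0 ?eqxx // => i _; apply/eqP/negPn/negP; rewrite mulmxA => nz.
by apply: nex; exists i; exact: intertwine.
Qed.

Lemma toRa0 : toR a != 0. Proof. exact: toR_neq0. Qed.

Lemma wmult_refl x : wmult (refl (toR a) x) = wmult x.
Proof.
have reflK := reflK ipDl ipZl ip_gt0 toRa0.
apply: complexI; rewrite -!tr_wproj -[wproj (refl _ _)](mulmxK Wu).
rewrite (wproj_move (y := x)); last first.
  move=> i j /intertwine ->; apply/eqP/eqP => [|->//].
  by move=> /(congr1 (refl (toR a))); rewrite !reflK.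
by rewrite -mulmxA mxtrace_mulC mulmxKV.
Qed.
End Intertwiner.

Section RootSystem.
Variables (Phi : seq 'rV[int]_r) (h : 'rV[int]_r).
Hypothesis hroot : forall a, isroot a -> dot h a != 0.
Hypothesis hPhi : forall a, a \in Phi <-> isroot a /\ 0 < dot h a.
Local Notation PhiR := [seq toR a | a <- Phi].

Definition hR (x : 'rV[R]_r) : R := \sum_i x 0 i * (h 0 i)%:~R.
Lemma hRD x y : hR (x + y) = hR x + hR y.
Proof. by rewrite -big_split; apply: eq_bigr => i _; rewrite mxE mulrDl. Qed.
Lemma hRZ c x : hR (c *: x) = c * hR x.
Proof. by rewrite mulr_sumr; apply: eq_bigr => i _; rewrite mxE mulrA. Qed.
Lemma hR_toR a : hR (toR a) = (dot h a)%:~R.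
Proof. by rewrite rmorph_sum; apply: eq_bigr => i _; rewrite mxE rmorphM. Qed.
Lemma PhiRP x : x \in PhiR -> exists2 a, a \in Phi & x = toR a.
Proof. by case/seq.mapP => a aP ->; exists a. Qed.
Lemma hR_gt0 x : x \in PhiR -> 0 < hR x.
Proof. by move=> /PhiRP[a /hPhi[_ a0] ->]; rewrite hR_toR ltr0z. Qed.

Lemma PhiR_int x y : x \in PhiR -> y \in PhiR -> exists k : int, 2 * ip y x / ip x x = k%:~R.
Proof.
move=> /PhiRP[a /hPhi[ra _] ->] /PhiRP[b /hPhi[rb _] ->].
exact: (cartan_int rG mT Te chiI TE P1 PP Pn0).
Qed.

Lemma Phi_double a : a \in Phi -> a + a \notin Phi.
Proof.
move=> /hPhi[ra _]; have [a0 [E rE E0]] := ra.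
have [F sEF] := sl2pair_exists rG mT Te TE P1 PP a0 rE E0.
apply/negP => /hPhi[[_ [D rD D0]] _]; move: D0.
by rewrite (rs_double0 rG mT Te chiI TE P1 PP Pn0 sEF rD) eqxx.
Qed.

(** The two Cartan integers are 2 c and 2 / c, with product 4, so c is 1/2, 1 or 2. The values 1/2
    and 2 would make one root the double of another. *)
Lemma PhiR_red x y c : x \in PhiR -> y \in PhiR -> y = c *: x -> y = x.
Proof.
move=> xP yP yx; have [k Hk] := PhiR_int xP yP; have [l Hl] := PhiR_int yP xP.
have [a aP xa] := PhiRP xP; have [b bP yb] := PhiRP yP.
have x0 : 0 < ip x x by rewrite ip_gt0 // xa toR_neq0 //; case: ((hPhi a).1 aP) => -[].
have c0 : 0 < c.
  by have := hR_gt0 yP; rewrite yx hRZ pmulr_lgt0 // hR_gt0.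
have kc : k%:~R = 2 * c by rewrite -Hk yx ipZl mulrA mulfK // gt_eqF.
have lc : l%:~R * c = 2 :> R.
  rewrite -Hl yx ipZl (ipC x (c *: x)) !ipZl; field.
  by rewrite !gt_eqF // c0.
have k0 : 0 < k by rewrite -(ltr0z R) kc mulr_gt0.
have l0 : 0 < l by rewrite -(ltr0z R) -(pmulr_lgt0 _ c0) lc ltr0n.
have kl : k * l = 4.
  apply: (@intr_inj R); rewrite rmorphM /= kc -mulrA (mulrC c) lc; ring.
have : k = 1 \/ k = 2 \/ k = 4 by nia.
case=> [E|[E|E]].
- have cE : c = 2^-1 by move: kc; rewrite E => H; lra.
  have : a = b + b by apply: (@toR_inj R r); rewrite toRD -yb -xa yx cE; exact: (esym (halfD x)).
  by move=> E'; have := Phi_double bP; rewrite -E' aP.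
- by have -> : y = x by rewrite yx; have -> : c = 1 by [move: kc; rewrite E => H; lra]; rewrite scale1r.
- have cE : c = 2 by move: kc; rewrite E => H; lra.
  have : b = a + a by apply: (@toR_inj R r); rewrite toRD -yb -xa yx cE scaler_nat mulr2n.
  by move=> E'; have := Phi_double aP; rewrite -E' bP.
Qed.

(** Conjugation by the lift w of the reflection in a carries a root vector of b to one whose weight
    is the reflected root. *)
Lemma PhiR_refl x y : x \in PhiR -> y \in PhiR -> (refl x y \in PhiR) || (- refl x y \in PhiR).
Proof.
move=> /PhiRP[a aP ->] /PhiRP[b bP ->]; have [ra _] := (hPhi a).1 aP; have [rb _] := (hPhi b).1 bP.
have [k Hk] := cartan_int rG mT Te chiI TE P1 PP Pn0 ra rb.
have rE : refl (toR a) (toR b) = toR (b - k *: a) by rewrite /reflection Hk toRD toRN toRZ.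
have [w Gw Hw] := reflection_element rG mT Te chiI TE P1 PP Pn0 ra.
have wu := G_unit sG Gw.
have [_ [X [LX hX] X0]] := rb.
have rc : isroot (b - k *: a).
  split.
    apply/eqP => E; have : refl (toR a) (toR b) = 0 by rewrite rE E; apply/rowP => i; rewrite !mxE.
    move=> /(congr1 (refl (toR a))); rewrite (reflK ipDl ipZl ip_gt0); last by rewrite toR_neq0 //; case: ra.
    rewrite /reflection -[0](scale0r (toR a)) ipZl mul0r mulr0 mul0r !scale0r subr0 => b0.
    by case: rb => /negP[]; apply/eqP/(@toR_inj R r); rewrite b0; apply/rowP => i; rewrite !mxE.
  exists (w *m X *m invmx w); last first.
    apply: contraNneq X0 => E; rewrite -[X](mulKmx wu) -[w *m X](mulmxKV wu) E.
    by rewrite mul0mx mulmx0.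
  split=> [|z]; first exact: lie_Ad.
  have -> : lin z (b - k *: a) = lin (srefl a z) b.
    rewrite lin_srefl -(ipC (toR b)) Hk -[lin z _]/(lin z _) linD; congr (_ + _).
    rewrite -[- _]scaleN1r scalerA /lin mulr_suml -sumrN; apply: eq_bigr => i _.
    by rewrite mxE !rmorphM /= rmorphN1 rmorph_int; ring.
  have HX := hX (srefl a z).
  have -> : w *m X *m invmx w *m Hx chi P z = w *m (X *m Hx chi P (srefl a z)) *m invmx w.
    rewrite -[LHS]mulmx1 -(mulmxV wu) !mulmxA -(mulmxA _ (Hx chi P z)) Hw !mulmxA.
    by rewrite mulmxKV.
  have -> : Hx chi P z *m (w *m X *m invmx w) = w *m (Hx chi P (srefl a z) *m X) *m invmx w.
    by rewrite !mulmxA Hw.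
  by rewrite -mulmxBl -mulmxBr HX -scalemxAr -scalemxAl.
have nz := hroot rc; move: nz; rewrite neq_lt => /orP[n0|p0]; apply/orP.
  right; rewrite rE -toRN; apply: (seq.map_f toR); apply/hPhi; split.
    exact: (isrootN rG mT Te TE P1 PP).
  by rewrite dotN oppr_gt0.
by left; rewrite rE; apply: (seq.map_f toR); apply/hPhi.
Qed.

Lemma PhiR_uniq : uniq Phi -> uniq PhiR.
Proof. by move=> u; rewrite map_inj_uniq //; exact: toR_inj. Qed.

Definition chiR := [seq toR (chi i) | i <- enum 'I_N].
Lemma chiR_refl x y : x \in PhiR -> y \in chiR -> refl x y \in chiR.
Proof.
move=> /PhiRP[a aP ->] /seq.mapP[i _ ->]; have [ra _] := (hPhi a).1 aP.
have [w Gw Hw] := reflection_element rG mT Te chiI TE P1 PP Pn0 ra.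
have [j <-] := refl_weight P1 PP Pn0 (G_unit sG Gw) Hw i.
by apply: (seq.map_f (fun i => toR (chi i))); rewrite mem_enum.
Qed.
Lemma chiR_span (w w' : 'M[R]_r) : (forall x, x \in chiR -> x *m w = x *m w') -> w = w'.
Proof.
move=> H; have gu : gram chi P \in unitmx := gram_unit mT Te TE P1 PP Pn0.
rewrite -[w](mulKmx gu) -[w'](mulKmx gu); congr (_ *m _); rewrite gramE !mulmx_suml.
apply: eq_bigr => i _; rewrite -!scalemxAl -!mulmxA H //.
by apply: (seq.map_f (fun i => toR (chi i))); rewrite mem_enum.
Qed.
End RootSystem.
End WeightReflections.

Section Casimir.
Variable R : realType.
Local Notation C := R[i].
Local Notation br X Y := (X *m Y - Y *m X).
Variables (n : nat) (G T : set 'M[C]_n) (r : nat) (e : 'I_r -> 'M[C]_n -> C).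
Hypothesis rG : connected_reductive G.
Hypothesis mT : maximal_torus G T.
Hypothesis Te : char_basis T e.
Variables (N : nat) (chi : 'I_N -> 'rV[int]_r) (P : 'I_N -> 'M[C]_n).
Hypothesis chiI : injective chi.
Hypothesis TE : forall t, T t -> t = \sum_i char_of e (chi i) t *: P i.
Hypothesis P1 : \sum_i P i = 1%:M.
Hypothesis PP : forall i j, P i *m P j = if i == j then P i else 0.
Hypothesis Pn0 : forall i, P i != 0.
Let cG : closed_subgroup G. Proof. by case: rG. Qed.
Let sG : subgroup_GL G. Proof. by case: cG. Qed.
Local Notation rs := (rs G chi P).
Local Notation isroot := (isroot G chi P).

Local Notation toR := (@toR R r).
Local Notation ip := (@ip R n r N chi P).
Local Notation sl2pair := (sl2pair G chi P).
Let ipDl := @ipDl R n r N chi P.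
Let ipZl := @ipZl R n r N chi P.
Let ipC := @ipC R n r N chi P.
Let wt := @wt R n r N chi P.
Let delta1 k : 'rV[int]_r := delta_mx 0 k.

Variables (m : nat) (rho drho : 'M[C]_n -> 'M[C]_m).
Variables (M : nat) (mu : 'I_M -> 'rV[int]_r) (Q : 'I_M -> 'M[C]_m).
Hypothesis irr : irreducible_rep G rho.
Hypothesis drho_lin : forall a X Y, drho (a *: X + Y) = a *: drho X + drho Y.
Hypothesis drho_conj : forall g X, G g -> Lie G X ->
  rho g *m drho X = drho (g *m X *m invmx g) *m rho g.
Hypothesis drho_br : forall X Y, Lie G X -> Lie G Y -> drho (br X Y) = br (drho X) (drho Y).
Hypothesis drho_H : forall x, drho (Hx chi P x) = Hx mu Q x.
Hypothesis commG : forall A, (forall X, Lie G X -> A *m drho X = drho X *m A) ->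
  forall g, G g -> A *m rho g = rho g *m A.
Hypothesis muI : injective mu.
Hypothesis Q1 : \sum_i Q i = 1%:M.
Hypothesis QQ : forall i j, Q i *m Q j = if i == j then Q i else 0.
Hypothesis Qn0 : forall i, Q i != 0.


Let drho0 := drho0 drho_lin.
Let drhoZ := drhoZ drho_lin.
Let drhoD := drhoD drho_lin.
Let drho_sum := drho_sum drho_lin.

(** Expanding the brackets of X with the p.1 in the first family and with the p.2 in the dual one,
    the coefficients cancel in pairs by invariance of the trace. That the dual family also expands
    is a consequence of nondegeneracy. *)
Lemma casimir_commutes (L : seq ('M[C]_n * 'M[C]_n)) :
  (forall p, p \in L -> Lie G p.1 /\ Lie G p.2) ->
  (forall Y, Lie G Y -> Y = \sum_(p <- L) \tr (Y *m p.2) *: p.1) ->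
  forall X, Lie G X -> (\sum_(p <- L) drho p.1 *m drho p.2) *m drho X =
    drho X *m (\sum_(p <- L) drho p.1 *m drho p.2).
Proof.
move=> LL HL X LX.
have HL2 Y : Lie G Y -> Y = \sum_(p <- L) \tr (Y *m p.1) *: p.2.
  move=> LY; apply/eqP; rewrite -subr_eq0; apply/eqP/(trace_radical0 rG); split.
    apply: lieB => //; rewrite big_seq; apply: lie_sum => p pL.
    by apply: lieZ; case: (LL p pL).
  move=> Z LZ; pose f (p : 'M[C]_n * 'M[C]_n) := \tr (Z *m p.2) * \tr (Y *m p.1).
  have e1 : \tr (Y *m Z) = \sum_(p <- L) f p.
    rewrite {1}(HL Z LZ) mulmx_sumr raddf_sum; apply: eq_bigr => p _.
    by rewrite /= -scalemxAr mxtraceZ.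
  have e2 : \tr ((\sum_(p <- L) \tr (Y *m p.1) *: p.2) *m Z) = \sum_(p <- L) f p.
    rewrite mulmx_suml raddf_sum; apply: eq_bigr => p _.
    by rewrite /= -scalemxAl mxtraceZ (mxtrace_mulC p.2) mulrC.
  by rewrite mulmxBl raddfB /= e1 e2 subrr.
have brE p : p \in L -> drho X *m (drho p.1 *m drho p.2) - drho p.1 *m drho p.2 *m drho X =
    drho (br X p.1) *m drho p.2 + drho p.1 *m drho (br X p.2).
  move=> /LL[L1 L2]; rewrite !drho_br // mulmxBl mulmxBr !mulmxA addrA subrK //.
apply/esym/eqP; rewrite -subr_eq0 mulmx_sumr mulmx_suml -sumrB (eq_big_seq _ brE) big_split /=.
have -> : \sum_(p <- L) drho (br X p.1) *m drho p.2 =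
    \sum_(p <- L) \sum_(q <- L) \tr (br X p.1 *m q.2) *: (drho q.1 *m drho p.2).
  apply: eq_big_seq => p /LL[L1 L2]; rewrite {1}(HL (br X p.1)); last exact: lie_bracket.
  by rewrite drho_sum mulmx_suml; apply: eq_bigr => q _; rewrite drhoZ -scalemxAl.
have -> : \sum_(p <- L) drho p.1 *m drho (br X p.2) =
    \sum_(p <- L) \sum_(q <- L) \tr (br X q.2 *m p.1) *: (drho q.1 *m drho p.2).
  rewrite exchange_big /=.
  apply: eq_big_seq => p /LL[L1 L2]; rewrite {1}(HL2 (br X p.2)); last exact: lie_bracket.
  by rewrite drho_sum mulmx_sumr; apply: eq_bigr => q _; rewrite drhoZ -scalemxAr.
rewrite -big_split big1 //= => p _; rewrite -big_split big1 //= => q _.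
rewrite -scalerDl !mulmxBl !raddfB /=.
rewrite -[X *m q.2 *m p.1]mulmxA (mxtrace_mulC X) -[q.2 *m p.1 *m X]mulmxA (mxtrace_mulC q.2).
rewrite -[p.1 *m X *m q.2]mulmxA (mxtrace_mulC p.1).
by rewrite -(mulmxA X q.2) (mxtrace_mulC X (q.2 *m p.1)) (mxtrace_mulC _ q.2) mulmxA addrA subrK subrr scale0r.
Qed.

Variables (Phi : seq 'rV[int]_r) (h : 'rV[int]_r).
Hypothesis hroot : forall a, isroot a -> dot h a != 0.
Hypothesis hPhi : forall a, a \in Phi <-> isroot a /\ 0 < dot h a.
Hypothesis Phi_uniq : uniq Phi.
Variables (E F : 'rV[int]_r -> 'M[C]_n).
Hypothesis EF : forall a, a \in Phi -> sl2pair a (E a) (F a).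

(** A basis of Lie G paired with its dual basis for the trace form: the coordinate vectors of Lie T
    with their Gram duals, then each root vector with the opposite one. *)
Definition dual_pairs : seq ('M[C]_n * 'M[C]_n) :=
  [seq (Hx chi P (rC (toR (delta1 k))), Hx chi P (wt (delta1 k))) | k <- index_enum 'I_r] ++
  [seq (E a, F a) | a <- Phi] ++ [seq (F a, E a) | a <- Phi].

Lemma sum_dual_pairs (V : nmodType) (f : 'M[C]_n * 'M[C]_n -> V) : \sum_(p <- dual_pairs) f p =
  \sum_k f (Hx chi P (rC (toR (delta1 k))), Hx chi P (wt (delta1 k))) +
  \sum_(a <- Phi) (f (E a, F a) + f (F a, E a)).
Proof. by rewrite !big_cat !big_map /= big_split. Qed.

Lemma dual_pairs_lie p : p \in dual_pairs -> Lie G p.1 /\ Lie G p.2.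
Proof.
rewrite !mem_cat => /or3P[] /seq.mapP[a aP ->] /=.
- by split; exact: (lie_Hx mT Te TE P1).
- by have [_ [] ? _ [] ? _ _] := EF aP.
- by have [_ [] ? _ [] ? _ _] := EF aP.
Qed.

Lemma dual_expansion Y : Lie G Y -> Y = \sum_(p <- dual_pairs) \tr (Y *m p.2) *: p.1.
Proof.
pose L Y := \sum_(p <- dual_pairs) \tr (Y *m p.2) *: p.1.
have LD Y1 Y2 : L (Y1 + Y2) = L Y1 + L Y2.
  by rewrite -big_split; apply: eq_bigr => p _; rewrite mulmxDl raddfD /= scalerDl.
have L0 : L 0 = 0 by rewrite /L big1 // => p _; rewrite mul0mx raddf0 scale0r.
have tr0 a b X Z : rs a X -> rs b Z -> a + b != 0 -> \tr (X *m Z) = 0.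
  by move=> [_ hX] [_ hZ] ab; exact: (hw_tr0 ab (hwM hX hZ)).
have rH z : rs 0 (Hx chi P z).
  split=> [|x]; first exact: (lie_Hx mT Te TE P1).
  by rewrite /Hx !(dsumM PP) [lin x 0]raddf0 scale0r; under eq_bigr do rewrite mulrC; rewrite subrr.
have dpos a b : a \in Phi -> b \in Phi -> a + b != 0.
  move=> /hPhi[_ a0] /hPhi[_ b0]; apply/eqP => /(congr1 (dot h)); rewrite dotD dot0.
  by move/eqP; rewrite gt_eqF // addr_gt0.
have root0 a : a \in Phi -> a != 0 by move=> /hPhi[[]].
have LH z : L (Hx chi P z) = Hx chi P z.
  rewrite /L sum_dual_pairs /= [X in _ + X]big_seq [X in _ + X]big1 ?addr0 => [|a aP]; last first.
    have [_ rE rF _] := EF aP; rewrite (tr0 _ _ _ _ (rH z) rF) ?add0r ?oppr_eq0 ?root0 // scale0r add0r.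
    by rewrite (tr0 _ _ _ _ (rH z) rE) ?scale0r // add0r root0.
  under eq_bigr do rewrite mxtrace_mulC (trHx_wt mT Te TE P1 PP Pn0) lin_delta /Hx scaler_sumr.
  rewrite exchange_big; apply: eq_bigr => i _; under eq_bigr do rewrite scalerA.
  rewrite -scaler_suml; congr (_ *: _); apply: eq_bigr => k _; rewrite mulrC; congr (_ * _).
  rewrite lin_rC mxE (bigD1 k) //= big1 ?addr0 => [|l lk]; last by rewrite !mxE (negPf lk) mul0r.
  by rewrite !mxE !eqxx mul1r rmorph_int.
have LR b X : rs b X -> isroot b -> L X = X.
  move=> rX rb; rewrite /L sum_dual_pairs /= big1 ?add0r => [|k _]; last first.
    by rewrite (tr0 _ _ _ _ rX (rH _)) ?scale0r // addr0; case: rb.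
  have [bP|bP] := root_sign rG mT Te TE P1 PP hroot hPhi rb.
    have sb := EF bP; have [_ rE rF _] := sb.
    rewrite (bigD1_seq b) //= (tr0 _ _ _ _ rX rE) ?dpos // scale0r addr0.
    rewrite -(rs_dim1 rG mT Te chiI TE P1 PP Pn0 sb rX) big_seq_cond big1 ?addr0 // => a /andP[aP ab].
    have [_ rEa rFa _] := EF aP.
    by rewrite (tr0 _ _ _ _ rX rEa) ?dpos // (tr0 _ _ _ _ rX rFa) ?scale0r ?addr0 // subr_eq0 eq_sym.
  have sb := sl2pairN (EF bP); have [_ rE rF _] := sb; rewrite opprK in rF; rewrite opprK in sb.
  have dn a : a \in Phi -> b - a != 0.
    by move=> aP; rewrite -oppr_eq0 opprB addrC dpos.
  have := rs_dim1 rG mT Te chiI TE P1 PP Pn0 sb rX => rXE.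
  rewrite (bigD1_seq (- b)) //= -rXE.
  rewrite (tr0 b b _ _ rX) ?scale0r ?add0r; last 2 first.
  - by have [_ _] := EF bP; rewrite opprK.
  - by have := dn _ bP; rewrite opprK.
  rewrite big_seq_cond big1 ?addr0 // => a /andP[aP ab].
  have [_ rEa rFa _] := EF aP.
  by rewrite (tr0 _ _ _ _ rX rFa) ?dn // (tr0 _ _ _ _ rX rEa) ?scale0r ?addr0 // addrC addr_eq0.
move=> /(lie_decomp rG mT Te chiI TE P1 PP Pn0)[z [S [YE HS]]].
rewrite -/(L Y) [in RHS]YE LD LH [LHS]YE; congr (_ + _).
elim: S HS {YE} => [|a S IH] HS; first by rewrite !big_nil L0.
rewrite !big_cons LD -IH => [|b bS]; last by apply: HS; rewrite inE bS orbT.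
congr (_ + _); have [rC [->|ra]] := HS a (mem_head _ _); first by rewrite L0.
by rewrite (LR a).
Qed.

Local Notation wproj := (wproj mu Q).
Local Notation wmult := (wmult mu Q).

Lemma wproj_Hx u x : wproj x *m Hx mu Q (rC u) = ((u *m x^T) 0 0)%:C *: wproj x.
Proof.
rewrite /wproj /Hx scaler_sumr mulmx_suml; apply: eq_bigr => i _.
rewrite -scalemxAl (PHx mu QQ) !scalerA mulrC; case: eqP => [<-|_]; first by rewrite lin_rC.
by rewrite !mulr0.
Qed.

Lemma wproj_shift a X x : Lie G X -> hw chi P a X ->
  wproj x *m drho X = drho X *m wproj (x - toR a).
Proof.
move=> LX hX; apply: (wproj_move Q1) => i j nz.
have E1 : mu i - mu j = a.
  apply/eqP/negPn/negP => ne; move: nz.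
  by rewrite (hw_out QQ (hw_drho mT Te TE P1 drho_lin drho_br drho_H LX hX) ne) eqxx.
rewrite -E1 toRD toRN; apply/eqP/eqP => [<-|E2]; first by rewrite subKr.
by move: (congr1 (fun v => v + (toR (mu i) - toR (mu j))) E2); rewrite subrK addrC subrK.
Qed.

(* t is not determined by the weights, but t a (x - a) - t a x is. *)
Let t a x : C := \tr (wproj x *m drho (F a) *m drho (E a)).

(** By cyclicity, the trace of f e on the space of weight x - a is that of e f on the space of
    weight x. The difference is the trace of [e, f], which is the scalar [ip x a] there. *)
Lemma lowering_recurrence a x : a \in Phi ->
  t a (x - toR a) - t a x = (ip x (toR a) * wmult x)%:C.
Proof.
move=> aP; have [_ [LE hE] [LF hF] _] := EF aP; rewrite /t.
have E1 : wproj (x - toR a) *m drho (F a) = drho (F a) *m wproj x.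
  by rewrite (wproj_shift _ LF hF) toRN opprK subrK.
rewrite E1 -mulmxA mxtrace_mulC -raddfB /= -!mulmxA -mulmxBr -drho_br //.
rewrite (sl2pair_br rG mT Te chiI TE P1 PP Pn0 (EF aP)) drho_H wproj_Hx mxtraceZ (tr_wproj mu QQ).
by rewrite -[((_ *m _) _ _)]/(ip (toR a) x) ipC rmorphM.
Qed.

(** The trace of the scalar Casimir element on the weight space of x: the torus part gives the norm
    of x, and e f = f e + [e, f] turns the two terms of each root into one pairing and twice t. *)
Lemma casimir_trace : exists c : C, forall x, c * (wmult x)%:C = (ip x x * wmult x)%:C +
  \sum_(a <- Phi) ((ip x (toR a) * wmult x)%:C + 2 * t a x).
Proof.
have comm := casimir_commutes dual_pairs_lie dual_expansion.
have [c Hc] := schur irr commG comm; exists c => x.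
have := congr1 (fun A => \tr (wproj x *m A)) Hc.
rewrite mul_mx_scalar mxtraceZ (tr_wproj mu QQ) => <-.
rewrite mulmx_sumr raddf_sum sum_dual_pairs /=; congr (_ + _).
  under eq_bigr do rewrite !drho_H mulmxA wproj_Hx -scalemxAl wproj_Hx !mxtraceZ (tr_wproj mu QQ) -!rmorphM.
  rewrite -rmorph_sum; congr (_%:C); under eq_bigr do rewrite mulrA.
  rewrite -mulr_suml; congr (_ * _).
  have xE : x = \sum_k x 0 k *: toR (delta1 k).
    apply/rowP => l; rewrite summxE (bigD1 l) //= big1 ?addr0 => [|k kl]; rewrite !mxE ?eqxx ?mulr1 //.
    by rewrite eq_sym (negPf kl) mulr0.
  have ip_sum (I : Type) (s : seq I) (f : I -> 'rV[R]_r) y : ip (\sum_(i <- s) f i) y = \sum_(i <- s) ip (f i) y.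
    elim: s => [|i s IH]; last by rewrite !big_cons ipDl IH.
    by rewrite !big_nil -(scale0r (0 : 'rV[R]_r)) ipZl mul0r.
  transitivity (ip (\sum_k x 0 k *: toR (delta1 k)) x); last by rewrite -xE.
  rewrite ip_sum; apply: eq_bigr => k _; rewrite ipZl; congr (_ * _).
  rewrite mxE (bigD1 k) //= big1 ?addr0 => [|l lk]; last by rewrite !mxE (negPf lk) mul0r.
  by rewrite !mxE !eqxx mul1r.
apply: eq_big_seq => a aP; have [_ [LE hE] [LF hF] _] := EF aP; rewrite /= /t.
have -> : drho (E a) *m drho (F a) = drho (F a) *m drho (E a) + Hx mu Q (wt a).
  by rewrite -drho_H -(sl2pair_br rG mT Te chiI TE P1 PP Pn0 (EF aP)) drho_br // addrC subrK.
rewrite mulmxDr raddfD /= wproj_Hx mxtraceZ (tr_wproj mu QQ) -[((_ *m _) _ _)]/(ip (toR a) x) ipC rmorphM.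
rewrite !mulmxA; ring.
Qed.

Lemma rep_weightfun i0 : (forall j, exists c : 'rV[int]_r -> nat, mu i0 - mu j = \sum_(a <- Phi) a *+ c a) ->
  weightfun ip [seq toR a | a <- Phi] wmult (toR (mu i0)).
Proof.
move=> hwt; have [rhoG _ _] := irr; have [r1 _ _] := rhoG.
have supp x : wmult x != 0 -> exists j, x = toR (mu j).
  move=> nz; apply: contrapT => nex; move: nz; rewrite /wmult big1 ?eqxx // => j _.
  by case: eqP => [E'|]; rewrite ?mul0r //; case: nex; exists j.
constructor.
- exists [seq toR (mu j) | j <- enum 'I_M] => x xs; apply/eqP/negPn/negP => /supp[j xE].
  by case/negP: xs; rewrite xE; apply: (seq.map_f (fun j => toR (mu j))); rewrite mem_enum.
- move=> _ x /seq.mapP[a aP ->]; have [ra _] := (hPhi a).1 aP.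
  have [w Gw Hw] := reflection_element rG mT Te chiI TE P1 PP Pn0 ra.
  apply: (wmult_refl mT Te TE P1 PP Pn0 Q1 QQ (W := rho w)).
  + by case: ra.
  + exact: r1.
  + move=> z; have LH := lie_Hx mT Te TE P1 (srefl chi P a z).
    have := drho_conj Gw LH; rewrite -Hw mulmxK ?(G_unit sG) // !drho_H => <-; by [].
- rewrite /wmult (bigD1 i0) //= eqxx mul1r (highest_rank1 rG mT Te chiI TE P1 PP Pn0 irr drho_lin drho_conj drho_br drho_H commG Q1 QQ Qn0 hroot hPhi hwt).
  rewrite big1 ?addr0 // => j ji; rewrite (inj_eq (@toR_inj R r)) (inj_eq muI) (negPf ji) mul0r //.
- move=> x /supp[j ->]; have [c Hc] := hwt j; exists (flatten [seq nseq (c a) (toR a) | a <- Phi]).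
    move=> y /flatten_mapP[a aP]; rewrite mem_nseq => /andP[_ /eqP->]; exact: (seq.map_f toR).
  rewrite -toRN -toRD Hc big_flatten big_map /=; elim: (Phi) => [|a s IH].
    by rewrite !big_nil; apply/rowP => k; rewrite !mxE.
  by rewrite !big_cons toRD IH toRMn big_nseq iter_addr_0 scaler_nat.
have [c Hc] := casimir_trace.
(* The traces and the scalar c are complex, while the numerator is treated over the reals; taking
   real parts preserves both equations. The sum over roots with image [al] has one term when [al] is
   a root. *)
pose Tr (al x : 'rV[R]_r) : R := \sum_(a <- Phi | toR a == al) complex.Re (t a x).
have TrE a x : a \in Phi -> Tr (toR a) x = complex.Re (t a x).
  move=> aP; rewrite /Tr -big_filter (_ : [seq b <- Phi | toR b == toR a] = [:: a]) ?big_seq1 //.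
  have -> : [seq b <- Phi | toR b == toR a] = [seq b <- Phi | pred1 a b].
    by apply: eq_filter => b; rewrite /= (inj_eq (@toR_inj R r)).
  by rewrite filter_pred1_uniq.
exists Tr, (complex.Re c); split=> [_ x /seq.mapP[a aP ->]|x].
  by rewrite !TrE // -raddfB lowering_recurrence.
have ReM (y : C) (z : R) : complex.Re (y * z%:C) = complex.Re y * z.
  by case: y => u v; rewrite /= mulr0 subr0.
have := congr1 (@complex.Re R) (Hc x).
rewrite ReM (raddfD (@complex.Re R)) (raddf_sum (@complex.Re R)) [complex.Re _%:C]/= big_map.
move=> ->; congr (_ + _); apply: eq_big_seq => a aP; rewrite TrE //.
rewrite (raddfD (@complex.Re R)) mulr_natl (raddfMn (@complex.Re R)) mulr_natl; by [].
Qed.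
End Casimir.

(** * Chern classes as polynomials in the highest weight *)

Section NewtonIdentities.
Variable F : fieldType.
Implicit Types (s : seq F) (x : F).
Definition elem s : {poly F} := \prod_(x <- s) (1 + x%:P * 'X).

(** The logarithmic derivative of the product is the sum of the x X / (1 + x X); each is expanded as
    a geometric series to order K, and Q collects the remainders. *)
Lemma newton s K : exists Q, 'X * (elem s)^`() =
  elem s * (\sum_(i < K) (-1) ^+ i * \sum_(x <- s) (x%:P * 'X) ^+ i.+1) + 'X^(K.+1) * Q.
Proof.
rewrite /elem; elim: s => [|x s [Q IH]].
  exists 0; rewrite big_nil derivC !mulr0 addr0 big1 ?mulr0 // => i _.
  by rewrite big_nil mulr0.
pose y : {poly F} := x%:P * 'X; set E := \prod_(j <- s) _ in IH.
exists ((1 + y) * Q + (-1) ^+ K * x%:P ^+ K.+1 * E).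
have hS : (1 + y) * \sum_(i < K) (-1) ^+ i * y ^+ i.+1 = y - (-1) ^+ K * y ^+ K.+1.
  elim: (K) => [|k IHk]; first by rewrite big_ord0 expr0 mulr0 mul1r expr1 subrr.
  by rewrite big_ord_recr mulrDr IHk !exprS; ring.
have -> : \sum_(i < K) (-1) ^+ i * \sum_(z <- x :: s) (z%:P * 'X) ^+ i.+1 =
    \sum_(i < K) (-1) ^+ i * y ^+ i.+1 + \sum_(i < K) (-1) ^+ i * \sum_(z <- s) (z%:P * 'X) ^+ i.+1.
  by rewrite -big_split; apply: eq_bigr => i _; rewrite big_cons mulrDr.
rewrite big_cons -/E -/y derivM derivD derivC add0r derivM derivC mul0r add0r derivX mulr1.
transitivity (y * E + (1 + y) * ('X * E^`())); first by rewrite /y; ring.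
rewrite IH; set S := \sum_(i < K) (-1) ^+ i * y ^+ i.+1 in hS *; set A := \sum_(i < K) _.
have -> : (1 + y) * E * (S + A) = E * ((1 + y) * S) + (1 + y) * E * A by ring.
by rewrite hS /y exprMn; ring.
Qed.

Lemma newton_coef s k : k.+1%:R * (elem s)`_k.+1 =
  \sum_(i < k.+1) (-1) ^+ i * (\sum_(x <- s) x ^+ i.+1) * (elem s)`_(k - i).
Proof.
have [Q] := newton s k.+1 => /(congr1 (fun p : {poly F} => p`_k.+1)).
rewrite coefXM /= coef_deriv coefD coefXnM ltnSn addr0 mulr_natl => ->.
rewrite mulr_sumr coef_sum; apply: eq_bigr => i _.
have -> : (-1) ^+ i * \sum_(x <- s) (x%:P * 'X) ^+ i.+1 =
    ((-1) ^+ i * \sum_(x <- s) x ^+ i.+1)%:P * 'X^(i.+1) :> {poly F}.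
  rewrite polyCM rmorphXn rmorphN1 -mulrA; congr (_ * _).
  rewrite rmorph_sum mulr_suml; apply: eq_bigr => x _; by rewrite exprMn rmorphXn.
by rewrite [elem s * _]mulrCA coefCM coefMXn ltnS ltnNge -ltnS ltn_ord subSS.
Qed.

Lemma elem_coef0 s : (elem s)`_0 = 1.
Proof.
rewrite -horner_coef0 /elem; elim: s => [|x s IH]; first by rewrite big_nil hornerC.
by rewrite big_cons hornerM IH !hornerE /= ?mulr0 ?addr0 ?mulr1.
Qed.
End NewtonIdentities.

Section Digits.
Lemma digits_inj b r (f g : nat -> nat) : (forall i, f i < b)%N -> (forall i, g i < b)%N ->
  (\sum_(i < r) f i * b ^ i = \sum_(i < r) g i * b ^ i)%N -> forall i, (i < r)%N -> f i = g i.
Proof.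
elim: r f g => // r IH f g fb gb.
rewrite !big_ord_recl /= expn0 !muln1.
have shift (h : nat -> nat) : (\sum_(i < r) h (bump 0 i) * b ^ bump 0 i =
    b * \sum_(i < r) h i.+1 * b ^ i)%N.
  by rewrite big_distrr; apply: eq_bigr => i _; rewrite /= expnS mulnCA.
rewrite !shift => E.
have f0 : f 0%N = g 0%N.
  by have := congr1 (modn^~ b) E; rewrite /= ![(_ + b * _)%N]addnC ![(b * _)%N]mulnC !modnMDl !modn_small.
have b0 : (0 < b)%N by exact: leq_ltn_trans (fb 0%N).
case=> [//|i]; rewrite ltnS => ir; apply: (IH (fun i => f i.+1) (fun i => g i.+1)) => //.
by move: E; rewrite f0 => /eqP; rewrite eqn_add2l eqn_pmul2l // => /eqP.
Qed.
End Digits.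

Section Kronecker.
Variables (F : numFieldType) (r b : nat).
(** Kronecker substitution of X^(b^i) for the i-th variable. When b exceeds the degree, exponents
    are digits in base b, so no two monomials of that degree collide. *)
Definition kronecker (p : {mpoly int[r]}) : {poly F} :=
  mmap (fun z : int => z%:~R%:P) (fun i : 'I_r => 'X^(b ^ i)) p.
Definition digits (m : 'X_{1..r}) := (\sum_(i < r) m i * b ^ i)%N.

Lemma kronecker_mon m : mmap1 (fun i : 'I_r => 'X^(b ^ i) : {poly F}) m = 'X^(digits m).
Proof.
rewrite /mmap1 /digits (big_morph (fun k => 'X^k : {poly F}) (@exprD _ _) (expr0 _)).
by apply: eq_bigr => i _; rewrite -exprM mulnC.
Qed.
Lemma kroneckerE p : kronecker p = \sum_(m <- msupp p) (p@_m)%:~R *: 'X^(digits m).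
Proof. by apply: eq_bigr => m _; rewrite kronecker_mon mul_polyC. Qed.

Lemma digits_le k m : (0 < b)%N -> mdeg m = k -> (digits m <= k * b ^ r)%N.
Proof.
move=> b0 <-; rewrite mdegE big_distrl; apply: leq_sum => i _ /=.
by rewrite leq_mul2l leq_pexp2l ?orbT // ltnW.
Qed.

Lemma size_kronecker k p : (0 < b)%N -> p \is k.-homog -> (size (kronecker p) <= (k * b ^ r).+1)%N.
Proof.
move=> b0 /dhomogP hp; rewrite kroneckerE big_seq; elim/big_rec: _ => [|m q mp sq]; first by rewrite size_poly0.
rewrite (leq_trans (size_polyD _ _)) // geq_max sq andbT (leq_trans (size_scale_leq _ _)) //.
by rewrite size_polyXn ltnS (digits_le b0) //; exact: hp.
Qed.

Lemma digits_mono_inj k m m' : (k < b)%N -> mdeg m = k -> mdeg m' = k -> digits m = digits m' -> m = m'.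
Proof.
move=> kb dm dm' E; apply/mnmP => i.
pose f (m : 'X_{1..r}) j := if insub j is Some i then m (i : 'I_r) else 0%N.
have fE (n : 'X_{1..r}) (j : 'I_r) : f n j = n j by rewrite /f valK.
have fb n j : mdeg n = k -> (f n j < b)%N.
  move=> dn; rewrite /f; case: insubP => [u _ _|_]; last exact: leq_ltn_trans kb.
  by apply: leq_ltn_trans kb; rewrite -dn mdegE (bigD1 u) //= leq_addr.
rewrite -!fE; apply: (@digits_inj b r (f m) (f m')) => // [j|j|]; try exact: fb.
by under eq_bigr do rewrite fE; under [RHS]eq_bigr do rewrite fE.
Qed.

Lemma coef_kronecker k p m : (k < b)%N -> p \is k.-homog -> mdeg m = k ->
  (kronecker p)`_(digits m) = (p@_m)%:~R.
Proof.
move=> kb /dhomogP hp dm; rewrite kroneckerE coef_sum.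
under eq_bigr do rewrite coefZ coefXn.
have [mp|mnp] := boolP (m \in msupp p).
  rewrite (bigD1_seq m) //= eqxx mulr1 big_seq_cond big1 ?addr0 // => m' /andP[m'p ne].
  case: eqP => [E|_]; last by rewrite mulr0.
  by case/eqP: ne; apply: (digits_mono_inj kb) => //; exact: hp.
rewrite (memN_msupp_eq0 mnp) big_seq big1 // => m' m'p.
case: eqP => [E|_]; last by rewrite mulr0.
by move: mnp; rewrite (digits_mono_inj kb dm _ E) ?m'p //; exact: hp.
Qed.

(** The value of the linear form [c1 w] at the point H with coordinates t^(b^i). *)
Definition keval (t : F) (w : 'rV[int]_r) : F := \sum_(i < r) (w 0 i)%:~R * t ^+ (b ^ i).

Lemma kronecker_chern k (ws : seq 'rV[int]_r) t :
  (kronecker (pihomog mdeg k (\prod_(w <- ws) (1 + c1 w)))).[t] =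
  (elem [seq keval t w | w <- ws])`_k.
Proof.
pose Phi := mmap (polyC \o (intr : int -> F)) (fun i : 'I_r => (t ^+ (b ^ i))%:P * 'X).
have PhiE : Phi (\prod_(w <- ws) (1 + c1 w)) =
    elem [seq keval t w | w <- ws].
  rewrite /Phi rmorph_prod /elem big_map; apply: eq_bigr => w _.
  rewrite rmorphD rmorph1; congr (_ + _); rewrite /c1 rmorph_sum rmorph_sum mulr_suml.
  apply: eq_bigr => i _; rewrite /= mmapZ /= mmapX mmap1U mulrA -polyCM; congr (_ * _).
rewrite -PhiE; move: (\prod_(w <- ws) _) => p.
have mon1 m : mmap1 (fun i : 'I_r => (t ^+ (b ^ i))%:P * 'X) m = (t ^+ digits m)%:P * 'X^(mdeg m) :> {poly F}.
  rewrite /mmap1 mdegE /digits (big_morph (fun k => t ^+ k) (@exprD _ _) (expr0 _)).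
  rewrite (big_morph (fun k => 'X^k : {poly F}) (@exprD _ _) (expr0 _)) rmorph_prod -big_split.
  by apply: eq_bigr => i _; rewrite /= exprMn -rmorphXn -exprM mulnC.
rewrite /Phi /mmap coef_sum.
have -> : kronecker (pihomog mdeg k p) =
   \sum_(m <- msupp p) (mdeg m == k)%:R *: ((p@_m)%:~R *: 'X^(digits m)).
  rewrite pihomogE /kronecker -[fun z => _]/(polyC \o (intr : int -> F)) rmorph_sum big_mkcond /=.
  apply: eq_bigr => m _; case: eqP => _; last by rewrite scale0r.
  by rewrite mmapZ /= mmapX kronecker_mon mul_polyC scale1r.
rewrite horner_sum; apply: eq_bigr => m _; rewrite mon1 mulrA /= -polyCM coefCM coefXn.
by rewrite !hornerZ hornerXn [k == _]eq_sym mulrC.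
Qed.
End Kronecker.

Section Coefficients.
Variables (F : numFieldType) (r : nat) (T : Type) (X : T -> 'I_r -> F) (d : nat).
(** Coefficients are recovered from values at the points where B is nonzero: divide by X - y0 for
    one such y0 and apply induction to the quotient, whose values are controlled away from y0 and
    the zeros of B. *)
Lemma pdeg_coefs D (g : T -> {poly F}) (B : {poly F}) : B != 0 -> (forall t, size (g t) <= D)%N ->
  (forall y, B.[y] != 0 -> pdeg X d (fun t => (g t).[y])) -> forall j, pdeg X d (fun t => (g t)`_j).
Proof.
elim: D g B => [|D IH] g B B0 sg Hg j.
  apply: pdeg_ext (pdeg_const X d 0) => t; have := sg t; rewrite leqn0 size_poly_eq0 => /eqP->.
  by rewrite coef0.
have [k Bk] : exists k : nat, B.[k%:R] != 0.
  apply: contrapT => nex; move/eqP: B0; apply; apply: poly0_nat => k.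
  by apply/eqP/negPn/negP => H; apply: nex; exists k.
pose y0 : F := k%:R.
pose q t := (g t - (g t).[y0]%:P) %/ ('X - y0%:P).
have qE t : g t = q t * ('X - y0%:P) + (g t).[y0]%:P.
  rewrite divpK ?subrK // dvdp_XsubCl /root hornerD hornerN hornerC subrr eqxx //.
have sq t : (size (q t) <= D)%N.
  rewrite size_divp ?polyXsubC_eq0 // size_XsubC leq_subLR add1n.
  rewrite (leq_trans (size_polyD _ _)) // geq_max sg size_polyN size_polyC.
  by case: eqP.
have Hq := IH q (B * ('X - y0%:P)) _ sq; have {}Hq i : pdeg X d (fun t => (q t)`_i).
  apply: Hq => [|y]; first by rewrite mulf_neq0 // polyXsubC_eq0.
  rewrite hornerM hornerXsubC mulf_eq0 negb_or => /andP[By yy].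
  apply: pdeg_ext (pdegZ (y - y0)^-1 (pdegD (Hg y By) (pdegZ (-1) (Hg y0 Bk)))) => t.
  by rewrite {1}(qE t) !hornerE; field.
have E t : (g t)`_j = (if j is i.+1 then (q t)`_i else 0) - y0 * (q t)`_j + (j == 0%N)%:R * (g t).[y0].
  rewrite {1}(qE t) coefD mulrBr coefB coefMX (mulrC _ y0%:P) coefCM coefC.
  by case: j => [|i] /=; rewrite ?mul1r ?mul0r.
apply: pdeg_ext (pdegD (pdegD _ (pdegZ (- y0) (Hq j))) (pdegZ (j == 0%N)%:R (Hg y0 Bk))) => [t|].
  by rewrite E mulNr.
by case: j {E} => [|i]; [exact: pdeg_const | exact: Hq].
Qed.
End Coefficients.

Section PolynomialDependence.
Variable R : realType.
Local Notation C := R[i].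
Local Notation toR := (@toR R _).

Lemma pair_indicators (V : lmodType R) (I : eqType) (s : seq I) (a : I -> R) (y : I -> V) (g : V -> R) :
  pair (fun x => \sum_(i <- s) a i * (x == y i)%:R) g = \sum_(i <- s) a i * g (y i).
Proof.
rewrite (pairE g (undup_uniq [seq y i | i <- s])) => [|x]; last first.
  rewrite mem_undup => xs; rewrite big_seq big1 // => i is'; case: eqP => [E|_]; last by rewrite mulr0.
  by case/negP: xs; rewrite E; apply: seq.map_f.
under eq_bigr do rewrite mulr_suml; rewrite exchange_big /=; apply: eq_big_seq => i is'.
have ys : y i \in undup [seq y i | i <- s] by rewrite mem_undup; apply: seq.map_f.
rewrite (bigD1_seq (y i)) ?undup_uniq //= eqxx mulr1 big1 ?addr0 // => x /negPf->.
by rewrite mulr0 mul0r.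
Qed.

Lemma meval_map (A B : comNzRingType) (f : {rmorphism A -> B}) r (q : {mpoly A[r]}) x :
  (map_mpoly f q).@[fun i => f (x i)] = f (q.@[x]).
Proof.
elim/mpoly_ring_ind: q => [c|i|p q Hp Hq|p q Hp Hq].
- by rewrite map_mpolyC !mevalC.
- by rewrite map_mpolyX !mevalXU.
- by rewrite rmorphD !mevalD Hp Hq rmorphD.
- by rewrite rmorphM !mevalM Hp Hq rmorphM.
Qed.

Variables (r : nat) (Phi : seq 'rV[int]_r) (D : set 'rV[int]_r) (k : nat).
Variables (c : 'rV[int]_r -> {mpoly int[r]}) (W : seq ('M[R]_r * R)) (k0 : R).
Local Notation PhiR := [seq toR a | a <- Phi].
Hypothesis k0n0 : k0 != 0.
Hypothesis Phi_neq0 : forall a, a \in Phi -> a != 0.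
Let T := {lam : 'rV[int]_r | D lam}.
Variable ws : T -> seq 'rV[int]_r.
Hypothesis cE : forall t : T, c (sval t) = pihomog (@mdeg r) k (\prod_(w <- ws t) (1 + c1 w)).
Hypothesis HW : forall (t : T) x,
  k0 * delta PhiR (fun x => \sum_(w <- ws t) (toR w == x)%:R) x =
  \sum_(p <- W) p.2 * (x == (toR (sval t) + rhos PhiR) *m p.1)%:R.
Let X (t : T) i : R := (sval t 0 i)%:~R.
Let N := size Phi.

Section PowerSums.
Variable v : 'I_r -> R.
Let ell (x : 'rV[R]_r) := \sum_i x 0 i * v i.
Hypothesis regular_v : forall a, a \in Phi -> ell (toR a) != 0.

Lemma power_sum_pdeg j : pdeg X (j + N) (fun t => \sum_(w <- ws t) ell (toR w) ^+ j).
Proof.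
have ellD x y : ell (x + y) = ell x + ell y.
  by rewrite -big_split; apply: eq_bigr => i _; rewrite mxE mulrDl.
have ellZ a x : ell (a *: x) = a * ell x.
  by rewrite mulr_sumr; apply: eq_bigr => i _; rewrite mxE mulrA.
have nz x : x \in PhiR -> ell x != 0 by case/seq.mapP => a aP ->; exact: regular_v.
have [q sq Hq] := moment_delta ellD ellZ 'X^j nz.
have E t : \sum_(w <- ws t) ell (toR w) ^+ j =
    \sum_(p <- W) (k0^-1 * p.2) * q.[ell ((toR (sval t) + rhos PhiR) *m p.1)].
  pose m (x : 'rV[R]_r) : R := \sum_(w <- ws t) (toR w == x)%:R.
  have mE : m = fun x => \sum_(w <- ws t) 1 * (x == toR w)%:R.
    by apply: funext => x; apply: eq_bigr => w _; rewrite mul1r eq_sym.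
  have dE : delta PhiR m = fun x => \sum_(p <- W) (k0^-1 * p.2) * (x == (toR (sval t) + rhos PhiR) *m p.1)%:R.
    apply: funext => x; apply: (mulfI k0n0); rewrite HW mulr_sumr; apply: eq_bigr => p _.
    by rewrite !mulrA divff // mul1r.
  have fm : fs m.
    exists [seq toR w | w <- ws t] => x xs; rewrite /m big_seq big1 // => w wws.
    by case: eqP => // E; case/negP: xs; rewrite -E; apply: seq.map_f.
  have := Hq m fm; rewrite dE pair_indicators mE pair_indicators => <-.
  by apply: eq_bigr => w _; rewrite mul1r hornerXn.
apply: (@pdeg_ext _ _ _ X _ _ _ (fun t => esym (E t))); apply: pdeg_sum => p; apply: pdegZ.
apply: (@pdeg_le _ _ _ X (size q).-1).
  by move: sq; rewrite size_polyXn size_map -/N; case: (size q) => // u; rewrite addSn ltnS.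
apply: pdeg_horner.
apply: (@pdeg_ext _ _ _ X _ (fun t => \sum_l v l * \sum_i p.1 i l * (X t i + rhos PhiR 0 i))).
  move=> t; apply: eq_bigr => l _; rewrite mulrC mxE; congr (_ * _); apply: eq_bigr => i _.
  by rewrite mulrC !mxE.
apply: pdeg_sum => l; apply: pdegZ; apply: pdeg_sum => i; apply: pdegZ.
by apply: pdegD; [exact: pdeg_coord | exact: pdeg_const].
Qed.

Lemma elem_pdeg j : pdeg X (j * (N + 1)) (fun t => (elem [seq ell (toR w) | w <- ws t])`_j).
Proof.
have [K] := ubnP j; elim: K j => // K IH [|j] jK.
  by apply: pdeg_ext (pdeg_const X _ 1) => t; rewrite elem_coef0.
have E t : (elem [seq ell (toR w) | w <- ws t])`_j.+1 = j.+1%:R^-1 * \sum_(i < j.+1)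
    ((-1) ^+ i * ((\sum_(w <- ws t) ell (toR w) ^+ i.+1) * (elem [seq ell (toR w) | w <- ws t])`_(j - i))).
  have n0 : j.+1%:R != 0 :> R by rewrite pnatr_eq0.
  apply: (mulfI n0); rewrite newton_coef mulrA divff // mul1r; apply: eq_bigr => i _.
  by rewrite big_map mulrA.
apply: (@pdeg_ext _ _ _ X _ _ _ (fun t => esym (E t))); apply/pdegZ/pdeg_sum => i; apply: pdegZ.
have ij : (i <= j)%N by rewrite -ltnS.
(* The power sum of exponent i + 1 costs i + 1 + N, which is at most (i + 1) (N + 1), with equality
   at i = 0. *)
apply: (@pdeg_le _ _ _ X (i.+1 + N + (j - i) * (N + 1))).
  have : (i.+1 + N + (j - i) * (N + 1) <= (i.+1 + (j - i)) * (N + 1))%N.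
    by rewrite mulnDl leq_add2r mulnDr muln1 [(i.+1 + N)%N]addnC leq_add2r mulSn leq_addr.
  by move/leq_trans; apply; rewrite leq_mul2r addSn subnKC // leqnn orbT.
apply: pdegM; first exact: power_sum_pdeg.
by apply: IH; rewrite (leq_ltn_trans (leq_subr _ _)).
Qed.
End PowerSums.

Lemma chern_coef_pdeg (m : 'X_{1..r}) : mdeg m = k ->
  pdeg X (k * (N + 1)) (fun t => ((c (sval t))@_m)%:~R).
Proof.
(* Separating the monomials of degree k takes b > k; the choice k + 2 also gives b > 1 when k = 0,
   so that the exponents b^i in [B] are distinct. *)
move=> dm; pose b := k.+2; pose g (t : T) : {poly R} := kronecker R b (c (sval t)).
have hc (t : T) : c (sval t) \is k.-homog by rewrite cE; exact: pihomogP.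
apply: (@pdeg_ext _ _ _ X _ (fun t => (g t)`_(digits b m))).
  by move=> t; rewrite (coef_kronecker R _ (hc t) dm).
(* [B] at y is the product of the pairings of the positive roots with H = (y^(b^i)), so its
   nonvanishing says that H is regular. *)
pose B : {poly R} := \prod_(a <- Phi) \sum_(i < r) (a 0 i)%:~R *: 'X^(b ^ i).
apply: (@pdeg_coefs _ _ _ X _ (k * b ^ r).+1 g B) => [|t|y].
- rewrite /B prodf_seq_neq0; apply/allP => a aP /=.
  have [i ai] : exists i, a 0 i != 0.
    apply: contrapT => nex; move/eqP: (Phi_neq0 aP); apply; apply/rowP => i; rewrite mxE.
    by apply/eqP/negPn/negP => H; apply: nex; exists i.
  apply/eqP => /(congr1 (fun p : {poly R} => p`_(b ^ i))); rewrite coef0 coef_sum => /eqP.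
  rewrite (bigD1 i) //= coefZ coefXn eqxx mulr1 big1 ?addr0 => [|l li].
    by rewrite intr_eq0 (negPf ai).
  by rewrite coefZ coefXn eqn_exp2l // (inj_eq val_inj) eq_sym (negPf li) mulr0.
- exact: size_kronecker (hc t).
move=> By; pose v (i : 'I_r) := y ^+ (b ^ i).
have kE (w : 'rV[int]_r) : \sum_i toR w 0 i * v i = keval b y w by apply: eq_bigr => i _; rewrite mxE.
apply: (@pdeg_ext _ _ _ X _ (fun t => (elem [seq \sum_i toR w 0 i * v i | w <- ws t])`_k)).
  move=> t; rewrite /g cE kronecker_chern; congr (_`_ _); congr elem.
  by apply: eq_map => w; exact: kE.
apply: elem_pdeg => a aP; rewrite kE; apply: contraNneq By => E.
rewrite /B horner_prod prodf_seq_eq0; apply/hasP; exists a => //=.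
by rewrite -E horner_sum; apply/eqP/eq_bigr => i _; rewrite hornerZ hornerXn.
Qed.

Lemma chern_polynomial : polynomial_on R D k (k * (size Phi + 1))%N c.
Proof.
have /choice[q Hq] (m : 'X_{1..r < k.+1}) : exists q : {mpoly R[r]},
    (msize q <= (k * (N + 1)).+1)%N /\ (mdeg m = k -> forall t, ((c (sval t))@_m)%:~R = q.@[X t]).
  have [/chern_coef_pdeg[q sq Eq]|ne] := eqVneq (mdeg m) k; first by exists q.
  by exists 0; rewrite msize0; split=> // /eqP; rewrite (negPf ne).
pose f : R -> {mpoly C[r]} := (@mpolyC r C) \o (real_complex R).
(* Each monomial m of degree k has a coefficient q m that is polynomial in lam; the variables of q m
   become the outer ones, and m becomes part of the coefficients. *)
pose P : {mpoly {mpoly C[r]}[r]} := \sum_(m : 'X_{1..r < k.+1} | mdeg m == k)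
  'X_[m] *: map_mpoly ((@mpolyC r C) \o (real_complex R)) (q m).
have Pc m' : P@_m' = \sum_(m : 'X_{1..r < k.+1} | mdeg m == k) ((q m)@_m')%:C *: 'X_[m].
  rewrite /P raddf_sum; apply: eq_bigr => m _ /=.
  by rewrite mcoeffZ mcoeff_map_mpoly /= mulrC mul_mpolyC.
exists P; split.
- rewrite /mmeasure; apply/bigmax_leqP_seq => m' m'P _; rewrite ltnS leqNgt; apply/negP => big.
  move: m'P; rewrite mcoeff_msupp Pc big1 ?eqxx // => m _.
  have -> : (q m)@_m' = 0; last by rewrite scale0r.
  apply/eqP; rewrite mcoeff_eq0; apply/negP => /msize_mdeg_lt; apply/negP; rewrite -leqNgt.
  by apply: leq_trans big; case: (Hq m).
- by move=> m'; rewrite Pc rpred_sum // => m dm; rewrite rpredZ // dhomogX.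
move=> lam Dl; pose t : T := exist _ lam Dl.
have hc : c lam \is k.-homog by rewrite (cE t); exact: pihomogP.
have sc : (msize (c lam) <= k.+1)%N.
  rewrite /mmeasure; apply/bigmax_leqP_seq => m mP _; rewrite ltnS.
  by move/dhomogP: hc => /(_ m mP) ->.
rewrite -(pihomog_dE hc) (pihomogwE _ _ sc) rmorph_sum /P raddf_sum; apply: eq_bigr => m /eqP dm /=.
rewrite mevalZ.
have -> : (fun i => ((lam 0 i)%:~R : C)%:MP) = (fun i => ((@mpolyC r C) \o (real_complex R)) (X t i)).
  by apply: funext => i; rewrite /X /=; congr (_%:MP); exact: (esym (rmorph_int (real_complex R) _)).
rewrite meval_map -((Hq m).2 dm) mulrC.
rewrite map_mpolyZ map_mpolyX -mul_mpolyC; congr (_ * _); rewrite /=; congr (_%:MP).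
exact: (esym (rmorph_int (real_complex R) _)).
Qed.
End PolynomialDependence.

Section WeightMultiplicities.
Variable R : realType.
Local Notation C := R[i].
Variables (n : nat) (T : set 'M[C]_n) (r : nat) (e : 'I_r -> 'M[C]_n -> C).
Hypothesis Te : char_basis T e.
Variables (m M : nat) (rho : 'M[C]_n -> 'M[C]_m) (mu : 'I_M -> 'rV[int]_r) (Q : 'I_M -> 'M[C]_m).
Hypothesis rhoE : forall t, T t -> rho t = \sum_i char_of e (mu i) t *: Q i.
Hypothesis Q1 : \sum_i Q i = 1%:M.
Hypothesis QQ : forall i j, Q i *m Q j = if i == j then Q i else 0.

Lemma dim_fixed (F : fieldType) p (A : 'M[F]_p) (U : {vspace 'cV[F]_p}) : A *m A = A ->
  (forall u, u \in U <-> A *m u = u) -> \dim U = \rank A.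
Proof.
move=> AA HU; have [B BL] := row_fullP (col_base_full A).
have [B' RB] := row_freeP (row_base_free A).
have Af : A = col_base A *m row_base A by rewrite mulmx_base.
have AL : A *m col_base A = col_base A.
  have E : A *m col_base A *m row_base A = col_base A *m row_base A by rewrite -mulmxA -Af AA.
  by rewrite -[LHS]mulmx1 -RB mulmxA E -mulmxA RB mulmx1.
pose f := linfun (mulmx (col_base A) : 'cV[F]_(\rank A) -> 'cV[F]_p).
have -> : U = (f @: fullv)%VS.
  apply/vspaceP => u; apply/idP/idP => [/HU Au|/memv_imgP[w _ ->]].
    have -> : u = f (row_base A *m u) by rewrite lfunE /= mulmxA -Af Au.
    by apply: memv_img; exact: memvf.
  by apply/HU; rewrite lfunE /= mulmxA AL.
rewrite limg_dim_eq ?dimvf ?/dim /= ?muln1 //; apply/eqP; rewrite -subv0; apply/subvP => w.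
rewrite memv_cap memvf memv_ker lfunE /= => /eqP Lw; rewrite memv0.
by rewrite -[w]mul1mx -BL -mulmxA Lw mulmx0.
Qed.

Lemma weight_space_proj nu (u : 'cV[C]_m) :
  (forall t, T t -> rho t *m u = char_of e nu t *: u) <->
  (\sum_j (mu j == nu)%:R *: Q j) *m u = u.
Proof.
have Qs j : Q j *m (\sum_j (mu j == nu)%:R *: Q j) = (mu j == nu)%:R *: Q j.
  rewrite mulmx_sumr (bigD1 j) //= -scalemxAr QQ eqxx big1 ?addr0 // => i ij.
  by rewrite -scalemxAr QQ [j == i]eq_sym (negPf ij) scaler0.
split=> [H|Hu t Tt].
  rewrite mulmx_suml -[RHS]mul1mx -Q1 mulmx_suml; apply: eq_bigr => j _.
  case: eqP => [_|ne]; rewrite ?scale1r // scale0r mul0mx; apply/esym/eqP/negPn/negP => nz.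
  apply: ne; apply: (char_of_inj Te) => t Tt.
  have := congr1 (mulmx (Q j)) (H t Tt); rewrite rhoE // mulmxA mulmx_sumr (bigD1 j) //=.
  rewrite -scalemxAr QQ eqxx big1 => [|i ij]; last by rewrite -scalemxAr QQ [j == i]eq_sym (negPf ij) scaler0.
  rewrite addr0 -scalemxAl -scalemxAr => /eqP.
  by rewrite -subr_eq0 -scalerBl scaler_eq0 (negPf nz) orbF subr_eq0 => /eqP.
rewrite rhoE // -Hu !mulmxA scalemxAl; congr (_ *m _).
rewrite mulmx_suml scaler_sumr; apply: eq_bigr => j _; rewrite -scalemxAl Qs.
by case: eqP => [->//|_]; rewrite scale0r !scaler0.
Qed.

Lemma weight_proj_idem nu : let S := \sum_j (mu j == nu)%:R *: Q j in S *m S = S.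
Proof.
rewrite /= mulmx_suml; apply: eq_bigr => j _; rewrite -scalemxAl mulmx_sumr (bigD1 j) //=.
rewrite -scalemxAr QQ eqxx big1 ?addr0 => [|i ij]; last by rewrite -scalemxAr QQ [j == i]eq_sym (negPf ij) scaler0.
by case: (mu j == nu); rewrite ?scale1r ?scale0r.
Qed.

Lemma weight_multP nu d : weight_mult T e rho nu d <-> d = (\sum_j (mu j == nu) * \rank (Q j))%N.
Proof.
have rk : \rank (\sum_j (mu j == nu)%:R *: Q j)%R = (\sum_j (mu j == nu) * \rank (Q j))%N.
  apply/eqP; rewrite -(eqr_nat C) -mxtrace_idempotent ?weight_proj_idem // raddf_sum natr_sum.
  apply/eqP/eq_bigr => j _; rewrite /= mxtraceZ (mxtrace_idempotent (P := Q j)) ?QQ ?eqxx //.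
  by rewrite natrM.
split=> [[U HU <-]|->].
  by rewrite -rk; apply: dim_fixed (weight_proj_idem nu) _ => u; rewrite HU weight_space_proj.
have [U HU] : exists U : {vspace 'cV[C]_m}, forall u, u \in U <->
    forall t, T t -> rho t *m u = char_of e nu t *: u.
  apply: vspace_of_set => [t _|a x y Hx Hy t Tt]; first by rewrite mulmx0 scaler0.
  by rewrite mulmxDr -scalemxAr Hx // Hy // scalerDr !scalerA mulrC.
exists U => //; rewrite -rk; apply: dim_fixed (weight_proj_idem nu) _ => u.
by rewrite HU weight_space_proj.
Qed.
End WeightMultiplicities.

Section ChernClasses.
Variable R : realType.
Local Notation C := R[i].
Local Notation toR := (@toR R _).
Variables (n : nat) (G T : set 'M[C]_n) (r : nat) (e : 'I_r -> 'M[C]_n -> C).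
Hypothesis rG : connected_reductive G.
Hypothesis mT : maximal_torus G T.
Hypothesis Te : char_basis T e.
Variables (N : nat) (chi : 'I_N -> 'rV[int]_r) (P : 'I_N -> 'M[C]_n).
Hypothesis chiI : injective chi.
Hypothesis TE : forall t, T t -> t = \sum_i char_of e (chi i) t *: P i.
Hypothesis P1 : \sum_i P i = 1%:M.
Hypothesis PP : forall i j, P i *m P j = if i == j then P i else 0.
Hypothesis Pn0 : forall i, P i != 0.
Variables (Phi : seq 'rV[int]_r) (h : 'rV[int]_r).
Hypothesis Phi_uniq : uniq Phi.
Hypothesis hroot : forall a, isroot G chi P a -> dot h a != 0.
Hypothesis hPhi : forall a, a \in Phi <-> isroot G chi P a /\ 0 < dot h a.

Lemma chern_weightfun m (rho : 'M[C]_n -> 'M[C]_m) lam k cc :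
  irreducible_rep G rho -> highest_weight T e rho Phi lam -> chernT T e rho k cc ->
  exists ws : seq 'rV[int]_r, cc = pihomog (@mdeg r) k (\prod_(w <- ws) (1 + c1 w)) /\
    weightfun (ip chi P) [seq toR a | a <- Phi] (fun x => \sum_(w <- ws) (toR w == x)%:R) (toR lam).
Proof.
move=> irr [[d0 wlam d0n] hw] [ws Hws ->]; exists ws; split=> //.
have [cG conG _] := rG; have [tT TG _] := mT; have [rhoG _ _] := irr; have [r1 rM rr] := rhoG.
have rhoT : alg_morphism T (@GL R m) rho.
  split=> [g Tg|g g' Tg Tg'|i j]; [exact/r1/TG | by apply: rM; exact: TG |].
  by have [p [d Hp]] := rr i j; exists p, d => g Tg; apply/Hp/TG.
have [M [mu [Q [muI rhoE Q1 QQ Qn0]]]] := torus_weights tT Te rhoT.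
have [drho [[dl dc db dH] dcomm]] := @rep_derivative R n m G r rho cG rhoG.
have comm := commutant_group cG conG rhoG dc dcomm.
have drhoH x : drho (Hx chi P x) = Hx mu Q x.
  apply: dH => // z nz; have [Tz ez] := torus_curve tT Te TE nz; split; first exact: TG.
  have E i : char_of e (mu i) (curve P chi z) = mon z (mu i) by exact: char_curve.
  rewrite (rhoE _ Tz) /curve; apply: eq_bigr => i _; rewrite E; by [].
have wP := weight_multP Te rhoE Q1 QQ.
have [i0 Ei0] : exists i0, mu i0 = lam.
  apply: contrapT => nex; move: d0n; rewrite ((wP _ _).1 wlam) big1 // => j _.
  by case: eqP => // E; case: nex; exists j.
have hwt j : exists c' : 'rV[int]_r -> nat, mu i0 - mu j = \sum_(a <- Phi) a *+ c' a.
  rewrite Ei0; apply: hw; exists (\sum_l (mu l == mu j) * \rank (Q l))%N; first exact/wP.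
  by rewrite (bigD1 j) //= eqxx mul1n addn_gt0 lt0n mxrank_eq0 Qn0.
have /choice[EF HEF] (a : 'rV[int]_r) : exists EF : 'M[C]_n * 'M[C]_n, a \in Phi -> sl2pair G chi P a EF.1 EF.2.
  have [/hPhi[[a0 [E rE E0]] _]|] := boolP (a \in Phi); last by exists (0, 0).
  by have [F HF] := sl2pair_exists rG mT Te TE P1 PP a0 rE E0; exists (E, F).
have := rep_weightfun rG mT Te chiI TE P1 PP Pn0 irr dl dc db drhoH comm muI Q1 QQ Qn0 hroot hPhi Phi_uniq HEF hwt.
rewrite Ei0 => wf.
have <- // : wmult mu Q = fun x => \sum_(w <- ws) (toR w == x)%:R.
(* The list ws is known only through its counts, so the two functions are compared at each
   character; at real vectors that are not characters both vanish. *)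
apply: funext => x; have [[nu ->]|nex] := pselect (exists nu, x = toR nu); last first.
  rewrite /wmult !big1 // => j _; case: eqP => [E|_]; rewrite ?mul0r //; case: nex.
    by exists j.
  by exists (mu j).
transitivity ((count_mem nu ws)%:R : R).
  rewrite ((wP _ _).1 (Hws nu)) natr_sum; apply: eq_bigr => j _.
  by rewrite (inj_eq (@toR_inj R r)) natrM.
rewrite -sum1_count natr_sum big_mkcond; apply: eq_bigr => w _ /=.
by rewrite (inj_eq (@toR_inj R r)); case: eqP.
Qed.
End ChernClasses.

Theorem theorem1 (R : realType) (n : nat) (G T : set 'M[R[i]]_n)
    (r : nat) (e : 'I_r -> 'M[R[i]]_n -> R[i])
    (Phi : seq 'rV[int]_r)
    (dimpi : 'rV[int]_r -> nat)
    (pi : forall lam : 'rV[int]_r, 'M[R[i]]_n -> 'M[R[i]]_(dimpi lam))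
    (k : nat) (c : 'rV[int]_r -> {mpoly int[r]}) :
  connected_reductive G ->
  maximal_torus G T ->
  char_basis T e ->
  positive_system G T e Phi ->
  (forall lam, dominant G T e Phi lam ->
     irreducible_rep G (pi lam) /\ highest_weight T e (pi lam) Phi lam) ->
  (forall lam, dominant G T e Phi lam -> chernT T e (pi lam) k (c lam)) ->
  polynomial_on R (dominant G T e Phi) k (k * (size Phi + 1))%N c.
Proof.
move=> rG mT Te [Phi_uniq [h [h1 h2]]] Hpi Hc; have [tT TG _] := mT.
have [[_ [Tu _ _ _]] _] := tT.
(* The given embedding of T in GL_n is decomposed as a representation: its weights and projections
   give the coordinates on Lie T and the trace form. *)
have idT : alg_morphism T (@GL R n) id.
  split=> // i j; apply: (@regular_poly R n T _ (fun X => X i j)); exact: pfun_entry.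
have [N [chi [P [chiI TE P1 PP Pn0]]]] := torus_weights tT Te idT.
have rootE a : Defs.root G T e a <-> isroot G chi P a := rootP mT Te TE P1 PP a.
have hroot a : isroot G chi P a -> dot h a != 0 by move/rootE; exact: h1.
have hPhi a : a \in Phi <-> isroot G chi P a /\ 0 < dot h a.
  by rewrite h2; split=> -[ra ha]; split=> //; apply/rootE.
pose D := dominant G T e Phi.
have /choice[ws Hws] (t : {lam : 'rV[int]_r | D lam}) : exists ws : seq 'rV[int]_r,
    c (sval t) = pihomog (@mdeg r) k (\prod_(w <- ws) (1 + c1 w)) /\
    weightfun (ip chi P) [seq @toR R _ a | a <- Phi] (fun x => \sum_(w <- ws) (@toR R _ w == x)%:R) (toR R (sval t)).
  have [irr hw] := Hpi _ (svalP t).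
  exact: (chern_weightfun rG mT Te chiI TE P1 PP Pn0 Phi_uniq hroot hPhi irr hw (Hc _ (svalP t))).
(* The weights [chi] of the given embedding serve as the finite spanning set that makes the Weyl
   group finite. *)
have [W [k0 [k0n0 HW]]] := weyl_numerator (@ipDl R n r N chi P) (@ipZl R n r N chi P)
  (@ipC R n r N chi P) (@ip_gt0 R n G T r e mT Te N chi P TE P1 PP Pn0)
  (@hRD R r h) (@hRZ R r h) (hR_gt0 hPhi) (PhiR_uniq R Phi_uniq)
  (PhiR_refl rG mT Te chiI TE P1 PP Pn0 hroot hPhi)
  (PhiR_red rG mT Te chiI TE P1 PP Pn0 hPhi)
  (PhiR_int rG mT Te chiI TE P1 PP Pn0 hPhi)
  (chiR_refl rG mT Te chiI TE P1 PP Pn0 hPhi)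
  (chiR_span mT Te TE P1 PP Pn0).
apply: (@chern_polynomial R r Phi D k c W k0 k0n0 _ ws) => [a|t|t x].
- by move=> /hPhi[[]].
- by case: (Hws t).
- by apply: HW; case: (Hws t).
Qed.
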